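(* Let $E$ be a real or complex vector bundle over a Riemannian manifold $M$, endowed with a Riemannian (resp. Hermitian) metric and a compatible connection, and let $\mu=\varphi^2\,\mathrm{dv}$ be a weighted measure on $M$. Suppose that $L$ is a differential operator on $E$ of generalized Laplace type, $L=A^{\mathrm{ad}}A+B$. Assume that $L$ is formally self-adjoint and bounded from below with respect to $\mu$. Let $K\subsetneq M$ be a compact domain with smooth boundary. Then $$\sigma_{\mathrm{ess}}(L,M)=\sigma_{\mathrm{ess}}(L,M\setminus K).$$
   Context: $M$ is not assumed to be complete. A weighted measure is $\mu=\varphi^2\,\mathrm{dv}$ with $\varphi\in C^\infty(M)$ strictly positive and $\mathrm{dv}$ the Riemannian volume element. $\langle\cdot,\cdot\rangle_\mu$ and $\|\cdot\|_\mu$ denote $L^2$-inner product and $L^2$-norm with respect to $\mu$. The formal adjoint $A^{\mathrm{ad}}$ of a differential operator $A$ with respect to $\mu$ is the differential operator with $\langle Au,v\rangle_\mu=\langle u,A^{\mathrm{ad}}v\rangle_\mu$ for all smooth sections $u,v$ such that $\operatorname{supp}u\cap\operatorname{supp}v$ is compact; $L$ is formally self-adjoint if $L=L^{\mathrm{ad}}$. $L$ is bounded from below if there is $\beta\in\mathbb R$ with $\langle Lu,u\rangle_\mu\ge\beta\|u\|_\mu^2$ for all $u\in C^\infty_c(E)$. $L$ is of generalized Laplace type if $L$ is elliptic and of the form $L=A^{\mathrm{ad}}A+B$, where $A$ is a differential operator of order one (from sections of $E$ to sections of $E$ or of another Riemannian, resp. Hermitian, vector bundle over $M$) and $B$ is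 a differential operator on $E$ of order at most one. Friedrichs extension: let $H_L\subseteq L^2(E,\mu)$ be the completion of $C^\infty_c(E)$ with respect to $\langle u,v\rangle_L=\langle u,v\rangle_\mu+\langle(L-\beta)u,v\rangle_\mu$, and let $L^*$ be the Hilbert space adjoint of $L$ with domain $C^\infty_c(E)$. The Friedrichs extension $\bar L$ is the self-adjoint operator with domain $H_L\cap D(L^* )$ and $\bar L=L^*$ there. $\sigma_{\mathrm{ess}}(L,M)$ denotes the essential spectrum of $\bar L$, that is, the set of $\lambda\in\mathbb R$ such that $\bar L-\lambda$ is not Fredholm. $\sigma_{\mathrm{ess}}(L,M\setminus K)$ denotes the essential spectrum of the Friedrichs extension, in $L^2(E|_{M\setminus K},\mu)$, of $L$ with domain the smooth sections of $E$ with compact support in the open set $M\setminus K$. *)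

(* Defs.v *)
From HB Require Import structures.
From mathcomp Require Import all_boot all_order all_algebra.
From mathcomp Require Import all_classical all_reals all_analysis.
From mathcomp.real_closed Require Import complex.
Set Implicit Arguments.
Unset Strict Implicit.
Unset Printing Implicit Defensive.
Import Order.TTheory GRing.Theory Num.Theory.
Import numFieldNormedType.Exports.
Local Open Scope classical_set_scope.
Local Open Scope ring_scope.

(** * The base field of a vector bundle: R or R[i] *)

Record scalars (R : realType) := Scalars {
  sc_field :> numFieldType;
  sc_re : sc_field -> R;
  sc_im : sc_field -> R;
  sc_mk : R -> R -> sc_field }.

Definition real_scalars (R : realType) : scalars R :=
  @Scalars R R (fun x => x) (fun=> 0) (fun x _ => x).

Definition complex_scalars (R : realType) : scalars R :=
  @Scalars R R[i] (@complex.Re R) (@complex.Im R) (fun x y => Complex x y).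

Variant base_field := RealField | ComplexField.

Definition scalars_of (R : realType) (b : base_field) : scalars R :=
  match b with
  | RealField => real_scalars R
  | ComplexField => complex_scalars R
  end.

Definition sc_conj (R : realType) (S : scalars R) (z : S) : S :=
  sc_mk S (sc_re z) (- sc_im z).

Definition sc_real (R : realType) (S : scalars R) (x : R) : S := sc_mk S x 0.

(** * Smooth functions and Lebesgue measure on R^n *)

Fixpoint class_C (R : realType) (n : nat) (k : nat) (U : set 'rV[R]_n)
    (f : 'rV[R]_n -> R) : Prop :=
  (forall y, U y -> {for y, continuous f}) /\
  match k with
  | 0%N => True
  | k'.+1 => forall a : 'I_n,
      (forall y, U y -> derivable f y (delta_mx 0 a)) /\
      class_C k' U (fun y => 'D_(delta_mx 0 a) f y)
  end.

Definition smooth (R : realType) (n : nat) (U : set 'rV[R]_n)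
    (f : 'rV[R]_n -> R) : Prop := forall k, class_C k U f.

(* The n-fold product of [lebesgue_measure], by integration over slices. *)
Fixpoint lebesgue_rV (R : realType) (n : nat) : set 'rV[R]_n -> \bar R :=
  match n return set 'rV[R]_n -> \bar R with
  | 0%N => fun A => (\1_A (0 : 'rV[R]_0))%:E
  | n'.+1 => fun A =>
      (\int[@lebesgue_measure R]_t
         lebesgue_rV [set v : 'rV[R]_n' | A (row_mx (const_mx t : 'rV[R]_1) v)])%E
  end.

(** * Manifolds *)

Notation borel T := (g_sigma_algebraType (@open T)).

(* [chart i] and [param i] are mutually inverse homeomorphisms between [dom i]
   and its image; their values elsewhere are irrelevant. *)
Record manifold (R : realType) (n : nat) (M : ptopologicalType) := Manifold {
  atlas : Type;
  dom : atlas -> set M;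
  chart : atlas -> M -> 'rV[R]_n;
  param : atlas -> 'rV[R]_n -> M;
  man_hausdorff : hausdorff_space M;
  man_countable : @second_countable M;
  dom_open : forall i, open (dom i);
  dom_cover : forall x, exists i, dom i x;
  chart_continuous : forall i x, dom i x -> {for x, continuous (chart i)};
  chart_open : forall i, open (chart i @` dom i);
  chartK : forall i x, dom i x -> param i (chart i x) = x;
  param_continuous : forall i y, (chart i @` dom i) y ->
    {for y, continuous (param i)};
  chart_smooth : forall i j (a : 'I_n),
    smooth (chart i @` (dom i `&` dom j))
           (fun y => chart j (param i y) 0 a) }.

Section Manifolds.
Context (R : realType) (n : nat) (M : ptopologicalType) (X : manifold R n M).

Definition smooth_on (W : set M) (f : M -> R) : Prop :=
  forall i : atlas X, smooth (chart i @` (W `&` dom i)) (f \o param i).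

(* The partial derivative of f along the a-th coordinate of the chart i. *)
Definition pderiv (i : atlas X) (a : 'I_n) (f : M -> R) (x : M) : R :=
  'D_(delta_mx 0 a) (f \o param i) (chart i x).

Definition transition_jacobian (i j : atlas X) (x : M) : 'M[R]_n :=
  \matrix_(a, b) pderiv i a (fun y => chart j y 0 b) x.

(* A Riemannian metric, given by its Gram matrices in the coordinate frames. *)
Record riemannian_metric := RiemannianMetric {
  gram : atlas X -> M -> 'M[R]_n;
  gram_smooth : forall i a b, smooth_on (dom i) (fun x => gram i x a b);
  gram_sym : forall i x, dom i x -> (gram i x)^T = gram i x;
  gram_pos : forall i x (v : 'rV[R]_n), dom i x -> v != 0 ->
    0 < (v *m gram i x *m v^T) 0 0;
  gram_change : forall i j x, dom i x -> dom j x ->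
    gram i x = transition_jacobian i j x *m gram j x
                 *m (transition_jacobian i j x)^T }.

(* Together with second countability, this determines dv on Borel sets. *)
Definition riemannian_volume (g : riemannian_metric)
    (dv : {measure set (borel M) -> \bar R}) : Prop :=
  forall (i : atlas X) (A : set (borel M)), measurable A -> A `<=` dom i ->
    dv A = integral
             (@lebesgue_rV R n : set (borel 'rV[R]_n) -> \bar R)
             (chart i @` A)
             (fun y => (Num.sqrt (\det (gram g i (param i y))))%:E).

Definition weighted_measure (dv : {measure set (borel M) -> \bar R})
    (phi : M -> R) (mu : {measure set (borel M) -> \bar R}) : Prop :=
  forall A : set (borel M), measurable A ->
    mu A = (\int[dv]_(x in A) (phi x ^+ 2)%:E)%E.

(* K is closed (when compact) and, near each of its boundary points, a
   sublevel set of a smooth function without critical point there. *)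
Definition smooth_boundary (K : set M) : Prop :=
  forall x, K x -> ~ K° x ->
  exists (i : atlas X) (V : set M) (f : M -> R) (a : 'I_n),
    [/\ open V /\ V x, V `<=` dom i, smooth_on V f, pderiv i a f x != 0
      & forall y, V y -> (K y <-> f y <= 0)].

End Manifolds.

(** * Vector bundles *)

Section Scalar_functions.
Context (R : realType) (S : scalars R) (n : nat) (M : ptopologicalType).
Context (X : manifold R n M).

Definition smooth_onK (W : set M) (f : M -> S) : Prop :=
  smooth_on X W (fun x => sc_re (f x)) /\ smooth_on X W (fun x => sc_im (f x)).

Definition pderivK (i : atlas X) (a : 'I_n) (f : M -> S) (x : M) : S :=
  sc_mk S (pderiv i a (fun y => sc_re (f y)) x)
          (pderiv i a (fun y => sc_im (f y)) x).

Definition pderivV (i : atlas X) (r : nat) (a : 'I_n) (u : M -> 'cV[S]_r)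
    (x : M) : 'cV[S]_r :=
  \col_k pderivK i a (fun y => u y k 0) x.

Definition pderivs (i : atlas X) (r : nat) (t : seq 'I_n) (u : M -> 'cV[S]_r) :
    M -> 'cV[S]_r :=
  foldr (pderivV i (r:=r)) u t.

Record vbundle := VBundle {
  rank : nat;
  fiber : M -> lmodType S;
  triv_index : Type;
  triv_dom : triv_index -> set M;
  triv : triv_index -> forall x, {linear fiber x -> 'cV[S]_rank};
  triv_inv : triv_index -> forall x, {linear 'cV[S]_rank -> fiber x};
  triv_open : forall j, open (triv_dom j);
  triv_cover : forall x, exists j, triv_dom j x;
  trivK : forall j x, triv_dom j x -> cancel (triv j x) (triv_inv j x);
  triv_invK : forall j x, triv_dom j x -> cancel (triv_inv j x) (triv j x);
  triv_smooth : forall j l (v : 'cV[S]_rank) (a : 'I_rank),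
    smooth_onK (triv_dom j `&` triv_dom l)
               (fun x => triv l x (triv_inv j x v) a 0) }.

Definition section (E : vbundle) : Type := forall x : M, fiber E x.

Definition smooth_section (E : vbundle) (s : section E) : Prop :=
  forall (j : triv_index E) a,
    smooth_onK (triv_dom j) (fun x => triv j x (s x) a 0).

Definition supp (E : vbundle) (s : section E) : set M :=
  closure [set x | s x != 0].

(* C^oo_c of the restriction of E to the open set W, extended by zero. *)
Definition Cc (E : vbundle) (W : set M) (s : section E) : Prop :=
  [/\ smooth_section s, compact (supp s) & supp s `<=` W].

Definition frame (E : vbundle) (j : triv_index E) (a : 'I_(rank E)) : section E :=
  fun x => triv_inv j x (delta_mx a 0).

Record bundle_metric (E : vbundle) := BundleMetric {
  bm :> forall x, fiber E x -> fiber E x -> S;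
  bm_linear : forall x (w : fiber E x) (c : S) u v,
    bm (c *: u + v) w = c * bm u w + bm v w;
  bm_sym : forall x (u v : fiber E x), bm v u = sc_conj (bm u v);
  bm_pos : forall x (u : fiber E x), u != 0 -> 0 < bm u u;
  bm_smooth : forall (j : triv_index E) a b,
    smooth_onK (triv_dom j) (fun x => bm (frame j a x) (frame j b x)) }.

(* [nabla i a s x] is the covariant derivative of s at x along the a-th
   coordinate vector field of the chart i, for x in the domain of i. *)
Definition connection (E : vbundle)
    (nabla : atlas X -> 'I_n -> section E -> section E) : Prop :=
  [/\ forall i a s, smooth_section s -> forall (j : triv_index E) b,
        smooth_onK (dom i `&` triv_dom j)
                   (fun x => triv j x (nabla i a s x) b 0),
      forall i a s t, smooth_section s -> smooth_section t ->
        forall x, dom i x ->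
        nabla i a (fun y => s y + t y) x = nabla i a s x + nabla i a t x,
      forall i a (f : M -> S) s, smooth_onK setT f -> smooth_section s ->
        forall x, dom i x ->
        nabla i a (fun y => f y *: s y) x
          = pderivK i a f x *: s x + f x *: nabla i a s x
    & forall i j a s, smooth_section s -> forall x, dom i x -> dom j x ->
        nabla i a s x
          = \sum_b sc_real S (transition_jacobian i j x a b) *: nabla j b s x].

Definition metric_compatible (E : vbundle) (h : bundle_metric E)
    (nabla : atlas X -> 'I_n -> section E -> section E) : Prop :=
  forall i a s t, smooth_section s -> smooth_section t ->
    forall x, dom i x ->
    pderivK i a (fun y => h y (s y) (t y)) x
      = h x (nabla i a s x) (t x) + h x (s x) (nabla i a t x).

(** * Differential operators *)

(* In the chart i and the trivializations j of E and l of F, P is the sum of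
   the c_t d_t over the words t in the coordinates of length at most k.  The
   coefficients are not unique, since partial derivatives commute, but the
   homogeneous polynomial [symbol k c] is. *)
Definition local_form (E F : vbundle) (k : nat) (P : section E -> section F)
    (i : atlas X) (j : triv_index E) (l : triv_index F)
    (c : seq 'I_n -> M -> 'M[S]_(rank F, rank E)) : Prop :=
  let W := dom i `&` triv_dom j `&` triv_dom l in
  (forall t a b, smooth_onK W (fun x => c t x a b)) /\
  forall s, smooth_section s -> forall x, W x ->
    triv l x (P s x) =
      \sum_(m < k.+1) \sum_(t : m.-tuple 'I_n)
         c t x *m pderivs i t (fun y => triv j y (s y)) x.

(* Differential operator of order at most k; its values on non-smooth
   sections are irrelevant. *)
Definition diff_op (E F : vbundle) (k : nat) (P : section E -> section F) :
    Prop :=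
  forall i j l, exists c, @local_form E F k P i j l c.

Definition symbol (p q k : nat) (c : seq 'I_n -> M -> 'M[S]_(p, q)) (x : M)
    (xi : 'rV[R]_n) : 'M[S]_(p, q) :=
  \sum_(t : k.-tuple 'I_n) sc_real S (\prod_(a <- t) xi 0 a) *: c t x.

(* Ellipticity for the symbol of degree k. *)
Definition elliptic (E : vbundle) (k : nat) (P : section E -> section E) : Prop :=
  diff_op k P /\
  forall i j c, @local_form E E k P i j j c ->
    forall x, dom i x -> triv_dom j x ->
    forall xi : 'rV[R]_n, xi != 0 -> symbol k c x xi \in unitmx.

End Scalar_functions.

(** * L^2 theory with respect to mu *)

Section L2.
Context (R : realType) (S : scalars R) (n : nat) (M : ptopologicalType).
Context (X : manifold R n M) (mu : {measure set (borel M) -> \bar R}).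

Definition inner (E : vbundle S X) (h : bundle_metric E) (W : set M)
    (u v : section E) : S :=
  sc_mk S (Rintegral mu W (fun x => sc_re (h x (u x) (v x))))
          (Rintegral mu W (fun x => sc_im (h x (u x) (v x)))).

Definition norm2 (E : vbundle S X) (h : bundle_metric E) (W : set M)
    (u : section E) : R := sc_re (inner h W u u).

Definition dist2 (E : vbundle S X) (h : bundle_metric E) (W : set M)
    (u v : section E) : R := norm2 h W (fun x => u x - v x).

(* Sections over M stand for their restrictions to W, and L^2 sections are
   identified when they are at distance 0. *)
Definition L2 (E : vbundle S X) (h : bundle_metric E) (W : set M)
    (u : section E) : Prop :=
  (forall (j : triv_index E) a,
     measurable_fun (W `&` triv_dom j : set (borel M))
       (fun x => sc_re (triv j x (u x) a 0)) /\
     measurable_fun (W `&` triv_dom j : set (borel M))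
       (fun x => sc_im (triv j x (u x) a 0))) /\
  (\int[mu]_(x in W) (sc_re (h x (u x) (u x)))%:E < +oo)%E.

Definition formal_adjoint (E F : vbundle S X) (hE : bundle_metric E)
    (hF : bundle_metric F) (A : section E -> section F)
    (A' : section F -> section E) : Prop :=
  (exists k, diff_op k A') /\
  forall u v, smooth_section u -> smooth_section v ->
    compact (supp u `&` supp v) ->
    inner hF setT (A u) v = inner hE setT u (A' v).

Definition formally_self_adjoint (E : vbundle S X) (h : bundle_metric E)
    (L : section E -> section E) : Prop := formal_adjoint h h L L.

(* The inequality is that of S: for S = R[i] it includes the reality of the
   right-hand side. *)
Definition bounded_below (E : vbundle S X) (h : bundle_metric E)
    (L : section E -> section E) (beta : R) : Prop :=
  forall u, Cc setT u ->
    sc_real S (beta * norm2 h setT u) <= inner h setT (L u) u.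

Definition generalized_Laplace_type (E : vbundle S X) (h : bundle_metric E)
    (L : section E -> section E) : Prop :=
  elliptic 2 L /\
  exists (F : vbundle S X) (hF : bundle_metric F)
    (A : section E -> section F) (A' : section F -> section E)
    (B : section E -> section E),
    [/\ diff_op 1 A, formal_adjoint h hF A A', diff_op 1 B
      & forall s, smooth_section s -> forall x, L s x = A' (A s) x + B s x].

(** * Friedrichs extension and essential spectrum over an open set W *)

Section Friedrichs.
Context (E : vbundle S X) (h : bundle_metric E) (L : section E -> section E).
Context (beta : R) (W : set M).

Definition innerL (u v : section E) : S :=
  inner h W u v + inner h W (fun x => L u x - sc_real S beta *: u x) v.

Definition cauchyL (w : nat -> section E) : Prop :=
  forall e : R, 0 < e -> exists N : nat, forall k l, (N <= k)%N -> (N <= l)%N ->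
    sc_re (innerL (fun x => w k x - w l x) (fun x => w k x - w l x)) < e.

(* The completion of C^oo_c(E|W), realized in L^2(E|W, mu). *)
Definition form_domain (u : section E) : Prop :=
  L2 h W u /\
  exists w : nat -> section E,
    [/\ forall k, Cc W (w k), cauchyL w
      & (fun k => dist2 h W (w k) u) @ \oo --> (0 : R)].

(* u is in the domain of the adjoint of L on C^oo_c(E|W), and L^* u = f. *)
Definition adjoint_graph (u f : section E) : Prop :=
  [/\ L2 h W u, L2 h W f
    & forall v, Cc W v -> inner h W (L v) u = inner h W v f].

Definition friedrichs_graph (u f : section E) : Prop :=
  form_domain u /\ adjoint_graph u f.

End Friedrichs.

(* For an operator on L^2(E|W, mu) given by its graph G: the kernel is
   finite-dimensional and the range is closed of finite codimension. *)
Definition fredholm (E : vbundle S X) (h : bundle_metric E) (W : set M)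
    (G : section E -> section E -> Prop) : Prop :=
  [/\ exists (m : nat) (e : 'I_m -> section E),
        (forall k, L2 h W (e k)) /\
        forall u f, G u f -> norm2 h W f = 0 ->
        exists c : 'I_m -> S,
          dist2 h W u (fun x => \sum_(k < m) c k *: e k x) = 0,
      forall (u f : nat -> section E) (f' : section E),
        (forall k, G (u k) (f k)) -> L2 h W f' ->
        (fun k => dist2 h W (f k) f') @ \oo --> (0 : R) ->
        exists v g, G v g /\ dist2 h W g f' = 0
    & exists (m : nat) (e : 'I_m -> section E),
        (forall k, L2 h W (e k)) /\
        forall f, L2 h W f -> exists (c : 'I_m -> S) u g,
          G u g /\ dist2 h W f (fun x => g x + \sum_(k < m) c k *: e k x) = 0].

Definition sigma_ess (E : vbundle S X) (h : bundle_metric E)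
    (L : section E -> section E) (beta : R) (W : set M) : set R :=
  [set lambda | ~ fredholm h W (fun u g =>
     exists f, friedrichs_graph h L beta W u f /\
       g = (fun x => f x - sc_real S lambda *: u x))].

End L2.

(* Main.v *)
Require Import Defs.
From HB Require Import structures.
From mathcomp Require Import all_boot all_order all_algebra.
From mathcomp Require Import all_classical all_reals all_analysis measurable_realfun.
From mathcomp Require Import cyclic separable cyclotomic.
From mathcomp Require Import ring lra.
From mathcomp.real_closed Require Import complex.
Set Implicit Arguments.
Unset Strict Implicit.
Unset Printing Implicit Defensive.
Import Order.TTheory GRing.Theory Num.Theory.
Import numFieldNormedType.Exports.
Local Open Scope classical_set_scope.
Local Open Scope ring_scope.

(** The Friedrichs extension is shifted so that its form q dominates the norm;
its inverse T (over M) and T0 (over M \ K) are then bounded.  All Hilbert spaces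
are real, with the real part of the given inner products, and both operators act
on L^2(M), T0 seeing only the restriction to M \ K.  For kappa = lambda + 1 - beta,
being Fredholm amounts to an estimate
|f|^2 <= C (|f - kappa T f|^2 + sum_i <f, e_i>^2) with finitely many e_i,
and this passes from T to T0 and back as soon as T - T0 is compact in the form
|T f - T0 f|^2 <= e |f|^2 + sum_i <f, x_i>^2.

To see that T - T0 is compact, cut off with chi = 0 near K and eta^2 + chi^2 = 1.
As [A, eta] and [A, chi] are of order zero, the forms q(eta v) and q(chi v) are
bounded by q(v), and |v|^2 - q(v, chi^2 v) is controlled by the mass of v on a
compact set.  By a Rellich type estimate, that mass is at most
e q(v) + sum_i <v, x_i>^2.

Ellipticity of L = A^ad A + B makes the symbol of A injective: the commutator
identity <[[L, f], f] u, v> = -2 <[A, f] u, [A, f] v> relates it to the symbol of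
L.  The Rellich estimate then comes from Garding's inequality for A in small
coordinate cubes.  It is proved on grids, with the Fourier transform of
(Z/N)^n, where the discretization error tends to 0 for a fixed section while the
constants do not depend on N. *)

(** * Real pre-Hilbert spaces *)

(** Sections are not identified almost everywhere, so the inner products are only semi-definite,
    resolvents are relations, and equalities hold up to vectors of norm zero. The number kappa comes
    from [L - lambda = Lam - kappa] with [Lam = L + 1 - beta]: for [u = T f] the image of [u] under
    the extension of [L - lambda] is [f - kappa T f]. The estimate stands for the Fredholm property
    because it is visibly stable: a small multiple of |f|^2 is absorbed on the left, and finitely
    many functionals join the list. [T f] and [T0 f] satisfy the same weak equation against sections
    supported off [K], so their difference is q-orthogonal to such sections, in particular to chi^2
    v. The cutoff is squared because q(v, chi^2 v) differs from q(chi v) only by the square of a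
    commutator of order zero. In the grid estimates the order of the quantifiers is decisive: the
    leading constants and the functionals come before the section, the discretization errors after
    it, and only then does the mesh tend to 0. *)

Lemma discriminant_le (R : realFieldType) (a b c : R) : 0 <= c ->
  (forall t, 0 <= a + 2 * t * b + t ^+ 2 * c) -> b ^+ 2 <= a * c.
Proof.
move=> c0 H; have [c_eq|cn0] := eqVneq c 0.
  have [->|bn0] := eqVneq b 0; first by rewrite c_eq expr0n mulr0.
  have := H ((- a - 1) / (2 * b)); rewrite c_eq mulr0 addr0.
  have -> : a + 2 * ((- a - 1) / (2 * b)) * b = -1 by field.
  by rewrite ler0N1.
have cp : 0 < c by rewrite lt_neqAle eq_sym cn0.
have := H (- b / c).
have -> : a + 2 * (- b / c) * b + (- b / c) ^+ 2 * c = (a * c - b ^+ 2) / c by field.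
by rewrite pmulr_lge0 ?invr_gt0// subr_ge0.
Qed.

Lemma norm_le_sqr (R : realDomainType) (x e : R) :
  0 <= e -> x ^+ 2 <= e ^+ 2 -> `|x| <= e.
Proof.
by move=> e0 h; rewrite -(@ler_pXn2r _ 2) ?nnegrE// real_normK ?num_real.
Qed.

Section InnerProducts.
Context {R : realType} {V : lmodType R}.
Implicit Types (D : set V) (ip : V -> V -> R) (u v w : V) (s : nat -> V).

Definition subspace_of D := D 0 /\ forall a u v, D u -> D v -> D (a *: u + v).

(** Positivity is only semi-definite, since a section that vanishes almost everywhere need not be
    zero. The subspace [D] is explicit because the form q is meaningful on compactly supported
    smooth sections only. *)
Definition inner_product_on D ip :=
  [/\ forall a u v w, D u -> D v -> D w -> ip (a *: u + v) w = a * ip u w + ip v w,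
      forall u v, D u -> D v -> ip u v = ip v u
    & forall u, D u -> 0 <= ip u u].

Definition cauchy_seq ip s := forall e : R, 0 < e -> exists N : nat,
  forall k l, (N <= k)%N -> (N <= l)%N -> ip (s k - s l) (s k - s l) < e.

Definition ip_cvg ip s u := (fun k => ip (s k - u) (s k - u)) @ \oo --> (0 : R).

Definition ip_complete ip := forall s, cauchy_seq ip s -> exists u, ip_cvg ip s u.

Section OnSubspace.
Context (D : set V) (ip : V -> V -> R).
Hypotheses (subD : subspace_of D) (ipP : inner_product_on D ip).

Let D0 : D 0 := subD.1.
Lemma subspZ a u : D u -> D (a *: u).
Proof. by move=> Du; rewrite -[_ *: _]addr0; exact: subD.2. Qed.
Lemma subspD u v : D u -> D v -> D (u + v).
Proof. by move=> Du Dv; rewrite -[u]scale1r; exact: subD.2. Qed.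
Lemma subspN u : D u -> D (- u).
Proof. by move=> Du; rewrite -scaleN1r; exact: subspZ. Qed.
Lemma subspB u v : D u -> D v -> D (u - v).
Proof. by move=> Du Dv; apply: subspD => //; exact: subspN. Qed.

Lemma ipC u v : D u -> D v -> ip u v = ip v u.
Proof. by case: ipP => _ + _; exact. Qed.
Lemma ip_ge0 u : D u -> 0 <= ip u u.
Proof. by case: ipP => _ _; exact. Qed.
Lemma ipDl u v w : D u -> D v -> D w -> ip (u + v) w = ip u w + ip v w.
Proof.
by move=> Du Dv Dw; case: ipP => /(_ 1 u v w Du Dv Dw); rewrite scale1r mul1r.
Qed.
Lemma ip0l u : D u -> ip 0 u = 0.
Proof.
move=> Du; have := ipDl D0 D0 Du; rewrite addr0 => /eqP.
by rewrite -subr_eq subrr eq_sym => /eqP.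
Qed.
Lemma ipZl a u v : D u -> D v -> ip (a *: u) v = a * ip u v.
Proof.
move=> Du Dv; case: ipP => /(_ a u 0 v Du D0 Dv) + _ _.
by rewrite addr0 ip0l// addr0.
Qed.
Lemma ipNl u v : D u -> D v -> ip (- u) v = - ip u v.
Proof. by move=> Du Dv; rewrite -scaleN1r ipZl// mulN1r. Qed.
Lemma ipBl u v w : D u -> D v -> D w -> ip (u - v) w = ip u w - ip v w.
Proof. by move=> Du Dv Dw; rewrite ipDl ?ipNl//; exact: subspN. Qed.
Lemma ipDr u v w : D u -> D v -> D w -> ip w (u + v) = ip w u + ip w v.
Proof.
move=> Du Dv Dw; rewrite ipC//; last exact: subspD.
by rewrite ipDl// (ipC Dw)// (ipC Dw).
Qed.
Lemma ipZr a u v : D u -> D v -> ip v (a *: u) = a * ip v u.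
Proof. by move=> Du Dv; rewrite ipC ?ipZl ?(ipC Dv)//; exact: subspZ. Qed.
Lemma ipNr u v : D u -> D v -> ip v (- u) = - ip v u.
Proof. by move=> Du Dv; rewrite -scaleN1r ipZr// mulN1r. Qed.
Lemma ipBr u v w : D u -> D v -> D w -> ip w (u - v) = ip w u - ip w v.
Proof. by move=> Du Dv Dw; rewrite ipDr ?ipNr//; exact: subspN. Qed.
Lemma ip_sqrD t u v : D u -> D v ->
  ip (u + t *: v) (u + t *: v) = ip u u + 2 * t * ip u v + t ^+ 2 * ip v v.
Proof.
move=> Du Dv; have Dt := subspZ t Dv; have Ds := subspD Du Dt.
rewrite ipDl// ipDr// ipDr// !ipZl// !ipZr// (ipC Dv Du); ring.
Qed.

Lemma cauchy_schwarz u v : D u -> D v -> ip u v ^+ 2 <= ip u u * ip v v.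
Proof.
move=> Du Dv; apply: discriminant_le; first exact: ip_ge0.
by move=> t; rewrite -ip_sqrD//; apply: ip_ge0; apply: subspD => //; exact: subspZ.
Qed.

Lemma cauchy_schwarz_eps (e : R) u v : 0 < e -> D u -> D v ->
  2 * `|ip u v| <= e * ip u u + e^-1 * ip v v.
Proof.
move=> e0 Du Dv; wlog : v Dv / 0 <= ip u v => [hw|h0].
  have [|h] := leP 0 (ip u v); first exact: hw.
  have := hw (- v) (subspN Dv); rewrite ipNr// normrN oppr_ge0 ltW// => /(_ isT).
  by rewrite ipNl ?ipNr ?opprK//; exact: subspN.
rewrite ger0_norm//.
have := ip_ge0 (subspD Du (subspZ (- e^-1) Dv)); rewrite ip_sqrD// => h.
have : 0 <= e * (ip u u + 2 * (- e^-1) * ip u v + (- e^-1) ^+ 2 * ip v v).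
  by rewrite mulr_ge0// ltW.
have -> : e * (ip u u + 2 * (- e^-1) * ip u v + (- e^-1) ^+ 2 * ip v v)
   = e * ip u u - 2 * ip u v + e^-1 * ip v v.
  by field; rewrite gt_eqF.
by move=> ?; lra.
Qed.

Lemma ip_le_sum u v : D u -> D v -> ip (u + v) (u + v) <= 2 * ip u u + 2 * ip v v.
Proof.
move=> Du Dv; have := ip_ge0 (subspD Du (subspZ (-1) Dv)).
by rewrite -[in u + v](scale1r v) !ip_sqrD// sqrrN expr1n; lra.
Qed.

Lemma ip_le_sub u v : D u -> D v -> ip (u - v) (u - v) <= 2 * ip u u + 2 * ip v v.
Proof.
move=> Du Dv; have := ip_ge0 (subspD Du (subspZ 1 Dv)).
by rewrite -[in u - v]scaleN1r !ip_sqrD// sqrrN expr1n; lra.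
Qed.

Lemma ip_subC u v : D u -> D v -> ip (u - v) (u - v) = ip (v - u) (v - u).
Proof.
move=> Du Dv; rewrite -(opprB v u) ipNl ?ipNr ?opprK//; try exact: subspB.
by apply: subspN; exact: subspB.
Qed.

Lemma ip_eq0 u v : D u -> D v -> ip u u = 0 -> ip u v = 0.
Proof.
move=> Du Dv u0; have := cauchy_schwarz Du Dv; rewrite u0 mul0r => h.
by apply/eqP; rewrite -sqrf_eq0; apply/eqP/le_anti; rewrite h sqr_ge0.
Qed.

Lemma ip_suml (I : Type) (r : seq I) (P : pred I) (F : I -> V) v :
  (forall i, D (F i)) -> D v ->
  D (\sum_(i <- r | P i) F i) /\
  ip (\sum_(i <- r | P i) F i) v = \sum_(i <- r | P i) ip (F i) v.
Proof.
move=> DF Dv; elim/big_rec2 : _ => [|i y x _ [Dx <-]]; first by rewrite ip0l.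
by rewrite ipDl//; split => //; exact: subspD.
Qed.

Lemma ip_sqrt_le u v : D u -> D v -> `|ip u v| <= Num.sqrt (ip u u) * Num.sqrt (ip v v).
Proof.
move=> Du Dv; rewrite -sqrtrM ?ip_ge0//.
by rewrite -sqrtr_sqr ler_sqrt ?mulr_ge0 ?ip_ge0//; exact: cauchy_schwarz.
Qed.

End OnSubspace.

Lemma subspaceT : subspace_of (@setT V). Proof. by []. Qed.

Section Hilbert.
Context (ip : V -> V -> R).
Hypotheses (ipP : inner_product_on setT ip) (cpl : ip_complete ip).

Lemma ip_cvg_ip s u v : ip_cvg ip s u -> ip (s k) v @[k --> \oo] --> ip u v.
Proof.
move=> su; apply/cvgrPdist_le => e e0.
have d0 : 0 < e ^+ 2 / (1 + ip v v).
  by rewrite divr_gt0 ?exprn_gt0// ltr_wpDr ?(ip_ge0 ipP).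
move/cvgrPdist_lt/(_ _ d0) : su; apply: filterS => k.
rewrite distrC subr0 ger0_norm ?(ip_ge0 ipP)// => h.
rewrite distrC -(ipBl subspaceT ipP)//.
apply: norm_le_sqr; first exact: ltW.
apply: le_trans (cauchy_schwarz subspaceT ipP _ _) _ => //.
have vp : 0 < 1 + ip v v by rewrite ltr_wpDr ?(ip_ge0 ipP).
move: h; rewrite ltr_pdivlMr// => /ltW; apply: le_trans.
by apply: ler_wpM2l; rewrite ?(ip_ge0 ipP)// lerDr.
Qed.

Lemma ip_cvg_cauchy s u : ip_cvg ip s u -> cauchy_seq ip s.
Proof.
move=> su e e0; have d0 : 0 < e / 4 by rewrite divr_gt0.
move/cvgrPdist_lt/(_ _ d0) : su => [N _ HN]; exists N => k l Nk Nl.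
have hk := HN k Nk; have hl := HN l Nl.
rewrite /= distrC subr0 ger0_norm ?(ip_ge0 ipP)// in hk.
rewrite /= distrC subr0 ger0_norm ?(ip_ge0 ipP)// in hl.
have -> : s k - s l = (s k - u) - (s l - u) by rewrite opprB addrA subrK.
by apply: le_lt_trans (ip_le_sub subspaceT ipP _ _) _ => //; lra.
Qed.

Lemma ip_cvg_uniq s u v : ip_cvg ip s u -> ip_cvg ip s v -> ip (u - v) (u - v) = 0.
Proof.
move=> su sv; rewrite (ipBl subspaceT ipP)//.
have h1 := ip_cvg_ip (v := u - v) su; have h2 := ip_cvg_ip (v := u - v) sv.
by rewrite (cvg_unique (@norm_hausdorff _ _) h1 h2) subrr.
Qed.

Lemma ip_cvg_sqr s u : ip_cvg ip s u -> ip (s k) (s k) @[k --> \oo] --> ip u u.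
Proof.
move=> su.
have -> : (fun k => ip (s k) (s k)) =
   (fun k => ip (s k - u) (s k - u) + 2 * ip (s k) u - ip u u).
  apply/funext => k; rewrite !(ipBl subspaceT ipP)// !(ipBr subspaceT ipP)//.
  by rewrite (ipC ipP (u := u) (v := s k))//; ring.
have e : ip u u = 0 + 2 * ip u u - ip u u by ring.
have h := ip_cvg_ip (v := u) su; rewrite [X in _ --> X]e.
exact: (cvgB (cvgD su (cvgM (cvg_cst (2 : R)) h)) (cvg_cst (ip u u))).
Qed.

(* Dirichlet principle: [w] minimizes [q v v - 2 * ip f v] over [D]. *)
Lemma riesz_on D q (C : R) f : subspace_of D -> inner_product_on D q -> 0 < C ->
  (forall v, D v -> ip v v <= C * q v v) ->
  exists (w : nat -> V) u, [/\ forall k, D (w k), cauchy_seq q w, ip_cvg ip w u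
    & forall v, D v -> q (w k) v @[k --> \oo] --> ip f v].
Proof.
move=> subD qP C0 coer.
pose J v := q v v - 2 * ip f v.
have Jlb v : D v -> - (C * ip f f) <= J v.
  move=> Dv; rewrite /J.
  have := cauchy_schwarz_eps subspaceT ipP (u := f) (v := v) C0 I I.
  have := coer v Dv; rewrite -ler_pdivrMl// => h1 h2.
  have h3 := ler_norm (ip f v); lra.
have infJ : has_inf (J @` D).
  split; first by exists (J 0); exists 0 => //; exact: subD.1.
  by exists (- (C * ip f f)) => _ [v Dv <-]; exact: Jlb.
pose m := inf (J @` D).
have /choice [w Hw] : forall k : nat, exists v, D v /\ J v < m + k.+1%:R^-1.
  move=> k; have k0 : 0 < k.+1%:R^-1 :> R by rewrite invr_gt0.
  by have [_ [v Dv <-] h] := inf_adherent k0 infJ; exists v.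
have Dw k : D (w k) by case: (Hw k).
have mle v : D v -> m <= J v.
  by move=> Dv; apply: ge_inf; [case: infJ|exists v].
have Jpar t u v : D u -> D v ->
    J (u + t *: v) = J u + 2 * t * (q u v - ip f v) + t ^+ 2 * q v v.
  move=> Du Dv; rewrite /J (ip_sqrD subD qP)//.
  rewrite (ipDr subspaceT ipP)// (ipZr subspaceT ipP)//; ring.
have cw : cauchy_seq q w.
  move=> e e0; have e4 : 0 < e / 4 by rewrite divr_gt0.
  have [N _ HN] := near_infty_natSinv_lt (PosNum e4).
  exists N => k l Nk Nl.
  have hk := HN k Nk; have hl := HN l Nl; rewrite /= in hk hl.
  have [Dk Jk] := Hw k; have [Dl Jl] := Hw l.
  have Dd := subspB subD Dl Dk.
  have h1 := mle _ (subspD subD Dk (subspZ subD 2^-1 Dd)).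
  (* Parallelogram argument: [h1] bounds [J] from below at the midpoint of [w k] and [w l], [h2]
     evaluates it at [w l]. Together they bound [q (w l - w k)] by twice the sum of the two gaps to
     the infimum. *)
  have h2 := Jpar 1 _ _ Dk Dd.
  have e2 : w k + 1 *: (w l - w k) = w l by rewrite scale1r addrC subrK.
  rewrite e2 in h2.
  rewrite Jpar// in h1; rewrite (ip_subC subD qP)//.
  move: h1 h2 hk hl Jk Jl; set Q := q (w l - w k) _; set B := q (w k) _ - _.
  clearbody Q B m; clear; move: (J _) (J _) => x y.
  move: (k.+1%:R^-1) (l.+1%:R^-1) => p r *; lra.
have [u Hu] : exists u, ip_cvg ip w u.
  apply: cpl => e e0; have [|N HN] := cw (e / C); first by rewrite divr_gt0.
  exists N => k l Nk Nl; apply: le_lt_trans (coer _ (subspB subD (Dw k) (Dw l))) _.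
  by rewrite mulrC -ltr_pdivlMr//; exact: HN.
exists w, u; split => // v Dv.
apply/cvgrPdist_le => e e0.
have d0 : 0 < e ^+ 2 / (1 + q v v).
  by rewrite divr_gt0 ?exprn_gt0// ltr_wpDr ?(ip_ge0 qP).
have [N _ HN] := near_infty_natSinv_lt (PosNum d0); exists N => // k Nk.
have /= hk := HN k Nk; have [Dk Jk] := Hw k.
(* On any line through [w k], [J] drops by at most [k.+1%:R^-1]. The discriminant of this quadratic
   bounds the derivative, so [w k] solves the Euler equation approximately. *)
have : (q (w k) v - ip f v) ^+ 2 <= k.+1%:R^-1 * q v v.
  apply: discriminant_le; first exact: (ip_ge0 qP).
  move=> t; have := mle _ (subspD subD Dk (subspZ subD t Dv)).
  rewrite Jpar//; move: Jk; clearbody m; clear; move: (J _) (_ ^-1) => x y; lra.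
rewrite /= distrC => h.
apply: norm_le_sqr; first exact: ltW.
apply: le_trans h _.
have vp : 0 < 1 + q v v by rewrite ltr_wpDr ?(ip_ge0 qP).
move: hk; rewrite ltr_pdivlMr// => /ltW; apply: le_trans.
by apply: ler_wpM2l; rewrite ?invr_ge0// lerDr.
Qed.

End Hilbert.
End InnerProducts.

(** * Friedrichs resolvents and the Fredholm property *)

Section RealLimits.
Context (R : realType) (T : Type) (F : set_system T) {FF : Filter F}.
Implicit Types (f g : T -> R) (a b c : R).

Lemma cvg_add f g a b :
  f @ F --> a -> g @ F --> b -> f x + g x @[x --> F] --> a + b.
Proof. by move=> fa gb; exact: cvgD. Qed.

Lemma cvg_scale c f a : f @ F --> a -> c * f x @[x --> F] --> c * a.
Proof. by move=> fa; apply: cvgM => //; exact: cvg_cst. Qed.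

Lemma cvg_abs f a : f @ F --> a -> `|f x| @[x --> F] --> `|a|.
Proof. exact: cvg_norm. Qed.

End RealLimits.

Lemma cvg_sqr (R : realType) (T : Type) (F : set_system T) {FF : Filter F}
  (f : T -> R) (a : R) : f @ F --> a -> f x ^+ 2 @[x --> F] --> a ^+ 2.
Proof.
move=> fa; rewrite expr2.
have -> : (fun x => f x ^+ 2) = f \* f by apply/funext => x; rewrite expr2.
exact: cvgM.
Qed.

Section Friedrichs.
Context {R : realType} {V : lmodType R} (ip : V -> V -> R).
Hypotheses (ipP : inner_product_on setT ip) (cpl : ip_complete ip).
Context (Lam : V -> V).
Implicit Types (D : set V) (u v f g : V).

Let q u v := ip (Lam u) v.

(** The form domain inside the Hilbert space, as the limits of q-Cauchy sequences; no abstract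
    completion is formed. *)
Definition form_closure D u := exists w : nat -> V,
  [/\ forall k, D (w k), cauchy_seq q w & ip_cvg ip w u].

(* [u] is the image of [f] under the inverse of the Friedrichs extension of
   [Lam] restricted to [D]. *)
Definition resolvent_graph D u f :=
  form_closure D u /\ forall v, D v -> ip (Lam v) u = ip v f.

(** The constant 1 in the last clause is what the shift by [1 - beta] achieves; it makes the
    resolvent a contraction. *)
Definition coercive_form D :=
  [/\ subspace_of D, inner_product_on D q & forall v, D v -> ip v v <= q v v].

Lemma resolvent_ex D f : coercive_form D -> exists u, resolvent_graph D u f.
Proof.
move=> [subD qP co].
have [|w [u [Dw cw wu qw]]] := riesz_on ipP cpl f subD qP ltr01.
  by move=> v Dv; rewrite mul1r; exact: co.
exists u; split; first by exists w.
move=> v Dv; rewrite (ipC ipP)// (ipC ipP (u := v))//.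
apply: cvg_unique (qw v Dv); first exact: norm_hausdorff.
have -> : (fun k => q (w k) v) = (fun k => ip (w k) (Lam v)).
  by apply/funext => k; rewrite (ipC qP)// /q (ipC ipP).
exact: ip_cvg_ip.
Qed.

Lemma resolvent_lin D a u f v g : coercive_form D ->
  resolvent_graph D u f -> resolvent_graph D v g ->
  resolvent_graph D (a *: u + v) (a *: f + g).
Proof.
move=> [subD qP co] [[w [Dw cw wu]] uf] [[x [Dx cx xv]] vg]; split; last first.
  move=> y Dy; rewrite !(ipDr subspaceT ipP)// !(ipZr subspaceT ipP)//.
  by rewrite uf// vg.
exists (fun k => a *: w k + x k); split.
- by move=> k; exact: subD.2.
- move=> e e0.
  have [|N1 H1] := cw (e / (4 * (1 + a ^+ 2))).
    by rewrite divr_gt0// mulr_gt0// ltr_wpDr ?sqr_ge0.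
  have [|N2 H2] := cx (e / 4); first by rewrite divr_gt0.
  exists (maxn N1 N2) => k l; rewrite !geq_max => /andP[k1 k2] /andP[l1 l2].
  rewrite opprD addrACA -scalerBr.
  have Dwk := subspB subD (Dw k) (Dw l); have Dxk := subspB subD (Dx k) (Dx l).
  apply: le_lt_trans (ip_le_sum subD qP _ _) _ => //; first exact: subspZ.
  rewrite (ipZl subD qP)//; last exact: subspZ.
  rewrite (ipZr subD qP)//.
  have := H2 k l k2 l2; have := H1 k l k1 l1.
  have p0 := ip_ge0 qP Dwk.
  rewrite ltr_pdivlMr ?mulr_gt0// ?ltr_wpDr ?sqr_ge0//.
  by move: p0; set p := q (w k - w l) _; set r := q (x k - x l) _ => *; nra.
- apply/cvgrPdist_lt => e e0.
  have d0 : 0 < e / (4 * (1 + a ^+ 2)).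
    by rewrite divr_gt0// mulr_gt0// ltr_wpDr ?sqr_ge0.
  have e4 : 0 < e / 4 by rewrite divr_gt0.
  move/cvgrPdist_lt/(_ _ d0) : wu; move/cvgrPdist_lt/(_ _ e4) : xv.
  apply: filterS2 => k; rewrite !sub0r !normrN !ger0_norm ?(ip_ge0 ipP)//.
  rewrite opprD addrACA -scalerBr => h1 h2.
  apply: le_lt_trans (ip_le_sum subspaceT ipP _ _) _ => //.
  rewrite (ipZl subspaceT ipP)// (ipZr subspaceT ipP)//.
  have p0 := ip_ge0 ipP (I : setT (w k - u)).
  move: h2; rewrite ltr_pdivlMr ?mulr_gt0// ?ltr_wpDr ?sqr_ge0//.
  by move: p0 h1; set p := ip (w k - u) _; set r := ip (x k - v) _ => *; nra.
Qed.

(** As [q (w l) y] tends to [ip f y], the bound is the limit in [l] of Cauchy-Schwarz for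
    [w k - w l]. It is uniform in [y], so [y] may vary with [k]. *)
Lemma resolvent_approx D u f (w : nat -> V) (e : R) : coercive_form D ->
  (forall k, D (w k)) -> cauchy_seq q w -> ip_cvg ip w u ->
  (forall v, D v -> ip (Lam v) u = ip v f) -> 0 < e ->
  \forall k \near \oo, forall y, D y -> (q (w k) y - ip f y) ^+ 2 <= e * q y y.
Proof.
move=> [subD qP co] Dw cw wu uf e0.
have [N HN] := cw e e0; exists N => // k Nk y Dy.
have h : (fun l => (q (w k) y - q (w l) y) ^+ 2) @ \oo --> (q (w k) y - ip f y) ^+ 2.
  have hl : q (w l) y @[l --> \oo] --> ip f y.
    have -> : (fun l => q (w l) y) = (fun l => ip (w l) (Lam y)).
      by apply/funext => l; rewrite (ipC qP)// /q (ipC ipP).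
    by rewrite (ipC ipP (u := f))// -uf// (ipC ipP)//; exact: ip_cvg_ip.
  have hd : q (w k) y - q (w l) y @[l --> \oo] --> q (w k) y - ip f y.
    by apply: cvgB => //; exact: cvg_cst.
  exact: cvg_sqr hd.
apply: (cvgr_to_le h); exists N => // l Nl /=.
rewrite -(ipBl subD qP)//.
apply: le_trans (cauchy_schwarz subD qP _ _) _ => //; first exact: subspB.
by apply: ler_wpM2r; [exact: (ip_ge0 qP)|apply/ltW/HN].
Qed.

Lemma cauchy_bounded D (w : nat -> V) : coercive_form D ->
  (forall k, D (w k)) -> cauchy_seq q w ->
  exists B, \forall k \near \oo, q (w k) (w k) <= B.
Proof.
move=> [subD qP co] Dw cw; have [N HN] := cw 1 ltr01.
exists (2 + 2 * q (w N) (w N)); exists N => // k Nk /=.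
have h := HN k N Nk (leqnn N).
rewrite -(subrK (w N) (w k)).
apply: le_trans (ip_le_sum subD qP _ _) _ => //; first exact: subspB.
lra.
Qed.

(** Both arguments of q move with [k]; the uniformity in [resolvent_approx] handles this, as
    [q (x k) (x k)] stays bounded. Symmetry of the resolvent and its norm bound both follow from
    this limit. *)
Lemma resolvent_energy D u f (w : nat -> V) : coercive_form D ->
  (forall k, D (w k)) -> cauchy_seq q w -> ip_cvg ip w u ->
  (forall v, D v -> ip (Lam v) u = ip v f) ->
  forall v g (x : nat -> V),
  (forall k, D (x k)) -> cauchy_seq q x -> ip_cvg ip x v ->
  q (w k) (x k) @[k --> \oo] --> ip f v.
Proof.
move=> cD Dw cw wu uf v g x Dx cx xv.
have [B HB] := cauchy_bounded cD Dx cx.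
have fx : ip f (x k) @[k --> \oo] --> ip f v.
  have -> : (fun k => ip f (x k)) = (fun k => ip (x k) f).
    by apply/funext => k; rewrite (ipC ipP).
  by rewrite (ipC ipP)//; exact: ip_cvg_ip.
have h : (q (w k) (x k) - ip f (x k)) @[k --> \oo] --> (0 : R).
  apply/cvgrPdist_le => e e0; rewrite /=.
  have d0 : 0 < e ^+ 2 / (1 + `|B|) by rewrite divr_gt0 ?exprn_gt0// ltr_wpDr.
  have := resolvent_approx cD Dw cw wu uf d0; apply: filterS2 HB => k HBk h.
  rewrite sub0r normrN; apply: norm_le_sqr; first exact: ltW.
  apply: le_trans (h _ (Dx k)) _.
  rewrite mulrAC ler_pdivrMr ?ltr_wpDr//; apply: ler_wpM2l; first exact: sqr_ge0.
  by apply: le_trans HBk _; have := ler_norm B; lra.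
have -> : (fun k => q (w k) (x k)) =
    (fun k => (q (w k) (x k) - ip f (x k)) + ip f (x k)).
  by apply/funext => k; rewrite subrK.
rewrite -[X in _ --> X]add0r; exact: cvgD.
Qed.

Lemma resolvent_sym D u f v g : coercive_form D ->
  resolvent_graph D u f -> resolvent_graph D v g -> ip u g = ip f v.
Proof.
move=> cD [[w [Dw cw wu]] uf] [[x [Dx cx xv]] vg].
have h1 := resolvent_energy cD Dw cw wu uf g Dx cx xv.
have h2 := resolvent_energy cD Dx cx xv vg f Dw cw wu.
have e : (fun k => q (x k) (w k)) = (fun k => q (w k) (x k)).
  by apply/funext => k; case: cD => _ qP _; rewrite (ipC qP).
rewrite e in h2; rewrite (ipC ipP)//.
exact: (cvg_unique (@norm_hausdorff _ _) h2 h1).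
Qed.

Lemma resolvent_le D u f : coercive_form D -> resolvent_graph D u f ->
  ip u u <= ip f u.
Proof.
move=> cD [[w [Dw cw wu]] uf].
have h1 := resolvent_energy cD Dw cw wu uf 0 Dw cw wu.
apply: (ler_cvg_to (ip_cvg_sqr ipP wu) h1); near=> k.
by case: cD => _ _; apply.
Unshelve. all: by end_near. Qed.

Lemma resolvent_bound D u f : coercive_form D -> resolvent_graph D u f ->
  ip f u <= ip f f.
Proof.
move=> cD h; have h1 := resolvent_le cD h.
have := cauchy_schwarz_eps subspaceT ipP (u := f) (v := u) ltr01 I I.
by have := ler_norm (ip f u); rewrite invr1; lra.
Qed.

Lemma resolvent_uniq D u v f : coercive_form D ->
  resolvent_graph D u f -> resolvent_graph D v f -> ip (u - v) (u - v) = 0.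
Proof.
move=> cD h1 h2; have := resolvent_lin (-1) cD h2 h1.
rewrite scaleN1r addrC scaleN1r addNr => /(resolvent_le cD).
rewrite (ip0l subspaceT ipP)// => h; apply/le_anti.
by rewrite h (ip_ge0 ipP).
Qed.

Lemma resolvent_ip_lin D a u f v g w y : coercive_form D ->
  resolvent_graph D u f -> resolvent_graph D v g ->
  resolvent_graph D w (a *: f + g) -> ip w y = a * ip u y + ip v y.
Proof.
move=> cD uf vg wh; have := resolvent_uniq cD wh (resolvent_lin a cD uf vg).
move=> /(ip_eq0 subspaceT ipP (v := y) I I).
rewrite (ipBl subspaceT ipP)// (ipDl ipP)// (ipZl subspaceT ipP)//.
by move/eqP; rewrite subr_eq0 => /eqP.
Qed.

(** Compactness of the difference of two resolvents, as smallness up to a quadratic form of finite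
    rank. Only finite lists of functionals occur, so no subsequences have to be extracted later. *)
Definition compact_difference (D D0 : set V) := forall e : R, 0 < e ->
  exists s : seq V, forall f u u0, resolvent_graph D u f ->
    resolvent_graph D0 u0 f ->
    ip (u - u0) (u - u0) <= e * ip f f + \sum_(x <- s) ip f x ^+ 2.

(** The difference [u - u0] is the limit of [z k = w k - w0 k]. On [D0] both [q (w k)] and
    [q (w0 k)] approximate [ip f], and [X (z k)] lies in [D0] with bounded form, so
    [q (z k) (X (z k))] tends to 0. The last hypothesis, applied to [z k], then passes to the
    limit. *)
Lemma compact_differenceP (D D0 : set V) (X : V -> V) (C : R) :
  coercive_form D -> coercive_form D0 -> D0 `<=` D ->
  (forall v, D v -> D0 (X v)) ->
  (forall v, D v -> q (X v) (X v) <= C * q v v) ->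
  (forall e : R, 0 < e -> exists s : seq V, forall v, D v ->
     ip v v <= C * `|q v (X v)| + e * q v v + \sum_(x <- s) ip v x ^+ 2) ->
  compact_difference D D0.
Proof.
move=> cD cD0 D0D XD Xq H e e0.
have C0 : 0 <= C \/ C < 0 by case: (leP 0 C); [left|right].
(* The form of [z k] is at most twice those of [w k] and [w0 k] together, and each of these tends to
   a limit of at most [ip f f]: four times in all. *)
have e4 : 0 < e / 4 by rewrite divr_gt0.
have [s Hs] := H _ e4.
(* By symmetry of the resolvents, a functional of [u - u0] becomes a functional of [f], represented
   by [r x - r0 x]. *)
have /choice [r Hr] : forall x, exists u, resolvent_graph D u x.
  by move=> x; exact: resolvent_ex.
have /choice [r0 Hr0] : forall x, exists u, resolvent_graph D0 u x.
  by move=> x; exact: resolvent_ex.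
exists [seq r x - r0 x | x <- s] => f u u0 uf u0f.
have -> : \sum_(x <- [seq r x - r0 x | x <- s]) ip f x ^+ 2
    = \sum_(x <- s) ip (u - u0) x ^+ 2.
  rewrite big_map; apply: eq_bigr => x _.
  rewrite (ipBr subspaceT ipP)// (ipBl subspaceT ipP)//.
  by rewrite (resolvent_sym cD uf (Hr x)) (resolvent_sym cD0 u0f (Hr0 x)).
case: (uf) => -[w [Dw cw wu] hu]; case: (u0f) => -[w0 [Dw0 cw0 wu0] hu0].
have Dw0' k : D (w0 k) by exact: D0D.
pose z k := w k - w0 k.
have [subD qP co] := cD.
have Dz k : D (z k) by exact: subspB.
have zu : ip_cvg ip z (u - u0).
  apply/cvgrPdist_lt => d d0.
  have d4 : 0 < d / 4 by rewrite divr_gt0.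
  move/cvgrPdist_lt/(_ _ d4) : wu; move/cvgrPdist_lt/(_ _ d4) : wu0.
  apply: filterS2 => k; rewrite !sub0r !normrN !ger0_norm ?(ip_ge0 ipP)// => h1 h2.
  have -> : z k - (u - u0) = (w k - u) - (w0 k - u0) by rewrite /z !opprD !opprK addrACA.
  by apply: le_lt_trans (ip_le_sub subspaceT ipP _ _) _ => //; lra.
have qz : \forall k \near \oo, q (z k) (z k) <= 2 * q (w k) (w k) + 2 * q (w0 k) (w0 k).
  by near=> k; exact: (ip_le_sub subD qP).
have qw := resolvent_energy cD Dw cw wu hu 0 Dw cw wu.
have qw0 := resolvent_energy cD0 Dw0 cw0 wu0 hu0 0 Dw0 cw0 wu0.
have zx : q (z k) (X (z k)) @[k --> \oo] --> (0 : R).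
  have [B1 HB1] := cauchy_bounded cD Dw cw.
  have [B2 HB2] := cauchy_bounded cD0 Dw0 cw0.
  pose B := `|C| * (2 * `|B1| + 2 * `|B2|).
  have B0 : 0 <= B by rewrite mulr_ge0// addr_ge0// mulr_ge0.
  apply/cvgrPdist_le => d d0.
  (* The factor 4 pays for splitting the square into two approximation errors, [1 + B] for the size
     of the form at [X (z k)]. *)
  have d1 : 0 < d ^+ 2 / (4 * (1 + B)).
    by rewrite divr_gt0 ?exprn_gt0// mulr_gt0// ltr_wpDr.
  have a1 := resolvent_approx cD Dw cw wu hu d1.
  have a2 := resolvent_approx cD0 Dw0 cw0 wu0 hu0 d1.
  near=> k; rewrite sub0r normrN; apply: norm_le_sqr; first exact: ltW.
  have D0X : D0 (X (z k)) by exact: XD.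
  have h1 : (q (w k) (X (z k)) - ip f (X (z k))) ^+ 2
      <= d ^+ 2 / (4 * (1 + B)) * q (X (z k)) (X (z k)).
    suff : forall y, D y -> (q (w k) y - ip f y) ^+ 2 <= d ^+ 2 / (4 * (1 + B)) * q y y.
      by apply; exact: D0D.
    by near: k; exact: a1.
  have h2 : (q (w0 k) (X (z k)) - ip f (X (z k))) ^+ 2
      <= d ^+ 2 / (4 * (1 + B)) * q (X (z k)) (X (z k)).
    suff : forall y, D0 y -> (q (w0 k) y - ip f y) ^+ 2 <= d ^+ 2 / (4 * (1 + B)) * q y y.
      by apply.
    by near: k; exact: a2.
  have h3 : q (X (z k)) (X (z k)) <= B.
    apply: le_trans (Xq _ (Dz k)) _; apply: le_trans (ler_norm _) _.
    rewrite normrM; apply: ler_wpM2l => //; rewrite ger0_norm ?(ip_ge0 qP)//.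
    have hb1 : q (w k) (w k) <= B1 by near: k.
    have hb2 : q (w0 k) (w0 k) <= B2 by near: k.
    have hz : q (z k) (z k) <= 2 * q (w k) (w k) + 2 * q (w0 k) (w0 k) by near: k.
    by have := ler_norm B1; have := ler_norm B2; lra.
  rewrite /z {1}/q -/(z k) -/(q _ _) (ipBl subD qP)//; last exact: D0D.
  have hs x y : (x - y) ^+ 2 <= 2 * x ^+ 2 + 2 * y ^+ 2 :> R.
    by have := sqr_ge0 (x + y); rewrite sqrrD sqrrB; lra.
  have -> : q (w k) (X (z k)) - q (w0 k) (X (z k)) =
    (q (w k) (X (z k)) - ip f (X (z k))) - (q (w0 k) (X (z k)) - ip f (X (z k))).
    by ring.
  apply: le_trans (hs _ _) _.
  apply: (@le_trans _ _ (4 * (d ^+ 2 / (4 * (1 + B)) * q (X (z k)) (X (z k))))); first lra.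
  have -> : 4 * (d ^+ 2 / (4 * (1 + B)) * q (X (z k)) (X (z k)))
     = d ^+ 2 * (q (X (z k)) (X (z k)) / (1 + B)) by field; rewrite gt_eqF// ltr_wpDr.
  rewrite -[leRHS]mulr1.
  by apply: ler_wpM2l; rewrite ?sqr_ge0// ler_pdivrMr ?ltr_wpDr// mul1r; lra.
have l1 : C * `|q (z k) (X (z k))| @[k --> \oo] --> C * 0.
  by apply: cvg_scale; have := cvg_abs zx; rewrite normr0; exact.
have l2 : e / 4 * (2 * q (w k) (w k) + 2 * q (w0 k) (w0 k)) @[k --> \oo]
    --> e / 4 * (2 * ip f u + 2 * ip f u0).
  by apply: cvg_scale; apply: cvg_add; exact: cvg_scale.
have l3 : \sum_(x <- s) ip (z k) x ^+ 2 @[k --> \oo] --> \sum_(x <- s) ip (u - u0) x ^+ 2.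
  by apply: cvg_big => [|x _]; [exact: add_continuous|exact: (cvg_sqr (ip_cvg_ip ipP zu))].
have lim1 : C * `|q (z k) (X (z k))| + e / 4 * (2 * q (w k) (w k) + 2 * q (w0 k) (w0 k))
   + \sum_(x <- s) ip (z k) x ^+ 2 @[k --> \oo] -->
   C * 0 + e / 4 * (2 * ip f u + 2 * ip f u0) + \sum_(x <- s) ip (u - u0) x ^+ 2.
  by apply: cvg_add l3; exact: cvg_add.
have hk : \forall k \near \oo, ip (z k) (z k) <= C * `|q (z k) (X (z k))| +
    e / 4 * (2 * q (w k) (w k) + 2 * q (w0 k) (w0 k)) + \sum_(x <- s) ip (z k) x ^+ 2.
  near=> k; apply: le_trans (Hs _ (Dz k)) _; rewrite lerD2r lerD2l.
  by apply: ler_wpM2l; [exact: ltW|near: k].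
have := ler_cvg_to (ip_cvg_sqr ipP zu) lim1 hk.
rewrite mulr0 add0r => h; apply: (le_trans (h _)); rewrite lerD2r.
have := resolvent_bound cD uf; have := resolvent_bound cD0 u0f; nra.
Unshelve. all: by end_near. Qed.

End Friedrichs.

(** * Uniform boundedness principle *)

Section UniformBoundedness.
Context {R : realType} {V : lmodType R} (ip : V -> V -> R).
Hypotheses (ipP : inner_product_on setT ip) (cpl : ip_complete ip).

Let N u := Num.sqrt (ip u u).

Let N_ge0 u : 0 <= N u. Proof. exact: sqrtr_ge0. Qed.

Let N_sqr u : N u ^+ 2 = ip u u.
Proof. by rewrite sqr_sqrtr// (ip_ge0 ipP). Qed.

Let N_triangle u v : N (u + v) <= N u + N v.
Proof.
rewrite -(@ler_pXn2r _ 2) ?nnegrE ?addr_ge0// sqrrD !N_sqr.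
rewrite -[in u + v](scale1r v) (ip_sqrD subspaceT ipP)// expr1n mul1r.
rewrite lerD2r lerD2l mulr1 mulr2n mulrDl mul1r.
have := ip_sqrt_le subspaceT ipP (u := u) (v := v) I I.
rewrite -/(N u) -/(N v) => h; have := ler_norm (ip u v); lra.
Qed.

Let CS u v : `|ip u v| <= N u * N v.
Proof. exact: (ip_sqrt_le subspaceT ipP). Qed.

(* Sokal's proof: steps of size [3 ^- j] against functionals of norm [4 ^ j]. *)
Lemma uniform_boundedness (F : nat -> V) :
  (forall x, exists B, forall k, `|ip (F k) x| <= B) ->
  exists B, forall k, ip (F k) (F k) <= B.
Proof.
move=> wb; apply: contrapT => nb.
have /choice [n Hn] : forall j : nat, exists k, (4 ^+ j.+1) ^+ 2 < ip (F k) (F k).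
  move=> j; apply: contrapT => h; apply: nb; exists ((4 ^+ j.+1) ^+ 2) => k.
  by rewrite leNgt; apply/negP => hk; apply: h; exists k.
pose G j := F (n j).
have NG j : 4 ^+ j.+1 <= N (G j).
  rewrite -(@ler_pXn2r _ 2) ?nnegrE ?exprn_ge0 ?N_ge0// N_sqr.
  exact: ltW.
have NG0 j : 0 < N (G j) by apply: lt_le_trans (NG j); rewrite exprn_gt0.
(* With this sign the new step cannot cancel the value of [G j] at the current point, so that value
   becomes at least [3 ^- j.+1 * N (G j)] in modulus. *)
pose sg x j : R := if 0 <= ip (G j) x then 1 else -1.
pose x := fix x (j : nat) : V := if j is i.+1 then
   x i + (sg (x i) i * 3 ^- i.+1 / N (G i)) *: G i else 0.
have xS j : x j.+1 = x j + (sg (x j) j * 3 ^- j.+1 / N (G j)) *: G j by [].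
have sg2 y j : sg y j ^+ 2 = 1 by rewrite /sg; case: ifP; rewrite ?sqrrN expr1n.
have three j : 0 < 3 ^- j :> R by rewrite invr_gt0 exprn_gt0.
have step i : N (x i.+1 - x i) = 3 ^- i.+1.
  apply/eqP; rewrite -(@eqrXn2 _ 2) ?N_ge0 ?ltW//; apply/eqP.
  rewrite N_sqr xS addrC addKr.
  rewrite (ipZl subspaceT ipP)// (ipZr subspaceT ipP)// -N_sqr.
  move: (NG0 i) (three i.+1) (sg2 (x i) i); set p := 3 ^- _; set c := sg _ _.
  move: (N (G i)) => y y0 p0 c2; rewrite -[RHS]mul1r -c2; field; exact: lt0r_neq0.
have dist j m : N (x (j + m)%N - x j) <= 3 ^- j / 2 * (1 - 3 ^- m).
  elim: m => [|m IH].
    by rewrite addn0 subrr expr0 invr1 subrr mulr0 /N (ip0l subspaceT ipP)// sqrtr0.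
  rewrite addnS -(subrK (x (j + m)%N) (x (j + m).+1)) -addrA.
  apply: le_trans (N_triangle _ _) _; rewrite step.
  apply: le_trans (lerD (lexx _) IH) _; rewrite -addnS exprD invfM exprS.
  rewrite le_eqVlt; apply/orP; left; apply/eqP; field.
  by rewrite !expf_neq0.
have dist' j k : (j <= k)%N -> N (x k - x j) <= 3 ^- j / 2.
  move=> jk; rewrite -(subnKC jk); apply: le_trans (dist _ _) _.
  by rewrite ler_piMr ?divr_ge0 ?ltW// lerBlDr lerDl ltW.
have cx : cauchy_seq ip x.
  move=> e e0; have s0 : 0 < Num.sqrt e by rewrite sqrtr_gt0.
  have [M HM] : exists M : nat, 3 ^- M < Num.sqrt e.
    pose M := Num.bound (Num.sqrt e)^-1; exists M.
    rewrite -[ltRHS]invrK ltf_pV2 ?posrE ?exprn_gt0 ?invr_gt0//.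
    have h1 : (Num.sqrt e)^-1 < M%:R.
      by apply: archi_boundP; rewrite invr_ge0 sqrtr_ge0.
    apply: lt_le_trans h1 _.
    rewrite -natrX ler_nat; apply: ltnW; exact: ltn_expl.
  exists M => k l Mk Ml; rewrite -N_sqr -[ltRHS](@sqr_sqrtr _ e) ?ltW//.
  rewrite ltr_pXn2r ?nnegrE ?sqrtr_ge0//; apply: le_lt_trans HM.
  have -> : x k - x l = (x k - x M) + - (x l - x M) by rewrite opprB addrA subrK.
  apply: le_trans (N_triangle _ _) _.
  have -> : N (- (x l - x M)) = N (x l - x M).
    by rewrite /N (ipNl subspaceT ipP)// (ipNr subspaceT ipP)// opprK.
  have := dist' _ _ Mk; have := dist' _ _ Ml; lra.
have [y xy] := cpl cx.
have [B HB] := wb y.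
(* All later steps together have length at most half of [3 ^- j.+1], so half of the gain at [G j]
   survives in the limit [y]. The powers of 4/3 are unbounded by Bernoulli's inequality. *)
have low j : 4 ^+ j.+1 * 3 ^- j.+1 / 2 <= B.
  apply: le_trans (HB (n j)); rewrite -/(G j).
  have l1 := cvg_abs (ip_cvg_ip ipP (v := G j) xy).
  rewrite (ipC ipP)//.
  apply: (cvgr_to_ge (l1 _)); exists j.+1 => // k /= jk.
  have h0 : ip (x k) (G j) = ip (x j.+1) (G j) + ip (x k - x j.+1) (G j).
    by rewrite -(ipDl ipP)// addrC subrK.
  have h1 := CS (x k - x j.+1) (G j).
  have h2 := dist' _ _ jk.
  have h3 : 3 ^- j.+1 * N (G j) <= `|ip (x j.+1) (G j)|.
    rewrite xS (ipDl ipP)// (ipZl subspaceT ipP)// -N_sqr.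
    have -> : sg (x j) j * 3 ^- j.+1 / N (G j) * N (G j) ^+ 2
      = sg (x j) j * (3 ^- j.+1 * N (G j)) by field; rewrite expf_neq0//= gt_eqF.
    have p0 : 0 <= 3 ^- j.+1 * N (G j) by rewrite mulr_ge0// ltW.
    move: p0; set p := 3 ^- _ * _ => p0.
    rewrite /sg (ipC ipP (u := x j))//; case: (leP 0 (ip (G j) (x j))) => h.
      by rewrite mul1r ger0_norm ?addr_ge0// lerDr.
    by rewrite mulN1r ltr0_norm; lra.
  have h4 : N (x k - x j.+1) * N (G j) <= 3 ^- j.+1 / 2 * N (G j).
    by rewrite ler_wpM2r.
  have h5 : 3 ^- j.+1 * 4 ^+ j.+1 <= 3 ^- j.+1 * N (G j).
    by rewrite ler_wpM2l// ltW.
  have h6 := lerB_dist (ip (x j.+1) (G j)) (- ip (x k - x j.+1) (G j)).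
  rewrite opprK normrN -h0 in h6.
  move: h1 h3 h4 h5 h6.
  move: (ip (x k - x j.+1) (G j)) (ip (x k) (G j)) (ip (x j.+1) (G j)) => a1 a2 a3.
  move: (N _) (N _) (3 ^- j.+1) (4 ^+ j.+1) => n1 n2 p r; lra.
have bern j : 1 + j%:R / 3 <= (4 / 3) ^+ j :> R.
  elim: j => [|j IH]; first by rewrite mul0r addr0 expr0.
  rewrite exprS -natr1.
  by have := ler0n R j; nra.
have := low (Num.bound (6 * `|B|)).
rewrite -expr_div_n; set M := Num.bound _ => h.
have h1 : 6 * `|B| < M%:R.
  by apply: archi_boundP; rewrite mulr_ge0.
have := bern M.+1; rewrite -natr1; have := ler_norm B; lra.
Qed.

End UniformBoundedness.

(** * The Fredholm property as a coercivity estimate *)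

Section Fredholm.
Context {R : realType} {V : lmodType R} (ip : V -> V -> R).
Hypotheses (ipP : inner_product_on setT ip) (cpl : ip_complete ip).
Context (Lam : V -> V) (D : set V) (kap : R).
Hypothesis cD : coercive_form ip Lam D.

Local Notation rg := (resolvent_graph ip Lam D).

(** Used with [u = T f]: how far [f] is from the kernel of [1 - kap T] and from the common zeros of
    the functionals. *)
Definition defect m (e : 'I_m -> V) (f u : V) : R :=
  ip (f - kap *: u) (f - kap *: u) + \sum_(i < m) ip f (e i) ^+ 2.

Definition fredholm_estimate m := exists (C : R) (e : 'I_m -> V), 0 < C /\
  forall u f, rg u f -> ip f f <= C * defect e f u.

Definition finite_codim m := exists e : 'I_m -> V, forall f,
  exists (c : 'I_m -> R) u g, rg u g /\
    let z := f - (g - kap *: u + \sum_(i < m) c i *: e i) in ip z z = 0.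

Let ge0 u : 0 <= ip u u. Proof. exact: (ip_ge0 ipP). Qed.

Lemma ip_null_add x y : ip y y = 0 -> ip (x + y) (x + y) = ip x x.
Proof.
move=> y0; rewrite -[in x + y](scale1r y) (ip_sqrD subspaceT ipP)//.
rewrite y0 (ipC ipP (u := x) (v := y))// (ip_eq0 subspaceT ipP (u := y))//.
by rewrite !mulr0 !addr0.
Qed.

Lemma ip_null_sum m (c : 'I_m -> R) (y : 'I_m -> V) :
  (forall i, ip (y i) (y i) = 0) ->
  let z := \sum_(i < m) c i *: y i in ip z z = 0.
Proof.
move=> y0 /=; elim/big_ind : _ => [|a b a0 b0|i _].
- by rewrite (ip0l subspaceT ipP).
- by rewrite ip_null_add.
- by rewrite (ipZl subspaceT ipP)// (ipZr subspaceT ipP)// y0 !mulr0.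
Qed.

Lemma defect_ge0 m (e : 'I_m -> V) f u : 0 <= defect e f u.
Proof. by rewrite addr_ge0// sumr_ge0// => i _; rewrite sqr_ge0. Qed.

Lemma defect_add m (e : 'I_m -> V) f u g v :
  defect e (f + g) (u + v) <= 2 * defect e f u + 2 * defect e g v.
Proof.
rewrite /defect scalerDr opprD addrACA.
have h1 := ip_le_sum subspaceT ipP (u := f - kap *: u) (v := g - kap *: v) I I.
have h2 : \sum_(i < m) ip (f + g) (e i) ^+ 2 <=
    2 * \sum_(i < m) ip f (e i) ^+ 2 + 2 * \sum_(i < m) ip g (e i) ^+ 2.
  rewrite !mulr_sumr -big_split/=; apply: ler_sum => i _.
  rewrite (ipDl ipP)//; have := sqr_ge0 (ip f (e i) - ip g (e i)).
  by move: (ip f (e i)) (ip g (e i)) => a b; lra.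
lra.
Qed.

Lemma defect_scale m (e : 'I_m -> V) t f u :
  defect e (t *: f) (t *: u) = t ^+ 2 * defect e f u.
Proof.
rewrite /defect scalerA mulrC -scalerA -scalerBr mulrDr mulr_sumr.
rewrite (ipZl subspaceT ipP)// (ipZr subspaceT ipP)// mulrA -expr2; congr (_ + _).
by apply: eq_bigr => i _; rewrite (ipZl subspaceT ipP)// exprMn.
Qed.

Lemma rgZ t u f : rg u f -> rg (t *: u) (t *: f).
Proof.
move=> h; have h0 := resolvent_lin ipP (-1) cD h h.
by have := resolvent_lin ipP t cD h h0; rewrite !scaleN1r !addNr !addr0.
Qed.

Lemma rgD u f v g : rg u f -> rg v g -> rg (u + v) (f + g).
Proof. by move=> h1 /(resolvent_lin ipP 1 cD h1); rewrite !scale1r. Qed.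

Lemma rgB u f v g : rg u f -> rg v g -> rg (u - v) (f - g).
Proof. by move=> h1 /(rgZ (-1)); rewrite !scaleN1r; exact: rgD. Qed.

Lemma defect_sub m (e : 'I_m -> V) f u g v :
  defect e (f - g) (u - v) <= 2 * defect e f u + 2 * defect e g v.
Proof.
apply: le_trans (defect_add _ _ _ _ _) _.
by rewrite -(scaleN1r g) -(scaleN1r v) defect_scale sqrrN expr1n mul1r.
Qed.

Lemma defect_le m (e : 'I_m -> V) : exists M : R, 0 < M /\
  forall u f, rg u f -> defect e f u <= M * ip f f.
Proof.
exists (2 + 2 * kap ^+ 2 + \sum_(i < m) ip (e i) (e i)); split.
  apply: ltr_pwDl; last exact: sumr_ge0.
  by rewrite ltr_pwDl// mulr_ge0// sqr_ge0.
move=> u f uf; rewrite mulrDl; apply: lerD.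
  apply: le_trans (ip_le_sub subspaceT ipP _ _) _ => //.
  rewrite (ipZl subspaceT ipP)// (ipZr subspaceT ipP)//.
  have := le_trans (resolvent_le ipP cD uf) (resolvent_bound ipP cD uf).
  by have := sqr_ge0 kap; nra.
rewrite mulr_suml; apply: ler_sum => i _.
by rewrite mulrC; apply: (cauchy_schwarz subspaceT ipP).
Qed.

(** If the estimate fails, there are vectors of unbounded norm and defect at most 1. Every [x] is
    [(1 - kap T) g] plus a combination of the [e i], and [1 - kap T] is symmetric, so the pairing of
    these vectors with [x] is bounded by their defect. Uniform boundedness gives a contradiction. *)
Lemma finite_codim_estimate m : finite_codim m -> fredholm_estimate m.
Proof.
move=> [e He]; apply: contrapT => ne.
have /choice [fu Hfu] : forall k : nat, exists fu : V * V, rg fu.2 fu.1 /\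
    k.+1%:R * defect e fu.1 fu.2 < ip fu.1 fu.1.
  move=> k; apply: contrapT => h; apply: ne; exists k.+1%:R, e; split => // u f uf.
  by rewrite leNgt; apply/negP => hk; apply: h; exists (f, u).
pose f k := (fu k).1; pose u k := (fu k).2.
have f0 k : 0 < ip (f k) (f k).
  by case: (Hfu k) => _; apply: le_lt_trans; rewrite mulr_ge0// defect_ge0.
pose t k : R := Num.sqrt (k.+1%:R / ip (f k) (f k)).
have t2 k : t k ^+ 2 = k.+1%:R / ip (f k) (f k) by rewrite sqr_sqrtr// divr_ge0.
have nF k : ip (t k *: f k) (t k *: f k) = k.+1%:R.
  rewrite (ipZl subspaceT ipP)// (ipZr subspaceT ipP)// mulrA -expr2 t2.
  by rewrite mulfVK// gt_eqF.
have dF k : defect e (t k *: f k) (t k *: u k) <= 1.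
  rewrite defect_scale t2 mulrAC ler_pdivrMr// mul1r; apply: ltW.
  by case: (Hfu k).
have rF k : rg (t k *: u k) (t k *: f k) by apply: rgZ; case: (Hfu k).
have [B HB] : exists B, forall k, ip (t k *: f k) (t k *: f k) <= B.
  apply: (uniform_boundedness ipP cpl) => x.
  have [c [v [g [vg xz]]]] := He x.
  exists (1 + ip g g + \sum_(i < m) `|c i|) => k.
  move: (rF k) (dF k); move: (t k *: f k) (t k *: u k) => F U rU dU.
  have hsq1 i : ip F (e i) ^+ 2 <= 1.
    apply: le_trans dU; rewrite /defect (bigD1 i)//=.
    rewrite addrCA lerDl addr_ge0// sumr_ge0// => j _; exact: sqr_ge0.
  have hT : ip (F - kap *: U) (F - kap *: U) <= 1.
    by apply: le_trans dU; rewrite lerDl sumr_ge0// => j _; exact: sqr_ge0.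
  set s := \sum_(i < m) c i *: e i in xz *.
  have -> : ip F x = ip (F - kap *: U) g + ip F s.
    have -> : ip (F - kap *: U) g = ip F (g - kap *: v).
      rewrite (ipBl subspaceT ipP)// (ipBr subspaceT ipP)//.
      rewrite (ipZl subspaceT ipP)// (ipZr subspaceT ipP)//.
      by rewrite (resolvent_sym ipP cD rU vg).
    rewrite -(ipDr subspaceT ipP)//.
    have := ip_eq0 subspaceT ipP (v := F) I I xz.
    rewrite (ipC ipP)// (ipBr subspaceT ipP)// => /eqP.
    by rewrite subr_eq0 => /eqP.
  apply: le_trans (ler_normD _ _) _; apply: lerD.
    have := cauchy_schwarz_eps subspaceT ipP (u := F - kap *: U) (v := g) ltr01 I I.
    by rewrite invr1; have := ge0 g; have := normr_ge0 (ip (F - kap *: U) g); lra.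
  rewrite (ipC ipP)// (ip_suml subspaceT ipP _ _ (fun i => I) I).2.
  apply: le_trans (ler_norm_sum _ _ _) _; apply: ler_sum => i _.
  rewrite (ipZl subspaceT ipP)// normrM ler_piMr//.
  by rewrite (ipC ipP)//; apply: norm_le_sqr => //; rewrite expr1n.
have := HB (Num.bound B); rewrite nF leNgt => /negP; apply.
apply: lt_le_trans (archi_boundP _) _; last by rewrite ler_nat.
by apply: le_trans (HB 0%N); rewrite nF.
Qed.

Let rg_choice : exists r : V -> V, forall f, rg (r f) f.
Proof. by have [r Hr] := choice (fun f => resolvent_ex ipP cpl f cD); exists r. Qed.

(* [T^2 + sum_i <., e_i> e_i], with [T = 1 - kap (resolvent)], is coercive,
   hence onto. *)
Lemma estimate_finite_codim m : fredholm_estimate m -> finite_codim m.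
Proof.
move=> [C [e [C0 He]]]; have [r Hr] := rg_choice.
exists e => x.
pose T f := f - kap *: r f.
pose s f g := ip (T f) (T g) + \sum_(i < m) ip f (e i) * ip g (e i).
have rlin a f g y : ip (r (a *: f + g)) y = a * ip (r f) y + ip (r g) y.
  exact: (resolvent_ip_lin ipP y cD (Hr f) (Hr g) (Hr _)).
have Tlin a f g y : ip (T (a *: f + g)) y = a * ip (T f) y + ip (T g) y.
  rewrite /T !(ipBl subspaceT ipP)// !(ipZl subspaceT ipP)// rlin.
  rewrite (ipDl ipP)// (ipZl subspaceT ipP)//; ring.
have Tsym f g : ip (T f) g = ip f (T g).
  rewrite /T (ipBl subspaceT ipP)// (ipBr subspaceT ipP)//.
  rewrite (ipZl subspaceT ipP)// (ipZr subspaceT ipP)//.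
  by rewrite (resolvent_sym ipP cD (Hr f) (Hr g)).
have sP : inner_product_on setT s.
  split => [a u v w _ _ _|u v _ _|u _].
  - rewrite /s Tlin mulrDr mulr_sumr addrACA -big_split/=; congr (_ + _).
    apply: eq_bigr => i _.
    by rewrite (ipDl ipP)// (ipZl subspaceT ipP)// mulrDl mulrA.
  - rewrite /s (ipC ipP)//; congr (_ + _).
    by apply: eq_bigr => i _; rewrite mulrC.
  - by rewrite /s addr_ge0// sumr_ge0// => i _; rewrite -expr2 sqr_ge0.
have [|w [u [_ _ wu su]]] := riesz_on ipP cpl x subspaceT sP C0.
  move=> v _; apply: le_trans (He _ _ (Hr v)) _; rewrite ler_pM2l//.
pose z := T (T u) + \sum_(i < m) ip u (e i) *: e i.
exists (fun i => ip u (e i)), (r (T u)), (T u); split; first exact: Hr.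
rewrite -/(T (T u)) -/z /=.
suff h v : ip (x - z) v = 0 by exact: h.
rewrite (ipBl subspaceT ipP)//; apply/eqP; rewrite subr_eq0; apply/eqP.
have l1 := su v I.
have l2 : s (w k) v @[k --> \oo] --> ip u (T (T v) + \sum_(i < m) ip v (e i) *: e i).
  have -> : (fun k => s (w k) v) =
      (fun k => ip (w k) (T (T v) + \sum_(i < m) ip v (e i) *: e i)).
    apply/funext => k; rewrite /s (ipDr subspaceT ipP)// -(Tsym (w k) (T v)); congr (_ + _).
    rewrite (ipC ipP (u := w k))// (ip_suml subspaceT ipP _ _ (fun i => I) I).2.
    apply: eq_bigr => i _.
    by rewrite (ipZl subspaceT ipP)// mulrC (ipC ipP (u := w k)).
  exact: (ip_cvg_ip ipP).
rewrite (cvg_unique (@norm_hausdorff _ _) l1 l2) /z.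
rewrite (ipDr subspaceT ipP)// (ipDl ipP)// (Tsym (T u)) -(Tsym u (T v)); congr (_ + _).
rewrite (ipC ipP (u := u))// !(ip_suml subspaceT ipP _ _ (fun i => I) I).2.
by apply: eq_bigr => i _; rewrite !(ipZl subspaceT ipP)// mulrC !(ipC ipP (u := e i)).
Qed.

(** A family in the kernel of [1 - kap T], biorthogonal to the functionals: adding its members
    adjusts the values at the [e j] without changing the image under [1 - kap T]. *)
Definition dual_kernel m (e n : 'I_m -> V) (r : 'I_m -> V) :=
  [/\ forall i, rg (r i) (n i),
      forall i, ip (n i - kap *: r i) (n i - kap *: r i) = 0
    & forall i j, ip (n i) (e j) = (i == j)%:R].

(* Functionals [e] in minimal number are linearly independent on the kernel:
   when [e i] cannot be dropped there are approximate null vectors killed by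
   the other [e j] and normalized by [e i]; by the estimate they converge. *)
Lemma minimal_estimate m : fredholm_estimate m ->
  exists m' (e n : 'I_m' -> V) (r : 'I_m' -> V) (C : R),
    [/\ 0 < C, forall u f, rg u f -> ip f f <= C * defect e f u
      & dual_kernel e n r].
Proof.
move=> Hm.
have ex : exists m, `[< fredholm_estimate m >] by exists m; apply/asboolP.
case: (ex_minnP ex) => m' /asboolP[C [e [C0 He]]] mmin.
suff /choice [nr Hnr] : forall i, exists nr : V * V, [/\ rg nr.2 nr.1,
    ip (nr.1 - kap *: nr.2) (nr.1 - kap *: nr.2) = 0
    & forall j, ip nr.1 (e j) = (i == j)%:R].
  exists m', e, (fun i => (nr i).1), (fun i => (nr i).2), C; split => //.
  by split => i; case: (Hnr i).
move=> i; case: m' i e He mmin => [[]//|m'] i e He mmin.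
have nmin : ~ fredholm_estimate m'.
  by move/asboolP/mmin; rewrite ltnn.
pose e' := e \o lift i.
have defE f u : defect e f u = defect e' f u + ip f (e i) ^+ 2.
  by rewrite /defect (bigD1_ord i)//= addrCA addrC.
have [r Hr] := rg_choice.
have /choice [fu Hfu] : forall k : nat, exists fu : V * V, [/\ rg fu.2 fu.1,
    defect e' fu.1 fu.2 <= 2 * C / k.+1%:R & ip fu.1 (e i) = 1].
  (* The summand [2 * C] forces the dropped functional to carry at least half of the estimate, so
     [ip f (e i)] is nonzero and can be normalized to 1. The summand [k.+1%:R] makes the remaining
     defect tend to 0. *)
  move=> k; pose c := k.+1%:R + 2 * C.
  have c0 : 0 < c by rewrite addr_gt0// mulr_gt0.
  have [[f u] /= [uf fl]] : exists fu : V * V, rg fu.2 fu.1 /\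
     c * defect e' fu.1 fu.2 < ip fu.1 fu.1.
    apply: contrapT => h; apply: nmin; exists c, e'; split => // u f uf.
    by rewrite leNgt; apply/negP => hk; apply: h; exists (f, u).
  have d0 := defect_ge0 e' f u.
  have hC := He _ _ uf; rewrite defE mulrDr in hC.
  have hi : ip f f <= 2 * C * ip f (e i) ^+ 2.
    have : 2 * C * defect e' f u <= ip f f.
      by apply/ltW/(le_lt_trans _ fl)/ler_wpM2r => //; rewrite lerDr.
    lra.
  have ff : 0 < ip f f.
    by apply: le_lt_trans fl; rewrite mulr_ge0// ltW.
  have i0 : ip f (e i) != 0.
    by apply/eqP => i0; move: hi; rewrite i0 expr0n mulr0; rewrite leNgt ff.
  exists ((ip f (e i))^-1 *: f, (ip f (e i))^-1 *: u); split => /=.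
  - exact: rgZ.
  - rewrite defect_scale exprVn mulrC ler_pdivrMr; last first.
      by rewrite lt_neqAle sqr_ge0 eq_sym sqrf_eq0 i0.
    rewrite mulrAC ler_pdivlMr//; apply: le_trans hi.
    apply/ltW/(le_lt_trans _ fl); rewrite mulrC ler_wpM2r//.
    by rewrite lerDl mulr_ge0// ltW.
  - by rewrite (ipZl subspaceT ipP)// mulVf.
pose f k := (fu k).1; pose u k := (fu k).2.
have small (d : R) : 0 < d -> \forall k \near \oo, defect e' (f k) (u k) < d.
  move=> d0; have d1 : 0 < d / (2 * C) by rewrite divr_gt0// mulr_gt0.
  have := near_infty_natSinv_lt (PosNum d1); apply: filterS => k /= hk.
  case: (Hfu k) => _ h _; apply: le_lt_trans h _.
  by rewrite mulrC -ltr_pdivlMr ?mulr_gt0.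
have [n fn] : exists n, ip_cvg ip f n.
  apply: cpl => d d0.
  have d1 : 0 < d / (4 * C) by rewrite divr_gt0// mulr_gt0.
  have [N _ HN] := small _ d1; exists N => k l Nk Nl.
  have [rk _ ik] := Hfu k; have [rl _ il] := Hfu l.
  apply: le_lt_trans (He _ _ (rgB rk rl)) _.
  rewrite defE (ipBl subspaceT ipP)// ik il subrr expr0n addr0.
  apply: (@le_lt_trans _ _ (C * (2 * defect e' (f k) (u k) + 2 * defect e' (f l) (u l)))).
    by rewrite ler_pM2l//; exact: defect_sub.
  have := HN k Nk; have := HN l Nl; rewrite /= !ltr_pdivlMr ?mulr_gt0//; nra.
exists (n, r n); split => /=; first exact: Hr; last first.
  have hi : ip n (e i) = 1.
    have h := ip_cvg_ip ipP (v := e i) fn.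
    have h1 : ip (f k) (e i) @[k --> \oo] --> (1 : R).
      have -> : (fun k => ip (f k) (e i)) = cst 1.
        by apply/funext => k; case: (Hfu k).
      exact: cvg_cst.
    exact: (cvg_unique (@norm_hausdorff _ _) h h1).
  have d0 : defect e' n (r n) <= 0.
    have [M [M0 HM]] := defect_le e'.
    apply/ler_addgt0Pl => d d0; rewrite addr0.
    have d4 : 0 < d / 4 by rewrite divr_gt0.
    have d4M : 0 < d / (4 * M) by rewrite divr_gt0// mulr_gt0.
    move/cvgrPdist_lt/(_ _ d4M) : fn => fn.
    have [k [h1]] := filter_ex (filterI fn (small _ d4)) => h2.
    rewrite sub0r normrN ger0_norm// in h1.
    have [rk _ _] := Hfu k.
    have -> : n = f k - (f k - n) by rewrite subKr.
    have hd : defect e' (f k - (f k - n)) (r n) <= 2 * defect e' (f k) (u k) + 2 * defect e' (f k - n) (u k - r n).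
      rewrite -[in leLHS](subKr (u k) (r n)); exact: defect_sub.
    rewrite {2}subKr; apply: le_trans hd _.
    have := HM _ _ (rgB rk (Hr n)); rewrite -/(f k) -/(u k) => h3.
    move: h1; rewrite ltr_pdivlMr ?mulr_gt0//; lra.
  move=> j; case: (unliftP i j) => [j' ->|->]; last by rewrite eqxx hi.
  rewrite (negbTE (neq_lift _ _)); apply/eqP; rewrite -sqrf_eq0; apply/eqP/le_anti.
  rewrite sqr_ge0 andbT; apply: le_trans d0; rewrite /defect (bigD1 j')//=.
  by rewrite addrCA lerDl addr_ge0// sumr_ge0// => l _; exact: sqr_ge0.
have [M [M0 HM]] := defect_le e'.
apply/le_anti; rewrite ge0 andbT.
apply/ler_addgt0Pl => d d0; rewrite addr0.
have d4 : 0 < d / 4 by rewrite divr_gt0.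
have d4M : 0 < d / (4 * M) by rewrite divr_gt0// mulr_gt0.
move/cvgrPdist_lt/(_ _ d4M) : fn => fn.
have [k [h1]] := filter_ex (filterI fn (small _ d4)) => h2.
rewrite sub0r normrN ger0_norm// in h1.
have [rk _ _] := Hfu k.
have hd := defect_sub e' (f k) (u k) (f k - n) (u k - r n).
rewrite !subKr in hd.
have := HM _ _ (rgB rk (Hr n)); rewrite -/(f k) -/(u k) => h3.
apply: (@le_trans _ _ (defect e' n (r n))).
  by rewrite /defect lerDl sumr_ge0// => l _; exact: sqr_ge0.
move: h1; rewrite ltr_pdivlMr ?mulr_gt0//; lra.
Qed.

(** Projection along the kernel onto the common zeros of the functionals, where the estimate bounds
    the norm by the norm of the image alone. *)
Lemma dual_kernel_adjust m (e n r : 'I_m -> V) u f : dual_kernel e n r -> rg u f ->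
  exists c : 'I_m -> R,
  let f' := f + \sum_(i < m) c i *: n i in
  let u' := u + \sum_(i < m) c i *: r i in
  [/\ rg u' f', forall j, ip f' (e j) = 0 &
    exists2 z, ip z z = 0 & f' - kap *: u' = f - kap *: u + z].
Proof.
move=> [rn n0 ne] uf; exists (fun i => - ip f (e i)) => /=; split.
- apply: rgD => //; elim/big_ind2 : _ => [|a b a' b' h h'|i _].
  + by have := rgB uf uf; rewrite !subrr.
  + exact: rgD.
  + exact: rgZ.
- move=> j; rewrite (ipDl ipP)// (ip_suml subspaceT ipP _ _ (fun i => I) I).2.
  rewrite (bigD1 j)//= big1 ?addr0 => [|i ij]; last first.
    by rewrite (ipZl subspaceT ipP)// ne (negbTE ij) mulr0.
  by rewrite (ipZl subspaceT ipP)// ne eqxx mulr1 subrr.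
- exists (\sum_(i < m) - ip f (e i) *: (n i - kap *: r i)); first exact: ip_null_sum.
  rewrite scalerDr opprD addrACA; congr (_ + _).
  rewrite scaler_sumr -sumrB; apply: eq_bigr => i _.
  by rewrite scalerBr !scalerA mulrC.
Qed.

(** After adjustment a kernel vector has defect zero. By the estimate it is then null, and so is its
    resolvent. *)
Lemma estimate_kernel m : fredholm_estimate m -> exists m' (r : 'I_m' -> V),
  forall u f, rg u f -> ip (f - kap *: u) (f - kap *: u) = 0 ->
  exists c : 'I_m' -> R, let z := u - \sum_(i < m') c i *: r i in ip z z = 0.
Proof.
move=> /minimal_estimate [m' [e [n [r [C [C0 He dk]]]]]].
exists m', r => u f uf f0.
have [c [/= h1 h2 [z z0 hz]]] := dual_kernel_adjust dk uf.
exists (fun i => - c i) => /=.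
have -> : u - \sum_(i < m') - c i *: r i = u + \sum_(i < m') c i *: r i.
  by congr (_ + _); rewrite -sumrN; apply: eq_bigr => i _; rewrite scaleNr opprK.
apply/le_anti; rewrite ge0 andbT.
apply: le_trans (resolvent_le ipP cD h1) _.
apply: le_trans (resolvent_bound ipP cD h1) _; apply: le_trans (He _ _ h1) _.
rewrite /defect hz ip_null_add// f0 add0r big1 ?mulr0// => j _.
by rewrite h2 expr0n.
Qed.

(** The preimages of a convergent sequence need not converge, but after adjustment by kernel vectors
    the estimate makes them Cauchy. *)
Lemma estimate_closed_range m : fredholm_estimate m ->
  forall (u f : nat -> V) g, (forall k, rg (u k) (f k)) ->
  ip_cvg ip (fun k => f k - kap *: u k) g ->
  exists v h, rg v h /\ ip (h - kap *: v - g) (h - kap *: v - g) = 0.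
Proof.
move=> /minimal_estimate [m' [e [n [r [C [C0 He dk]]]]]] u f g uf fg.
have /choice [x Hx] : forall k, exists x : V * V, [/\ rg x.2 x.1,
    forall j, ip x.1 (e j) = 0 &
    exists2 z, ip z z = 0 & x.1 - kap *: x.2 = f k - kap *: u k + z].
  move=> k; have [c [h1 h2 h3]] := dual_kernel_adjust dk (uf k).
  by eexists (_, _); split; [exact: h1|exact: h2|exact: h3].
have [h xh] : exists h, ip_cvg ip (fun k => (x k).1) h.
  apply: cpl => d d0.
  have [|N HN] := ip_cvg_cauchy ipP fg (e := d / C); first by rewrite divr_gt0.
  exists N => k l Nk Nl; have [h1 h2 [z z0 hz]] := Hx k.
  have [h1' h2' [z' z0' hz']] := Hx l.
  apply: le_lt_trans (He _ _ (rgB h1 h1')) _.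
  rewrite /defect big1 ?addr0 => [|j _]; last first.
    by rewrite (ipBl subspaceT ipP)// h2 h2' subrr expr0n.
  have -> : (x k).1 - (x l).1 - kap *: ((x k).2 - (x l).2) =
    (f k - kap *: u k) - (f l - kap *: u l) + (z - z').
    rewrite scalerBr !opprD !opprK addrACA.
    have -> : - (x l).1 + kap *: (x l).2 = - ((x l).1 - kap *: (x l).2).
      by rewrite opprB addrC.
    by rewrite hz hz' [- (_ + z')]opprD addrACA !opprD !opprK.
  rewrite ip_null_add; last first.
    by rewrite ip_null_add// (ipNl subspaceT ipP)// (ipNr subspaceT ipP)// opprK.
  by rewrite mulrC -ltr_pdivlMr//; exact: HN.
have [v vh] := resolvent_ex ipP cpl h cD.
exists v, h; split => //.
have Th : ip_cvg ip (fun k => (x k).1 - kap *: (x k).2) (h - kap *: v).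
  (* For the empty family, [defect_le] is the continuity of [1 - kap T]. *)
  have e0 : 'I_0 -> V by move=> [].
  have [M [M0 HM]] := defect_le e0.
  apply/cvgrPdist_lt => d d0; have dM : 0 < d / M by rewrite divr_gt0.
  move/cvgrPdist_lt/(_ _ dM) : xh; apply: filterS => k.
  rewrite !sub0r !normrN !ger0_norm// ltr_pdivlMr// => hk.
  have [h1 _ _] := Hx k; have := HM _ _ (rgB h1 vh).
  rewrite /defect big_ord0 addr0 => h2.
  have -> : (x k).1 - kap *: (x k).2 - (h - kap *: v) =
     (x k).1 - h - kap *: ((x k).2 - v).
    by rewrite scalerBr !opprD !opprK addrACA.
  by apply: le_lt_trans h2 _; rewrite mulrC.
apply: (ip_cvg_uniq ipP Th).
move: fg; rewrite /ip_cvg.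
suff -> : (fun k => ip (f k - kap *: u k - g) (f k - kap *: u k - g)) =
  (fun k => ip ((x k).1 - kap *: (x k).2 - g) ((x k).1 - kap *: (x k).2 - g)) by [].
apply/funext => k.
have [_ _ [z z0 ->]] := Hx k.
have -> : f k - kap *: u k + z - g = f k - kap *: u k - g + z by rewrite addrAC.
by rewrite (ip_null_add _ z0).
Qed.

End Fredholm.

(** * Stability of the estimate under compact differences *)

Section Transfer.
Context {R : realType} {V : lmodType R} (ip : V -> V -> R).
Hypotheses (ipP : inner_product_on setT ip) (cpl : ip_complete ip).
Context (Lam : V -> V).

Lemma compact_differenceC D D0 : compact_difference ip Lam D D0 ->
  compact_difference ip Lam D0 D.
Proof.
move=> h e e0; have [s Hs] := h e e0; exists s => f u u0 uf u0f.
by rewrite (ip_subC subspaceT ipP)//; exact: Hs.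
Qed.

(** Replacing [u] by [u0] in the defect costs [2 * kap ^+ 2] times the square norm of [u - u0],
    hence [K] times it in the estimate. The tolerance [(2 * (1 + K))^-1] makes the resulting
    multiple of [ip f f] at most one half, which is absorbed. *)
Lemma estimate_transfer D D0 kap m : coercive_form ip Lam D ->
  compact_difference ip Lam D D0 -> fredholm_estimate ip Lam D kap m ->
  exists m', fredholm_estimate ip Lam D0 kap m'.
Proof.
move=> cD cd [C [e [C0 He]]].
pose K := 2 * kap ^+ 2 * C; have K0 : 0 <= K.
  by apply: mulr_ge0; [rewrite mulr_ge0 ?sqr_ge0|exact: ltW].
have d0 : 0 < (2 * (1 + K))^-1 by rewrite invr_gt0 mulr_gt0// ltr_wpDr.
have [s Hs] := cd _ d0.
pose g (i : 'I_(m + size s)) : V :=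
  match fintype.split i with inl j => e j | inr j => tnth (in_tuple s) j end.
exists (m + size s)%N, (2 * (C * 2 + K)), g; split.
  by rewrite mulr_gt0// ltr_pwDl// mulr_gt0.
move=> u0 f u0f; have [u uf] := resolvent_ex ipP cpl f cD.
have h1 := He _ _ uf; have h2 := Hs _ _ _ uf u0f.
rewrite /defect big_split_ord /=.
have -> : \sum_(i < m) ip f (g (lshift (size s) i)) ^+ 2 = \sum_(i < m) ip f (e i) ^+ 2.
  by apply: eq_bigr => i _; rewrite /g -[lshift _ _]/(fintype.unsplit (inl i)) fintype.unsplitK.
have -> : \sum_(i < size s) ip f (g (rshift m i)) ^+ 2 = \sum_(x <- s) ip f x ^+ 2.
  rewrite [RHS]big_tnth; apply: eq_bigr => i _.
  by rewrite /g -[rshift _ _]/(fintype.unsplit (inr i)) fintype.unsplitK.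
have h3 : ip (f - kap *: u) (f - kap *: u) <= 2 * ip (f - kap *: u0) (f - kap *: u0)
    + 2 * kap ^+ 2 * ip (u - u0) (u - u0).
  have -> : f - kap *: u = (f - kap *: u0) - kap *: (u - u0).
    by rewrite scalerBr opprB addrA subrK.
  apply: le_trans (ip_le_sub subspaceT ipP _ _) _ => //.
  by rewrite (ipZl subspaceT ipP)// (ipZr subspaceT ipP)// expr2 !mulrA.
move: h1; rewrite /defect.
set S1 := \sum_(i < m) _; set S2 := \sum_(x <- s) _ in h2 *.
have S10 : 0 <= S1 by apply: sumr_ge0 => i _; exact: sqr_ge0.
have S20 : 0 <= S2 by apply: sumr_ge0 => i _; exact: sqr_ge0.
move: h2 h3; set A := ip (f - _) _; set B := ip (f - kap *: u0) _.
set E := ip (u - u0) _; set F := ip f f => h2 h3 h1.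
have B0 : 0 <= B by exact: (ip_ge0 ipP).
have F0 : 0 <= F by exact: (ip_ge0 ipP).
have h4 : F <= C * (2 * B + S1) + K * ((2 * (1 + K))^-1 * F + S2).
  have := ler_wpM2l K0 h2; have := ler_wpM2l (ltW C0) h3.
  by rewrite /K; move: h1; nra.
have h5 : K * ((2 * (1 + K))^-1 * F) <= F / 2.
  rewrite mulrA mulrC; apply: ler_wpM2l => //.
  by rewrite invfM mulrCA ler_piMr ?invr_ge0// ler_pdivrMr ?mul1r ?lerDr// ltr_wpDr.
rewrite mulrDr in h4.
have h6 : 0 <= C * B by rewrite mulr_ge0// ltW.
have h7 : 0 <= C * S1 by rewrite mulr_ge0// ltW.
have h8 : 0 <= C * S2 by rewrite mulr_ge0// ltW.
have h9 : 0 <= K * B by rewrite mulr_ge0.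
have h10 : 0 <= K * S1 by rewrite mulr_ge0.
have h11 : 0 <= K * S2 by rewrite mulr_ge0.
lra.
Qed.

End Transfer.

(** * Discrete Fourier analysis on the torus (Z/N)^n *)

Section Characters.
Context {R : realType}.

Lemma complex_prim_root N : exists z : R[i], N.+1.-primitive_root z.
Proof.
pose p : {poly R[i]} := 'X^(N.+1) - 1; have [r Dp] := closed_field_poly_normal p.
rewrite (monicP _) ?monicXnsubC// scale1r in Dp.
have rn1 : all N.+1.-unity_root r by apply/allP=> z; rewrite -root_prod_XsubC -Dp.
have sz_r : (N.+1 < (size r).+1)%N.
  by rewrite -(size_prod_XsubC r id) -Dp size_XnsubC.
have ur : uniq r.
  by rewrite -separable_prod_XsubC -Dp separable_Xn_sub_1// pnatr_eq0.
by have [|z zr pz] := hasP (has_prim_root _ rn1 ur sz_r); last by exists z.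
Qed.

Lemma ReM (x y : R[i]) : complex.Re (x * y) = complex.Re x * complex.Re y - complex.Im x * complex.Im y.
Proof. by case: x => a b; case: y. Qed.

Lemma ImM (x y : R[i]) : complex.Im (x * y) = complex.Im x * complex.Re y + complex.Re x * complex.Im y.
Proof. by case: x => a b; case: y => c d /=; rewrite addrC. Qed.

Lemma mul_conjE (x : R[i]) : x * x^*%C = (complex.Re x ^+ 2 + complex.Im x ^+ 2)%:C%C.
Proof.
case: x => a b /=; apply/eqP; rewrite eq_complex /= !expr2; apply/andP; split; apply/eqP; ring.
Qed.

Context (n N : nat).
Local Notation G := {ffun 'I_n -> 'I_N.+1}.

(** Real and imaginary parts of the characters, products of powers of a primitive root of unity. The
    last clause is their orthogonality, from which Parseval's identity follows. *)
Lemma dual_characters : exists c s : G -> G -> R,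
  [/\ forall k x y, c k (x + y) = c k x * c k y - s k x * s k y,
      forall k x y, s k (x + y) = s k x * c k y + c k x * s k y,
      forall k x, c k (- x) = c k x /\ s k (- x) = - s k x
    & forall x y, \sum_(k : G) (c k x * c k y + s k x * s k y)
        = (N.+1 ^ n)%:R * (x == y)%:R].
Proof.
have [z pz] := complex_prim_root N.
have zN : z ^+ N.+1 = 1 by exact: prim_expr_order.
have zc : z * z^*%C = 1.
  (* The squared modulus is a non-negative real number with a positive power equal to 1. *)
  have h : complex.Re (z * z^*%C) = 1.
    have : (z * z^*%C) ^+ N.+1 = 1.
      by rewrite exprMn zN mul1r -rmorphXn/= zN rmorph1.
    rewrite mul_conjE -rmorphXn/= => /(congr1 (@complex.Re R)) /= /eqP.
    by rewrite pexpr_eq1 ?addr_ge0 ?sqr_ge0// => /eqP.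
  by rewrite mul_conjE /= in h *; rewrite h.
pose chi (k x : G) := \prod_(j < n) z ^+ (k j * x j)%N.
have chiD k x y : chi k (x + y) = chi k x * chi k y.
  rewrite /chi -big_split/=; apply: eq_bigr => j _.
  rewrite ffunE -exprD -mulnDr; apply/eqP.
  by rewrite (eq_prim_root_expr pz) /= modnMmr.
have chi0 k : chi k 0 = 1.
  by rewrite /chi big1// => j _; rewrite ffunE muln0 expr0.
have chiU k x : chi k x * (chi k x)^*%C = 1.
  rewrite /chi rmorph_prod -big_split/= big1// => j _.
  by rewrite rmorphXn/= -exprMn zc expr1n.
have chiN k x : chi k (- x) = (chi k x)^*%C.
  have cx0 : chi k x != 0.
    by apply/eqP => h; have := chiU k x; rewrite h mul0r => /eqP; rewrite eq_sym oner_eq0.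
  by apply: (mulfI cx0); rewrite chiU -chiD subrr chi0.
have chiS x : \sum_(k : G) chi k x = (N.+1 ^ n)%:R * (x == 0)%:R.
  rewrite /chi -(bigA_distr_bigA (fun j (i : 'I_N.+1) => z ^+ (i * x j)%N)) /=.
  have [->|xn0] := eqVneq x 0.
    rewrite mulr1 (eq_bigr (fun=> N.+1%:R)) => [|j _].
      by rewrite prodr_const card_ord natrX.
    rewrite (eq_bigr (fun=> 1)) => [|i _]; last by rewrite ffunE muln0 expr0.
    by rewrite sumr_const card_ord.
  have [j xj] : exists j, x j != 0.
    apply/existsP; apply: contraNT xn0 => /existsPn h; apply/eqP/ffunP => j.
    by rewrite ffunE; apply/eqP/negPn/h.
  rewrite mulr0 (bigD1 j)//= (_ : \sum_i _ = 0) ?mul0r//.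
  (* At a coordinate where [x] is nonzero the factor is a geometric sum over a full period, hence
     zero. *)
  have zx : z ^+ x j - 1 != 0.
    rewrite subr_eq0 -(expr0 z) (eq_prim_root_expr pz) mod0n modn_small//.
  apply: (mulfI zx); rewrite mulr0.
  transitivity ((z ^+ x j) ^+ N.+1 - 1).
    have -> : \sum_(i : 'I_N.+1) z ^+ (i * x j)%N = \sum_(i < N.+1) (z ^+ x j) ^+ i.
      by apply: eq_bigr => i _; rewrite mulnC exprM.
    by rewrite -subrX1.
  by rewrite exprAC zN expr1n subrr.
exists (fun k x => complex.Re (chi k x)), (fun k x => complex.Im (chi k x)); split.
- by move=> k x y; rewrite chiD ReM.
- by move=> k x y; rewrite chiD ImM.
- by move=> k x; rewrite chiN; case: (chi k x).
- move=> x y.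
  have -> : \sum_(k : G) (complex.Re (chi k x) * complex.Re (chi k y) +
      complex.Im (chi k x) * complex.Im (chi k y)) = \sum_(k : G) complex.Re (chi k (x - y)).
    apply: eq_bigr => k _; rewrite chiD chiN ReM.
    by case: (chi k y) => a b /=; rewrite mulrN opprK.
  rewrite -raddf_sum chiS subr_eq0.
  by case: (x == y) => /=; rewrite ?mulr0// !mulr1 -(rmorph_nat (real_complex R)).
Qed.

(** Not divided by the mesh, since the inequality below is homogeneous in it. *)
Definition central_diff (J : Type) (ej : 'I_n -> G) (u : G -> J -> R) j x i : R :=
  u (x + ej j) i - u (x - ej j) i.

(* [sum_j a_j D_j] acts on the two real Fourier transforms through its symbol
   at real frequencies because the central differences [D_j] are skew. *)
Lemma discrete_garding (J P : finType) (a : 'I_n -> P -> J -> R) (C : R)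
  (ej : 'I_n -> G) (u : G -> J -> R) :
  (forall (xi : 'I_n -> R) (w : J -> R),
     (\sum_j xi j ^+ 2) * (\sum_i w i ^+ 2)
       <= C * \sum_p (\sum_j \sum_i xi j * a j p i * w i) ^+ 2) ->
  \sum_(x : G) \sum_j \sum_i central_diff ej u j x i ^+ 2
   <= C * \sum_(x : G) \sum_p (\sum_j \sum_i a j p i * central_diff ej u j x i) ^+ 2.
Proof.
pose D := central_diff ej u.
rewrite -/D => Ha; have [c [s [cD sD cN cs]]] := dual_characters.
pose Fc (f : G -> R) k := \sum_(x : G) f x * c k x.
pose Fs (f : G -> R) k := \sum_(x : G) f x * s k x.
have pars f : \sum_(k : G) (Fc f k ^+ 2 + Fs f k ^+ 2) = (N.+1 ^ n)%:R * \sum_(x : G) f x ^+ 2.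
  transitivity (\sum_(k : G) \sum_(x : G) \sum_(y : G) f x * f y * (c k x * c k y + s k x * s k y)).
    apply: eq_bigr => k _; rewrite /Fc /Fs !expr2 !mulr_suml -big_split/=.
    apply: eq_bigr => x _; rewrite !mulr_sumr -big_split/=.
    by apply: eq_bigr => y _; ring.
  rewrite exchange_big/= mulr_sumr; apply: eq_bigr => x _.
  rewrite exchange_big/= (bigD1 x)//= -mulr_sumr cs eqxx mulr1 big1 ?addr0.
    by rewrite -expr2 mulrC.
  by move=> y yx; rewrite -mulr_sumr cs eq_sym (negbTE yx) !mulr0.
have shiftr (f : G -> R) e : \sum_(x : G) f (x + e) = \sum_(x : G) f x.
  by rewrite [RHS](reindex (fun x : G => x + e))//=; exists (fun x : G => x - e) => x _; rewrite ?addrK ?subrK.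
(* The real frequency: the j-th central difference exchanges the cosine and sine transforms, up to
   sign, with this factor. *)
pose t j k := 2 * s k (ej j).
have shc (f : G -> R) (g : G -> G -> R) e k :
    \sum_(x : G) f (x + e) * g k x = \sum_(x : G) f x * g k (x - e).
  rewrite -(shiftr (fun x => f x * g k (x - e)) e).
  by apply: eq_bigr => x _; rewrite addrK.
have FcD j i k : Fc (fun x => D j x i) k = t j k * Fs (u^~ i) k.
  rewrite /Fc /Fs /D /central_diff (eq_bigr (fun x => u (x + ej j) i * c k x - u (x - ej j) i * c k x)); last first.
    by move=> x _; rewrite mulrBl.
  rewrite sumrB (shc (u^~ i) c) (shc (u^~ i) c (- ej j)) -sumrB mulr_sumr.
  apply: eq_bigr => x _; rewrite opprK !cD; have [-> ->] := cN k (ej j).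
  by rewrite /t; ring.
have FsD j i k : Fs (fun x => D j x i) k = - t j k * Fc (u^~ i) k.
  rewrite /Fc /Fs /D /central_diff (eq_bigr (fun x => u (x + ej j) i * s k x - u (x - ej j) i * s k x)); last first.
    by move=> x _; rewrite mulrBl.
  rewrite sumrB (shc (u^~ i) s) (shc (u^~ i) s (- ej j)) -sumrB mulr_sumr.
  apply: eq_bigr => x _; rewrite opprK !sD; have [-> ->] := cN k (ej j).
  by rewrite /t; ring.
have N0 : 0 < (N.+1 ^ n)%:R :> R by rewrite ltr0n expn_gt0.
have linF (F : (G -> R) -> G -> R) (g : G -> G -> R) p k :
    (forall f k, F f k = \sum_(x : G) f x * g k x) ->
    F (fun x => \sum_j \sum_i a j p i * D j x i) k =
    \sum_j \sum_i a j p i * F (fun x => D j x i) k.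
  move=> FE; rewrite FE.
  under eq_bigr do rewrite mulr_suml.
  rewrite exchange_big/=; apply: eq_bigr => j _.
  under eq_bigr do rewrite mulr_suml.
  rewrite exchange_big/=; apply: eq_bigr => i _.
  rewrite FE mulr_sumr; apply: eq_bigr => x _; ring.
rewrite -(ler_pM2l N0) mulrCA.
have -> : (N.+1 ^ n)%:R * (\sum_(x : G) \sum_j \sum_i D j x i ^+ 2) =
    \sum_(k : G) \sum_j \sum_i (Fc (fun x => D j x i) k ^+ 2 + Fs (fun x => D j x i) k ^+ 2).
  rewrite exchange_big/= mulr_sumr [RHS]exchange_big/=; apply: eq_bigr => j _.
  rewrite exchange_big/= mulr_sumr [RHS]exchange_big/=; apply: eq_bigr => i _.
  by rewrite -pars.
have -> : (N.+1 ^ n)%:R * (\sum_(x : G) \sum_p (\sum_j \sum_i a j p i * D j x i) ^+ 2) =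
    \sum_(k : G) \sum_p ((\sum_j \sum_i a j p i * Fc (fun x => D j x i) k) ^+ 2 +
                   (\sum_j \sum_i a j p i * Fs (fun x => D j x i) k) ^+ 2).
  rewrite exchange_big/= mulr_sumr [RHS]exchange_big/=; apply: eq_bigr => p _.
  rewrite -(pars (fun x => \sum_j \sum_i a j p i * D j x i)); apply: eq_bigr => k _.
  by rewrite (linF Fc c)// (linF Fs s).
rewrite mulr_sumr; apply: ler_sum => k _.
have h1 := Ha (t^~ k) (fun i => Fs (u^~ i) k).
have h2 := Ha (t^~ k) (fun i => Fc (u^~ i) k).
have e1 : \sum_j \sum_i (Fc (fun x => D j x i) k ^+ 2 + Fs (fun x => D j x i) k ^+ 2)
   = (\sum_j t j k ^+ 2) * (\sum_i Fs (u^~ i) k ^+ 2) +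
     (\sum_j t j k ^+ 2) * (\sum_i Fc (u^~ i) k ^+ 2).
  rewrite -mulrDr -big_split/= mulr_suml; apply: eq_bigr => j _.
  rewrite mulr_sumr; apply: eq_bigr => i _.
  by rewrite FcD FsD; ring.
rewrite e1; apply: le_trans (lerD h1 h2) _.
rewrite -mulrDr -big_split/= le_eqVlt; apply/orP; left; apply/eqP.
congr (_ * _); apply: eq_bigr => p _; congr (_ + _).
  congr (_ ^+ 2); apply: eq_bigr => j _; apply: eq_bigr => i _.
  by rewrite FcD; ring.
rewrite -[LHS]sqrrN; congr (_ ^+ 2); rewrite -sumrN; apply: eq_bigr => j _.
by rewrite -sumrN; apply: eq_bigr => i _; rewrite FsD; ring.
Qed.

End Characters.

(** * Poincaré inequality on the discrete torus *)

Section DiscretePoincare.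
Context {R : realType} (n N : nat).
Local Notation G := {ffun 'I_n -> 'I_N.+1}.
Context (J : finType) (u : G -> J -> R).

Definition shift_energy (z : G) : R := \sum_(x : G) \sum_i (u (x + z) i - u x i) ^+ 2.

Lemma shift_energy_ge0 z : 0 <= shift_energy z.
Proof. by apply: sumr_ge0 => x _; apply: sumr_ge0 => i _; exact: sqr_ge0. Qed.

Lemma shift_energy0 : shift_energy 0 = 0.
Proof.
rewrite /shift_energy big1// => x _; rewrite big1// => i _.
by rewrite addr0 subrr expr0n.
Qed.

Lemma shift_energyD (t : R) z w : 0 < t ->
  shift_energy (z + w) <= (1 + t) * shift_energy z + (1 + t^-1) * shift_energy w.
Proof.
move=> t0; rewrite /shift_energy.
have -> : \sum_(x : G) \sum_i (u (x + z) i - u x i) ^+ 2 =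
    \sum_(x : G) \sum_i (u (x + w + z) i - u (x + w) i) ^+ 2.
  by rewrite (reindex (fun x : G => x + w))//=; exists (fun x : G => x - w) => x _; rewrite ?addrK ?subrK.
rewrite !mulr_sumr -big_split/=; apply: ler_sum => x _.
rewrite !mulr_sumr -big_split/=; apply: ler_sum => i _.
rewrite (addrC z) addrA.
set p := u _ i; set q := u (x + w) i; set r := u x i.
have -> : p - r = (p - q) + (q - r) by rewrite addrA subrK.
move: (p - q) (q - r) => a b; rewrite -subr_ge0.
have -> : (1 + t) * a ^+ 2 + (1 + t^-1) * b ^+ 2 - (a + b) ^+ 2 = t^-1 * (t * a - b) ^+ 2.
  by field; rewrite gt_eqF.
by rewrite mulr_ge0 ?invr_ge0 ?sqr_ge0// ltW.
Qed.

Lemma shift_energyN z : shift_energy (- z) = shift_energy z.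
Proof.
rewrite /shift_energy (reindex (fun x : G => x + z))/=; last first.
  by exists (fun x : G => x - z) => x _; rewrite ?addrK ?subrK.
apply: eq_bigr => x _; apply: eq_bigr => i _.
by rewrite addrK -sqrrN opprB.
Qed.

(** The weight [k.+1%:R^-1] in [shift_energyD] is the one that loses nothing, so the growth is
    exactly quadratic, as for the square of a seminorm. *)
Lemma shift_energyMn z k : shift_energy (z *+ k) <= k%:R ^+ 2 * shift_energy z.
Proof.
elim: k => [|k IH]; first by rewrite mulr0n shift_energy0 expr0n mul0r.
case: k IH => [_|k IH]; first by rewrite mulr1n expr1n mul1r.
have k0 : 0 < k.+1%:R :> R by [].
rewrite mulrSr; apply: le_trans (shift_energyD _ _ (_ : 0 < k.+1%:R^-1)) _.
  by rewrite invr_gt0.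
have h : (1 + k.+1%:R^-1) * shift_energy (z *+ k.+1) <=
         (1 + k.+1%:R^-1) * (k.+1%:R ^+ 2 * shift_energy z).
  by apply: ler_wpM2l => //; rewrite addr_ge0.
apply: le_trans (lerD h (lexx _)) _; rewrite invrK -[k.+2%:R]natr1.
rewrite le_eqVlt; apply/orP; left; apply/eqP; field; exact: lt0r_neq0.
Qed.

Lemma shift_energy_sum (I : Type) (r : seq I) (z : I -> G) :
  shift_energy (\sum_(i <- r) z i) <= 2 ^+ size r * \sum_(i <- r) shift_energy (z i).
Proof.
elim: r => [|i r IH]; first by rewrite !big_nil shift_energy0 mulr0.
rewrite !big_cons; apply: le_trans (shift_energyD _ _ ltr01) _.
rewrite invr1 /= exprS.
have h1 : 1 <= 2 ^+ size r :> R by rewrite exprn_ege1// ler1n.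
have h2 := shift_energy_ge0 (z i).
nra.
Qed.

Definition offset m (s : {ffun 'I_n -> 'I_m}) : G := [ffun j => inZp (s j)].

(** [x - block_residue m x] is the lowest corner of the block of side [m] that contains [x]. *)
Definition block_residue m (x : G) : G := [ffun j => inZp (x j %% m)].

(* Every grid block of side [m] is sampled at its point of offset [d]; for
   some [d], the average over all [d] bounds the error. *)
Lemma discrete_poincare m (ej : 'I_n -> G) : (0 < m)%N ->
  (forall j, ej j = [ffun i => if i == j then inZp 1 else 0]) ->
  exists d : {ffun 'I_n -> 'I_m},
    \sum_(x : G) \sum_i (u x i - u (x - block_residue m x + offset d) i) ^+ 2
    <= 4 ^+ n * m%:R ^+ 2 * \sum_j shift_energy (ej j).
Proof.
move=> m0 ejE; pose B := 4 ^+ n * m%:R ^+ 2 * \sum_j shift_energy (ej j).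
(* Displacements with coordinates from [- m] to [m - 1], indexed by natural numbers shifted by
   [m]. *)
pose sg (s : {ffun 'I_n -> 'I_(m + m)}) : G := [ffun j => inZp (s j) - inZp m].
have B2 s : shift_energy (sg s) <= 2 ^+ n * m%:R ^+ 2 * \sum_j shift_energy (ej j).
  have -> : sg s = \sum_(j <- index_enum 'I_n) (ej j *+ s j - ej j *+ m).
    have eM a j i : (ej j *+ a) i = if i == j then inZp a else 0.
      rewrite ffunMnE ejE ffunE; case: eqP => _; last by rewrite mul0rn.
      by apply/val_inj; rewrite /= Zp_mulrn /= modnMml mul1n.
    have eB (f h : G) i : (f - h) i = f i - h i by rewrite !ffunE.
    apply/ffunP => i; rewrite sum_ffunE ffunE (bigD1 i)//= big1 => [|j ji].
      by rewrite addr0 eB !eM eqxx.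
    by rewrite eB !eM eq_sym (negbTE ji) subrr.
  apply: le_trans (shift_energy_sum _ _) _.
  rewrite /index_enum -enumT size_enum_ord -mulrA; apply: ler_wpM2l; first by rewrite exprn_ge0.
  rewrite mulr_sumr enumT; apply: ler_sum => j _.
  have [sm|ms] := leqP m (s j).
    have -> : ej j *+ s j - ej j *+ m = ej j *+ (s j - m) by rewrite mulrnBr.
    apply: le_trans (shift_energyMn _ _) _; apply: ler_wpM2r; first exact: shift_energy_ge0.
    rewrite ler_pXn2r ?nnegrE// ler_nat leq_subLR; exact/ltnW/ltn_ord.
  have -> : ej j *+ s j - ej j *+ m = - (ej j *+ (m - s j)).
    by rewrite mulrnBr ?opprB// ltnW.
  rewrite shift_energyN.
  apply: le_trans (shift_energyMn _ _) _; apply: ler_wpM2r; first exact: shift_energy_ge0.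
  by rewrite ler_pXn2r ?nnegrE// ler_nat leq_subr.
pose g (d : {ffun 'I_n -> 'I_m}) x : R := \sum_i (u x i - u (x - block_residue m x + offset d) i) ^+ 2.
apply: contrapT => nex.
have big d : B < \sum_(x : G) g d x.
  by rewrite ltNge; apply/negP => h; apply: nex; exists d.
have le1 : \sum_d \sum_(x : G) g d x <= \sum_(s : {ffun 'I_n -> 'I_(m + m)}) shift_energy (sg s).
  rewrite exchange_big/= [leRHS]exchange_big/=; apply: ler_sum => x _.
  (* For fixed [x], the displacement from [x] to the sample point of offset [d] determines [d]. The
     sum over [d] is therefore part of the sum over all displacements. *)
  have lt2 (a : 'I_m) j : (a + m - x j %% m < m + m)%N.
    by apply: leq_ltn_trans (leq_subr _ _) _; rewrite ltn_add2r.
  pose ph (d : {ffun 'I_n -> 'I_m}) := [ffun j => Ordinal (lt2 (d j) j)].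
  have phi : injective ph.
    move=> d d' /ffunP h; apply/ffunP => j; apply/val_inj.
    have := congr1 val (h j); rewrite !ffunE /= => /eqP.
    have hx : (x j %% m <= m)%N by rewrite ltnW// ltn_pmod.
    by rewrite -!addnBA// eqn_add2r => /eqP.
  have -> : \sum_d g d x =
      \sum_(s in ph @: [set: {ffun 'I_n -> 'I_m}]%SET) \sum_i (u (x + sg s) i - u x i) ^+ 2.
    rewrite big_imset/=; last by move=> d d' _ _; exact: phi.
    apply: eq_big => [d|d _]; first by rewrite finset.in_setT.
    apply: eq_bigr => i _; rewrite -sqrrN opprB; congr ((u _ _ - _) ^+ 2).
    rewrite -addrA; congr (_ + _); apply/ffunP => j; rewrite !ffunE.
    have e : inZp (d j) + inZp m = inZp (Ordinal (lt2 (d j) j)) + inZp (x j %% m) :> 'I_N.+1.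
      apply/val_inj => /=; rewrite !modnDm subnK//.
      by rewrite (leq_trans _ (leq_addl _ _))// ltnW// ltn_pmod.
    by rewrite addrC; apply/eqP; rewrite subr_eq addrAC eq_sym subr_eq e.
  rewrite big_mkcond/=; apply: ler_sum => s _; case: ifP => // _.
  by apply: sumr_ge0 => i _; exact: sqr_ge0.
(* There are [(2 * m) ^ n] displacements; with the factor [2 ^+ n] from [B2] this produces the
   [4 ^+ n] of the statement. *)
have le2 : \sum_(s : {ffun 'I_n -> 'I_(m + m)}) shift_energy (sg s) <= (m ^ n)%:R * B.
  apply: le_trans (ler_sum _ (fun s _ => B2 s)) _.
  rewrite sumr_const card_ffun !card_ord -[leLHS]mulr_natl addnn -mul2n expnMn natrM.
  have e4 : 4 ^+ n = 2 ^+ n * 2 ^+ n :> R by rewrite -exprMn -natrM.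
  rewrite /B e4 [(2 ^ n)%:R]natrX.
  by rewrite le_eqVlt; apply/orP; left; apply/eqP; ring.
have lt3 : (m ^ n)%:R * B < \sum_d \sum_(x : G) g d x.
  have -> : (m ^ n)%:R * B = \sum_(d : {ffun 'I_n -> 'I_m}) B.
    by rewrite sumr_const card_ffun !card_ord mulr_natl.
  by apply: ltr_sum => //; apply/hasP; exists [ffun=> Ordinal m0] => //.
by have := lt_le_trans lt3 (le_trans le1 le2); rewrite ltxx.
Qed.

End DiscretePoincare.

(** * Smooth functions *)

Section DeriveAlong.
Context {R : realType} {V : normedModType R}.

Lemma derive_along (f : V -> R) (x v : V) :
  'D_v f x = 'D_1 (fun h : R => f (h *: v + x)) 0.
Proof.
rewrite /derive; suff -> : (fun h : R => h^-1 *: ((f \o shift x) (h *: v) - f x)) =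
  (fun h => h^-1 *: (((fun h : R => f (h *: v + x)) \o shift 0) (h *: 1) - f (0 *: v + x))) by [].
by apply/funext => h /=; rewrite !addr0 scale0r add0r [h *: 1]mulr1.
Qed.

Lemma is_derive_comp_scalar (t : V -> R) (F : R -> R) (dF : R) (x v : V) :
  derivable t x v -> is_derive (t x) 1 F dF ->
  is_derive x v (F \o t) (dF * 'D_v t x).
Proof.
move=> dt FdF; have dt1 := (derivable1P _ _ _).1 dt.
have dt0 : is_derive (0 : R) 1 (fun h : R => t (h *: v + x)) ('D_v t x).
  by rewrite derive_along; exact: derivableP.
have F0 : is_derive (t (0 *: v + x)) 1 F dF by rewrite scale0r add0r.
have dc := is_derive1_comp F0 dt0.
apply: DeriveDef; first by apply/derivable1P; case: dc.
by rewrite derive_along; case: dc => _; exact.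
Qed.

End DeriveAlong.

Section ClassC.
Context {R : realType} {n : nat}.
Implicit Types (U : set 'rV[R]_n) (f g : 'rV[R]_n -> R).
Local Notation e a := (delta_mx (0 : 'I_1) a).

Lemma class_C_continuous k U f y : class_C k U f -> U y -> {for y, continuous f}.
Proof. by case: k => [|k] [h _]; exact: h. Qed.

Lemma class_C_derivable k U f a y : class_C k.+1 U f -> U y -> derivable f y (e a).
Proof. by case=> _ /(_ a)[h _]; exact: h. Qed.

Lemma class_C_derive k U f a : class_C k.+1 U f -> class_C k U (fun y => 'D_(e a) f y).
Proof. by case=> _ /(_ a)[]. Qed.

Lemma class_C_sub k U U' f : U' `<=` U -> class_C k U f -> class_C k U' f.
Proof.
move=> UU'; elim: k f => [|k IH] f [cf df]; split => //.
- by move=> y /UU'; exact: cf.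
- by move=> y /UU'; exact: cf.
- move=> a; have [h1 h2] := df a; split; last exact: IH.
  by move=> y /UU'; exact: h1.
Qed.

Lemma class_C_pred k U f : class_C k.+1 U f -> class_C k U f.
Proof.
elim: k f => [|k IH] f [cf df]; split => // a.
by have [h1 h2] := df a; split => //; exact: IH.
Qed.

Lemma class_C_local k U f :
  (forall y, U y -> exists U', U' y /\ class_C k U' f) -> class_C k U f.
Proof.
elim: k f => [|k IH] f h; split => //.
- by move=> y /h[U' [U'y /class_C_continuous]]; exact.
- by move=> y /h[U' [U'y /class_C_continuous]]; exact.
- move=> a; split; first by move=> y /h[U' [U'y /class_C_derivable]]; exact.
  by apply: IH => y /h[U' [U'y /class_C_derive h']]; exists U'.
Qed.

Lemma open_near_eq U f g y : open U -> (forall z, U z -> f z = g z) -> U y ->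
  \near y, f y = g y.
Proof.
move=> oU fg Uy; have : nbhs y U by exact: open_nbhs_nbhs.
by apply: filterS => z; exact: fg.
Qed.

Lemma class_C_eq k U f g : open U -> (forall y, U y -> f y = g y) ->
  class_C k U f -> class_C k U g.
Proof.
move=> oU; elim: k f g => [|k IH] f g fg [cf df]; split => //.
- move=> y Uy; rewrite /prop_for /continuous_at -(fg _ Uy) => A /(cf y Uy).
  by apply: filterS2 (open_near_eq oU fg Uy) => z /= <-.
- move=> y Uy; rewrite /prop_for /continuous_at -(fg _ Uy) => A /(cf y Uy).
  by apply: filterS2 (open_near_eq oU fg Uy) => z /= <-.
- move=> a; have [h1 h2] := df a; split.
    by move=> y Uy; apply: near_eq_derivable (h1 _ Uy); exact: (open_near_eq oU fg Uy).
  apply: IH h2 => y Uy; apply: near_eq_derive; exact: (open_near_eq oU fg Uy).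
Qed.

Lemma class_C_cst k U (c : R) : class_C k U (fun=> c).
Proof.
elim: k c => [|k IH] c; split => //.
- by move=> y _; exact: cst_continuous.
- by move=> y _; exact: cst_continuous.
- move=> a; split; first by move=> y _; exact: derivable_cst.
  have -> : (fun y : 'rV[R]_n => 'D_(e a) (fun=> c) y) = (fun=> 0); last exact: IH.
  by apply/funext => y; exact: derive_cst.
Qed.

Lemma class_C_coord k U (i : 'I_n) : class_C k U (fun y => y 0 i).
Proof.
have lin : linear (fun y : 'rV[R]_n => y 0 i : R^o) by move=> c x y; rewrite !mxE.
have cont y : {for y, continuous (fun y : 'rV[R]_n => y 0 i)}.
  exact: coord_continuous.
case: k => [|k]; split => // a.
have dv y : is_derive y (e a) (fun y : 'rV[R]_n => y 0 i) (e a 0 i : R).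
  have d := @differentiable_coord _ _ _ y 0 i.
  apply: DeriveDef; first exact: diff_derivable.
  rewrite deriveE//.
  pose L : {linear 'rV[R]_n -> R^o} :=
    HB.pack (fun y : 'rV[R]_n => y 0 i : R^o) (GRing.isLinear.Build _ _ _ _ _ lin).
  by rewrite (@diff_lin _ _ _ L)//; exact: cont.
split; first by move=> y _; case: (dv y).
have -> : (fun y : 'rV[R]_n => 'D_(e a) (fun y : 'rV[R]_n => y 0 i) y) = (fun=> e a 0 i).
  by apply/funext => y; case: (dv y).
exact: class_C_cst.
Qed.

Lemma class_C_add k U f g : open U ->
  class_C k U f -> class_C k U g -> class_C k U (fun y => f y + g y).
Proof.
move=> oU; elim: k f g => [|k IH] f g [cf df] [cg dg]; split => //.
- by move=> y Uy; apply: continuousD; [exact: cf|exact: cg].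
- by move=> y Uy; apply: continuousD; [exact: cf|exact: cg].
- move=> a; have [f1 f2] := df a; have [g1 g2] := dg a; split.
    by move=> y Uy; apply: derivableD; [exact: f1|exact: g1].
  apply: (@class_C_eq _ _ (fun y => 'D_(e a) f y + 'D_(e a) g y)) => //; last exact: IH.
  by move=> y Uy; rewrite (deriveD (f1 _ Uy) (g1 _ Uy)).
Qed.

Lemma class_C_mul k U f g : open U ->
  class_C k U f -> class_C k U g -> class_C k U (fun y => f y * g y).
Proof.
move=> oU; elim: k f g => [|k IH] f g cf cg; split => //.
- by move=> y Uy; apply: continuousM; [exact: (class_C_continuous cf)|exact: (class_C_continuous cg)].
- by move=> y Uy; apply: continuousM; [exact: (class_C_continuous cf)|exact: (class_C_continuous cg)].
- move=> a; split.
    by move=> y Uy; apply: derivableM; [exact: (class_C_derivable (a := a) cf Uy)|exact: (class_C_derivable (a := a) cg Uy)].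
  apply: (@class_C_eq _ _ (fun y => f y * 'D_(e a) g y + g y * 'D_(e a) f y)) => //.
    by move=> y Uy; rewrite (deriveM (class_C_derivable (a := a) cf Uy) (class_C_derivable (a := a) cg Uy)).
  by apply: class_C_add => //; apply: IH; do ?exact: class_C_pred; exact: class_C_derive.
Qed.

Lemma class_C_scale k U c f : open U -> class_C k U f -> class_C k U (fun y => c * f y).
Proof. by move=> oU cf; apply: class_C_mul => //; exact: class_C_cst. Qed.

Lemma class_C_opp k U f : open U -> class_C k U f -> class_C k U (fun y => - f y).
Proof.
move=> oU cf; apply: class_C_eq (class_C_scale (-1) oU cf) => // y _.
by rewrite mulN1r.
Qed.

Lemma class_C_sum (I : Type) (r : seq I) k U (F : I -> 'rV[R]_n -> R) : open U ->
  (forall i, class_C k U (F i)) -> class_C k U (fun y => \sum_(i <- r) F i y).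
Proof.
move=> oU cF; elim: r => [|i r IH].
  by apply: class_C_eq (class_C_cst k U 0) => // y _; rewrite big_nil.
by apply: class_C_eq (class_C_add oU (cF i) IH) => // y _; rewrite big_cons.
Qed.

Lemma class_C_inv k U f : open U -> (forall y, U y -> f y != 0) ->
  class_C k U f -> class_C k U (fun y => (f y)^-1).
Proof.
move=> oU f0; elim: k => [|k IH] cf; split => //.
- by move=> y Uy; apply: continuousV; [exact: f0|exact: (class_C_continuous cf)].
- by move=> y Uy; apply: continuousV; [exact: f0|exact: (class_C_continuous cf)].
- move=> a; split.
    by move=> y Uy; apply: derivableV; [exact: f0|exact: (class_C_derivable (a := a) cf Uy)].
  have IH' := IH (class_C_pred cf).
  apply: (@class_C_eq _ _ (fun y => - ((f y)^-1 * (f y)^-1) * 'D_(e a) f y)) => //.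
    move=> y Uy; rewrite (deriveV (f0 _ Uy) (class_C_derivable (a := a) cf Uy)).
    by rewrite -exprVn expr2.
  apply: class_C_mul => //; last exact: class_C_derive.
  by apply: class_C_opp => //; exact: class_C_mul.
Qed.

(* [F] ranges over a family of functions of one variable closed under
   differentiation. *)
Lemma class_C_comp (I : Type) (F : I -> R -> R) (d : I -> I) k U t : open U ->
  (forall i (s : R), is_derive s 1 (F i) (F (d i) s)) ->
  class_C k U t -> forall i, class_C k U (fun y => F i (t y)).
Proof.
move=> oU dF; have contF i s : {for s, continuous (F i)}.
  apply/differentiable_continuous/derivable1_diffP; by case: (dF i s).
elim: k => [|k IH] ct i; split => //.
- by move=> y Uy; apply: continuous_comp; [exact: (class_C_continuous ct)|exact: contF].
- by move=> y Uy; apply: continuous_comp; [exact: (class_C_continuous ct)|exact: contF].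
- move=> a; have dc y (Uy : U y) := is_derive_comp_scalar (class_C_derivable (a := a) ct Uy) (dF i (t y)).
  split; first by move=> y Uy; case: (dc y Uy).
  apply: (@class_C_eq _ _ (fun y => F (d i) (t y) * 'D_(e a) t y)) => //.
    by move=> y Uy; case: (dc y Uy) => _ <-.
  by apply: class_C_mul => //; [exact/IH/class_C_pred|exact: class_C_derive].
Qed.

End ClassC.

(** * Smooth step functions *)

Section FlatFunction.
Context {R : realType}.
Implicit Types (p : {poly R}) (t : R).

Definition flat p t : R := if 0 < t then p.[t^-1] * expR (- t^-1) else 0.

Lemma poly_expRN_bounded p : exists C : R, forall s, 0 <= s -> `|p.[s] * expR (- s)| <= C.
Proof.
have mono i (s : R) : 0 <= s -> s ^+ i * expR (- s) <= i`!%:R.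
  case: i => [|i] s0.
    by rewrite expr0 mul1r fact0 -expR0 ler_expR oppr_le0.
  rewrite expRN ler_pdivrMr ?expR_gt0// mulrC -ler_pdivrMr ?ltr0n ?fact_gt0//.
  by apply: le_trans (expR_ge1Dxn i s0); rewrite lerDr.
exists (\sum_(i < size p) `|p`_i| * i`!%:R) => s s0.
rewrite horner_coef mulr_suml; apply: le_trans (ler_norm_sum _ _ _) _.
apply: ler_sum => i _; rewrite -mulrA normrM; apply: ler_wpM2l => //.
by rewrite ger0_norm ?mono// mulr_ge0 ?exprn_ge0// expR_ge0.
Qed.

Lemma flat_derive p t : is_derive t 1 (flat p) (flat ('X^2 * (p - p^`())) t).
Proof.
have [t0|t0|->] := ltgtP t 0.
- have -> : flat ('X^2 * (p - p^`())) t = 0 by rewrite /flat ltNge (ltW t0).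
  have h : is_derive t 1 (cst (0 : R)) (0 : R) by exact: is_derive_cst.
  apply: near_eq_is_derive h; near=> s; rewrite /flat ltNge ltW//.
  by near: s; exact: lt_nbhsl.
- rewrite /flat t0.
  have hi : is_derive t 1 (fun s : R => s^-1) (- t ^- 2).
    have did : derivable (@id R) t 1 by exact: derivable_id.
    apply: DeriveDef; first by exact: (derivableV (lt0r_neq0 t0) did).
    by rewrite (deriveV (lt0r_neq0 t0) did) derive_id [_ *: _]mulr1.
  have hp : is_derive (t^-1) 1 (horner p) (p^`().[t^-1]).
    by apply: DeriveDef; [exact: derivable_horner|rewrite -derive1E -derivE].
  have hpc := is_derive1_comp hp hi.
  have he : is_derive (- t^-1) 1 (@expR R) (expR (- t^-1)) by exact: is_derive_expR.
  have hn : is_derive t 1 (fun s : R => - s^-1) (t ^- 2).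
    by have := is_deriveN hi; rewrite opprK.
  have hec : is_derive t 1 (@expR R \o (fun s : R => - s^-1)) (expR (- t^-1) * t ^- 2).
    exact: (@is_derive1_comp _ _ (fun s : R => - s^-1)).
  have hm := is_deriveM hpc hec.
  have e1 : 'D_1 (fun s : R => p.[s^-1] * expR (- s^-1)) t =
     ('X^2 * (p - p^`())).[t^-1] * expR (- t^-1).
    rewrite (@derive_val _ _ _ _ _ _ _ hm) /= !hornerE.
    have sc (x y : R) : x *: y = x * y by [].
    by rewrite !sc; field; exact: lt0r_neq0.
  have h : is_derive t 1 (fun s : R => p.[s^-1] * expR (- s^-1))
      (('X^2 * (p - p^`())).[t^-1] * expR (- t^-1)).
    by rewrite -e1; apply: derivableP; case: hm.
  apply: near_eq_is_derive h; near=> s; rewrite ifT//.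
  by near: s; exact: lt_nbhsr.
- have -> : flat ('X^2 * (p - p^`())) 0 = 0 by rewrite /flat ltxx.
  have [C HC] := poly_expRN_bounded ('X^2 * p).
  have C0 : 0 <= C by apply: le_trans (HC 0 (lexx _)); exact: normr_ge0.
  have lim0 : (fun h : R => h^-1 *: ((flat p \o shift 0) (h *: 1) - flat p 0)) @ 0^' --> (0 : R).
    apply/cvgrPdist_le => e e0; near=> h.
    rewrite sub0r normrN /= [h *: 1]mulr1 addr0 {2}/flat ltxx subr0 /flat.
    case: ifPn => h0; last by rewrite scaler0 normr0 ltW.
    rewrite /GRing.scale /=.
    have := HC h^-1; rewrite invr_ge0 ltW// => /(_ isT).
    rewrite hornerM hornerXn => hh.
    have -> : h^-1 * (p.[h^-1] * expR (- h^-1)) = h * (h^-1 ^+ 2 * p.[h^-1] * expR (- h^-1)).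
      by field; exact: lt0r_neq0.
    rewrite normrM (ger0_norm (ltW h0)).
    apply: (@le_trans _ _ (h * C)); first by apply: ler_wpM2l => //; exact: ltW.
    have hd : h < e / (1 + C).
      near: h; apply: nbhs_dnbhs; apply: lt_nbhsl.
      by rewrite divr_gt0// ltr_wpDr.
    move: hd; rewrite ltr_pdivlMr ?ltr_wpDr// mulrDr mulr1 => hd; lra.
  apply: DeriveDef; first by apply/cvg_ex; exists 0.
  exact: cvg_lim.
Unshelve. all: by end_near. Qed.

Definition plateau t : R := flat 1 t / (flat 1 t + flat 1 (1 - t)).

Lemma flat1_ge0 t : 0 <= flat 1 t.
Proof. by rewrite /flat; case: ifP => // _; rewrite hornerC mul1r expR_ge0. Qed.

Lemma flat1_gt0 t : 0 < t -> 0 < flat 1 t.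
Proof. by rewrite /flat => ->; rewrite hornerC mul1r expR_gt0. Qed.

Lemma plateau_den_gt0 t : 0 < flat 1 t + flat 1 (1 - t).
Proof.
have [t0|t0] := ltP 0 t; first by rewrite ltr_pwDl ?flat1_gt0// flat1_ge0.
by rewrite ltr_wpDl ?flat1_ge0// flat1_gt0// subr_gt0 (le_lt_trans t0).
Qed.

Lemma plateau_ge0 t : 0 <= plateau t.
Proof. by rewrite divr_ge0 ?flat1_ge0// ltW// plateau_den_gt0. Qed.

Lemma plateau_le1 t : plateau t <= 1.
Proof. by rewrite ler_pdivrMr ?plateau_den_gt0// mul1r lerDl flat1_ge0. Qed.

Lemma plateau_eq1 t : 1 <= t -> plateau t = 1.
Proof.
move=> t1; rewrite /plateau; have -> : flat 1 (1 - t) = 0.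
  by rewrite /flat ltNge subr_le0 t1.
by rewrite addr0 divff// lt0r_neq0// flat1_gt0// (lt_le_trans ltr01).
Qed.

Lemma plateau_eq0 t : t <= 0 -> plateau t = 0.
Proof. by move=> t0; rewrite /plateau {1}/flat ltNge t0 mul0r. Qed.

Lemma class_C_plateau n k (U : set 'rV[R]_n) f : open U ->
  class_C k U f -> class_C k U (fun y => plateau (f y)).
Proof.
move=> oU cf; have h1 := class_C_comp oU flat_derive cf 1.
have c1 : class_C k U (fun y => 1 - f y).
  by apply: class_C_add => //; [exact: class_C_cst|exact: class_C_opp].
have h2 := class_C_comp oU flat_derive c1 1.
apply: class_C_mul => //; apply: class_C_inv => //; last exact: class_C_add.
by move=> y _; rewrite lt0r_neq0// plateau_den_gt0.
Qed.

End FlatFunction.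

(** The finite subcover argument, isolated once; it turns local constants, cutoffs and estimates
    into ones for a whole compact set. *)
Lemma compact_induction (T : ptopologicalType) (K : set T) (P : set T -> Prop) :
  compact K -> P set0 -> (forall A B, A `<=` B -> P B -> P A) ->
  (forall A B, P A -> P B -> P (A `|` B)) ->
  (forall x, K x -> exists U, [/\ open U, U x & P U]) -> P K.
Proof.
rewrite compact_cover => cK P0 PS PU loc.
have /choice [U HU] : forall x, exists U, K x -> [/\ open U, U x & P U].
  move=> x; have [Kx|nKx] := pselect (K x); last by exists set0.
  by have [U HU] := loc x Kx; exists U.
have [D DK KD] := cK T K U (fun x Kx => let: And3 h _ _ := HU x Kx in h)
   (fun x Kx => ex_intro2 _ _ x Kx (let: And3 _ h _ := HU x Kx in h)).
apply: (PS _ (\big[setU/set0]_(x <- finmap.enum_fset D) U x)).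
  move=> x /KD[y yD Uy]; rewrite -bigcup_seq; exists y => //.
have : forall y, y \in finmap.enum_fset D -> K y by move=> y /DK; rewrite inE.
elim: (finmap.enum_fset D) => [|y s IH] sK; first by rewrite big_nil.
rewrite big_cons; apply: PU; last by apply: IH => z zs; apply: sK; rewrite inE zs orbT.
by have [] := HU y (sK y (mem_head _ _)).
Qed.

Section Boxes.
Context {R : realType} {n : nat}.
Implicit Types (y : 'rV[R]_n) (r : R).

Definition cbox y r := [set z : 'rV[R]_n | forall a, `|z 0 a - y 0 a| <= r].
Definition obox y r := [set z : 'rV[R]_n | forall a, `|z 0 a - y 0 a| < r].

Lemma nbhs_cbox y (A : set 'rV[R]_n) : nbhs y A -> exists2 r, 0 < r & cbox y r `<=` A.
Proof.
move=> /nbhs_ballP[r /= r0 rA]; exists (r / 2); first by rewrite divr_gt0.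
move=> z yz; apply: rA; split => // i a; rewrite (ord1 i) /ball /= distrC.
by apply: le_lt_trans (yz a) _; rewrite ltr_pdivrMr// ltr_pMr// ltr1n.
Qed.

Lemma obox_open y r : open (obox y r).
Proof.
rewrite openE => z zr.
have r0 a : 0 < r - `|z 0 a - y 0 a| by rewrite subr_gt0.
pose d := \big[Num.min/1]_a (r - `|z 0 a - y 0 a|).
have d0 : 0 < d by apply/lt_bigmin.
apply/nbhs_ballP; exists d => //= w [_ zw] a.
have := zw 0 a; rewrite /ball /= distrC => h.
have h2 : d <= r - `|z 0 a - y 0 a| by exact: bigmin_le_cond.
have -> : w 0 a - y 0 a = (w 0 a - z 0 a) + (z 0 a - y 0 a) by rewrite addrA subrK.
apply: le_lt_trans (ler_normD _ _) _; lra.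
Qed.

Lemma cbox_compact y r : compact (cbox y r).
Proof.
have := @rV_compact R n (fun a => [set t | `|t - y 0 a| <= r]) _; apply => a.
have -> : [set t | `|t - y 0 a| <= r] = `[y 0 a - r, y 0 a + r]%classic.
  by apply/seteqP; split => t /=; rewrite in_itv /= ler_distl.
exact: segment_compact.
Qed.

End Boxes.

(** * Smooth functions and cutoffs on the manifold *)

Section SmoothOnManifold.
Context {R : realType} {n : nat} {M : ptopologicalType} (X : manifold R n M).
Implicit Types (W V : set M) (f g : M -> R).

Lemma chart_image_open (i : atlas X) W : open W -> open (chart i @` (W `&` dom i)).
Proof.
move=> oW.
have -> : chart i @` (W `&` dom i) = chart i @` dom i `&` param i @^-1` W.
  apply/seteqP; split => [_ [x [Wx dx] <-]|y [[x dx <-]]] /=.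
    by split; [exists x|rewrite /= chartK].
  by rewrite chartK// => Wx; exists x.
rewrite openE => y [iy Wy]; apply: filterI.
  by apply: open_nbhs_nbhs; split => //; exact: chart_open.
by apply: (param_continuous iy); exact: open_nbhs_nbhs.
Qed.

Lemma smooth_on_sub W V f : V `<=` W -> smooth_on X W f -> smooth_on X V f.
Proof.
move=> VW sf i k; apply: class_C_sub (sf i k) => _ [x [Vx dx] <-].
by exists x => //; split => //; exact: VW.
Qed.

Lemma smooth_on_local W f :
  (forall x, W x -> exists V, V x /\ smooth_on X V f) -> smooth_on X W f.
Proof.
move=> h i k; apply: class_C_local => _ [x [Wx dx] <-].
have [V [Vx sV]] := h x Wx; exists (chart i @` (V `&` dom i)); split; first by exists x.
exact: sV.
Qed.

Lemma smooth_on_eq W f g : open W -> (forall x, W x -> f x = g x) ->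
  smooth_on X W f -> smooth_on X W g.
Proof.
move=> oW fg sf i k; apply: class_C_eq (sf i k); first exact: chart_image_open.
by move=> _ [x [Wx dx] <-]; rewrite /= chartK// fg.
Qed.

Lemma smooth_on_cst W (c : R) : smooth_on X W (fun=> c).
Proof. by move=> i k; exact: class_C_cst. Qed.

Lemma smooth_on_add W f g : open W -> smooth_on X W f -> smooth_on X W g ->
  smooth_on X W (fun x => f x + g x).
Proof.
by move=> oW sf sg i k; apply: class_C_add (sf i k) (sg i k); exact: chart_image_open.
Qed.

Lemma smooth_on_mul W f g : open W -> smooth_on X W f -> smooth_on X W g ->
  smooth_on X W (fun x => f x * g x).
Proof.
by move=> oW sf sg i k; apply: class_C_mul (sf i k) (sg i k); exact: chart_image_open.
Qed.

Lemma smooth_on_opp W f : open W -> smooth_on X W f -> smooth_on X W (fun x => - f x).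
Proof.
by move=> oW sf i k; apply: class_C_opp (sf i k); exact: chart_image_open.
Qed.

Lemma smooth_on_sum (I : Type) (r : seq I) W (F : I -> M -> R) : open W ->
  (forall j, smooth_on X W (F j)) -> smooth_on X W (fun x => \sum_(j <- r) F j x).
Proof.
move=> oW sF; elim: r => [|j r IH].
  by apply: smooth_on_eq (smooth_on_cst W 0) => // x _; rewrite big_nil.
by apply: smooth_on_eq (smooth_on_add oW (sF j) IH) => // x _; rewrite big_cons.
Qed.

Lemma smooth_on_inv W f : open W -> (forall x, W x -> f x != 0) ->
  smooth_on X W f -> smooth_on X W (fun x => (f x)^-1).
Proof.
move=> oW f0 sf i k; apply: class_C_inv (sf i k); first exact: chart_image_open.
by move=> _ [x [Wx dx] <-]; rewrite /= chartK// f0.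
Qed.

Lemma smooth_on_plateau W f : open W ->
  smooth_on X W f -> smooth_on X W (fun x => plateau (f x)).
Proof.
by move=> oW sf i k; apply: class_C_plateau (sf i k); exact: chart_image_open.
Qed.

Lemma smooth_on_coord (i : atlas X) a : smooth_on X (dom i) (fun x => chart i x 0 a).
Proof.
move=> j k; have := chart_smooth j i a k; rewrite setIC; exact.
Qed.

Lemma smooth_on_continuous W f x : open W -> smooth_on X W f -> W x ->
  {for x, continuous f}.
Proof.
move=> oW sf Wx; have [i dx] := dom_cover X x.
have cx : (chart i @` (W `&` dom i)) (chart i x) by exists x.
have c1 := class_C_continuous (sf i 0%N) cx.
have c2 := chart_continuous dx.
have c3 : {for x, continuous ((f \o param i) \o chart i)}.
  by apply: continuous_comp => //; exact: c1.
have e : \near x, ((f \o param i) \o chart i) x = f x.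
  have : nbhs x (dom i) by apply: open_nbhs_nbhs; split => //; exact: dom_open.
  by apply: filterS => y dy; rewrite /= chartK.
rewrite /prop_for /continuous_at => A; rewrite -[f x](nbhs_singleton e) => /c3.
by apply: filterS2 e => y /= <-.
Qed.

(** The value 1 is required on a neighbourhood of [A], so that the derivatives of [s] also vanish
    there. *)
Definition cutoff (A V : set M) (s : M -> R) :=
  [/\ smooth_on X setT s, (forall x, 0 <= s x <= 1),
      exists W, [/\ open W, A `<=` W & forall x, W x -> s x = 1]
    & exists C, [/\ compact C, C `<=` V & forall x, ~ C x -> s x = 0]].

Lemma bump_ex V x : open V -> V x -> exists s, cutoff [set x] V s.
Proof.
move=> oV Vx; have [i dx] := dom_cover X x; pose y := chart i x.
have oU := chart_image_open (i := i) oV.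
have Uy : (chart i @` (V `&` dom i)) y by exists x.
have [r r0 rU] := nbhs_cbox (open_nbhs_nbhs (conj oU Uy)).
pose g z := \sum_a (chart i z 0 a - y 0 a) * (chart i z 0 a - y 0 a).
pose r2 := r ^+ 2 / 2; have r20 : 0 < r2 by rewrite divr_gt0// exprn_gt0.
(* Equal to 1 where [g <= r2] and to 0 where [g >= 2 * r2 = r ^+ 2], hence outside the cube of
   half-side [r]. *)
pose b z := plateau (2 + - (g z * r2^-1)).
(* The extension by 0 is smooth because [b] vanishes off a compact set [C] inside the chart domain,
   and [C] is closed as [M] is Hausdorff. *)
pose s z := if pselect (dom i z) then b z else 0.
have g0 z : 0 <= g z by apply: sumr_ge0 => a _; rewrite -expr2 sqr_ge0.
have gb z : g z <= 2 * r2 -> cbox y r (chart i z).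
  move=> gz a; apply: norm_le_sqr; first exact: ltW.
  have -> : r ^+ 2 = 2 * r2 by rewrite /r2; field.
  apply: le_trans gz; rewrite /g (bigD1 a)//= -expr2 lerDl sumr_ge0// => c _.
  by rewrite -expr2 sqr_ge0.
have sg : smooth_on X (dom i) g.
  have od := dom_open i.
  apply: smooth_on_sum => // a; apply: smooth_on_mul => //; apply: smooth_on_add => //;
    by [exact: smooth_on_coord|exact: smooth_on_cst].
have sb : smooth_on X (dom i) b.
  have od := dom_open i.
  apply: smooth_on_plateau => //; apply: smooth_on_add => //; first exact: smooth_on_cst.
  apply: smooth_on_opp => //; apply: smooth_on_mul => //; exact: smooth_on_cst.
pose C := param i @` cbox y r.
have pc z : cbox y r z -> dom i (param i z) /\ chart i (param i z) = z.
  by move=> /rU[w [Vw dw] <-]; rewrite chartK.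
have cC : compact C.
  apply: continuous_compact; last exact: cbox_compact.
  apply: continuous_in_subspaceT => z /set_mem /rU [w [_ dw] <-].
  by apply: param_continuous; exists w.
have CV : C `<=` V by move=> _ [z /rU [w [Vw dw] <-] <-]; rewrite chartK.
have sC z : ~ C z -> s z = 0.
  move=> nC; rewrite /s; case: pselect => // dz; rewrite /b plateau_eq0//.
  rewrite leNgt; apply/negP => h; apply: nC; exists (chart i z); last exact: chartK.
  by apply: gb; move: h; rewrite subr_gt0 ltr_pdivrMr// => /ltW.
exists s; split.
- apply: smooth_on_local => z _; have [dz|ndz] := pselect (dom i z).
    exists (dom i); split => //.
    apply: smooth_on_eq sb; first exact: dom_open.
    by move=> w dw; rewrite /s; case: pselect.
  exists (~` C); split.
    by move=> [w /pc [dw _] wz]; apply: ndz; rewrite -wz.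
  apply: smooth_on_eq (smooth_on_cst _ 0).
    by apply: closed_openC; apply: compact_closed => //; exact: (man_hausdorff X).
  by move=> w /sC.
- move=> z; rewrite /s; case: pselect => dz /=; last by rewrite lexx ler01.
  by rewrite /b plateau_ge0 plateau_le1.
(* Each of the [n] squares in [g] is below [r2 / n.+1%:R] here, so [g <= r2]; [n.+1] keeps the side
   positive in dimension zero. *)
- pose W := [set z | dom i z /\ obox y (Num.sqrt (r2 / n.+1%:R)) (chart i z)].
  have q0 : 0 < Num.sqrt (r2 / n.+1%:R) by rewrite sqrtr_gt0 divr_gt0.
  exists W; split.
  + rewrite openE => z [dz oz]; apply: filterI.
      by apply: open_nbhs_nbhs; split => //; exact: dom_open.
    by apply: (chart_continuous dz); apply: open_nbhs_nbhs; split => //; exact: obox_open.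
  + by move=> _ ->; split => // a; rewrite subrr normr0.
  + move=> z [dz oz]; rewrite /s; case: pselect => // dz1 /=; apply: plateau_eq1.
    suff : g z <= r2.
      by rewrite -(mul1r r2) -ler_pdivrMr// => h; lra.
    apply: (@le_trans _ _ (\sum_(a < n) r2 / n.+1%:R)).
      apply: ler_sum => a _; rewrite -expr2 -[leLHS]real_normK ?num_real//.
      have <- : Num.sqrt (r2 / n.+1%:R) ^+ 2 = r2 / n.+1%:R.
        by rewrite sqr_sqrtr// divr_ge0// ltW.
      by rewrite ler_pXn2r ?nnegrE ?sqrtr_ge0//; exact/ltW/oz.
    rewrite sumr_const card_ord -[leLHS]mulr_natl mulrCA.
    by apply: ler_piMr; [exact: ltW|rewrite ler_pdivrMr// mul1r ler_nat].
- by exists C.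
Qed.

Lemma cutoff_ex A V : open V -> compact A -> A `<=` V -> exists s, cutoff A V s.
Proof.
move=> oV cA AV.
(* Compact induction passes through sets that leave [V], so the property is stated for their part
   inside [V]. *)
suff : exists s, cutoff (A `&` V) V s.
  by have -> : A `&` V = A by apply/setIidPl.
apply: (compact_induction (P := fun A => exists s, cutoff (A `&` V) V s)) cA _ _ _ _.
- exists (fun=> 0); split.
  + exact: smooth_on_cst.
  + by move=> x; rewrite lexx ler01.
  + by exists set0; split => //; rewrite ?set0I//; exact: open0.
  + by exists set0; split => //; exact: compact0.
- move=> B B' BB' [s [s1 s2 [W [oW B'W W1]] s4]]; exists s; split => //.
  by exists W; split => // x [/BB' Bx Vx]; exact: B'W.
- move=> B B' [s [s1 s2 [W [oW BW W1]] [C [cC CV C0]]]].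
  move=> [s' [s1' s2' [W' [oW' BW' W1']] [C' [cC' CV' C0']]]].
  exists (fun x => 1 + - ((1 + - s x) * (1 + - s' x))); split.
  + have oT := @openT M.
    by do ![apply: smooth_on_add => //|apply: smooth_on_opp => //|
      apply: smooth_on_mul => //|exact: smooth_on_cst].
  + move=> x; have /andP[h1 h2] := s2 x; have /andP[h3 h4] := s2' x.
    by apply/andP; split; nra.
  + exists (W `|` W'); split; first exact: openU.
      by move=> x [[Bx|Bx] Vx]; [left; exact: BW|right; exact: BW'].
    by move=> x [/W1 ->|/W1' ->]; rewrite subrr ?mul0r ?mulr0 subr0.
  + exists (C `|` C'); split; first exact: compactU.
      by move=> x []; [exact: CV|exact: CV'].
    by move=> x /not_orP[/C0 -> /C0' ->]; rewrite !subr0 mulr1 subrr.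
- move=> x Ax; have [s [s1 s2 [W [oW BW W1]] s4]] := bump_ex oV (AV _ Ax).
  exists W; split => //; first exact: BW.
  exists s; split => //; exists W; split => // z [] //.
Qed.

End SmoothOnManifold.

(** * Measure of small coordinate cubes *)

(** [lebesgue_rV] is evaluated on arbitrary sets by integrating slice functions that may fail to be
    measurable. Such an integral is a supremum over simple functions from below, which keeps
    monotonicity and superadditivity; these suffice to compare integrals with constants on boxes. *)
Definition premeasure_like (T : Type) (R : numDomainType) (nu : set T -> \bar R) :=
  [/\ nu set0 = 0%E, forall A, (0 <= nu A)%E,
  forall A B, A `<=` B -> (nu A <= nu B)%E
  & forall A B, A `&` B = set0 -> (nu A + nu B <= nu (A `|` B))%E].

Section LowerIntegral.
Import HBNNSimple.
Local Open Scope ereal_scope.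
Context d (T : measurableType d) (R : realType).
Implicit Types (nu : set T -> \bar R) (f g : T -> \bar R).

Definition lower_integral nu f := ereal_sup [set sintegral nu h |
  h in [set h : {nnsfun T >-> R} | forall x, (h x)%:E <= f x]].

Lemma ge0_integral_lower (mu : {measure set T -> \bar R}) f :
  (forall x, 0 <= f x) -> \int[mu]_x f x = lower_integral mu f.
Proof. by move=> f0; rewrite ge0_integralTE. Qed.

Lemma lower_integral_le nu f g : (forall x, f x <= g x) ->
  lower_integral nu f <= lower_integral nu g.
Proof.
move=> fg; apply: ub_ereal_sup => _ [h /= hf <-].
by apply: ereal_sup_ubound; exists h => //= x; exact: le_trans (hf x) (fg x).
Qed.

(** The sum of a simple minorant of [f] and one of [g] is a simple minorant of [f + g]. The rest of
    the proof separates the two suprema and treats infinite values. *)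
Lemma lower_integral_superadd (mu : {measure set T -> \bar R}) f g :
  (forall x, 0 <= f x) -> (forall x, 0 <= g x) ->
  lower_integral mu f + lower_integral mu g <= lower_integral mu (fun x => f x + g x).
Proof.
move=> f0 g0; set L := lower_integral mu (fun x => f x + g x); rewrite /lower_integral.
set A := [set sintegral mu h | h in [set h : {nnsfun T >-> R} | forall x, (h x)%:E <= f x]].
set B := [set sintegral mu h | h in [set h : {nnsfun T >-> R} | forall x, (h x)%:E <= g x]].
have B0 : 0 <= ereal_sup B.
  by apply: ereal_sup_ubound; exists nnsfun0 => //; exact: sintegral0.
have key (h : {nnsfun T >-> R}) : (forall x, (h x)%:E <= f x) -> forall k : {nnsfun T >-> R}, (forall x, (k x)%:E <= g x) ->
   sintegral mu h + sintegral mu k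
     <= L.
  move=> hf k kg; rewrite -sintegralD; apply: ereal_sup_ubound.
  by exists (add_nnsfun h k) => //= x; rewrite EFinD; exact: leeD.
have h0 (h : {nnsfun T >-> R}) : 0 <= sintegral mu h by exact: sintegral_ge0.
have [->|fin] := eqVneq (L) +oo; first by rewrite leey.
have Lfin : L \is a fin_num.
  rewrite ge0_fin_numE ?lt_neqAle ?fin ?leey//.
  by apply: ereal_sup_ubound; exists nnsfun0 => /=; [move=> x; exact: adde_ge0|exact: sintegral0].
have step1 (h : {nnsfun T >-> R}) : (forall x, (h x)%:E <= f x) ->
   ereal_sup B <= L - sintegral mu h.
  move=> hf.
  have hfin : sintegral mu h \is a fin_num.
    rewrite ge0_fin_numE//; have := key h hf nnsfun0 (fun x => g0 x).
    by rewrite (sintegral0 mu) adde0 => /le_lt_trans; apply; rewrite -ge0_fin_numE// (le_trans _ (key h hf nnsfun0 (fun x => g0 x)))// (sintegral0 mu) adde0.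
  apply: ub_ereal_sup => _ [k /= kg <-].
  by rewrite leeBrDr// addeC; exact: key.
have Bfin : ereal_sup B \is a fin_num.
  rewrite ge0_fin_numE//; have := step1 nnsfun0 (fun x => f0 x).
  by rewrite (sintegral0 mu) sube0 => /le_lt_trans; apply; rewrite lt_neqAle fin leey.
rewrite -leeBrDr//; apply: ub_ereal_sup => _ [h /= hf <-].
rewrite leeBrDr// addeC -leeBrDr; last first.
  rewrite ge0_fin_numE//; have := key h hf nnsfun0 (fun x => g0 x).
  by rewrite (sintegral0 mu) adde0 => /le_lt_trans; apply; rewrite lt_neqAle fin leey.
exact: step1.
Qed.

Section RawIntegral.
Context nu (nuP : premeasure_like nu).

Let nu0 : nu set0 = 0. Proof. by case: nuP. Qed.
Let nu_ge0 A : 0 <= nu A. Proof. by case: nuP. Qed.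

Lemma sintegral_range (h : {nnsfun T >-> R}) :
  sintegral nu h = \sum_(x <- finmap.enum_fset (fset_set (range h))) x%:E * nu (h @^-1` [set x]).
Proof.
rewrite /sintegral -(fsbig_widen (range h))//; first by rewrite fsbig_finite//; exact: fimfunP.
move=> x [_ /= nx]; rewrite (_ : _ @^-1` _ = set0) ?nu0 ?mule0//.
by apply/seteqP; split => // t /= hx; apply: nx; exists t.
Qed.

(** The level sets of a simple minorant at nonzero values are disjoint parts of [Q], so
    superadditivity and monotonicity bound the sum of their sizes by [nu Q]. *)
Lemma lower_integral_le_cst f (Q : set T) (S : R) : (0 <= S)%R ->
  (forall x, Q x -> f x <= S%:E) -> (forall x, ~ Q x -> f x <= 0) ->
  lower_integral nu f <= S%:E * nu Q.
Proof.
move=> S0 fQ f0; apply: ub_ereal_sup => _ [h /= hf <-].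
rewrite sintegral_range.
have hQ t : h t != 0%R -> Q t.
  move=> ht; apply: contrapT => nQ; have := le_trans (hf t) (f0 t nQ).
  by rewrite lee_fin => ht0; move/eqP : ht; apply; apply/le_anti; rewrite ht0 fun_ge0.
apply: (@le_trans _ _ (S%:E * \sum_(x <- finmap.enum_fset (fset_set (range h)) | x != 0%R) nu (h @^-1` [set x]))).
  rewrite ge0_sume_distrr; last by move=> *; exact: nu_ge0.
  rewrite [leRHS]big_mkcond/=; apply: lee_sum => x _.
  case: eqP => [->|/eqP x0]; first by rewrite mul0e.
  have [[t ht]|nt] := pselect (exists t, h t = x).
    apply: lee_wpmul2r; first exact: nu_ge0.
    by rewrite -ht; apply: le_trans (hf t) _; apply/fQ/hQ; rewrite ht.
  rewrite (_ : _ @^-1` _ = set0) ?nu0 ?mule0//.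
  by apply/seteqP; split => // t /= hx; apply: nt; exists t.
apply: lee_wpmul2l; first by rewrite lee_fin.
have : uniq (finmap.enum_fset (fset_set (range h))) by exact: finmap.fset_uniq.
have [_ _ mono sup] := nuP.
suff H (s : seq R) : uniq s -> \sum_(x <- s | x != 0%R) nu (h @^-1` [set x]) <=
    nu [set t | h t != 0%R /\ h t \in s].
  by move=> us; apply: le_trans (H _ us) _; apply: mono => t [/hQ].
elim: s => [|x s IH] /=; first by rewrite big_nil.
move=> /andP[xs us]; rewrite big_cons; case: ifPn => x0; last first.
  by apply: le_trans (IH us) _; apply: mono => t [h1 h2]; split => //; rewrite inE h2 orbT.
apply: (@le_trans _ _ (nu (h @^-1` [set x]) + nu [set t | h t != 0%R /\ h t \in s])).
  by rewrite leeD2l// IH.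
apply: le_trans (sup _ _ _) _.
  by apply/seteqP; split => // t [/= ->] [_]; rewrite (negbTE xs).
apply: mono => t [/= ->|[h1 h2]]; first by rewrite mem_head.
by split => //; rewrite inE h2 orbT.
Qed.

Lemma lower_integral_ge_cst f (Q : set T) (c : R) : (0 < c)%R -> measurable Q ->
  (forall x, 0 <= f x) -> (forall x, Q x -> c%:E <= f x) ->
  c%:E * nu Q <= lower_integral nu f.
Proof.
move=> c0 mQ f0 fQ.
have [h hE] : exists h : {nnsfun T >-> R}, forall x, h x = (c * \1_Q x)%R.
  by exists (scale_nnsfun (indic_nnsfun R mQ) (ltW c0)).
apply: ereal_sup_ubound; exists h.
  suff H x : (h x)%:E <= f x by exact: H.
  rewrite hE indicE; have [/set_mem/fQ|_] := boolP (x \in Q).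
    by rewrite mulr1.
  by rewrite mulr0.
rewrite /sintegral -(fsbig_widen [set c])//.
  rewrite fsbig_set1; congr (_ * nu _); apply/seteqP; split => x /=; rewrite hE indicE.
    by have [/set_mem//|_] := boolP (x \in Q); rewrite mulr0 => /esym/eqP; rewrite gt_eqF.
  by move=> /mem_set ->; rewrite mulr1.
move=> x [_ /= xc]; have [->|x0] := eqVneq x 0%R; first by rewrite mul0e.
rewrite (_ : _ @^-1` _ = set0) ?nu0 ?mule0//.
apply/seteqP; split => // t /=; rewrite hE indicE; case: (t \in Q).
  by rewrite mulr1 => /esym.
by rewrite mulr0 => /esym /eqP; rewrite (negbTE x0).
Qed.

(** Gives a meaning to the integral in [riemannian_volume], where [nu] is a bare set function: the
    negative part contributes 0 and a lower integral remains. *)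
Lemma integral_raw (Q : set T) (f : T -> R) : (forall x, (0 <= f x)%R) ->
  integral nu Q (fun x => (f x)%:E) = lower_integral nu ((fun x => (f x)%:E) \_ Q).
Proof.
move=> f0; rewrite /integral.
have g0 x : 0 <= ((fun x => (f x)%:E) \_ Q) x.
  by rewrite patchE; case: ifP => // _; rewrite lee_fin.
have -> : ((fun x => (f x)%:E) \_ Q)^\+ = (fun x => (f x)%:E) \_ Q.
  apply/funext => x; have := @ge0_funeposE _ _ setT _ (fun x _ => g0 x) x.
  by rewrite inE; apply.
have -> : ((fun x => (f x)%:E) \_ Q)^\- = cst 0.
  apply/funext => x; have := @ge0_funenegE _ _ setT _ (fun x _ => g0 x) x.
  by rewrite inE; apply.
rewrite -/(lower_integral nu _) -/(lower_integral nu (cst 0)).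
have -> : lower_integral nu (cst 0) = 0; last by rewrite sube0.
apply/le_anti/andP; split.
  have := @lower_integral_le_cst (cst 0) setT 0 (lexx _); rewrite mul0e; apply => //.
apply: ereal_sup_ubound; exists nnsfun0 => //=.
rewrite -[LHS]/(sintegral nu (nnsfun0 : {nnsfun T >-> R})) sintegral_range big1// => x _.
have [->|x0] := eqVneq x 0%R; first by rewrite mul0e.
rewrite (_ : _ @^-1` _ = set0) ?nu0 ?mule0//.
by apply/seteqP; split => // t /= /esym/eqP; rewrite (negbTE x0).
Qed.

End RawIntegral.
End LowerIntegral.

(** * Iterated Lebesgue measure of boxes *)

Section LebesgueBoxes.
Context {R : realType}.

Lemma lebesgue_rV_premeasure n : premeasure_like (@lebesgue_rV R n).
Proof.
elim: n => [|n [IH0 IHge IHmono IHsup]].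
  split => [|A|A B AB|A B AB0] /=; rewrite ?indicE ?in_set0 ?lee_fin//.
  - have [/set_mem/AB/mem_set -> //|] := boolP (_ \in A).
    by move=> _; rewrite ler0n.
  - rewrite in_setU; case: (boolP (0 \in A)) => hA; case: (boolP (0 \in B)) => hB;
      rewrite /= ?addr0 ?add0r//.
    have h : (A `&` B) 0 by split; exact: set_mem.
    by move: h; rewrite AB0.
have E (A : set 'rV[R]_n.+1) : lebesgue_rV A = lower_integral (@lebesgue_measure R)
   (fun t => lebesgue_rV [set v : 'rV[R]_n | A (row_mx (const_mx t : 'rV[R]_1) v)]).
  by rewrite -ge0_integral_lower.
split.
- rewrite E -ge0_integral_lower; last by move=> t; exact: IHge.
  rewrite (eq_integral (cst 0%E)) ?integral0// => t _ /=.
- move=> A; rewrite E; apply: le_trans (_ : lower_integral (@lebesgue_measure R) (cst 0) <= _)%E.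
    by apply: ereal_sup_ubound; exists nnsfun0 => //=; exact: sintegral0.
  by apply: lower_integral_le => x /=; exact: IHge.
- by move=> A B AB; rewrite !E; apply: lower_integral_le => t; apply: IHmono => v /AB.
- move=> A B AB0; rewrite !E; apply: le_trans (lower_integral_superadd _ _ _) _ => //.
  apply: lower_integral_le => t; apply: IHsup; apply/seteqP; split => // v [Av Bv].
  by have : (A `&` B) (row_mx (const_mx t : 'rV[R]_1) v) by []; rewrite AB0.
Qed.

(** Half-open, so that the cells of a grid tile a cube without overlap. *)
Definition hbox n (c : 'I_n -> R) (s : R) :=
  [set v : 'rV[R]_n | forall a, c a <= v 0 a < c a + s].

Lemma lebesgue_rV_hbox n c s : 0 <= s ->
  lebesgue_rV (@hbox n c s) = (s ^+ n)%:E.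
Proof.
move=> s0; elim: n c => [|n IH] c.
  rewrite /= indicE mem_set ?expr0//; first by move=> [].
pose c' (a : 'I_n) := c (lift ord0 a).
have E t : [set v : 'rV[R]_n | hbox c s (row_mx (const_mx t : 'rV[R]_1) v)] =
   if c ord0 <= t < c ord0 + s then hbox c' s else set0.
  have r0 v : (row_mx (const_mx t : 'rV[R]_1) v : 'rV[R]_n.+1) 0 ord0 = t.
    by rewrite mxE; case: fintype.splitP => [j _|j //]; rewrite mxE.
  have rl v a : (row_mx (const_mx t : 'rV[R]_1) v : 'rV[R]_n.+1) 0 (lift ord0 a) = v 0 a.
    rewrite mxE; case: fintype.splitP => [j|j [e]].
      by rewrite /= /bump /= => e; have := ltn_ord j; rewrite -e.
    by congr (v 0 _); apply/val_inj.
  apply/seteqP; split => v.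
    move=> h; have := h ord0; rewrite r0 => ->; move=> a.
    by have := h (lift ord0 a); rewrite rl.
  case: ifP => // ct h a; case: (unliftP ord0 a) => [b ->|->]; last by rewrite r0.
  by rewrite rl; exact: h.
rewrite /=; under eq_integral do rewrite E.
pose I : set R := `[c ord0, c ord0 + s[%classic.
transitivity (\int[@lebesgue_measure R]_(t in I) (s ^+ n)%:E)%E.
  rewrite [RHS]integral_mkcond; apply: eq_integral => t _.
  rewrite patchE /I mem_setE in_itv /=; case: ifP => _; first exact: IH.
  by case: (lebesgue_rV_premeasure n).
have mI : measurable I by exact: measurable_itv.
have e : (@lebesgue_measure R I = (if 0 < s then s else 0)%:E)%E.
  rewrite /I lebesgue_measure_itv /= lte_fin ltrDl; case: ifP => // _.
  by rewrite -EFinB addrAC subrr add0r.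
transitivity ((s ^+ n)%:E * (if 0 < s then s else 0)%:E)%E.
  by rewrite integral_cst//; congr (_ * _)%E.
have [sp|] := ltP 0 s; first by rewrite -EFinM mulrC exprS.
move=> s0'; have -> : s = 0 by apply/le_anti; rewrite s0 s0'.
by rewrite mule0 expr0n.
Qed.

End LebesgueBoxes.

Lemma borel_open (T : ptopologicalType) (U : set (borel T)) : open U -> measurable U.
Proof. by move=> oU; exact: sub_sigma_algebra. Qed.

Lemma continuous_on_measurable (R : realType) (T : ptopologicalType)
  (U : set (borel T)) (f : borel T -> R) : open (U : set T) ->
  (forall x : T, U x -> {for x, continuous (f : T -> R)}) -> measurable_fun U f.
Proof.
move=> oU cf; apply: (@measurability _ _ _ _ _ _ (@measurable_realfun.RGenOInfty.G R)).
  exact: measurable_realfun.RGenOInfty.measurableE.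
move=> _ [_ [x ->] <-]; apply: borel_open.
rewrite openE => y [Uy fy]; apply: filterI; first exact: open_nbhs_nbhs.
by apply: (cf y Uy); apply: open_nbhs_nbhs; split => //; exact: interval_open.
Qed.

Lemma compact_bounded_on (R : realType) (T : ptopologicalType) (K : set T)
  (f : T -> R) : compact K -> (forall x, K x -> {for x, continuous f}) ->
  exists2 C, 0 < C & forall x, K x -> `|f x| <= C.
Proof.
move=> cK cf; apply: (compact_induction (P := fun A =>
  exists2 C, 0 < C & forall x, A x -> `|f x| <= C)) cK _ _ _ _.
- by exists 1.
- by move=> A B AB [C C0 HC]; exists C => // x /AB; exact: HC.
- move=> A B [C C0 HC] [C' C0' HC']; exists (C + C'); first exact: addr_gt0.
  move=> x [/HC h|/HC' h]; apply: le_trans h _; first by rewrite lerDl ltW.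
  by rewrite lerDr ltW.
- move=> x Kx; have h := cf x Kx.
  move/cvgrPdist_lt/(_ 1 ltr01) : h => h.
  exists (interior [set y | `|f x - f y| < 1]); split => //; first exact: open_interior.
  exists (`|f x| + 1); first by rewrite ltr_wpDl.
  move=> y /interior_subset /= xy; rewrite -lerBlDl.
  by apply: le_trans (ltW xy); rewrite distrC; exact: lerB_dist.
Qed.

(** On the segment from the identity to [G] all matrices are positive definite, hence invertible.
    The determinant is a polynomial along the segment and equals 1 at the identity, so by the
    intermediate value theorem it cannot change sign. *)
Lemma posdef_det_gt0 (R : realType) n (G : 'M[R]_n) :
  (forall v : 'rV[R]_n, v != 0 -> 0 < (v *m G *m v^T) 0 0) -> 0 < \det G.
Proof.
move=> pG.
pose H (t : R) : 'M[R]_n := t *: G + (1 - t) *: 1%:M.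
have sq (v : 'rV[R]_n) : v != 0 -> 0 < (v *m v^T) 0 0.
  move=> v0; have [a va] : exists a, v 0 a != 0.
    apply/existsP; apply: contraNT v0 => /existsPn h; apply/eqP/rowP => a.
    by rewrite mxE; apply/eqP/negPn/h.
  rewrite mxE (bigD1 a)//= mxE -expr2; apply: ltr_pwDl; last first.
    by apply: sumr_ge0 => c _; rewrite mxE -expr2 sqr_ge0.
  by rewrite lt_neqAle sqr_ge0 eq_sym sqrf_eq0 va.
have Hdet t : 0 <= t <= 1 -> \det (H t) != 0.
  move=> /andP[t0 t1]; apply/det0P => -[v v0 vH].
  have : (v *m H t *m v^T) 0 0 = 0 by rewrite vH mul0mx mxE.
  rewrite /H mulmxDr mulmxDl -!scalemxAr -!scalemxAl mulmx1 !mxE.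
  have := pG v v0; have := sq v v0; rewrite !mxE.
  move: (\sum_j _) (\sum_j _) => a b a0 b0.
  have [->|tn0] := eqVneq t 0; first by rewrite mul0r add0r subr0 mul1r => h; rewrite h ltxx in a0.
  have tp : 0 < t by rewrite lt_neqAle eq_sym tn0.
  by nra.
pose Hp : 'M[{poly R}]_n := \matrix_(i, j) ('X * (G i j)%:P + (1 - 'X) * ((i == j)%:R)%:P).
have HpE t : (\det Hp).[t] = \det (H t).
  rewrite -[LHS]/(horner_eval t (\det Hp)) -det_map_mx; congr (\det _).
  by apply/matrixP => i j; rewrite !mxE /= /horner_eval !hornerE.
have p0 : (\det Hp).[0] = 1.
  by rewrite HpE /H scale0r add0r subr0 scale1r det1.
rewrite ltNge; apply/negP => p1.
have := @poly_ivt R (- \det Hp) 0 1 ler01.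
rewrite !hornerN p0 HpE /H scale1r subrr scale0r addr0 oppr_le0 ler01 oppr_ge0 p1 /=.
move=> /(_ isT)[t t01]; rewrite /root hornerN oppr_eq0 HpE.
by apply/negP/Hdet.
Qed.

(** * The weighted measure in charts *)

Section ManifoldMeasure.
Context {R : realType} {n : nat} {M : ptopologicalType} (X : manifold R n M).
Context (g : riemannian_metric X).
Context (dv mu : {measure set (borel M) -> \bar R}) (phi : M -> R).
Hypotheses (vol : riemannian_volume g dv) (sphi : smooth_on X setT phi).
Hypotheses (phi0 : forall x, 0 < phi x) (wm : weighted_measure dv phi mu).

Lemma smooth_on_prod (I : Type) (r : seq I) (W : set M) (F : I -> M -> R) : open W ->
  (forall j, smooth_on X W (F j)) -> smooth_on X W (fun x => \prod_(j <- r) F j x).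
Proof.
move=> oW sF; elim: r => [|j r IH].
  apply: (smooth_on_eq (f := fun=> 1)) => //; last exact: smooth_on_cst.
  by move=> x _; rewrite big_nil.
by apply: smooth_on_eq (smooth_on_mul oW (sF j) IH) => // x _; rewrite big_cons.
Qed.

Lemma gram_det_smooth (i : atlas X) : smooth_on X (dom i) (fun x => \det (gram g i x)).
Proof.
have od := dom_open i; rewrite /determinant; apply: smooth_on_sum => // s.
apply: smooth_on_mul => //; first exact: smooth_on_cst.
by apply: smooth_on_prod => // a; exact: gram_smooth.
Qed.

Lemma gram_det_gt0 (i : atlas X) x : dom i x -> 0 < \det (gram g i x).
Proof. by move=> dx; apply: posdef_det_gt0 => v; exact: gram_pos. Qed.

Definition chart_box (i : atlas X) (p : 'I_n -> R) (s : R) : set (borel M) :=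
  [set x | dom i x /\ hbox p s (chart i x)].

Lemma chart_box_measurable i p s : measurable (chart_box i p s).
Proof.
have od := dom_open i.
have -> : chart_box i p s = dom i `&` \bigcap_(a in [set: 'I_n])
    (dom i `&` (fun x => chart i x 0 a) @^-1` `[p a, p a + s[%classic).
  apply/seteqP; split => x.
    by move=> [dx hx]; split => // a _; split => //=; rewrite in_itv /=; exact: hx.
  by move=> [dx hx]; split => // a; have [_ /=] := hx a I; rewrite in_itv.
apply: measurableI; first exact: borel_open.
apply: fin_bigcap_measurable => // a _.
have mf : measurable_fun (dom i : set (borel M)) (fun x => chart i x 0 a).
  apply: continuous_on_measurable => // x dx.
  exact: smooth_on_continuous od (smooth_on_coord i a) dx.
by apply: mf => //; apply: borel_open.
Qed.

Lemma hbox_measurable p s : measurable (@hbox R n p s : set (borel 'rV[R]_n)).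
Proof.
have -> : @hbox R n p s = \bigcap_(a in [set: 'I_n])
    (setT `&` (fun y : 'rV[R]_n => y 0 a) @^-1` `[p a, p a + s[%classic).
  apply/seteqP; split => x.
    by move=> hx a _; split => //=; rewrite in_itv /=; exact: hx.
  by move=> hx a; have [_ /=] := hx a I; rewrite in_itv.
apply: fin_bigcap_measurable => // a _.
have mf : measurable_fun (setT : set (borel 'rV[R]_n)) (fun y : 'rV[R]_n => y 0 a).
  apply: continuous_on_measurable; first exact: openT.
  by move=> x _; exact: coord_continuous.
by apply: mf.
Qed.

Lemma chart_image_box i p s : hbox p s `<=` chart i @` dom i ->
  chart i @` chart_box i p s = hbox p s.
Proof.
move=> h; apply/seteqP; split => [_ [x [dx hx] <-]//|y hy].
by have [x dx xy] := h y hy; exists x => //; split => //; rewrite xy.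
Qed.

(* The density of [mu] in the chart is bounded above and below on the compact
   cube. *)
Lemma chart_box_measure (i : atlas X) y r : cbox y r `<=` chart i @` dom i ->
  exists c C : R, [/\ 0 < c, 0 < C & forall p s, 0 <= s -> hbox p s `<=` cbox y r ->
    ((c * s ^+ n)%:E <= mu (chart_box i p s) /\ mu (chart_box i p s) <= (C * s ^+ n)%:E)%E].
Proof.
move=> yr; pose K := param i @` cbox y r.
have Kd x : K x -> dom i x by move=> [z /yr [w dw <-] <-]; rewrite chartK.
have cK : compact K.
  apply: continuous_compact; last exact: cbox_compact.
  apply: continuous_in_subspaceT => z /set_mem /yr [w dw <-].
  by apply: param_continuous; exists w.
have od := dom_open i.
have cdet x : dom i x -> {for x, continuous (fun x => \det (gram g i x))}.
  by move=> dx; exact: smooth_on_continuous od (gram_det_smooth i) dx.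
have cphi x : {for x, continuous phi} by exact: (smooth_on_continuous openT sphi).
have cinv (f : M -> R) x : f x != 0 -> {for x, continuous f} ->
    {for x, continuous (fun x => (f x)^-1)} by exact: continuousV.
have [C1 C10 HC1] := compact_bounded_on cK (fun x Kx => cdet x (Kd x Kx)).
have [C2 C20 HC2] := compact_bounded_on (f := fun x => (\det (gram g i x))^-1) cK
   (fun x Kx => cinv (fun x => \det (gram g i x)) x (lt0r_neq0 (gram_det_gt0 (Kd x Kx))) (cdet x (Kd x Kx))).
have [C3 C30 HC3] := compact_bounded_on cK (fun x _ => cphi x).
have [C4 C40 HC4] := compact_bounded_on (f := fun x => (phi x)^-1) cK
   (fun x _ => cinv phi x (lt0r_neq0 (phi0 x)) (cphi x)).
pose D x := Num.sqrt (\det (gram g i x)).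
have D1 x : K x -> D x <= Num.sqrt C1.
  move=> Kx; apply: ler_wsqrtr; apply: le_trans (HC1 x Kx); exact: ler_norm.
have D2 x : K x -> Num.sqrt C2^-1 <= D x.
  move=> Kx; have d0 := gram_det_gt0 (Kd x Kx).
  apply: ler_wsqrtr; rewrite -[leRHS]invrK lef_pV2 ?posrE ?invr_gt0//.
  apply: le_trans (HC2 x Kx); exact: ler_norm.
have c0 : 0 < Num.sqrt C2^-1 by rewrite sqrtr_gt0 invr_gt0.
have e0 : 0 < C4 ^- 2 by rewrite invr_gt0 exprn_gt0.
exists (C4 ^- 2 * Num.sqrt C2^-1), (C3 ^+ 2 * Num.sqrt C1); split.
- by rewrite mulr_gt0.
- by rewrite mulr_gt0 ?exprn_gt0// sqrtr_gt0.
move=> p s s0 hs; pose A := chart_box i p s.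
have AK : A `<=` K.
  by move=> x [dx hx]; exists (chart i x); [exact: hs|rewrite chartK].
have mA : measurable A by exact: chart_box_measurable.
have nuP := @lebesgue_rV_premeasure R n.
have hbE x : hbox p s x -> K (param i x) by move=> /hs h; exists x.
have dvE : dv A = lower_integral (@lebesgue_rV R n : set (borel 'rV[R]_n) -> \bar R)
    ((fun y => (D (param i y))%:E) \_ (hbox p s : set (borel 'rV[R]_n))).
  rewrite (@vol i)//; last by move=> x [].
  rewrite chart_image_box; last by move=> z /hs /yr.
  by rewrite integral_raw// => z; exact: sqrtr_ge0.
have dv1 : (dv A <= (Num.sqrt C1 * s ^+ n)%:E)%E.
  rewrite dvE EFinM -(lebesgue_rV_hbox p s0); apply: lower_integral_le_cst => //.
  - move=> z hz; rewrite patchE mem_set// lee_fin; exact/D1/hbE.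
  - by move=> z nz; rewrite patchE memNset.
have dv2 : ((Num.sqrt C2^-1 * s ^+ n)%:E <= dv A)%E.
  rewrite dvE EFinM -(lebesgue_rV_hbox p s0); apply: lower_integral_ge_cst => //.
  - exact: hbox_measurable.
  - by move=> z; rewrite patchE; case: ifP => // _; rewrite lee_fin sqrtr_ge0.
  - move=> z hz; rewrite patchE mem_set// lee_fin; exact/D2/hbE.
have mphi : measurable_fun A (EFin \o (fun x : borel M => phi x ^+ 2)).
  apply/measurable_EFinP; apply: (measurable_funS measurableT) => //.
  apply: measurable_funX; apply: continuous_on_measurable => //; exact: openT.
rewrite (wm mA); split.
  apply: (@le_trans _ _ (\int[dv]_(x in A) (C4 ^- 2)%:E)%E).
    rewrite integral_cst// -mulrA EFinM; apply: lee_wpmul2l => //; rewrite lee_fin; exact: ltW.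
  apply: ge0_le_integral => //.
  - by move=> x _; rewrite lee_fin ltW.
  - move=> x Ax; have Kx := AK x Ax; rewrite lee_fin -exprVn.
    have h : (phi x)^-1 <= C4 by exact: le_trans (ler_norm _) (HC4 x Kx).
    have h0 := phi0 x; have h1 : C4^-1 <= phi x.
      by rewrite -[leRHS]invrK lef_pV2 ?posrE ?invr_gt0.
    by rewrite ler_pXn2r ?nnegrE ?invr_ge0 ?(ltW C40) ?(ltW h0).
apply: (@le_trans _ _ (\int[dv]_(x in A) (C3 ^+ 2)%:E)%E); last first.
  rewrite integral_cst// -[X in (_ <= X%:E)%E]mulrA [X in (_ <= X)%E]EFinM.
  by apply: lee_wpmul2l => //; rewrite lee_fin; exact: sqr_ge0.
apply: ge0_le_integral => //.
- by move=> x _; rewrite lee_fin sqr_ge0.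
- move=> x Ax; rewrite lee_fin; have h := HC3 x (AK x Ax); have h0 := phi0 x.
  rewrite ler_pXn2r ?nnegrE ?(ltW C30) ?(ltW h0)//.
  exact: le_trans (ler_norm _) h.
Qed.

Lemma hbox_sub_cbox (y : 'rV[R]_n) (p : 'I_n -> R) s r :
  (forall a, y 0 a - r <= p a /\ p a + s <= y 0 a + r) -> hbox p s `<=` cbox y r.
Proof.
move=> h z hz a; have [h1 h2] := h a; have /andP[h3 h4] := hz a.
by rewrite ler_distl; apply/andP; split; [exact: le_trans h1 h3|exact: le_trans (ltW h4) h2].
Qed.

Lemma mu_locally_finite x : exists U : set M, [/\ open U, U x & (mu U < +oo)%E].
Proof.
have [i dx] := dom_cover X x; pose y := chart i x.
have oU := chart_image_open (X := X) (i := i) openT; rewrite setTI in oU.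
have Uy : (chart i @` dom i) y by exists x.
have [r r0 rU] := nbhs_cbox (open_nbhs_nbhs (conj oU Uy)).
have [c [C [c0 C0 HC]]] := chart_box_measure rU.
pose p a := y 0 a - r.
have hs : hbox p (r * 2) `<=` cbox y r.
  by apply: hbox_sub_cbox => a; rewrite /p; split => //; lra.
have [_ h2] := HC p (r * 2) (mulr_ge0 (ltW r0) (ler0n _ 2)) hs.
exists (dom i `&` chart i @^-1` obox y r); split.
- rewrite openE => z [dz oz]; apply: filterI.
    by apply: open_nbhs_nbhs; split => //; exact: dom_open.
  by apply: (chart_continuous dz); apply: open_nbhs_nbhs; split => //; exact: obox_open.
- by split => // a; rewrite subrr normr0.
apply: le_lt_trans (ltry _); apply: le_trans h2; apply: le_measure; rewrite ?inE.
- apply: borel_open; rewrite openE => z [dz oz]; apply: filterI.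
    by apply: open_nbhs_nbhs; split => //; exact: dom_open.
  by apply: (chart_continuous dz); apply: open_nbhs_nbhs; split => //; exact: obox_open.
- exact: chart_box_measurable.
move=> z [dz oz]; split => // a; have := oz a; rewrite ltr_distl /p => /andP[h3 h4].
by apply/andP; split; [exact: ltW|lra].
Qed.

Lemma mu_open_gt0 (V : set M) x : open V -> V x -> (0 < mu V)%E.
Proof.
move=> oV Vx; have [i dx] := dom_cover X x; pose y := chart i x.
have oU := chart_image_open (X := X) (i := i) oV.
have Uy : (chart i @` (V `&` dom i)) y by exists x.
have [r r0 rU] := nbhs_cbox (open_nbhs_nbhs (conj oU Uy)).
have rU' : cbox y r `<=` chart i @` dom i by move=> z /rU [w [_ dw] <-]; exists w.
have [c [C [c0 C0 HC]]] := chart_box_measure rU'.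
pose p a := y 0 a - r.
have hs : hbox p (r * 2) `<=` cbox y r.
  by apply: hbox_sub_cbox => a; rewrite /p; split => //; lra.
have [h1 _] := HC p (r * 2) (mulr_ge0 (ltW r0) (ler0n _ 2)) hs.
apply: (@lt_le_trans _ _ (c * (r * 2) ^+ n)%:E).
  by rewrite lte_fin mulr_gt0// exprn_gt0// mulr_gt0.
apply: le_trans h1 _; apply: le_measure; rewrite ?inE.
- exact: chart_box_measurable.
- exact: borel_open.
by move=> z [dz /hs/rU [w [Vw dw] wz]]; rewrite -(chartK dz) -wz chartK.
Qed.

Lemma mu_compact_finite (K : set M) : compact K -> exists U : set M,
  [/\ open U, K `<=` U & (mu U < +oo)%E].
Proof.
move=> cK; apply: (compact_induction (P := fun A => exists U : set M,
  [/\ open U, A `<=` U & (mu U < +oo)%E])) cK _ _ _ _.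
- by exists set0; split => //; [exact: open0|rewrite measure0].
- by move=> A B AB [U [oU BU fU]]; exists U; split => // x /AB /BU.
- move=> A B [U [oU AU fU]] [U' [oU' BU' fU']]; exists (U `|` U'); split.
  + exact: openU.
  + by move=> x [/AU|/BU']; [left|right].
  + apply: (@le_lt_trans _ _ (mu U + mu U')%E); last by rewrite lte_add_pinfty.
    by apply: measureU2; exact: borel_open.
- move=> x _; have [U [oU Ux fU]] := mu_locally_finite x.
  by exists U; split => //; exists U; split.
Qed.

End ManifoldMeasure.

(** * Scalars, fibers and the Hilbert space of square-integrable sections *)

Section ScalarsTheory.
Context {R : realType} {b : base_field}.
Local Notation S := (scalars_of R b).
Implicit Types (x y z : S) (r : R).

Lemma sc_reD x y : sc_re (x + y) = sc_re x + sc_re y.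
Proof. by move: x y; case: b => [//|[? ?] [? ?]]. Qed.
Lemma sc_imD x y : sc_im (x + y) = sc_im x + sc_im y.
Proof. by move: x y; case: b => [? ?|[? ?] [? ?]] //=; rewrite addr0. Qed.
Lemma sc_reN x : sc_re (- x) = - sc_re x.
Proof. by move: x; case: b => [//|[? ?]]. Qed.
Lemma sc_imN x : sc_im (- x) = - sc_im x.
Proof. by move: x; case: b => [?|[? ?]] //=; rewrite oppr0. Qed.
Lemma sc_reM x y : sc_re (x * y) = sc_re x * sc_re y - sc_im x * sc_im y.
Proof. by move: x y; case: b => [? ?|[? ?] [? ?]] //=; rewrite mulr0 subr0. Qed.
Lemma sc_imM x y : sc_im (x * y) = sc_re x * sc_im y + sc_im x * sc_re y.
Proof.
by move: x y; case: b => [? ?|[? ?] [? ?]] //=; rewrite mulr0 mul0r addr0.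
Qed.
Lemma sc_re0 : sc_re (0 : S) = 0. Proof. by case: b. Qed.
Lemma sc_im0 : sc_im (0 : S) = 0. Proof. by case: b. Qed.
Lemma sc_re1 : sc_re (1 : S) = 1. Proof. by case: b. Qed.
Lemma sc_im1 : sc_im (1 : S) = 0. Proof. by case: b. Qed.
Lemma sc_re_mk r s : sc_re (sc_mk S r s) = r. Proof. by case: b. Qed.
Lemma sc_re_real r : sc_re (sc_real S r) = r. Proof. by case: b. Qed.
Lemma sc_im_real r : sc_im (sc_real S r) = 0. Proof. by case: b. Qed.
Lemma sc_mkE z : sc_mk S (sc_re z) (sc_im z) = z.
Proof. by move: z; case: b => [//|[? ?]]. Qed.
Lemma sc_ext x y : sc_re x = sc_re y -> sc_im x = sc_im y -> x = y.
Proof. by move=> h1 h2; rewrite -(sc_mkE x) h1 h2 sc_mkE. Qed.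
Lemma sc_le_re x y : x <= y -> sc_re x <= sc_re y.
Proof.
by move: x y; case: b => [//|[? ?] [? ?]]; rewrite lecE /= => /andP[].
Qed.
Lemma sc_gt0 x : 0 < x -> 0 < sc_re x /\ sc_im x = 0.
Proof.
move: x; case: b => [//|[? ?]]; rewrite ltcE /= => /andP[/eqP -> ->]; by split.
Qed.
Lemma sc_re_sum (I : Type) (s : seq I) (F : I -> S) :
  sc_re (\sum_(i <- s) F i) = \sum_(i <- s) sc_re (F i).
Proof. by elim/big_ind2 : _ => [|? ? ? ? <- <-|//]; rewrite ?sc_re0 ?sc_reD. Qed.
Lemma sc_im_sum (I : Type) (s : seq I) (F : I -> S) :
  sc_im (\sum_(i <- s) F i) = \sum_(i <- s) sc_im (F i).
Proof. by elim/big_ind2 : _ => [|? ? ? ? <- <-|//]; rewrite ?sc_im0 ?sc_imD. Qed.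
Lemma sc_re_conj x : sc_re (sc_conj x) = sc_re x.
Proof. by rewrite sc_re_mk. Qed.
Lemma sc_im_conj x : sc_im (sc_conj x) = - sc_im x.
Proof. by move: x; case: b => [?|[? ?]] //=; rewrite oppr0. Qed.
Lemma sc_conjK x : sc_conj (sc_conj x) = x.
Proof. by apply: sc_ext; rewrite ?sc_re_conj ?sc_im_conj ?opprK. Qed.
Lemma sc_conjD x y : sc_conj (x + y) = sc_conj x + sc_conj y.
Proof.
by apply: sc_ext; rewrite ?(sc_re_conj, sc_im_conj, sc_reD, sc_imD)// opprD.
Qed.
Lemma sc_conjM x y : sc_conj (x * y) = sc_conj x * sc_conj y.
Proof.
apply: sc_ext; rewrite ?(sc_re_conj, sc_im_conj, sc_reM, sc_imM)//.
  by rewrite mulrNN.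
by rewrite opprD mulrN mulNr.
Qed.
Lemma sc_realD r s : sc_real S (r + s) = sc_real S r + sc_real S s.
Proof. by apply: sc_ext; rewrite ?(sc_reD, sc_imD, sc_re_real, sc_im_real) ?addr0. Qed.
Lemma sc_realM r s : sc_real S (r * s) = sc_real S r * sc_real S s.
Proof.
by apply: sc_ext; rewrite ?(sc_reM, sc_imM, sc_re_real, sc_im_real) ?mulr0 ?mul0r ?addr0 ?subr0.
Qed.
Lemma sc_real0 : sc_real S 0 = 0.
Proof. by apply: sc_ext; rewrite ?(sc_re_real, sc_im_real) ?sc_re0 ?sc_im0. Qed.
Lemma sc_real1 : sc_real S 1 = 1.
Proof. by apply: sc_ext; rewrite ?(sc_re_real, sc_im_real) ?sc_re1 ?sc_im1. Qed.
Lemma sc_realN r : sc_real S (- r) = - sc_real S r.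
Proof. by apply: sc_ext; rewrite ?(sc_reN, sc_imN, sc_re_real, sc_im_real) ?oppr0. Qed.

Definition nsq z : R := sc_re z ^+ 2 + sc_im z ^+ 2.

Lemma nsq_ge0 z : 0 <= nsq z. Proof. by rewrite addr_ge0 ?sqr_ge0. Qed.
Lemma nsqM x y : nsq (x * y) = nsq x * nsq y.
Proof. by rewrite /nsq sc_reM sc_imM; ring. Qed.
Lemma nsq0 : nsq 0 = 0. Proof. by rewrite /nsq sc_re0 sc_im0 expr0n addr0. Qed.
Lemma nsq_real r : nsq (sc_real S r) = r ^+ 2.
Proof. by rewrite /nsq sc_re_real sc_im_real expr0n addr0. Qed.
Lemma nsqN z : nsq (- z) = nsq z.
Proof. by rewrite /nsq sc_reN sc_imN !sqrrN. Qed.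
Lemma nsqD_le x y : nsq (x + y) <= 2 * nsq x + 2 * nsq y.
Proof.
rewrite /nsq sc_reD sc_imD.
move: (sc_re x) (sc_re y) (sc_im x) (sc_im y) => p q r s.
by have := sqr_ge0 (p - q); have := sqr_ge0 (r - s); lra.
Qed.
Lemma mul_conj_nsq z : z * sc_conj z = sc_real S (nsq z).
Proof.
apply: sc_ext; rewrite ?(sc_reM, sc_imM, sc_re_conj, sc_im_conj, sc_re_real, sc_im_real) /nsq.
  by ring.
by ring.
Qed.

Lemma nsq_sum_le (I : Type) (s : seq I) (F : I -> S) :
  nsq (\sum_(i <- s) F i) <= (size s)%:R * \sum_(i <- s) nsq (F i).
Proof.
elim: s => [|i s IH]; first by rewrite !big_nil nsq0 mulr0.
rewrite !big_cons /=; set X := F i; set Y := \sum_(j <- s) F j in IH *.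
set Z := \sum_(j <- s) nsq (F j) in IH *.
have Z0 : 0 <= Z by apply: sumr_ge0 => j _; exact: nsq_ge0.
case: s => [|j s] in Y Z Z0 IH *.
  by rewrite /Y /Z !big_nil !addr0 mul1r.
move: (size (j :: s)) (isT : (0 < size (j :: s))%N) IH => k k0 IH.
have kp : 0 < k%:R :> R by rewrite ltr0n.
have h : nsq (X + Y) <= (1 + k%:R) * nsq X + (1 + k%:R^-1) * nsq Y.
  rewrite /nsq sc_reD sc_imD -subr_ge0.
  move: (sc_re X) (sc_re Y) (sc_im X) (sc_im Y) => p q r t.
  have -> : (1 + k%:R) * (p ^+ 2 + r ^+ 2) + (1 + k%:R^-1) * (q ^+ 2 + t ^+ 2)
     - ((p + q) ^+ 2 + (r + t) ^+ 2)
     = k%:R^-1 * ((k%:R * p - q) ^+ 2 + (k%:R * r - t) ^+ 2).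
    by field; exact: lt0r_neq0.
  by rewrite mulr_ge0 ?invr_ge0 ?addr_ge0 ?sqr_ge0// ltW.
have hk : (1 + k%:R^-1) * nsq Y <= (1 + k%:R^-1) * (k%:R * Z).
  by apply: ler_wpM2l => //; rewrite addr_ge0// invr_ge0.
have e : (1 + k%:R^-1) * (k%:R * Z) = (1 + k%:R) * Z by field; exact: lt0r_neq0.
rewrite e in hk; have -> : k.+1%:R = 1 + k%:R :> R by rewrite -natr1 addrC.
move: (k%:R) (nsq X) (nsq Y) (nsq (X + Y)) h hk => k' p q r h hk.
by rewrite mulrDr; lra.
Qed.

Definition cnsq m (w : 'cV[S]_m) : R := \sum_a nsq (w a 0).

Lemma cnsq_ge0 m (w : 'cV[S]_m) : 0 <= cnsq w.
Proof. by apply: sumr_ge0 => a _; exact: nsq_ge0. Qed.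

Lemma cnsqD_le m (v w : 'cV[S]_m) : cnsq (v + w) <= 2 * cnsq v + 2 * cnsq w.
Proof.
rewrite /cnsq !mulr_sumr -big_split /=; apply: ler_sum => a _.
by rewrite mxE; exact: nsqD_le.
Qed.

Lemma cnsqN m (w : 'cV[S]_m) : cnsq (- w) = cnsq w.
Proof. by apply: eq_bigr => a _; rewrite mxE nsqN. Qed.

Lemma cnsqZ m z (w : 'cV[S]_m) : cnsq (z *: w) = nsq z * cnsq w.
Proof. by rewrite /cnsq mulr_sumr; apply: eq_bigr => a _; rewrite mxE nsqM. Qed.

Lemma cnsq_sum_le m (I : Type) (s : seq I) (F : I -> 'cV[S]_m) :
  cnsq (\sum_(i <- s) F i) <= (size s)%:R * \sum_(i <- s) cnsq (F i).
Proof.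
rewrite /cnsq exchange_big/= mulr_sumr; apply: ler_sum => a _.
by rewrite summxE; exact: nsq_sum_le.
Qed.

Lemma cnsq_mulmx_le p m (A : 'M[S]_(p, m)) (w : 'cV[S]_m) :
  cnsq (A *m w) <= m%:R * (\sum_i \sum_j nsq (A i j)) * cnsq w.
Proof.
rewrite [leLHS]/cnsq -mulrA mulr_suml mulr_sumr; apply: ler_sum => i _.
rewrite mxE; apply: le_trans (nsq_sum_le _ _) _.
rewrite /index_enum -enumT size_enum_ord; apply: ler_wpM2l => //.
rewrite mulr_suml enumT; apply: ler_sum => j _; rewrite nsqM; apply: ler_wpM2l; first exact: nsq_ge0.
by rewrite /cnsq (bigD1 j)//= lerDl sumr_ge0// => k _; exact: nsq_ge0.
Qed.

(** An injective matrix has a left inverse, here [B^T], and the bound on the left inverse gives the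
    constant. *)
Lemma mulmx_injective_bound p m (A : 'M[S]_(p, m)) :
  (forall w : 'cV[S]_m, A *m w = 0 -> w = 0) ->
  exists2 c, 0 < c & forall w : 'cV[S]_m, c * cnsq w <= cnsq (A *m w).
Proof.
move=> injA; have fA : row_free A^T.
  rewrite -kermx_eq0; apply/eqP/row_matrixP => i; rewrite row0.
  have := mulmx_ker A^T; move/(congr1 (row i)); rewrite row_mul row0 => h.
  have := injA (row i (kermx A^T))^T.
  have -> : A *m (row i (kermx A^T))^T = 0 by rewrite -[LHS]trmxK trmx_mul trmxK h trmx0.
  move=> /(_ erefl).
  by move/(congr1 trmx); rewrite trmxK trmx0.
have [B AB] := row_freeP fA.
pose K : R := m%:R * 0 + p%:R * (\sum_i \sum_j nsq (B^T i j)) + 1.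
have s0 : 0 <= \sum_i \sum_j nsq (B^T i j).
  by apply: sumr_ge0 => i _; apply: sumr_ge0 => j _; exact: nsq_ge0.
have K0 : 0 < K by rewrite /K mulr0 add0r ltr_wpDl// mulr_ge0.
exists K^-1; first by rewrite invr_gt0.
move=> w; rewrite -ler_pdivlMl ?invr_gt0// invrK.
have {1}-> : w = B^T *m (A *m w).
  by rewrite mulmxA -[A]trmxK -trmx_mul AB trmx1 mul1mx.
apply: le_trans (cnsq_mulmx_le _ _) _; apply: ler_wpM2r; first exact: cnsq_ge0.
by rewrite /K mulr0 add0r lerDl.
Qed.

End ScalarsTheory.

(** * Bundle metrics in trivializations *)

Section FiberEstimates.
Context {R : realType} {b : base_field} {n : nat} {M : ptopologicalType}.
Local Notation S := (scalars_of R b).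
Context {X : manifold R n M} {E : vbundle S X} (h : bundle_metric E).

Definition hr x (u v : fiber E x) : R := sc_re (h x u v).

Lemma bmDl x (u v w : fiber E x) : h x (u + v) w = h x u w + h x v w.
Proof. by have := bm_linear h w 1 u v; rewrite scale1r mul1r. Qed.
Lemma bm0l x (w : fiber E x) : h x 0 w = 0.
Proof. by have := bmDl 0 0 w; rewrite addr0 => /eqP; rewrite -subr_eq subrr eq_sym => /eqP. Qed.
Lemma bmZl x c (u w : fiber E x) : h x (c *: u) w = c * h x u w.
Proof. by have := bm_linear h w c u 0; rewrite addr0 bm0l addr0. Qed.
Lemma bmDr x (u v w : fiber E x) : h x w (u + v) = h x w u + h x w v.
Proof. by rewrite (bm_sym h (u + v) w) bmDl sc_conjD -!bm_sym. Qed.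
Lemma bmZr x c (u w : fiber E x) : h x w (c *: u) = sc_conj c * h x w u.
Proof. by rewrite (bm_sym h (c *: u) w) bmZl sc_conjM -bm_sym. Qed.
Lemma bm_suml x (I : Type) (s : seq I) (F : I -> fiber E x) w :
  h x (\sum_(i <- s) F i) w = \sum_(i <- s) h x (F i) w.
Proof. by elim/big_ind2 : _ => [|? ? ? ? <- <-|//]; rewrite ?bm0l ?bmDl. Qed.
Lemma bm_sumr x (I : Type) (s : seq I) (F : I -> fiber E x) w :
  h x w (\sum_(i <- s) F i) = \sum_(i <- s) h x w (F i).
Proof.
elim: s => [|i s IH]; first by rewrite !big_nil (bm_sym h 0 w) bm0l; apply: sc_ext;
  rewrite ?sc_re_conj ?sc_im_conj ?sc_re0 ?sc_im0 ?oppr0.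
by rewrite !big_cons bmDr IH.
Qed.

Lemma hr_sym x (u v : fiber E x) : hr u v = hr v u.
Proof. by rewrite /hr (bm_sym h u v) sc_re_conj. Qed.
Lemma hrDl x (u v w : fiber E x) : hr (u + v) w = hr u w + hr v w.
Proof. by rewrite /hr bmDl sc_reD. Qed.
Lemma hrDr x (u v w : fiber E x) : hr w (u + v) = hr w u + hr w v.
Proof. by rewrite hr_sym hrDl !(hr_sym w). Qed.
Lemma hrZl x r (u w : fiber E x) : hr (sc_real S r *: u) w = r * hr u w.
Proof. by rewrite /hr bmZl sc_reM sc_re_real sc_im_real mul0r subr0. Qed.
Lemma hrZr x r (u w : fiber E x) : hr w (sc_real S r *: u) = r * hr w u.
Proof. by rewrite hr_sym hrZl hr_sym. Qed.
Lemma hrNl x (u w : fiber E x) : hr (- u) w = - hr u w.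
Proof. by rewrite -scaleN1r -[-1](@sc_ext _ _ (sc_real S (-1)))
  ?hrZl ?mulN1r// ?sc_re_real ?sc_im_real ?sc_reN ?sc_imN ?sc_re1 ?sc_im1 ?oppr0. Qed.
Lemma hrNr x (u w : fiber E x) : hr w (- u) = - hr w u.
Proof. by rewrite hr_sym hrNl hr_sym. Qed.
Lemma hr0 x (w : fiber E x) : hr 0 w = 0.
Proof. by rewrite /hr bm0l sc_re0. Qed.
Lemma hr_gt0 x (u : fiber E x) : u != 0 -> 0 < hr u u.
Proof. by move=> /(bm_pos h)/sc_gt0[]. Qed.
Lemma hr_ge0 x (u : fiber E x) : 0 <= hr u u.
Proof. by have [->|/hr_gt0/ltW//] := eqVneq u 0; rewrite hr0. Qed.
Lemma hr_eq0 x (u : fiber E x) : hr u u = 0 -> u = 0.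
Proof. by move=> u0; apply: contrapT => /eqP/hr_gt0; rewrite u0 ltxx. Qed.
Lemma hr_scale x c (u : fiber E x) : hr (c *: u) (c *: u) = nsq c * hr u u.
Proof.
rewrite /hr bmZl bmZr mulrA mul_conj_nsq sc_reM sc_re_real sc_im_real.
by rewrite mul0r subr0.
Qed.

Lemma hr_cauchy_schwarz x (u v : fiber E x) : hr u v ^+ 2 <= hr u u * hr v v.
Proof.
apply: discriminant_le; first exact: hr_ge0.
move=> t; have := hr_ge0 (u + sc_real S t *: v).
rewrite hrDl !hrDr !hrZl !hrZr (hr_sym v u).
by move: (hr u u) (hr u v) (hr v v) => p q r; congr (0 <= _); ring.
Qed.

Lemma hr_le_sum x (u v : fiber E x) : hr (u + v) (u + v) <= 2 * hr u u + 2 * hr v v.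
Proof.
have := hr_ge0 (u - v); rewrite !(hrDl, hrDr, hrNl, hrNr) (hr_sym v u).
by move: (hr u u) (hr u v) (hr v v) => p q r; lra.
Qed.

Lemma hr_norm_le x (u v : fiber E x) : `|hr u v| <= hr u u + hr v v.
Proof.
have h1 := hr_ge0 (u - v); have h2 := hr_ge0 (u + v).
rewrite !(hrDl, hrDr, hrNl, hrNr) (hr_sym v u) in h1 h2.
have h3 := hr_ge0 u; have h4 := hr_ge0 v.
by rewrite ler_norml; apply/andP; split; lra.
Qed.

(** The real inequality is applied to [v] scaled by [h x u v], whose real inner product with [u] is
    the squared modulus of [h x u v]. *)
Lemma bm_cauchy_schwarz x (u v : fiber E x) : nsq (h x u v) <= hr u u * hr v v.
Proof.
have := hr_cauchy_schwarz u (h x u v *: v); rewrite hr_scale.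
rewrite {1}/hr bmZr mulrC mul_conj_nsq sc_re_real.
move=> h1; have [h0|h0] := eqVneq (nsq (h x u v)) 0.
  by rewrite h0 mulr_ge0// hr_ge0.
have hp : 0 < nsq (h x u v) by rewrite lt_neqAle eq_sym h0 nsq_ge0.
by rewrite -(ler_pM2l hp); move: h1; rewrite expr2 (mulrCA (hr u u)).
Qed.

Lemma triv_expand (j : triv_index E) x (u : fiber E x) : triv_dom j x ->
  u = \sum_a triv j x u a 0 *: frame j a x.
Proof.
move=> jx; rewrite -{1}(trivK jx u).
have {1}-> : triv j x u = \sum_a triv j x u a 0 *: (delta_mx a 0 : 'cV_ _).
  apply/colP => c; rewrite summxE (bigD1 c)//= !mxE !eqxx mulr1 big1 ?addr0// => a ac.
  by rewrite !mxE eq_sym (negbTE ac) mulr0.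
by rewrite linear_sum; apply: eq_bigr => a _; rewrite linearZ.
Qed.

Lemma bm_expand (j : triv_index E) x (u v : fiber E x) : triv_dom j x ->
  h x u v = \sum_a \sum_c triv j x u a 0 * sc_conj (triv j x v c 0)
     * h x (frame j a x) (frame j c x).
Proof.
move=> jx; rewrite {1}(triv_expand u jx) bm_suml; apply: eq_bigr => a _.
rewrite bmZl {1}(triv_expand v jx) bm_sumr mulr_sumr; apply: eq_bigr => c _.
by rewrite bmZr mulrA.
Qed.

Lemma hr_upper (j : triv_index E) x : triv_dom j x -> exists C, 0 < C /\
  forall u : fiber E x, hr u u <= C * cnsq (triv j x u).
Proof.
move=> jx; pose C := \sum_a hr (frame j a x) (frame j a x).
have C0 : 0 <= C by apply: sumr_ge0 => a _; exact: hr_ge0.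
exists ((rank E)%:R * C + 1); split; first by rewrite ltr_wpDl// mulr_ge0.
move=> u; have hs (s : seq 'I_(rank E)) :
   let z := \sum_(a <- s) triv j x u a 0 *: frame j a x in
   hr z z <= (size s)%:R * \sum_(a <- s) nsq (triv j x u a 0) * hr (frame j a x) (frame j a x).
  elim: s => [|a s IH] /=; first by rewrite !big_nil hr0 mulr0.
  rewrite !big_cons; move: IH => /=.
  set z := \sum_(i <- s) _ *: _; set w := triv j x u a 0 *: frame j a x.
  set Q := \sum_(i <- s) _ => IH.
  have Q0 : 0 <= Q by apply: sumr_ge0 => i _; rewrite mulr_ge0 ?nsq_ge0 ?hr_ge0.
  have [s0|s0] := posnP (size s).
    have := IH; rewrite s0 mul0r => z0.
    have -> : z = 0 by apply: hr_eq0; apply/le_anti; rewrite z0 hr_ge0.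
    by rewrite addr0 mul1r hr_scale lerDl.
  have kp : 0 < (size s)%:R :> R by rewrite ltr0n.
  rewrite -[(size s).+1%:R]natr1.
  move: ((size s)%:R) kp IH => k kp IH.
  have hD : hr (w + z) (w + z) <= (1 + k) * hr w w + (1 + k^-1) * hr z z.
    have := hr_ge0 (sc_real S k *: w - z).
    rewrite !(hrDl, hrDr, hrNl, hrNr, hrZl, hrZr) (hr_sym z w) => h1.
    rewrite -subr_ge0 -(pmulr_rge0 _ kp).
    have -> : k * ((1 + k) * hr w w + (1 + k^-1) * hr z z -
      (hr w w + hr w z + (hr w z + hr z z))) =
      k * (k * hr w w) - k * hr w z - (k * hr w z - hr z z).
      by field; exact: lt0r_neq0.
    by move: h1; congr (0 <= _); ring.
  apply: le_trans hD _.
  have : (1 + k^-1) * hr z z <= (1 + k^-1) * (k * Q).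
    by apply: ler_wpM2l => //; rewrite addr_ge0// invr_ge0 ltW.
  have -> : (1 + k^-1) * (k * Q) = (1 + k) * Q by field; exact: lt0r_neq0.
  by rewrite /w hr_scale; move: (nsq _ * _) => t; lra.
rewrite {1 2}(triv_expand u jx); apply: le_trans (hs _) _.
rewrite /index_enum -enumT size_enum_ord.
apply: (@le_trans _ _ ((rank E)%:R * (C * cnsq (triv j x u)))).
  apply: ler_wpM2l => //; rewrite /cnsq mulr_sumr enumT; apply: ler_sum => a _.
  rewrite mulrC; apply: ler_wpM2r; first exact: nsq_ge0.
  by rewrite /C (bigD1 a)//= lerDl sumr_ge0// => c _; exact: hr_ge0.
by rewrite mulrA; apply: ler_wpM2r; [exact: cnsq_ge0|rewrite lerDl].
Qed.

(* The coordinate functionals are inner products with vectors of the dual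
   frame, given by the inverse of the Gram matrix. *)
Lemma hr_lower (j : triv_index E) x : triv_dom j x -> exists C, 0 < C /\
  forall u : fiber E x, cnsq (triv j x u) <= C * hr u u.
Proof.
move=> jx; pose H := \matrix_(a, c) h x (frame j a x) (frame j c x).
have uH : H \in unitmx.
  rewrite -row_free_unit -kermx_eq0; apply/eqP/row_matrixP => i; rewrite row0.
  have := mulmx_ker H; move/(congr1 (row i)); rewrite row_mul row0.
  move: (row i (kermx H)) => v vH.
  pose w := \sum_a v 0 a *: frame j a x.
  have w0 : w = 0.
    apply: hr_eq0; rewrite /hr {2}/w bm_sumr big1 ?sc_re0// => c _.
    rewrite bmZr /w bm_suml.
    have := congr1 (fun m : 'rV_ _ => m 0 c) vH; rewrite !mxE => vc.
    rewrite (eq_bigr (fun a => v 0 a * H a c)) ?vc ?mulr0// => a _.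
    by rewrite bmZl mxE.
  apply/rowP => a; rewrite mxE.
  have : triv j x w a 0 = 0 by rewrite w0 linear0 mxE.
  rewrite /w linear_sum summxE (bigD1 a)//= linearZ /= (triv_invK jx) !mxE !eqxx mulr1.
  rewrite big1 ?addr0// => c ca.
  by rewrite linearZ /= (triv_invK jx) !mxE eq_sym (negbTE ca) mulr0.
pose K := invmx H.
pose e a := \sum_c sc_conj (K c a) *: frame j c x.
have eE a u : h x u (e a) = triv j x u a 0.
  rewrite {1}(triv_expand u jx) bm_suml.
  have -> : triv j x u a 0 = (triv j x u)^T 0 a by rewrite mxE.
  have -> : (triv j x u)^T = (triv j x u)^T *m H *m K by rewrite mulmxK.
  rewrite -mulmxA mxE; apply: eq_bigr => c _; rewrite bmZl !mxE; congr (_ * _).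
  rewrite /e bm_sumr; apply: eq_bigr => d _.
  by rewrite bmZr sc_conjK !mxE mulrC.
pose C := \sum_a hr (e a) (e a).
have C0 : 0 <= C by apply: sumr_ge0 => a _; exact: hr_ge0.
exists (C + 1); split; first by rewrite ltr_wpDl.
move=> u; apply: (@le_trans _ _ (C * hr u u)); last first.
  by apply: ler_wpM2r; [exact: hr_ge0|rewrite lerDl].
rewrite /cnsq /C mulr_suml; apply: ler_sum => a _.
by rewrite -eE mulrC; exact: bm_cauchy_schwarz.
Qed.

End FiberEstimates.

Lemma fatou_le d (T : measurableType d) (R : realType) (mu : {measure set T -> \bar R})
  (f : nat -> T -> R) (g : T -> R) (c : R) :
  (forall k, measurable_fun setT (f k)) -> (forall k x, 0 <= f k x) ->
  (forall x, f ^~ x @ \oo --> g x) ->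
  (\forall k \near \oo, (\int[mu]_x (f k x)%:E <= c%:E)%E) ->
  (\int[mu]_x (g x)%:E <= c%:E)%E.
Proof.
move=> mf f0 fg fc.
have gE x : (g x)%:E = limn_einf (fun k => (f k x)%:E).
  have h : (fun k => (f k x)%:E) @ \oo --> (g x)%:E by apply: cvg_EFin; [exact: nearW|exact: fg].
  by have [-> _] := cvg_limn_einf_sup h.
rewrite (eq_integral (fun x => limn_einf (fun k => (f k x)%:E))); last by move=> x _; exact: gE.
apply: le_trans (fatou _ _ _ _) _ => //.
- by move=> k; apply/measurable_EFinP; exact: mf.
- by move=> k x _; rewrite lee_fin.
rewrite limn_einf_lim; apply: lime_le; first exact: is_cvg_einfs.
apply: filterS fc => k hk; apply: le_trans hk; apply: ereal_inf_lbound.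
by exists k => //=.
Qed.

Lemma seq_add (R : realType) (f g : nat -> R) (p q : R) :
  f @ \oo --> p -> g @ \oo --> q -> (fun k => f k + g k) @ \oo --> p + q.
Proof. by move=> hf hg; apply: (cvg_add (F := \oo)). Qed.

Lemma seq_scale (R : realType) (f : nat -> R) (c p : R) :
  f @ \oo --> p -> (fun k => c * f k) @ \oo --> c * p.
Proof. by move=> hf; apply: (cvg_scale (F := \oo)). Qed.

Lemma geometric_increments_cvg (R : realType) (a : nat -> R) (K : R) :
  (forall k, `|a k.+1 - a k| <= K * 4^-1 ^+ k) -> exists l : R, a @ \oo --> l.
Proof.
move=> h; pose d k := a k.+1 - a k.
have cd : cvgn (series d).
  apply: normed_cvg; apply: (series_le_cvg (v_ := geometric K 4^-1)).
  - by move=> k /=.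
  - by move=> k /=; apply: le_trans (normr_ge0 _) (h k).
  - by move=> k /=; exact: h.
  - by apply: is_cvg_geometric_series; rewrite ger0_norm ?invr_ge0// invf_lt1// ltr1n.
have aE k : a k = a 0%N + series d k.
  by rewrite /series /= telescope_sumr// addrC subrK.
exists (a 0%N + limn (series d)).
have c0 : (fun=> a 0%N) @ \oo --> a 0%N by exact: cvg_cst.
have := seq_add c0 cd; suff -> : (fun k => a 0%N + series d k) = a by [].
by apply/funext => k; rewrite -aE.
Qed.

Lemma sum_cvg0 (R : realType) (I : Type) (r : seq I) (F : I -> nat -> R) :
  (forall i, F i @ \oo --> (0 : R)) -> (fun k => \sum_(i <- r) F i k) @ \oo --> (0 : R).
Proof.
move=> h; elim: r => [|i r IH].
  by under eq_fun do rewrite big_nil; exact: cvg_cst.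
under eq_fun do rewrite big_cons.
by have := seq_add (h i) IH; rewrite addr0.
Qed.

Section MeasurableScalars.
Context {R : realType} {b : base_field} {M : ptopologicalType}.
Local Notation S := (scalars_of R b).
Implicit Types (D : set (borel M)) (f g : M -> S).

Definition measurableK D f :=
  measurable_fun D (fun x : borel M => sc_re (f x)) /\
  measurable_fun D (fun x : borel M => sc_im (f x)).

Lemma measurableK_eq D f g : (forall x, D x -> f x = g x) -> measurableK D f -> measurableK D g.
Proof.
by move=> fg [h1 h2]; split; [apply: eq_measurable_fun h1|apply: eq_measurable_fun h2] => x /set_mem Dx;
  rewrite fg.
Qed.

Lemma measurableK_cst D (c : S) : measurableK D (fun=> c).
Proof. by split; exact: measurable_cst. Qed.

Lemma measurableK_add D f g : measurableK D f -> measurableK D g ->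
  measurableK D (fun x => f x + g x).
Proof.
move=> [f1 f2] [g1 g2]; split.
  by apply: eq_measurable_fun (measurable_funD f1 g1) => x _; rewrite sc_reD.
by apply: eq_measurable_fun (measurable_funD f2 g2) => x _; rewrite sc_imD.
Qed.

Lemma measurableK_mul D f g : measurableK D f -> measurableK D g ->
  measurableK D (fun x => f x * g x).
Proof.
move=> [f1 f2] [g1 g2]; split.
  apply: eq_measurable_fun (measurable_funB (measurable_funM f1 g1) (measurable_funM f2 g2)).
  by move=> x _; rewrite sc_reM.
apply: eq_measurable_fun (measurable_funD (measurable_funM f1 g2) (measurable_funM f2 g1)).
by move=> x _; rewrite sc_imM.
Qed.

Lemma measurableK_conj D f : measurableK D f -> measurableK D (fun x => sc_conj (f x)).
Proof.
move=> [f1 f2]; split.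
  by apply: eq_measurable_fun f1 => x _; rewrite sc_re_conj.
apply: (eq_measurable_fun (fun x : borel M => -1 * sc_im (f x))) => [x _|].
  by rewrite sc_im_conj mulN1r.
by apply: measurable_funM => //; exact: measurable_cst.
Qed.

Lemma measurableK_sum D (I : Type) (r : seq I) (F : I -> M -> S) :
  (forall i, measurableK D (F i)) -> measurableK D (fun x => \sum_(i <- r) F i x).
Proof.
move=> h; elim: r => [|i r IH].
  by apply: measurableK_eq (measurableK_cst D 0) => x _; rewrite big_nil.
by apply: measurableK_eq (measurableK_add (h i) IH) => x _; rewrite big_cons.
Qed.

Lemma sc_cvg (z : nat -> S) (p q : R) :
  (fun k => sc_re (z k)) @ \oo --> p -> (fun k => sc_im (z k)) @ \oo --> q ->
  exists l : S, sc_re l = p /\ sc_im l = q.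
Proof.
move: z; case: b => z h1 h2; last by exists (Complex p q).
exists p; split => //=.
have h3 : (fun=> 0 : R) @ \oo --> (0 : R) by exact: cvg_cst.
by apply: (@cvg_unique _ (@norm_hausdorff _ _) _ _ _ _ h3 h2).
Qed.

End MeasurableScalars.

(** * Square-integrable sections as a real Hilbert space *)

Section L2Space.
Context {R : realType} {b : base_field} {n : nat} {M : ptopologicalType}.
Local Notation S := (scalars_of R b).
Context {X : manifold R n M} (mu : {measure set (borel M) -> \bar R}).
Context {E : vbundle S X} (h : bundle_metric E).
Implicit Types (u v w : section E).

(** Measurability of a section is tested in one trivialization at a time; a countable cover makes it
    global. Each basic open set contained in some trivialization domain selects one such
    trivialization, through a code in the natural numbers. *)
Lemma countable_triv : exists J : nat -> triv_index E, forall x, exists k, triv_dom (J k) x.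
Proof.
have [B cB [oB bB]] := man_countable X.
have [f fI] : exists f : set M -> nat, {in B &, injective f} by exact/countable_injP.
have [j0 _] := triv_cover E point.
have /choice [J HJ] : forall k : nat, exists j : triv_index E, forall U, B U -> f U = k ->
    (exists j', U `<=` triv_dom (v0 := E) j') -> U `<=` triv_dom j.
  move=> k; case: (pselect (exists U, [/\ B U, f U = k & exists j', U `<=` triv_dom (v0 := E) j'])).
    move=> [U [BU fU [j' Uj]]]; exists j' => U' BU' fU' _.
    by have -> : U' = U by apply: fI; rewrite ?inE ?fU ?fU'.
  by move=> nex; exists j0 => U BU fU ex; exfalso; apply: nex; exists U.
exists J => x; have [j jx] := triv_cover E x.
have [U [BU Ux] Uj] := bB x _ (open_nbhs_nbhs (conj (triv_open j) jx)).
by exists (f U); apply: (HJ _ U BU erefl _ x Ux); exists j.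
Qed.

Definition measurable_section u := forall (j : triv_index E) a,
  measurableK (triv_dom j) (fun x => triv j x (u x) a 0).

Lemma L2_measurable u : L2 mu h setT u -> measurable_section u.
Proof. by move=> [hu _] j a; have := hu j a; rewrite setTI. Qed.

Lemma gram_measurable (j : triv_index E) a c :
  measurableK (triv_dom j) (fun x => h x (frame j a x) (frame j c x)).
Proof.
have [h1 h2] := bm_smooth h j a c.
by split; apply: continuous_on_measurable; try exact: triv_open;
  move=> x jx; apply: (smooth_on_continuous (X := X)) jx => //; exact: triv_open.
Qed.

Lemma hr_measurable u v : measurable_section u -> measurable_section v ->
  measurable_fun setT (fun x : borel M => hr h (u x) (v x)).
Proof.
move=> mu_ mv; have [J JP] := countable_triv.
have -> : [set: borel M] = \bigcup_k (triv_dom (J k) : set (borel M)).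
  by apply/seteqP; split => // x _; have [k] := JP x; exists k.
apply/measurable_fun_bigcup => [k|k]; first by apply: borel_open; exact: triv_open.
suff [] : measurableK (triv_dom (J k)) (fun x => h x (u x) (v x)) by [].
apply: (measurableK_eq (f := fun x => \sum_a \sum_c triv (J k) x (u x) a 0 *
    sc_conj (triv (J k) x (v x) c 0) * h x (frame (J k) a x) (frame (J k) c x))).
  by move=> x jx; rewrite -bm_expand.
apply: measurableK_sum => a; apply: measurableK_sum => c; apply: measurableK_mul; last first.
  exact: gram_measurable.
by apply: measurableK_mul => //; exact: measurableK_conj.
Qed.

Lemma integrable_add (f g : borel M -> R) : mu.-integrable setT (EFin \o f) ->
  mu.-integrable setT (EFin \o g) -> mu.-integrable setT (EFin \o (fun x => f x + g x)).
Proof. by move=> hf hg; apply: eq_integrable (integrableD measurableT hf hg). Qed.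

Lemma integrable_scale c (f : borel M -> R) : mu.-integrable setT (EFin \o f) ->
  mu.-integrable setT (EFin \o (fun x => c * f x)).
Proof. by move=> hf; apply: eq_integrable (integrableZl measurableT c hf). Qed.

Lemma integrable_le (f g : borel M -> R) : measurable_fun setT f ->
  (forall x, `|f x| <= g x) -> mu.-integrable setT (EFin \o g) ->
  mu.-integrable setT (EFin \o f).
Proof.
move=> mf fg ig; apply: (le_integrable _ _ _ ig) => //; first exact/measurable_EFinP.
move=> x _ /=; rewrite lee_fin [leRHS]ger0_norm//.
exact: le_trans (normr_ge0 _) (fg x).
Qed.

Lemma L2E u : L2 mu h setT u <-> measurable_section u /\
  mu.-integrable setT (EFin \o (fun x : borel M => hr h (u x) (u x))).
Proof.
split => [Lu|[mu_ iu]].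
  have mu_ := L2_measurable Lu; split => //; apply/integrableP; split.
    by apply/measurable_EFinP; exact: hr_measurable.
  have [_] := Lu; congr (_ < _)%E; apply: eq_integral => x _ /=.
  by rewrite ger0_norm// hr_ge0.
split; first by move=> j a; rewrite setTI; exact: mu_.
move/integrableP : iu => [_]; congr (_ < _)%E; apply: eq_integral => x _ /=.
by rewrite ger0_norm// hr_ge0.
Qed.

Lemma L2_integrable u v : L2 mu h setT u -> L2 mu h setT v ->
  mu.-integrable setT (EFin \o (fun x : borel M => hr h (u x) (v x))).
Proof.
move=> /L2E[mu_ iu] /L2E[mv iv]; apply: integrable_le (integrable_add iu iv).
  exact: hr_measurable.
by move=> x; exact: hr_norm_le.
Qed.

Lemma measurable_section_lin (c : M -> S) u v : (forall j, measurableK (triv_dom (v0 := E) j) c) ->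
  measurable_section u -> measurable_section v ->
  measurable_section (fun x => c x *: u x + v x).
Proof.
move=> mc mu_ mv j a.
apply: measurableK_eq (measurableK_add (measurableK_mul (mc j) (mu_ j a)) (mv j a)) => x jx.
by rewrite linearP !mxE.
Qed.

Lemma L2_lin (c : S) u v : L2 mu h setT u -> L2 mu h setT v ->
  L2 mu h setT (fun x => c *: u x + v x).
Proof.
move=> /L2E[mu_ iu] /L2E[mv iv].
have mcu : measurable_section (fun x => c *: u x + v x).
  by apply: measurable_section_lin => // j; exact: measurableK_cst.
apply/L2E; split => //.
apply: integrable_le (integrable_add (integrable_scale (2 * nsq c) iu) (integrable_scale 2 iv)).
  exact: hr_measurable.
move=> x; rewrite ger0_norm ?hr_ge0//; apply: le_trans (hr_le_sum _ _ _) _.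
by rewrite hr_scale mulrA.
Qed.

Lemma L2_zero : L2 mu h setT (fun=> 0).
Proof.
apply/L2E; split.
  by move=> j a; apply: measurableK_eq (measurableK_cst _ 0) => x _; rewrite linear0 mxE.
apply: (eq_integrable _ (fun=> 0%E)) => //; last exact: integrable0.
by move=> x _ /=; rewrite hr0.
Qed.

(** Genuine sections instead of classes modulo null sets, so that cutoffs and extension by zero act
    pointwise. Scalars are restricted to the reals. *)
Record l2sec := L2Sec { l2val : section E; l2P : L2 mu h setT l2val }.

Lemma l2sec_ext (u v : l2sec) : (forall x, l2val u x = l2val v x) -> u = v.
Proof.
case: u v => u up [v vp] /= uv; have e : u = v by apply: functional_extensionality_dep.
by subst v; congr L2Sec; exact: Prop_irrelevance.
Qed.

Definition l2lin (c : S) (u v : l2sec) := L2Sec (L2_lin c (l2P u) (l2P v)).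
Definition l2zero := L2Sec L2_zero.
Definition l2add (u v : l2sec) := l2lin 1 u v.
Definition l2scale (r : R) (u : l2sec) := l2lin (sc_real S r) u l2zero.
Definition l2opp (u : l2sec) := l2lin (-1) u l2zero.

HB.instance Definition _ := gen_eqMixin l2sec.
HB.instance Definition _ := gen_choiceMixin l2sec.

Fact l2addA : associative l2add.
Proof. by move=> u v w; apply: l2sec_ext => x /=; rewrite !scale1r addrA. Qed.
Fact l2addC : commutative l2add.
Proof. by move=> u v; apply: l2sec_ext => x /=; rewrite !scale1r addrC. Qed.
Fact l2add0 : left_id l2zero l2add.
Proof. by move=> u; apply: l2sec_ext => x /=; rewrite scale1r add0r. Qed.
Fact l2addN : left_inverse l2zero l2opp l2add.
Proof.
by move=> u; apply: l2sec_ext => x /=; rewrite scale1r scaleN1r addr0 addNr.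
Qed.
HB.instance Definition _ := GRing.isZmodule.Build l2sec l2addA l2addC l2add0 l2addN.

Fact l2scaleA (a c : R) (u : l2sec) : l2scale a (l2scale c u) = l2scale (a * c) u.
Proof. by apply: l2sec_ext => x /=; rewrite !addr0 scalerA sc_realM. Qed.
Fact l2scale1 : left_id 1 l2scale.
Proof. by move=> u; apply: l2sec_ext => x /=; rewrite sc_real1 scale1r addr0. Qed.
Fact l2scaleDr : right_distributive l2scale +%R.
Proof. by move=> a u v; apply: l2sec_ext => x /=; rewrite !scale1r !addr0 scalerDr. Qed.
Fact l2scaleDl (u : l2sec) : {morph l2scale^~ u : a c / a + c}.
Proof. by move=> a c; apply: l2sec_ext => x /=; rewrite !scale1r !addr0 sc_realD scalerDl. Qed.
HB.instance Definition _ := GRing.Zmodule_isLmodule.Build R l2sec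
  l2scaleA l2scale1 l2scaleDr l2scaleDl.

Lemma l2valD (u v : l2sec) x : l2val (u + v) x = l2val u x + l2val v x.
Proof. by rewrite /= scale1r. Qed.
Lemma l2valZ r (u : l2sec) x : l2val (r *: u) x = sc_real S r *: l2val u x.
Proof. by rewrite /= addr0. Qed.
Lemma l2valN (u : l2sec) x : l2val (- u) x = - l2val u x.
Proof. by rewrite /= scaleN1r addr0. Qed.
Lemma l2valB (u v : l2sec) x : l2val (u - v) x = l2val u x - l2val v x.
Proof. by rewrite l2valD l2valN. Qed.

Definition l2ip (u v : l2sec) : R :=
  Rintegral mu setT (fun x : borel M => hr h (l2val u x) (l2val v x)).

Lemma l2ip_integral (u : l2sec) :
  (\int[mu]_x (hr h (l2val u x) (l2val u x))%:E = (l2ip u u)%:E)%E.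
Proof.
rewrite /l2ip /Rintegral fineK//; apply: integrable_fin_num => //.
exact: L2_integrable (l2P u) (l2P u).
Qed.

Lemma l2_ipP : inner_product_on setT l2ip.
Proof.
split.
- move=> a u v w _ _ _; rewrite /l2ip.
  rewrite (@eq_Rintegral _ _ _ mu setT (fun x : borel M => a * hr h (l2val u x) (l2val w x) + hr h (l2val v x) (l2val w x))).
    rewrite RintegralD ?RintegralZl//; try exact: L2_integrable (l2P _) (l2P _).
    by apply: integrable_scale; exact: L2_integrable (l2P _) (l2P _).
  by move=> x _; rewrite l2valD l2valZ hrDl hrZl.
- by move=> u v _ _; apply: eq_Rintegral => x _; rewrite hr_sym.
- by move=> u _; apply: Rintegral_ge0 => x _; exact: hr_ge0.
Qed.

(** A fiber carries no topology, so convergence is obtained in the coordinates of a trivialization.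
    The weight [16 ^+ k] on squares makes the increments there of order [4 ^- k], hence summable. *)
Lemma fiber_complete x (t : nat -> fiber E x) (B : R) :
  (forall k, 16 ^+ k * hr h (t k.+1 - t k) (t k.+1 - t k) <= B) ->
  exists y, (fun k => hr h (t k - y) (t k - y)) @ \oo --> (0 : R).
Proof.
move=> hB; have [j jx] := triv_cover E x.
have [C [C0 HC]] := hr_lower h jx; have [C' [C'0 HC']] := hr_upper h jx.
have B0 : 0 <= B by apply: le_trans (hB 0%N); rewrite expr0 mul1r hr_ge0.
pose z a k := triv j x (t k) a 0.
have dz a k : nsq (z a k.+1 - z a k) <= C * B * 16^-1 ^+ k.
  apply: (@le_trans _ _ (cnsq (triv j x (t k.+1 - t k)))).
    rewrite /cnsq (bigD1 a)//= linearB !mxE lerDl sumr_ge0// => i _; exact: nsq_ge0.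
  apply: le_trans (HC _) _; rewrite -mulrA; apply: ler_wpM2l; first exact: ltW.
  by rewrite exprVn ler_pdivlMr ?exprn_gt0// mulrC.
have h16 k : C * B * 16^-1 ^+ k <= ((C * B + 1) * 4^-1 ^+ k) ^+ 2.
  rewrite exprMn -exprM mulnC exprM.
  have -> : (4^-1) ^+ 2 = 16^-1 :> R by field.
  apply: ler_wpM2r; first by rewrite exprn_ge0// invr_ge0.
  have : 0 <= C * B by rewrite mulr_ge0// ltW.
  by move: (C * B) => y y0; rewrite expr2; nra.
have cb k : 0 <= (C * B + 1) * 4^-1 ^+ k.
  by rewrite mulr_ge0 ?exprn_ge0 ?invr_ge0// addr_ge0// mulr_ge0// ltW.
have /choice [l Hl] : forall a, exists l : S, (fun k => nsq (z a k - l)) @ \oo --> (0 : R).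
  move=> a.
  have [p Hp] : exists p : R, (fun k => sc_re (z a k)) @ \oo --> p.
    apply: (geometric_increments_cvg (K := C * B + 1)) => k; apply: norm_le_sqr => //.
    apply: le_trans (h16 k); apply: le_trans (dz a k).
    by rewrite /nsq !sc_reD sc_reN lerDl sqr_ge0.
  have [q Hq] : exists q : R, (fun k => sc_im (z a k)) @ \oo --> q.
    apply: (geometric_increments_cvg (K := C * B + 1)) => k; apply: norm_le_sqr => //.
    apply: le_trans (h16 k); apply: le_trans (dz a k).
    by rewrite /nsq !sc_imD sc_imN lerDr sqr_ge0.
  have [l [lp lq]] := sc_cvg Hp Hq; exists l.
  have e1 : (fun k => (sc_re (z a k) + - p) ^+ 2) @ \oo --> ((p + - p) ^+ 2 : R).
    by apply: (cvg_sqr (F := \oo)); apply: (cvg_add (F := \oo)) => //; exact: cvg_cst.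
  have e2 : (fun k => (sc_im (z a k) + - q) ^+ 2) @ \oo --> ((q + - q) ^+ 2 : R).
    by apply: (cvg_sqr (F := \oo)); apply: (cvg_add (F := \oo)) => //; exact: cvg_cst.
  have := seq_add e1 e2; rewrite !subrr expr0n /= addr0.
  have -> // : (fun k => (sc_re (z a k) + - p) ^+ 2 + (sc_im (z a k) + - q) ^+ 2) =
    (fun k => nsq (z a k - l)).
  by apply/funext => k; rewrite -lp -lq /nsq sc_reD sc_imD sc_reN sc_imN.
pose y := triv_inv j x (\col_a l a); exists y.
apply: (squeeze_cvgr (f := fun=> 0) (h := fun k => C' * \sum_a nsq (z a k - l a))).
- near=> k; rewrite hr_ge0 /=; apply: le_trans (HC' _) _; apply: ler_wpM2l; first exact: ltW.
  rewrite /cnsq le_eqVlt; apply/orP; left; apply/eqP; apply: eq_bigr => a _.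
  by rewrite linearB /= /y triv_invK// !mxE.
- exact: cvg_cst.
- have := seq_scale (c := C') (@sum_cvg0 R _ (index_enum _) _ Hl).
  by rewrite mulr0.
Unshelve. all: by end_near. Qed.

Lemma l2_complete : ip_complete l2ip.
Proof.
move=> s cs.
have ipT := subspaceT (V := l2sec).
have cB (u v : l2sec) : l2ip (u - v) (u - v) = l2ip (v - u) (v - u) by exact: (ip_subC ipT l2_ipP).
(* The factor 16 feeds [fiber_complete]; the powers of 2 make the sum [G] of the weighted increments
   integrable. *)
pose eps k : R := (16 ^+ k * (2 ^ k.+1)%:R)^-1.
have e0 k : 0 < eps k by rewrite invr_gt0 mulr_gt0 ?exprn_gt0// ltr0n expn_gt0.
have /choice [N HN] := fun k => cs (eps k) (e0 k).
(* A bound for all thresholds up to [k] that also tends to infinity, for the comparison with the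
   whole sequence. *)
pose m k := (\sum_(i < k.+1) N i + k)%N.
have mN k l : (k <= l)%N -> (N k <= m l)%N.
  move=> kl; rewrite /m (bigD1 (inord k))//= inordK ?ltnS// -addnA; exact: leq_addr.
pose t k := s (m k).
have dt k : l2ip (t k.+1 - t k) (t k.+1 - t k) < eps k.
  by apply: HN; apply: mN.
pose g k (x : borel M) : R := 16 ^+ k * hr h (l2val (t k.+1 - t k) x) (l2val (t k.+1 - t k) x).
have g0 k x : 0 <= g k x by rewrite mulr_ge0 ?exprn_ge0 ?hr_ge0.
have msec (u : l2sec) : measurable_section (l2val u) := L2_measurable (l2P u).
have mg k : measurable_fun setT (g k).
  by apply: measurable_funM; [exact: measurable_cst|exact: hr_measurable].
have ig k : (\int[mu]_x (g k x)%:E <= (1 / (2 ^ k.+1)%:R)%:E)%E.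
  under eq_integral do rewrite EFinM.
  rewrite ge0_integralZl//; last 2 first.
  - by apply/measurable_EFinP; exact: hr_measurable.
  - by move=> *; rewrite lee_fin ?hr_ge0 ?exprn_ge0.
  rewrite l2ip_integral -EFinM lee_fin; apply: le_trans (ler_wpM2l _ (ltW (dt k))) _.
    by rewrite exprn_ge0.
  rewrite /eps invfM mulrA divff ?mul1r ?div1r//.
pose G (x : borel M) : \bar R := (\sum_(k <oo) (g k x)%:E)%E.
have mG : measurable_fun setT G.
  by apply: ge0_emeasurable_sum => [k x _ _|k _]; [rewrite lee_fin|apply/measurable_EFinP].
have G0 x : (0 <= G x)%E by apply: nneseries_ge0 => k _ _; rewrite lee_fin.
have iG : mu.-integrable setT G.
  apply/integrableP; split => //.
  rewrite (eq_integral G); last by move=> x _; rewrite gee0_abs.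
  rewrite integral_nneseries//; last 2 first.
  - by move=> k; apply/measurable_EFinP.
  - by move=> k x _; rewrite lee_fin.
  apply: (@le_lt_trans _ _ (\sum_(k <oo) (1 / (2 ^ k.+1)%:R)%:E)%E).
    by apply: lee_nneseries => k _ *; [apply: integral_ge0 => x _; rewrite lee_fin|exact: ig].
  apply: le_lt_trans (epsilon_trick0 _ _) _ => //; exact: ltry.
pose A : set (borel M) := [set x | (G x < +oo)%E].
have mA : measurable A.
  have := emeasurable_fun_infty_o measurableT mG +oo%E; by rewrite setTI.
(* Outside [A], a null set's complement, the subsequence is set to 0, so that a limit exists at
   every point and is measurable. *)
pose t' k : section E := fun x => sc_real S (\1_A (x : borel M)) *: l2val (t k) x.
have mt' k : measurable_section (t' k).
  have -> : t' k = (fun x => sc_real S (\1_A (x : borel M)) *: l2val (t k) x + 0).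
    by apply: functional_extensionality_dep => x; rewrite addr0.
  apply: measurable_section_lin => [j||]; last 2 first.
  - exact: msec.
  - exact: (L2_measurable L2_zero).
  split.
    apply: (eq_measurable_fun (\1_A : borel M -> R)) => [x _|]; first by rewrite sc_re_real.
    by apply: measurable_funTS; exact: measurable_indic.
  apply: (eq_measurable_fun (fun=> 0 : R)) => [x _|]; first by rewrite sc_im_real.
  exact: measurable_cst.
have gG k x : A x -> g k x <= fine (G x).
  move=> Ax; rewrite -lee_fin fineK ?ge0_fin_numE//.
  apply: le_trans (nneseries_lim_ge k.+1 _); last by move=> i _ _; rewrite lee_fin.
  rewrite big_nat_recr//= leeDr// sume_ge0// => i _; by rewrite lee_fin.
have exu : forall x, exists y : fiber E x,
    (fun k => hr h (t' k x - y) (t' k x - y)) @ \oo --> (0 : R).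
  move=> x; apply: (fiber_complete (B := if `[< A x >] then fine (G x) else 0)) => k.
  rewrite /t' -scalerBr hr_scale nsq_real; case: asboolP => Ax.
    rewrite indicE mem_set// expr1n mul1r -l2valB; exact: gG.
  by rewrite indicE memNset// expr0n /= mul0r mulr0.
pose u : section E := fun x => projT1 (cid (exu x)).
have Hu x : (fun k => hr h (t' k x - u x) (t' k x - u x)) @ \oo --> (0 : R).
  exact: projT2 (cid (exu x)).
have mu_ : measurable_section u.
  move=> j a; have nsq0_cvg x : triv_dom j x ->
      (fun k => nsq (triv j x (t' k x) a 0 - triv j x (u x) a 0)) @ \oo --> (0 : R).
    move=> jx; have [C [C0 HC]] := hr_lower h jx.
    apply: (squeeze_cvgr (f := fun=> 0) (h := fun k => C * hr h (t' k x - u x) (t' k x - u x))).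
    - near=> k; rewrite nsq_ge0 /=; apply: le_trans (HC _).
      by rewrite /cnsq (bigD1 a)//= linearB !mxE lerDl sumr_ge0// => i _; exact: nsq_ge0.
    - exact: cvg_cst.
    - by have := seq_scale (c := C) (Hu x); rewrite mulr0.
  have sq_cvg (y : nat -> R) (l : R) (z : nat -> R) : (forall k, (y k - l) ^+ 2 <= z k) ->
      z @ \oo --> (0 : R) -> y @ \oo --> l.
    move=> hz z0; apply/cvgrPdist_le => e ep.
    have e2 : 0 < e ^+ 2 by rewrite exprn_gt0.
    move/cvgrPdist_le : z0 => /(_ _ e2); apply: filterS => k; rewrite sub0r normrN => hk.
    apply: norm_le_sqr; first exact: ltW.
    by rewrite -sqrrN opprB; apply: le_trans (hz k) _; apply: le_trans (ler_norm _) hk.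
  split.
    apply: (measurable_fun_cvg (h := fun k (x : borel M) => sc_re (triv j x (t' k x) a 0))).
      by move=> k; have [] := mt' k j a.
    move=> x jx; apply: sq_cvg (nsq0_cvg x jx) => k.
    by rewrite /nsq sc_reD sc_reN lerDl sqr_ge0.
  apply: (measurable_fun_cvg (h := fun k (x : borel M) => sc_im (triv j x (t' k x) a 0))).
    by move=> k; have [] := mt' k j a.
  move=> x jx; apply: sq_cvg (nsq0_cvg x jx) => k.
  by rewrite /nsq sc_imD sc_imN lerDr sqr_ge0.
have hsub (p q r : section E) x : hr h (p x - q x) (p x - q x) = hr h (q x - p x) (q x - p x).
  by rewrite -opprB hrNl hrNr opprK.
have msub (p q : section E) : measurable_section p -> measurable_section q ->
    measurable_section (fun x => p x - q x).
  move=> mp mq.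
  have -> : (fun x => p x - q x) = (fun x => (-1 : S) *: q x + p x).
    by apply: functional_extensionality_dep => x; rewrite scaleN1r addrC.
  by apply: measurable_section_lin => // j; exact: measurableK_cst.
(* Fatou's lemma along the subsequence bounds the distance of each late [s i] to the pointwise
   limit. *)
have key (e : R) : 0 < e -> exists K, forall i, (K <= i)%N ->
    (\int[mu]_x (hr h (l2val (s i) x - u x) (l2val (s i) x - u x))%:E <= e%:E)%E.
  move=> ep; have [K HK] := cs e ep; exists K => i Ki.
  apply: (fatou_le (f := fun k (x : borel M) =>
     hr h (l2val (s i) x - t' k x) (l2val (s i) x - t' k x))).
  - by move=> k; apply: hr_measurable; apply: msub => //; exact: msec.
  - by move=> k x; exact: hr_ge0.
  - move=> x; set p := l2val (s i) x.
    have h1 k : hr h (p - t' k x) (p - t' k x) = hr h (p - u x) (p - u x)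
       + (- 2 * hr h (p - u x) (t' k x - u x) + hr h (t' k x - u x) (t' k x - u x)).
      have -> : p - t' k x = (p - u x) + - (t' k x - u x) by rewrite opprB addrA subrK.
      move: (p - u x) (t' k x - u x) => y z.
      by rewrite !(hrDl, hrDr, hrNl, hrNr) (hr_sym h z y); lra.
    under eq_fun do rewrite h1.
    have h2 : (fun k => hr h (p - u x) (t' k x - u x)) @ \oo --> (0 : R).
      apply/cvgrPdist_le => e' ep'; pose B := hr h (p - u x) (p - u x) + 1.
      have B0 : 0 < B by rewrite ltr_wpDl// hr_ge0.
      have e2 : 0 < e' ^+ 2 / B by rewrite divr_gt0// exprn_gt0.
      have := Hu x; move/cvgrPdist_le => /(_ _ e2); apply: filterS => k.
      rewrite !sub0r !normrN ger0_norm ?hr_ge0// => hk.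
      apply: norm_le_sqr; first exact: ltW.
      apply: le_trans (hr_cauchy_schwarz _ _ _) _.
      apply: (@le_trans _ _ (B * hr h (t' k x - u x) (t' k x - u x))).
        by apply: ler_wpM2r; [exact: hr_ge0|rewrite lerDl].
      by rewrite mulrC -ler_pdivlMr.
    have := seq_add (seq_scale (c := -2) h2) (Hu x); rewrite mulr0 addr0 => h3.
    have h4 : (fun=> hr h (p - u x) (p - u x)) @ \oo --> (hr h (p - u x) (p - u x)) by exact: cvg_cst.
    by have := seq_add h4 h3; rewrite addr0.
  - exists K => // k /= Kk.
    have -> : (\int[mu]_x (hr h (l2val (s i) x - t' k x) (l2val (s i) x - t' k x))%:E)%E =
       (l2ip (s i - t k) (s i - t k))%:E.
      rewrite -l2ip_integral; apply: ge0_ae_eq_integral => //.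
      + apply/measurable_EFinP; apply: hr_measurable; apply: msub => //; exact: msec.
      + by apply/measurable_EFinP; exact: hr_measurable.
      + by move=> x _; rewrite lee_fin hr_ge0.
      + by move=> x _; rewrite lee_fin hr_ge0.
      have := integrable_ae measurableT iG; apply: filterS => x /(_ I) Gx _.
      have Ax : A x by rewrite /A /= ltey_eq Gx.
      by rewrite l2valB /t' indicE mem_set// sc_real1 scale1r.
    rewrite lee_fin; apply: ltW; apply: HK => //; apply: leq_trans Kk _.
    exact: leq_addl.
have Lu : L2 mu h setT u.
  have [K /(_ K (leqnn K)) hK] := key 1 ltr01.
  have Ld : L2 mu h setT (fun x => l2val (s K) x - u x).
    split.
      by move=> j a; rewrite setTI; apply: msub => //; exact: msec.
    by apply: le_lt_trans hK _; exact: ltry.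
  have -> : u = (fun x => (-1 : S) *: (l2val (s K) x - u x) + l2val (s K) x).
    by apply: functional_extensionality_dep => x; rewrite scaleN1r opprB subrK.
  exact: (L2_lin (-1) Ld (l2P (s K))).
exists (L2Sec Lu); apply/cvgrPdist_le => e ep.
have [K HK] := key e ep; exists K => // i /= Ki.
rewrite sub0r normrN ger0_norm; last exact: (ip_ge0 l2_ipP).
rewrite -lee_fin -l2ip_integral.
by under eq_integral do rewrite l2valB; exact: HK.
Unshelve. all: by end_near. Qed.

End L2Space.

(** * Calculus of differential operators *)

Section ChartCalculus.
Context {R : realType} {b : base_field} {n : nat} {M : ptopologicalType}.
Local Notation S := (scalars_of R b).
Context {X : manifold R n M} (i : atlas X).
Implicit Types (W : set M) (f g : M -> R) (a : 'I_n).

(** Smoothness read in the single chart [i]. It is preserved by the partial derivatives of that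
    chart, without a chain rule for changes of charts. *)
Definition smooth_in W f := smooth (chart i @` (W `&` dom i)) (f \o param i).

Lemma smooth_in_local W f :
  (forall x, W x -> dom i x -> exists V, V x /\ smooth_in V f) -> smooth_in W f.
Proof.
move=> h k; apply: class_C_local => _ [x [Wx dx] <-].
by have [V [Vx sV]] := h x Wx dx; exists (chart i @` (V `&` dom i)); split; [exists x|exact: sV].
Qed.

Lemma smooth_in_eq W f g : open W -> (forall x, W x -> f x = g x) ->
  smooth_in W f -> smooth_in W g.
Proof.
move=> oW fg sf k; apply: class_C_eq (sf k); first exact: chart_image_open.
by move=> _ [x [Wx dx] <-]; rewrite /= chartK// fg.
Qed.

Lemma smooth_in_cst W (c : R) : smooth_in W (fun=> c).
Proof. by move=> k; exact: class_C_cst. Qed.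

Lemma smooth_in_add W f g : open W -> smooth_in W f -> smooth_in W g ->
  smooth_in W (fun x => f x + g x).
Proof. by move=> oW sf sg k; apply: class_C_add (sf k) (sg k); exact: chart_image_open. Qed.

Lemma smooth_in_mul W f g : open W -> smooth_in W f -> smooth_in W g ->
  smooth_in W (fun x => f x * g x).
Proof. by move=> oW sf sg k; apply: class_C_mul (sf k) (sg k); exact: chart_image_open. Qed.

Lemma smooth_in_pderiv W f a : open W -> smooth_in W f -> smooth_in W (pderiv i a f).
Proof.
move=> oW sf k; apply: class_C_eq (class_C_derive a (sf k.+1)).
  exact: chart_image_open.
by move=> _ [x [Wx dx] <-]; rewrite /pderiv /= chartK.
Qed.

Lemma smooth_in_derivable W f a x : smooth_in W f -> W x -> dom i x ->
  derivable (f \o param i) (chart i x) (delta_mx 0 a).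
Proof. by move=> sf Wx dx; apply: class_C_derivable (sf 1%N) _; exists x. Qed.

Lemma pderiv_eq W f g a x : open W -> W x -> dom i x -> (forall y, W y -> f y = g y) ->
  pderiv i a f x = pderiv i a g x.
Proof.
move=> oW Wx dx fg; apply: near_eq_derive.
apply: (@open_near_eq _ _ (chart i @` (W `&` dom i))); first exact: chart_image_open.
  by move=> _ [y [Wy dy] <-]; rewrite /= chartK// fg.
by exists x.
Qed.

Lemma pderiv_cst a (c : R) x : pderiv i a (fun=> c) x = 0.
Proof. exact: derive_cst. Qed.

Lemma pderiv_add W f g a x : smooth_in W f -> smooth_in W g -> W x -> dom i x ->
  pderiv i a (fun y => f y + g y) x = pderiv i a f x + pderiv i a g x.
Proof.
move=> sf sg Wx dx.
exact: (deriveD (smooth_in_derivable (a := a) sf Wx dx) (smooth_in_derivable (a := a) sg Wx dx)).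
Qed.

Lemma pderiv_mul W f g a x : smooth_in W f -> smooth_in W g -> W x -> dom i x ->
  pderiv i a (fun y => f y * g y) x = pderiv i a f x * g x + f x * pderiv i a g x.
Proof.
move=> sf sg Wx dx.
have := deriveM (smooth_in_derivable (a := a) sf Wx dx) (smooth_in_derivable (a := a) sg Wx dx).
by rewrite /pderiv /= chartK// => ->; rewrite addrC mulrC; congr (_ + _); rewrite mulrC.
Qed.

Definition smooth_inK W (f : M -> S) :=
  smooth_in W (fun x => sc_re (f x)) /\ smooth_in W (fun x => sc_im (f x)).

Lemma smooth_inK_eq W (f g : M -> S) : open W -> (forall x, W x -> f x = g x) ->
  smooth_inK W f -> smooth_inK W g.
Proof.
by move=> oW fg [h1 h2]; split; [apply: smooth_in_eq h1|apply: smooth_in_eq h2] => // x Wx; rewrite fg.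
Qed.

Lemma smooth_inK_local W (f : M -> S) :
  (forall x, W x -> dom i x -> exists V, V x /\ smooth_inK V f) -> smooth_inK W f.
Proof.
move=> h; split; apply: smooth_in_local => x Wx dx; have [V [Vx [h1 h2]]] := h x Wx dx;
  by exists V.
Qed.

Lemma smooth_inK_cst W (c : S) : smooth_inK W (fun=> c).
Proof. by split; exact: smooth_in_cst. Qed.

Lemma smooth_inK_real W f : open W -> smooth_in W f -> smooth_inK W (fun x => sc_real S (f x)).
Proof.
move=> oW sf; split; first by apply: smooth_in_eq sf => // x _; rewrite sc_re_real.
by apply: smooth_in_eq (smooth_in_cst W 0) => // x _; rewrite sc_im_real.
Qed.

Lemma smooth_inK_add W (f g : M -> S) : open W -> smooth_inK W f -> smooth_inK W g ->
  smooth_inK W (fun x => f x + g x).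
Proof.
move=> oW [f1 f2] [g1 g2]; split.
  by apply: smooth_in_eq (smooth_in_add oW f1 g1) => // x _; rewrite sc_reD.
by apply: smooth_in_eq (smooth_in_add oW f2 g2) => // x _; rewrite sc_imD.
Qed.

Lemma smooth_inK_mul W (f g : M -> S) : open W -> smooth_inK W f -> smooth_inK W g ->
  smooth_inK W (fun x => f x * g x).
Proof.
move=> oW [f1 f2] [g1 g2]; split.
  apply: smooth_in_eq (smooth_in_add oW (smooth_in_mul oW f1 g1)
    (smooth_in_mul oW (smooth_in_cst W (-1)) (smooth_in_mul oW f2 g2))) => // x _.
  by rewrite sc_reM mulN1r.
apply: smooth_in_eq (smooth_in_add oW (smooth_in_mul oW f1 g2) (smooth_in_mul oW f2 g1)) => // x _.
by rewrite sc_imM.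
Qed.

Lemma smooth_inK_sum (I : Type) (r : seq I) W (F : I -> M -> S) : open W ->
  (forall k, smooth_inK W (F k)) -> smooth_inK W (fun x => \sum_(k <- r) F k x).
Proof.
move=> oW h; elim: r => [|k r IH].
  by apply: smooth_inK_eq (smooth_inK_cst W 0) => // x _; rewrite big_nil.
by apply: smooth_inK_eq (smooth_inK_add oW (h k) IH) => // x _; rewrite big_cons.
Qed.

Lemma sc_re_pderivK a (f : M -> S) x : sc_re (pderivK i a f x) = pderiv i a (fun y => sc_re (f y)) x.
Proof. by rewrite sc_re_mk. Qed.

Lemma sc_im_pderivK a (f : M -> S) x : sc_im (pderivK i a f x) = pderiv i a (fun y => sc_im (f y)) x.
Proof. by move: f; case: b => f //=; rewrite pderiv_cst. Qed.

Lemma smooth_inK_pderiv W (f : M -> S) a : open W -> smooth_inK W f ->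
  smooth_inK W (pderivK i a f).
Proof.
move=> oW [f1 f2]; split.
  by apply: smooth_in_eq (smooth_in_pderiv a oW f1) => // x _; rewrite sc_re_pderivK.
by apply: smooth_in_eq (smooth_in_pderiv a oW f2) => // x _; rewrite sc_im_pderivK.
Qed.

Lemma pderivK_eq W (f g : M -> S) a x : open W -> W x -> dom i x ->
  (forall y, W y -> f y = g y) -> pderivK i a f x = pderivK i a g x.
Proof.
move=> oW Wx dx fg; apply: sc_ext; rewrite ?sc_re_pderivK ?sc_im_pderivK;
  by apply: (pderiv_eq a oW Wx dx) => y Wy; rewrite fg.
Qed.

Lemma pderivK_add W (f g : M -> S) a x : smooth_inK W f -> smooth_inK W g -> open W ->
  W x -> dom i x ->
  pderivK i a (fun y => f y + g y) x = pderivK i a f x + pderivK i a g x.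
Proof.
move=> [f1 f2] [g1 g2] oW Wx dx; apply: sc_ext.
  rewrite sc_reD !sc_re_pderivK -(pderiv_add a f1 g1 Wx dx).
  by apply: (pderiv_eq a oW Wx dx) => y _; rewrite sc_reD.
rewrite sc_imD !sc_im_pderivK -(pderiv_add a f2 g2 Wx dx).
by apply: (pderiv_eq a oW Wx dx) => y _; rewrite sc_imD.
Qed.

Lemma pderivK_real f a x : pderivK i a (fun y => sc_real S (f y)) x = sc_real S (pderiv i a f x).
Proof.
have h1 : (fun y => sc_re (sc_real S (f y))) = f by apply/funext => y; rewrite sc_re_real.
have h2 : (fun y => sc_im (sc_real S (f y))) = (fun=> 0) by apply/funext => y; rewrite sc_im_real.
by apply: sc_ext; rewrite ?sc_re_pderivK ?sc_im_pderivK ?h1 ?h2 ?sc_re_real ?sc_im_real ?pderiv_cst.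
Qed.

Lemma pderivK_cst (c : S) a x : pderivK i a (fun=> c) x = 0.
Proof.
by apply: sc_ext; rewrite ?sc_re_pderivK ?sc_im_pderivK pderiv_cst ?sc_re0 ?sc_im0.
Qed.

Lemma pderivK_mul W (f g : M -> S) a x : smooth_inK W f -> smooth_inK W g -> open W ->
  W x -> dom i x ->
  pderivK i a (fun y => f y * g y) x = pderivK i a f x * g x + f x * pderivK i a g x.
Proof.
move=> [f1 f2] [g1 g2] oW Wx dx; apply: sc_ext.
  rewrite sc_reD !sc_reM !sc_re_pderivK !sc_im_pderivK.
  have h1 := smooth_in_mul oW (smooth_in_cst W (-1)) (smooth_in_mul oW f2 g2).
  rewrite (pderiv_eq (W := W) (g := fun y => sc_re (f y) * sc_re (g y) + -1 * (sc_im (f y) * sc_im (g y))) a oW Wx dx).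
    rewrite (pderiv_add a (smooth_in_mul oW f1 g1) h1 Wx dx) (pderiv_mul a f1 g1 Wx dx).
    rewrite (pderiv_mul a (smooth_in_cst W (-1)) (smooth_in_mul oW f2 g2) Wx dx).
    by rewrite pderiv_cst (pderiv_mul a f2 g2 Wx dx); ring.
  by move=> y _; rewrite sc_reM mulN1r.
rewrite sc_imD !sc_imM !sc_re_pderivK !sc_im_pderivK.
rewrite (pderiv_eq (W := W) (g := fun y => sc_re (f y) * sc_im (g y) + sc_im (f y) * sc_re (g y)) a oW Wx dx).
  rewrite (pderiv_add a (smooth_in_mul oW f1 g2) (smooth_in_mul oW f2 g1) Wx dx).
  by rewrite (pderiv_mul a f1 g2 Wx dx) (pderiv_mul a f2 g1 Wx dx); ring.
by move=> y _; rewrite sc_imM.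
Qed.

Section Vectors.
Context {m : nat}.
Implicit Types (u v : M -> 'cV[S]_m) (t : seq 'I_n).

Definition smooth_inV W u := forall k, smooth_inK W (fun x => u x k 0).

Lemma smooth_inV_eq W u v : open W -> (forall x, W x -> u x = v x) ->
  smooth_inV W u -> smooth_inV W v.
Proof. by move=> oW uv su k; apply: smooth_inK_eq (su k) => // x Wx; rewrite uv. Qed.

Lemma smooth_inV_lin W (c : M -> S) u v : open W -> smooth_inK W c ->
  smooth_inV W u -> smooth_inV W v -> smooth_inV W (fun x => c x *: u x + v x).
Proof.
move=> oW sc su sv k.
apply: smooth_inK_eq (smooth_inK_add oW (smooth_inK_mul oW sc (su k)) (sv k)) => // x _.
by rewrite !mxE.
Qed.

Lemma smooth_inV_scale W (c : M -> S) u : open W -> smooth_inK W c ->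
  smooth_inV W u -> smooth_inV W (fun x => c x *: u x).
Proof.
move=> oW sc su k.
by apply: smooth_inK_eq (smooth_inK_mul oW sc (su k)) => // x _; rewrite !mxE.
Qed.

Lemma pderivV_eq W u v a x : open W -> W x -> dom i x ->
  (forall y, W y -> u y = v y) -> pderivV i a u x = pderivV i a v x.
Proof.
move=> oW Wx dx uv; apply/colP => k; rewrite !mxE.
by apply: (pderivK_eq a oW Wx dx) => y Wy; rewrite uv.
Qed.

Lemma smooth_inV_pderiv W u a : open W -> smooth_inV W u -> smooth_inV W (pderivV i a u).
Proof.
by move=> oW su k; apply: smooth_inK_eq (smooth_inK_pderiv a oW (su k)) => // x _; rewrite mxE.
Qed.

Lemma smooth_inV_pderivs W u t : open W -> smooth_inV W u -> smooth_inV W (pderivs i t u).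
Proof. by move=> oW su; elim: t => [//|a t IH]; exact: smooth_inV_pderiv. Qed.

Lemma pderivV_add W u v a x : smooth_inV W u -> smooth_inV W v -> open W -> W x -> dom i x ->
  pderivV i a (fun y => u y + v y) x = pderivV i a u x + pderivV i a v x.
Proof.
move=> su sv oW Wx dx; apply/colP => k; rewrite !mxE.
rewrite -(pderivK_add a (su k) (sv k) oW Wx dx).
by apply: (pderivK_eq a oW Wx dx) => y _; rewrite mxE.
Qed.

Lemma pderivV_mul W (c : M -> S) u a x : smooth_inK W c -> smooth_inV W u -> open W ->
  W x -> dom i x ->
  pderivV i a (fun y => c y *: u y) x = pderivK i a c x *: u x + c x *: pderivV i a u x.
Proof.
move=> sc su oW Wx dx; apply/colP => k; rewrite !mxE.
rewrite -(pderivK_mul a sc (su k) oW Wx dx).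
by apply: (pderivK_eq a oW Wx dx) => y _; rewrite mxE.
Qed.

Lemma pderivs_eq W u v t x : open W -> W x -> dom i x ->
  (forall y, W y -> u y = v y) -> pderivs i t u x = pderivs i t v x.
Proof.
move=> oW Wx dx uv.
have oW' : open (W `&` dom i) by apply: openI => //; exact: dom_open.
suff : forall y, (W `&` dom i) y -> pderivs i t u y = pderivs i t v y by apply; split.
elim: t => [|a t IH] y [Wy dy] /=; first exact: uv.
exact: (pderivV_eq a oW').
Qed.

Lemma pderivs_lin W (c : S) u v t x : smooth_inV W u -> smooth_inV W v -> open W ->
  W x -> dom i x ->
  pderivs i t (fun y => c *: u y + v y) x = c *: pderivs i t u x + pderivs i t v x.
Proof.
move=> su sv oW Wx dx.
have oW' : open (W `&` dom i) by apply: openI => //; exact: dom_open.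
suff : forall y, (W `&` dom i) y ->
    pderivs i t (fun y => c *: u y + v y) y = c *: pderivs i t u y + pderivs i t v y.
  by apply; split.
elim: t => [//|a t IH] y [Wy dy] /=.
have su' := smooth_inV_pderivs t oW su; have sv' := smooth_inV_pderivs t oW sv.
have sc := smooth_inK_cst W c.
rewrite (pderivV_eq a oW' (conj Wy dy) dy IH).
rewrite (pderivV_add a (smooth_inV_scale oW sc su') sv' oW Wy dy).
by rewrite (pderivV_mul a sc su' oW Wy dy) pderivK_cst scale0r add0r.
Qed.

Definition smul f u : M -> 'cV[S]_m := fun x => sc_real S (f x) *: u x.

Lemma pderivV_smul W f u a x : smooth_in W f -> smooth_inV W u -> open W -> W x -> dom i x ->
  pderivV i a (smul f u) x =
  sc_real S (pderiv i a f x) *: u x + sc_real S (f x) *: pderivV i a u x.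
Proof.
move=> sf su oW Wx dx.
by rewrite (pderivV_mul a (smooth_inK_real oW sf) su oW Wx dx) pderivK_real.
Qed.

Lemma smooth_inV_smul W f u : open W -> smooth_in W f -> smooth_inV W u ->
  smooth_inV W (smul f u).
Proof. by move=> oW sf su; apply: smooth_inV_scale => //; exact: smooth_inK_real. Qed.

(** The monomial of the word [t] at the differential of [f], kept only in degree [k]. Summed against
    the coefficients of all words it gives the symbol of degree [k] at [grad]. *)
Definition word_part (k : nat) t f x : R :=
  if size t == k then \prod_(a <- t) pderiv i a f x else 0.

Lemma pderivs_comm1 W f u t x : smooth_in W f -> smooth_inV W u -> open W -> W x -> dom i x ->
  (size t <= 1)%N ->
  pderivs i t (smul f u) x - sc_real S (f x) *: pderivs i t u x =
  sc_real S (word_part 1 t f x) *: u x.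
Proof.
move=> sf su oW Wx dx; case: t => [|a [|//]] _ /=.
  by rewrite /word_part /= sc_real0 scale0r subrr.
by rewrite /word_part /= big_seq1 (pderivV_smul a sf su oW Wx dx) addrK.
Qed.

(** The double commutator of a derivative with [f]: Leibniz' rule leaves only the terms in which
    both derivatives fall on [f]. The 2 counts the two ways to distribute them. *)
Lemma pderivs_comm2 W f u t x : smooth_in W f -> smooth_inV W u -> open W -> W x -> dom i x ->
  (size t <= 2)%N ->
  pderivs i t (smul f (smul f u)) x - sc_real S (2 * f x) *: pderivs i t (smul f u) x
    + sc_real S (f x ^+ 2) *: pderivs i t u x =
  sc_real S (2 * word_part 2 t f x) *: u x.
Proof.
move=> sf su oW Wx dx; have sfu := smooth_inV_smul oW sf su.
have oW' : open (W `&` dom i) by apply: openI => //; exact: dom_open.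
case: t => [|a [|c [|//]]] _.
- rewrite /= /smul /word_part /= mulr0 sc_real0 scale0r !scalerA -!sc_realM -scalerBl -sc_realN.
  rewrite -sc_realD -scalerDl -sc_realD.
  have -> : f x * f x + - (2 * f x * f x) + f x ^+ 2 = 0 by ring.
  by rewrite sc_real0 scale0r.
- rewrite /= (pderivV_smul a sf sfu oW Wx dx) !(pderivV_smul a sf su oW Wx dx).
  rewrite /word_part /= mulr0 sc_real0 scale0r.
  move: (pderivV i a u x) (pderiv i a f x) => v d; rewrite /smul.
  apply/colP => k; rewrite !mxE; move: (v k 0) (u x k 0) (f x) => p q r.
  rewrite expr2 !sc_realM.
  have -> : sc_real S 2 = 2 by rewrite -[2]/(1 + 1 : R) sc_realD sc_real1.
  by ring.
have dE v y : smooth_inV W v -> (W `&` dom i) y -> pderivV i c (smul f v) y =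
   smul (pderiv i c f) v y + smul f (pderivV i c v) y.
  by move=> sv [Wy dy]; exact: pderivV_smul.
have sdf := smooth_in_pderiv c oW sf; have sdu := smooth_inV_pderiv c oW su.
have s1 := smooth_inV_smul oW sdf su; have s2 := smooth_inV_smul oW sf sdu.
have s3 := smooth_inV_smul oW sdf sfu; have s4 := smooth_inV_pderiv c oW sfu.
have s5 := smooth_inV_smul oW sf s4.
rewrite /= (pderivV_eq (W := W `&` dom i) (v := fun y => smul (pderiv i c f) (smul f u) y
  + smul f (pderivV i c (smul f u)) y) a oW' (conj Wx dx) dx); last by move=> y; exact: dE.
rewrite (pderivV_add a s3 s5 oW Wx dx).
rewrite (pderivV_smul a sdf sfu oW Wx dx) (pderivV_smul a sf s4 oW Wx dx).
have -> : pderivV i a (pderivV i c (smul f u)) x =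
  pderivV i a (fun y => smul (pderiv i c f) u y + smul f (pderivV i c u) y) x.
  by apply: (pderivV_eq (W := W `&` dom i) a oW' (conj Wx dx) dx) => y; exact: dE.
rewrite (pderivV_add a s1 s2 oW Wx dx) (dE _ _ su (conj Wx dx)).
rewrite !(pderivV_smul a _ su oW Wx dx)// (pderivV_smul a sf sdu oW Wx dx).
rewrite /word_part /= big_cons big_seq1 /smul.
apply/colP => k; rewrite !mxE.
rewrite expr2 !sc_realM.
have -> : sc_real S 2 = 2 by rewrite -[2]/(1 + 1 : R) sc_realD sc_real1.
by ring.
Qed.

End Vectors.

Lemma smooth_inV_mulmx m p W (c : M -> 'M[S]_(p, m)) (u : M -> 'cV[S]_m) : open W ->
  (forall k l, smooth_inK W (fun x => c x k l)) -> smooth_inV W u ->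
  smooth_inV W (fun x => c x *m u x).
Proof.
move=> oW sc su k.
apply: (smooth_inK_eq (f := fun x => \sum_l c x k l * u x l 0)) => //.
  by move=> x _; rewrite mxE.
by apply: smooth_inK_sum => // l; exact: smooth_inK_mul.
Qed.

Lemma smooth_inV_sum m W (I : Type) (r : seq I) (F : I -> M -> 'cV[S]_m) : open W ->
  (forall k, smooth_inV W (F k)) -> smooth_inV W (fun x => \sum_(k <- r) F k x).
Proof.
move=> oW h a; apply: (smooth_inK_eq (f := fun x => \sum_(k <- r) F k x a 0)) => //.
  by move=> x _; rewrite summxE.
by apply: smooth_inK_sum => // k; exact: h.
Qed.

End ChartCalculus.

(** * Differential operators: locality and commutators *)

Section Sections.
Context {R : realType} {b : base_field} {n : nat} {M : ptopologicalType}.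
Local Notation S := (scalars_of R b).
Context {X : manifold R n M}.

Lemma smooth_onK_in (W : set M) (f : M -> S) :
  smooth_onK X W f <-> forall i : atlas X, smooth_inK i W f.
Proof.
split => [[h1 h2] i|h]; first by split; [exact: h1|exact: h2].
by split => i; have [h1 h2] := h i; [exact: h1|exact: h2].
Qed.

Lemma smooth_inK_sub (i : atlas X) (W V : set M) (f : M -> S) : V `<=` W ->
  smooth_inK i W f -> smooth_inK i V f.
Proof.
move=> VW [h1 h2]; split => k; [apply: class_C_sub (h1 k)|apply: class_C_sub (h2 k)];
  by move=> _ [x [Vx dx] <-]; exists x => //; split => //; exact: VW.
Qed.

Definition rmul (E : vbundle S X) (f : M -> R) (s : section E) : section E :=
  fun x => sc_real S (f x) *: s x.

Definition slin (E : vbundle S X) (c : S) (s t : section E) : section E :=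
  fun x => c *: s x + t x.

Section OneBundle.
Context {E : vbundle S X}.
Implicit Types (s t : section E) (f g : M -> R).

Definition coords (j : triv_index E) s : M -> 'cV[S]_(rank E) := fun x => triv j x (s x).

Lemma smooth_sectionE s : smooth_section s <->
  forall (i : atlas X) j, smooth_inV i (triv_dom j) (coords j s).
Proof.
split => [h i j a|h j a]; first by move/smooth_onK_in : (h j a); exact.
by apply/smooth_onK_in => i; exact: h.
Qed.

Lemma triv_inj j x : triv_dom (v0 := E) j x -> injective (triv j x).
Proof. by move=> jx; exact: can_inj (trivK jx). Qed.

Lemma smooth_slin c s t : smooth_section s -> smooth_section t -> smooth_section (slin c s t).
Proof.
move=> /smooth_sectionE hs /smooth_sectionE ht; apply/smooth_sectionE => i j.
have oj := triv_open j.
apply: smooth_inV_eq (smooth_inV_lin oj (smooth_inK_cst i _ c) (hs i j) (ht i j)) => // x _.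
by rewrite /coords linearP.
Qed.

Lemma smooth_rmul f s : smooth_on X setT f -> smooth_section s -> smooth_section (rmul f s).
Proof.
move=> sf /smooth_sectionE hs; apply/smooth_sectionE => i j; have oj := triv_open j.
have sf' : smooth_in i (triv_dom j) f by exact: (smooth_on_sub (@subsetT _ _) sf).
apply: smooth_inV_eq (smooth_inV_smul oj sf' (hs i j)) => // x _.
by rewrite /coords linearZ.
Qed.

Lemma smooth_section0 : smooth_section (fun x => 0 : fiber E x).
Proof.
apply/smooth_sectionE => i j k; apply: (smooth_inK_eq (f := fun=> 0)); first exact: triv_open.
  by move=> x _; rewrite /coords linear0 mxE.
exact: smooth_inK_cst.
Qed.

Lemma suppP s x : ~ supp s x <-> exists2 U, nbhs x U & forall y, U y -> s y = 0.
Proof.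
split => [nx|[U nU sU] cx].
  have : open_nbhs x (~` supp s) by split => //; apply: closed_openC; exact: closed_closure.
  move/open_nbhs_nbhs => nU; exists (~` supp s) => // y ny; apply: contrapT => /eqP sy.
  by apply: ny; exact: subset_closure.
by have [y [/= /eqP sy Uy]] := cx U nU; apply: sy; exact: sU.
Qed.

Lemma supp_sub s (C : set M) : closed C -> (forall x, ~ C x -> s x = 0) -> supp s `<=` C.
Proof.
move=> cC h; rewrite /supp (closure_id C).1//; apply: closure_subset => x /= /eqP sx.
by apply: contrapT => nx; apply: sx; exact: h.
Qed.

Lemma supp0 s x : ~ supp s x -> s x = 0.
Proof. by move=> /suppP[U /nbhs_singleton Ux]; exact. Qed.

Lemma supp_closed s : closed (supp s). Proof. exact: closed_closure. Qed.

End OneBundle.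

Section Operators.
Context {E F : vbundle S X}.
Implicit Types (s t : section E) (f g : M -> R).

Section LocalForm.
Context (k : nat) (P : section E -> section F) (i : atlas X) (j : triv_index E).
Context (l : triv_index F) (c : seq 'I_n -> M -> 'M[S]_(rank F, rank E)).
Hypothesis lf : local_form k P i j l c.
Let W := dom i `&` triv_dom j `&` triv_dom l.

Let oW : open W.
Proof. by apply: openI; [apply: openI; [exact: dom_open|exact: triv_open]|exact: triv_open]. Qed.

Lemma local_form_eq s x : smooth_section s -> W x ->
  triv l x (P s x) = \sum_(m < k.+1) \sum_(t : m.-tuple 'I_n)
     c t x *m pderivs i t (coords j s) x.
Proof. by move=> ss Wx; exact: lf.2. Qed.

Lemma local_form_smooth s : smooth_section s ->
  smooth_inV i W (fun x => triv l x (P s x)).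
Proof.
move=> /[dup] ss /smooth_sectionE hs.
apply: (smooth_inV_eq (u := fun x => \sum_(m < k.+1) \sum_(t : m.-tuple 'I_n)
     c t x *m pderivs i t (coords j s) x)) => //.
  by move=> x Wx; rewrite local_form_eq.
apply: smooth_inV_sum => // m; apply: smooth_inV_sum => // t.
apply: smooth_inV_mulmx => //; first by move=> p q; have /smooth_onK_in := lf.1 t p q; exact.
apply: smooth_inV_pderivs => // p; apply: smooth_inK_sub (hs i j p) => x; by case=> -[].
Qed.

Lemma local_form_lin a s t x : smooth_section s -> smooth_section t -> W x ->
  triv l x (P (slin a s t) x) = a *: triv l x (P s x) + triv l x (P t x).
Proof.
move=> ss st Wx; have sst := smooth_slin a ss st; rewrite !local_form_eq//.
move/smooth_sectionE : (ss) => hs; move/smooth_sectionE : (st) => ht.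
have [[dx jx] lx] := Wx.
rewrite scaler_sumr -big_split; apply: eq_bigr => m _.
rewrite scaler_sumr -big_split; apply: eq_bigr => q _ /=.
rewrite scalemxAr -mulmxDr -(pderivs_lin (W := triv_dom j) _ _ (hs i j) (ht i j) (triv_open j) jx dx).
congr (_ *m _); apply: (pderivs_eq (W := triv_dom j)) => //; first exact: triv_open.
by move=> y _; rewrite /coords /slin linearP.
Qed.

Lemma local_form_local s t x (U : set M) : smooth_section s -> smooth_section t -> W x ->
  open U -> U x -> (forall y, U y -> s y = t y) -> triv l x (P s x) = triv l x (P t x).
Proof.
move=> ss st Wx oU Ux st_; rewrite !local_form_eq//; have [[dx jx] lx] := Wx.
apply: eq_bigr => m _; apply: eq_bigr => q _; congr (_ *m _).
by apply: (pderivs_eq (W := U)) => // y Uy; rewrite /coords st_.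
Qed.

Definition grad f x : 'rV[R]_n := \row_a pderiv i a f x.

Let smul_coords f s : coords j (rmul f s) = smul f (coords j s).
Proof. by apply/funext => x; rewrite /coords /smul linearZ. Qed.

Lemma symbol_word q x f : symbol q c x (grad f x) =
  \sum_(m < q.+1) \sum_(t : m.-tuple 'I_n) sc_real S (word_part i q t f x) *: c t x.
Proof.
rewrite big_ord_recr /= big1 ?add0r => [|m _].
  apply: eq_bigr => t _; rewrite /word_part size_tuple eqxx; congr (sc_real S _ *: _).
  by apply: eq_bigr => a _; rewrite mxE.
apply: big1 => t _; rewrite /word_part size_tuple /= ltn_eqF ?ltn_ord//.
by rewrite sc_real0 scale0r.
Qed.

(** The commutator with a function turns the symbol into an operator of order zero, so that symbols
    can be studied by pairing sections. *)
Lemma comm1_symbol f s x : k = 1%N -> smooth_on X setT f -> smooth_section s -> W x ->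
  triv l x (P (rmul f s) x - sc_real S (f x) *: P s x) =
  symbol 1 c x (grad f x) *m coords j s x.
Proof.
move=> k1 sf ss Wx; have [[dx jx] lx] := Wx; have oj := triv_open j.
have sf' : smooth_in i (triv_dom j) f by exact: (smooth_on_sub (@subsetT _ _) sf).
rewrite linearB linearZ /= !local_form_eq//; last exact: smooth_rmul.
rewrite smul_coords symbol_word k1 mulmx_suml scaler_sumr -sumrB; apply: eq_bigr => m _.
rewrite mulmx_suml scaler_sumr -sumrB; apply: eq_bigr => t _.
rewrite scalemxAr -mulmxBr -scalemxAl scalemxAr; congr (_ *m _).
move/smooth_sectionE : ss => hs.
apply: (pderivs_comm1 sf' (hs i j) oj jx dx).
by rewrite size_tuple -ltnS ltn_ord.
Qed.

Lemma comm2_symbol f s x : (k <= 2)%N -> smooth_on X setT f -> smooth_section s -> W x ->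
  triv l x (P (rmul f (rmul f s)) x - sc_real S (2 * f x) *: P (rmul f s) x
    + sc_real S (f x ^+ 2) *: P s x) =
  (if k == 2 then sc_real S 2 *: symbol 2 c x (grad f x) else 0) *m coords j s x.
Proof.
move=> k2 sf ss Wx; have [[dx jx] lx] := Wx; have oj := triv_open j.
have sf' : smooth_in i (triv_dom j) f by exact: (smooth_on_sub (@subsetT _ _) sf).
have sfs := smooth_rmul sf ss; have sffs := smooth_rmul sf sfs.
have -> : (if k == 2 then sc_real S 2 *: symbol 2 c x (grad f x) else 0) =
   sc_real S 2 *: \sum_(m < k.+1) \sum_(t : m.-tuple 'I_n) sc_real S (word_part i 2 t f x) *: c t x.
  case: eqP => [k2'|/eqP k2']; first by rewrite symbol_word k2'.
  rewrite big1 ?scaler0// => m _; apply: big1 => t _; rewrite /word_part size_tuple.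
  by rewrite ltn_eqF ?sc_real0 ?scale0r//; apply: leq_trans (ltn_ord m) _; rewrite ltn_neqAle k2'.
rewrite linearD linearB !linearZ /= !local_form_eq// !smul_coords.
rewrite scalerN -scalemxAl mulmx_suml !scaler_sumr -sumrB -big_split /=.
apply: eq_bigr => m _.
rewrite mulmx_suml !scaler_sumr -sumrB -big_split /=; apply: eq_bigr => t _.
rewrite !scalemxAr -mulmxBr -mulmxDr -scalemxAl !scalemxAr scalerA -sc_realM; congr (_ *m _).
move/smooth_sectionE : ss => hs; rewrite [word_part _ _ _ _ _ * 2]mulrC.
apply: (pderivs_comm2 sf' (hs i j) oj jx dx).
by rewrite size_tuple; apply: leq_trans k2; rewrite -ltnS ltn_ord.
Qed.

End LocalForm.

Section DiffOp.
Context (k : nat) (P : section E -> section F) (dP : diff_op k P).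

Lemma diff_op_smooth s : smooth_section s -> smooth_section (P s).
Proof.
move=> ss; apply/smooth_sectionE => i l a; apply: smooth_inK_local => x lx dx.
have [j jx] := triv_cover E x; have [c lf] := dP i j l.
exists (dom i `&` triv_dom j `&` triv_dom l); split => //.
exact: (local_form_smooth lf ss).
Qed.

Lemma diff_op_lin a s t x : smooth_section s -> smooth_section t ->
  P (slin a s t) x = a *: P s x + P t x.
Proof.
move=> ss st; have [i dx] := dom_cover X x; have [j jx] := triv_cover E x.
have [l lx] := triv_cover F x; have [c lf] := dP i j l.
by apply: (triv_inj lx); rewrite (local_form_lin lf)// linearP.
Qed.

Lemma diff_op_local s t x (U : set M) : smooth_section s -> smooth_section t ->
  nbhs x U -> (forall y, U y -> s y = t y) -> P s x = P t x.
Proof.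
move=> ss st; rewrite nbhsE => -[V [oV Vx] VU] st_.
have [i dx] := dom_cover X x; have [j jx] := triv_cover E x.
have [l lx] := triv_cover F x; have [c lf] := dP i j l.
apply: (triv_inj lx); apply: (local_form_local lf) oV Vx _ => //.
by move=> y /VU; exact: st_.
Qed.

Lemma diff_op0 x : P (fun y => 0) x = 0.
Proof.
have h := @smooth_section0 E; have := diff_op_lin (-1) x h h.
have -> : slin (-1) (fun y => 0 : fiber E y) (fun y => 0) = (fun y => 0).
  by apply: functional_extensionality_dep => y; rewrite /slin scaler0 addr0.
by rewrite scaleN1r addNr.
Qed.

Lemma diff_op_supp s : smooth_section s -> supp (P s) `<=` supp s.
Proof.
move=> ss; apply: supp_sub; first exact: supp_closed.
move=> x /suppP[U nU sU]; rewrite -[RHS](diff_op0 x).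
by apply: diff_op_local nU sU => //; exact: smooth_section0.
Qed.

End DiffOp.
End Operators.

(* The double commutator of [P] with [f], of order zero for [P] of order two. *)
Definition double_comm (E F : vbundle S X) (P : section E -> section F) (f : M -> R) (s : section E) : section F :=
  fun x => P (rmul f (rmul f s)) x - sc_real S (2 * f x) *: P (rmul f s) x
    + sc_real S (f x ^+ 2) *: P s x.

Lemma double_comm1 (E F : vbundle S X) (P : section E -> section F) f s x :
  diff_op 1 P -> smooth_on X setT f -> smooth_section s -> double_comm P f s x = 0.
Proof.
move=> dP sf ss; have [i dx] := dom_cover X x; have [j jx] := triv_cover E x.
have [l lx] := triv_cover F x; have [c lf] := dP i j l.
by apply: (triv_inj lx); rewrite (comm2_symbol lf)// mul0mx linear0.
Qed.

End Sections.

(** * Locally uniform bounds for coefficients and metrics *)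

Section LocalBounds.
Context {R : realType} {b : base_field} {n : nat} {M : ptopologicalType}.
Local Notation S := (scalars_of R b).
Context {X : manifold R n M}.

Lemma smooth_onK_nsq (W : set M) (f : M -> S) : open W -> smooth_onK X W f ->
  smooth_on X W (fun x => nsq (f x)).
Proof.
move=> oW [h1 h2].
apply: smooth_on_eq (smooth_on_add oW (smooth_on_mul oW h1 h1) (smooth_on_mul oW h2 h2)) => //.
Qed.

Section Matrices.
Context (p m : nat) (c : M -> 'M[S]_(p, m)) (W : set M) (x0 : M).
Hypotheses (oW : open W) (Wx0 : W x0).
Hypothesis sc : forall k l, smooth_onK X W (fun x => c x k l).

Lemma mxdist_continuous (A : 'M[S]_(p, m)) :
  {for x0, continuous (fun x => \sum_k \sum_l nsq (c x k l - A k l))}.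
Proof.
apply: (smooth_on_continuous (X := X) oW) Wx0.
apply: smooth_on_sum => // k; apply: smooth_on_sum => // l; apply: smooth_onK_nsq => //.
have [h1 h2] := sc k l; split.
  apply: smooth_on_eq (smooth_on_add oW h1 (@smooth_on_cst _ _ _ X W (- sc_re (A k l)))) => // x _.
  by rewrite sc_reD sc_reN.
apply: smooth_on_eq (smooth_on_add oW h2 (@smooth_on_cst _ _ _ X W (- sc_im (A k l)))) => // x _.
by rewrite sc_imD sc_imN.
Qed.

Lemma near_mx_bounded : exists C, 0 < C /\
  \forall x \near x0, forall w : 'cV_m, cnsq (c x *m w) <= C * cnsq w.
Proof.
pose f := fun x : M => \sum_k \sum_l nsq (c x k l - (0 : 'M[S]_(p, m)) k l).
have cf : {for x0, continuous f} by exact: mxdist_continuous.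
have f0 x : 0 <= f x.
  by apply: sumr_ge0 => k _; apply: sumr_ge0 => l _; exact: nsq_ge0.
exists (m%:R * (f x0 + 1) + 1); split.
  by rewrite ltr_wpDl// mulr_ge0// addr_ge0.
have : \forall x \near x0, f x < f x0 + 1 by apply: cvgr_lt cf _ _; rewrite ltrDl.
apply: filterS => x fx w; apply: le_trans (cnsq_mulmx_le _ _) _.
apply: ler_wpM2r; first exact: cnsq_ge0.
apply: (@le_trans _ _ (m%:R * (f x0 + 1))); last by rewrite lerDl.
apply: ler_wpM2l => //; apply: le_trans (ltW fx).
by rewrite /f; apply: ler_sum => k _; apply: ler_sum => l _; rewrite mxE subr0.
Qed.

Lemma near_mx_close (d : R) : 0 < d ->
  \forall x \near x0, forall w : 'cV_m, cnsq ((c x - c x0) *m w) <= d * cnsq w.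
Proof.
move=> d0; pose f := fun x : M => \sum_k \sum_l nsq (c x k l - c x0 k l).
have cf : {for x0, continuous f} by exact: mxdist_continuous.
have mp : 0 < m%:R + 1 :> R by rewrite ltr_wpDl.
have : \forall x \near x0, f x < d / (m%:R + 1).
  apply: cvgr_lt cf _ _; rewrite /f big1 ?divr_gt0// => k _; apply: big1 => l _.
  by rewrite subrr nsq0.
apply: filterS => x fx w; apply: le_trans (cnsq_mulmx_le _ _) _.
apply: ler_wpM2r; first exact: cnsq_ge0.
have e : \sum_k \sum_l nsq ((c x - c x0) k l) = f x.
  by apply: eq_bigr => k _; apply: eq_bigr => l _; rewrite !mxE.
rewrite e; have f0 : 0 <= f x.
  by apply: sumr_ge0 => k _; apply: sumr_ge0 => l _; exact: nsq_ge0.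
have : (m%:R + 1) * f x <= d by rewrite mulrC -ler_pdivlMr// ltW.
by rewrite mulrDl mul1r => h; apply: le_trans h; rewrite lerDl.
Qed.

End Matrices.

Context {E : vbundle S X} (h : bundle_metric E).
Implicit Types (s t : section E).

Lemma smooth_onK_conj (W : set M) (f : M -> S) : open W -> smooth_onK X W f ->
  smooth_onK X W (fun x => sc_conj (f x)).
Proof.
move=> oW [h1 h2]; split.
  by apply: smooth_on_eq h1 => // x _; rewrite sc_re_conj.
by apply: smooth_on_eq (smooth_on_opp oW h2) => // x _; rewrite sc_im_conj.
Qed.

(** Conjugated because [dot] conjugates its second argument, where this matrix is applied in
    [hr_dot]. *)
Definition conj_gram (j : triv_index E) x : 'M[S]_(rank E) :=
  \matrix_(a, c) sc_conj (h x (frame j a x) (frame j c x)).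

Lemma conj_gram_smooth (j : triv_index E) a c :
  smooth_onK X (triv_dom j) (fun x => conj_gram j x a c).
Proof.
have oj := triv_open j; have [h1 h2] := smooth_onK_conj oj (bm_smooth h j a c).
by split; [apply: smooth_on_eq h1|apply: smooth_on_eq h2] => // x _; rewrite mxE.
Qed.

Definition dot m (v w : 'cV[S]_m) : R := \sum_a sc_re (v a 0 * sc_conj (w a 0)).

Lemma dot_le m (d : R) (v w : 'cV[S]_m) : 0 < d ->
  2 * `|dot v w| <= d * cnsq v + d^-1 * cnsq w.
Proof.
move=> d0; have key (sgn : R) : sgn ^+ 2 = 1 -> 2 * (sgn * dot v w) <= d * cnsq v + d^-1 * cnsq w.
  move=> s1; rewrite /dot /cnsq !mulr_sumr -big_split /=; apply: ler_sum => a _.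
  rewrite sc_reM sc_re_conj sc_im_conj /nsq.
  move: (sc_re (v a 0)) (sc_im (v a 0)) (sc_re (w a 0)) (sc_im (w a 0)) => p q r t.
  rewrite -subr_ge0.
  have -> : d * (p ^+ 2 + q ^+ 2) + d^-1 * (r ^+ 2 + t ^+ 2) - 2 * (sgn * (p * r - q * - t)) =
     d^-1 * ((d * p - sgn * r) ^+ 2 + (d * q - sgn * t) ^+ 2)
     + d^-1 * ((1 - sgn ^+ 2) * (r ^+ 2 + t ^+ 2)) by field; exact: lt0r_neq0.
  rewrite s1 subrr mul0r mulr0 addr0; apply: mulr_ge0; first by rewrite invr_ge0 ltW.
  by apply: addr_ge0; exact: sqr_ge0.
have [d1|d1] := ger0P (dot v w); first by have := key 1 (expr1n _ _); rewrite mul1r.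
by have := key (-1); rewrite sqrrN expr1n mulN1r; apply.
Qed.

Lemma hr_dot (j : triv_index E) x (u : fiber E x) : triv_dom j x ->
  hr h u u = dot (triv j x u) (conj_gram j x *m triv j x u).
Proof.
move=> jx; rewrite /hr (bm_expand h u u jx) sc_re_sum; apply: eq_bigr => a _.
rewrite mxE; congr (sc_re _).
have -> : sc_conj (\sum_c conj_gram j x a c * triv j x u c 0) =
   \sum_c sc_conj (conj_gram j x a c * triv j x u c 0).
  elim/big_rec2 : _ => [|c y1 y2 _ <-]; last by rewrite sc_conjD.
  by apply: sc_ext; rewrite ?sc_re_conj ?sc_im_conj ?sc_re0 ?sc_im0 ?oppr0.
rewrite mulr_sumr; apply: eq_bigr => c _.
by rewrite sc_conjM mxE sc_conjK -mulrA; congr (_ * _); rewrite mulrC.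
Qed.

Lemma near_hr_upper (j : triv_index E) x0 : triv_dom j x0 -> exists C, 0 < C /\
  \forall x \near x0, forall u : fiber E x, hr h u u <= C * cnsq (triv j x u).
Proof.
move=> jx; have [C [C0 HC]] := near_mx_bounded (triv_open j) jx (conj_gram_smooth j).
exists (1 + C); split; first by rewrite addr_gt0.
have nj : nbhs x0 (triv_dom j) by apply: open_nbhs_nbhs; split => //; exact: triv_open.
apply: filterS2 HC nj => x hx jx' u; rewrite (hr_dot u jx').
have := dot_le (triv j x u) (conj_gram j x *m triv j x u) (d := 1) ltr01.
have := hx (triv j x u); have := ler_norm (dot (triv j x u) (conj_gram j x *m triv j x u)).
have := cnsq_ge0 (triv j x u); have := cnsq_ge0 (conj_gram j x *m triv j x u).
rewrite invr1 !mul1r.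
move: (cnsq (triv j x u)) (cnsq (_ *m _)) (dot _ _) (`|_|) => p q r t.
have -> : (1 + C) * p = p + C * p by ring.
by move: (C * p) => y; lra.
Qed.

(** The lower bound at [x0] is applied to the vector with the same coordinates. Near [x0] the Gram
    matrix changes so little that the error, weighted by [d = (2 * C)^-1], takes away at most half
    of it. *)
Lemma near_hr_lower (j : triv_index E) x0 : triv_dom j x0 -> exists C, 0 < C /\
  \forall x \near x0, forall u : fiber E x, cnsq (triv j x u) <= C * hr h u u.
Proof.
move=> jx; have [C [C0 HC]] := hr_lower h jx.
pose d := (2 * C)^-1; have d0 : 0 < d by rewrite invr_gt0 mulr_gt0.
have hc := near_mx_close (triv_open j) jx (conj_gram_smooth j) (d := d ^+ 2) (exprn_gt0 2 d0).
exists (2 * C); split; first by rewrite mulr_gt0.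
have nj : nbhs x0 (triv_dom j) by apply: open_nbhs_nbhs; split => //; exact: triv_open.
apply: filterS2 hc nj => x hx jx' u.
set w := triv j x u; pose u0 := triv_inv j x0 w.
have w0 : triv j x0 u0 = w by rewrite /u0 triv_invK.
have := HC u0; rewrite w0 (hr_dot u0 jx) w0 (hr_dot u jx') -/w => h1.
have e : dot w (conj_gram j x0 *m w) = dot w (conj_gram j x *m w)
    - dot w ((conj_gram j x - conj_gram j x0) *m w).
  rewrite /dot -sumrB; apply: eq_bigr => a _; rewrite -sc_reN -sc_reD -mulrBr.
  congr (sc_re (_ * _)); rewrite mulmxBl.
  move: (conj_gram j x *m w) (conj_gram j x0 *m w) => p q; rewrite !mxE.
  apply: sc_ext; rewrite ?(sc_re_conj, sc_im_conj, sc_reD, sc_imD, sc_reN, sc_imN) //.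
    by lra.
  by lra.
have h2 := dot_le w ((conj_gram j x - conj_gram j x0) *m w) d0.
have h3 := hx w; have h4 := ler_norm (- dot w ((conj_gram j x - conj_gram j x0) *m w)).
rewrite normrN in h4.
have h5 : d^-1 * cnsq ((conj_gram j x - conj_gram j x0) *m w) <= d * cnsq w.
  by rewrite ler_pdivrMl// mulrA -expr2.
move: e h1 h2 h4 h5; have dC : C * d = 2^-1 by rewrite /d; field; exact: lt0r_neq0.
move: (dot w (conj_gram j x *m w)) (dot w (conj_gram j x0 *m w))
  (dot w ((conj_gram j x - conj_gram j x0) *m w)) => p q r -> h1 h2 h4 h5.
have h6 : - r <= d * cnsq w by move: (`|r|) (d * cnsq w) (d^-1 * _) h2 h4 h5 => *; lra.
have : C * (p - r) <= C * p + C * (d * cnsq w) by rewrite -mulrDr; apply: ler_wpM2l; [exact: ltW|lra].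
rewrite mulrA dC => h7; have := le_trans h1 h7.
by rewrite -mulrA; move: (C * p) (cnsq w) => y z; lra.
Qed.

Lemma hr_smooth s t : smooth_section s -> smooth_section t ->
  smooth_on X setT (fun x => hr h (s x) (t x)).
Proof.
move=> ss st; apply: smooth_on_local => x _; have [j jx] := triv_cover E x.
exists (triv_dom j); split => //; have oj := triv_open j.
suff [] : smooth_onK X (triv_dom j) (fun x => h x (s x) (t x)) by [].
apply/smooth_onK_in => i.
apply: (smooth_inK_eq (f := fun x => \sum_a \sum_c triv j x (s x) a 0 *
    sc_conj (triv j x (t x) c 0) * h x (frame j a x) (frame j c x))) => //.
  by move=> y jy; rewrite -bm_expand.
apply: smooth_inK_sum => // a; apply: smooth_inK_sum => // c; apply: smooth_inK_mul => //.
  apply: smooth_inK_mul => //; first by have /smooth_onK_in := ss j a; exact.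
  by have /smooth_onK_in := smooth_onK_conj oj (st j c); exact.
by have /smooth_onK_in := bm_smooth h j a c; exact.
Qed.

Lemma hr_continuous s t x : smooth_section s -> smooth_section t ->
  {for x, continuous (fun x => hr h (s x) (t x))}.
Proof.
by move=> ss st; apply: (smooth_on_continuous openT (hr_smooth ss st)).
Qed.

End LocalBounds.

(** * Compactly supported sections *)

Section CompactSupport.
Context {R : realType} {b : base_field} {n : nat} {M : ptopologicalType}.
Local Notation S := (scalars_of R b).
Context {X : manifold R n M} {E : vbundle S X}.
Implicit Types (s t : section E) (f g : M -> R) (W V A : set M).
Let hM := man_hausdorff X.

Lemma glue_smooth W V A g f : open W -> open V -> cutoff X A V f ->
  smooth_on X (V `&` W) g -> smooth_on X W (fun x => f x * g x).
Proof.
move=> oW oV [sf _ _ [C [cC CV fC]]] sg; apply: smooth_on_local => x Wx.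
have oVW : open (V `&` W) by exact: openI.
have [Vx|nVx] := pselect (V x).
  exists (V `&` W); split => //; apply: smooth_on_mul => //.
  exact: smooth_on_sub (@subsetT _ _) sf.
have oC : open (~` C) by apply: closed_openC; exact: compact_closed.
exists (~` C); split; first by move=> /CV.
by apply: smooth_on_eq (@smooth_on_cst _ _ _ X (~` C) 0) => // y Cy; rewrite fC// mul0r.
Qed.

Lemma supp_rmul f s : supp (rmul f s) `<=` supp s.
Proof.
by apply: supp_sub; [exact: supp_closed|move=> x /supp0 sx; rewrite /rmul sx scaler0].
Qed.

Lemma Cc_sub W V s : W `<=` V -> Cc W s -> Cc V s.
Proof. by move=> WV [h1 h2 h3]; split => //; exact: subset_trans WV. Qed.

Lemma Cc0 W : Cc W (fun x => 0 : fiber E x).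
Proof.
have e : supp (fun x => 0 : fiber E x) = set0.
  by rewrite -subset0; apply: supp_sub; [exact: closed0|].
by split; [exact: smooth_section0|rewrite e; exact: compact0|rewrite e].
Qed.

Lemma Cc_supp_sub W s (C : set M) : smooth_section s -> compact C -> C `<=` W ->
  (forall x, ~ C x -> s x = 0) -> Cc W s.
Proof.
move=> ss cC CW h.
have sC : supp s `<=` C by apply: supp_sub => //; exact: compact_closed.
split => //; last exact: subset_trans CW.
by apply: subclosed_compact sC => //; exact: supp_closed.
Qed.

Lemma Cc_slin W c s t : Cc W s -> Cc W t -> Cc W (slin c s t).
Proof.
move=> [ss cs sW] [st ct tW].
apply: (Cc_supp_sub (C := supp s `|` supp t)); first exact: smooth_slin.
- exact: compactU.
- by move=> x [/sW|/tW].
- move=> x nx; rewrite /slin (supp0 (s := s)) ?(supp0 (s := t)) ?scaler0 ?addr0//.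
    by move=> h; apply: nx; right.
  by move=> h; apply: nx; left.
Qed.

Lemma Cc_rmul W f s : smooth_on X setT f -> Cc W s -> Cc W (rmul f s).
Proof.
move=> sf [ss cs sW]; apply: (Cc_supp_sub (C := supp s)) => //; first exact: smooth_rmul.
by move=> x /supp0 sx; rewrite /rmul sx scaler0.
Qed.

Lemma Cc_rmul_supp W V f s (C : set M) : smooth_on X setT f -> Cc V s ->
  closed C -> C `<=` W -> (forall x, ~ C x -> f x = 0) -> Cc W (rmul f s).
Proof.
move=> sf [ss cs sV] cC CW fC; apply: (Cc_supp_sub (C := supp s `&` C)).
- exact: smooth_rmul.
- exact: compact_closedI.
- by move=> x [_ /CW].
move=> x nx; have [sx|/supp0 sx] := pselect (supp s x); last by rewrite /rmul sx scaler0.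
by rewrite /rmul fC ?sc_real0 ?scale0r// => Cx; apply: nx.
Qed.

Context (mu : {measure set (borel M) -> \bar R}) (h : bundle_metric E).
Hypothesis mu_fin : forall K : set M, compact K ->
  exists U : set M, [/\ open U, K `<=` U & (mu U < +oo)%E].

Lemma smooth_measurable s : smooth_section s -> measurable_section s.
Proof.
move=> ss j a; have [h1 h2] := ss j a; have oj := triv_open j.
by split; apply: continuous_on_measurable => // x jx; apply: (smooth_on_continuous (X := X) oj) jx.
Qed.

Lemma integrable_bounded_on (K : set M) (f : borel M -> R) : compact K ->
  measurable_fun setT f -> (exists B, forall x, `|f x| <= B) -> (forall x, ~ K x -> f x = 0) ->
  mu.-integrable setT (EFin \o f).
Proof.
move=> cK mf [B HB] fK; have [U [oU KU fU]] := mu_fin cK.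
have mU : measurable (U : set (borel M)) by exact: borel_open.
apply: (integrable_le (g := fun x => B * \1_(U : set (borel M)) x)) => //.
  move=> x; rewrite indicE; case: (pselect (U x)) => Ux; first by rewrite mem_set// mulr1.
  by rewrite memNset// mulr0 fK ?normr0// => /KU.
apply: integrable_scale; apply/integrableP; split.
  by apply/measurable_EFinP; exact: measurable_indic.
rewrite (eq_integral (fun x : borel M => (\1_(U : set (borel M)) x)%:E)).
  by rewrite integral_indic// setIT.
by move=> x _ /=; rewrite ger0_norm.
Qed.

Lemma Cc_L2 W s : Cc W s -> L2 mu h setT s.
Proof.
move=> [ss cs sW]; apply/L2E; split; first exact: smooth_measurable.
have [B B0 HB] := compact_bounded_on cs (fun x _ => @hr_continuous _ _ _ _ _ _ h s s x ss ss).
have z x : ~ supp s x -> hr h (s x) (s x) = 0 by move=> /supp0 ->; rewrite hr0.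
apply: (integrable_bounded_on cs) => //.
  by apply: hr_measurable; exact: smooth_measurable.
exists B => x; have [/HB//|/z ->] := pselect (supp s x); rewrite normr0; exact: ltW.
Qed.

End CompactSupport.

Lemma Cc_diff_op (R : realType) (b : base_field) (n : nat) (M : ptopologicalType)
  (X : manifold R n M) (E F : vbundle (scalars_of R b) X) k (P : section E -> section F) (W : set M) (s : section E) :
  diff_op k P -> Cc W s -> Cc W (P s).
Proof.
move=> dP [ss cs sW]; apply: (Cc_supp_sub (C := supp s)) => //;
  first exact: (diff_op_smooth dP).
by move=> x nx; apply: supp0 => h; apply: nx; exact: (diff_op_supp dP ss).
Qed.

(** * Injectivity of the principal symbol of the first-order factor *)

Section TestObjects.
Context {R : realType} {b : base_field} {n : nat} {M : ptopologicalType}.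
Local Notation S := (scalars_of R b).
Context {X : manifold R n M}.

Lemma coord_derive (a c : 'I_n) (y : 'rV[R]_n) :
  is_derive y (delta_mx 0 a) (fun y : 'rV[R]_n => y 0 c) (delta_mx (0 : 'I_1) a 0 c : R).
Proof.
have lin : linear (fun y : 'rV[R]_n => y 0 c : R^o) by move=> k x z; rewrite !mxE.
have cont z : {for z, continuous (fun y : 'rV[R]_n => y 0 c)} by exact: coord_continuous.
have d := @differentiable_coord _ _ _ y 0 c.
apply: DeriveDef; first exact: diff_derivable.
rewrite deriveE//.
pose L : {linear 'rV[R]_n -> R^o} :=
  HB.pack (fun y : 'rV[R]_n => y 0 c : R^o) (GRing.isLinear.Build _ _ _ _ _ lin).
by rewrite (@diff_lin _ _ _ L)//; exact: cont.
Qed.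

Lemma smooth_on_in (i : atlas X) (W : set M) f : smooth_on X W f -> smooth_in i W f.
Proof. by move=> sf; exact: sf. Qed.

Lemma pderiv_chart (i : atlas X) a c x : dom i x ->
  pderiv i a (fun y => chart i y 0 c) x = (a == c)%:R.
Proof.
move=> dx; rewrite /pderiv.
have -> : 'D_(delta_mx 0 a) ((fun y => chart i y 0 c) \o param i) (chart i x) =
    'D_(delta_mx 0 a) (fun y : 'rV[R]_n => y 0 c) (chart i x).
  apply: near_eq_derive; apply: (@open_near_eq _ _ (chart i @` (dom i `&` dom i))).
  - by apply: chart_image_open; exact: dom_open.
  - by move=> _ [y [dy _] <-]; rewrite /= chartK.
  - by exists x.
by have /@derive_val -> := coord_derive a c (chart i x); rewrite mxE eqxx eq_sym.
Qed.

(** A linear function of the coordinates, cut off by a bump that equals 1 near [x] and therefore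
    leaves the gradient at [x] unchanged. *)
Lemma grad_prescribed (i : atlas X) x (xi : 'rV[R]_n) : dom i x ->
  exists f : M -> R, smooth_on X setT f /\ grad i f x = xi.
Proof.
move=> dx; have [s cs] := bump_ex X (dom_open i) dx.
pose g := fun y => \sum_c xi 0 c * chart i y 0 c.
have sg : smooth_on X (dom i) g.
  apply: smooth_on_sum => [|c]; first exact: dom_open.
  apply: smooth_on_mul; [exact: dom_open|exact: smooth_on_cst|exact: smooth_on_coord].
exists (fun y => s y * g y); split.
  by apply: (glue_smooth openT (dom_open i) cs); rewrite setIT.
have [ss _ [W [oW xW sW]] _] := cs.
apply/rowP => a; rewrite mxE.
rewrite (pderiv_eq (W := W) (g := g) a oW (xW _ erefl) dx); last by move=> y /sW ->; rewrite mul1r.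
have hs (r : seq 'I_n) : smooth_in i (dom i) (fun y => \sum_(c <- r) xi 0 c * chart i y 0 c) /\
   pderiv i a (fun y => \sum_(c <- r) xi 0 c * chart i y 0 c) x = \sum_(c <- r) xi 0 c * (a == c)%:R.
  have od := dom_open i; elim: r => [|c r [IH1 IH2]].
    have e : (fun y : M => \sum_(c <- [::]) xi 0 c * chart i y 0 c) = (fun=> 0 : R).
      by apply/funext => y; rewrite big_nil.
    by rewrite e big_nil pderiv_cst; split => //; exact: smooth_in_cst.
  have s1 : smooth_in i (dom i) (fun y => chart i y 0 c) by apply: smooth_on_in; exact: smooth_on_coord.
  have s0 := @smooth_in_cst _ _ _ _ i (dom i) (xi 0 c).
  have s2 := smooth_in_mul od s0 s1.
  have e : (fun y => \sum_(k <- c :: r) xi 0 k * chart i y 0 k) =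
    (fun y => xi 0 c * chart i y 0 c + \sum_(k <- r) xi 0 k * chart i y 0 k).
    by apply/funext => y; rewrite big_cons.
  rewrite e big_cons; split; first exact: smooth_in_add.
  rewrite (pderiv_add a s2 IH1 dx dx) IH2 (pderiv_mul a s0 s1 dx dx) pderiv_cst mul0r add0r.
  by rewrite pderiv_chart.
rewrite /g; have [_ ->] := hs (index_enum _); rewrite (bigD1 a)//= eqxx mulr1 big1 ?addr0// => c ca.
by rewrite eq_sym (negbTE ca) mulr0.
Qed.

Lemma cutoff_section (E : vbundle S X) (j : triv_index E) (A V : set M) s (w : 'cV[S]_(rank E)) :
  open V -> V `<=` triv_dom j -> cutoff X A V s -> Cc V (fun y => sc_real S (s y) *: triv_inv j y w).
Proof.
move=> oV Vj cs; have [ss _ [W [oW xW sW]] [C [cC CV sC]]] := cs.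
apply: (Cc_supp_sub (C := C)) => //; last by move=> y /sC ->; rewrite sc_real0 scale0r.
move=> l a; have ol := triv_open l; have [h1 h2] := triv_smooth j l w a.
have aux (g : M -> R) : smooth_on X (triv_dom j `&` triv_dom l) g ->
    smooth_on X (triv_dom l) (fun y => s y * g y).
  move=> sg; apply: (glue_smooth ol oV cs).
  by apply: smooth_on_sub sg => y [/Vj jy ly].
split.
  apply: smooth_on_eq (aux _ h1) => // y _.
  by rewrite linearZ mxE sc_reM sc_re_real sc_im_real mul0r subr0.
apply: smooth_on_eq (aux _ h2) => // y _.
by rewrite linearZ mxE sc_imM sc_re_real sc_im_real mul0r addr0.
Qed.

Lemma section_prescribed (E : vbundle S X) (j : triv_index E) (V : set M) x (w : 'cV[S]_(rank E)) :
  open V -> V x -> triv_dom j x ->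
  exists u : section E, Cc V u /\ triv j x (u x) = w.
Proof.
move=> oV Vx jx; have oj := triv_open j; have oVj := openI oV oj.
have [s cs] := bump_ex X oVj (conj Vx jx : (V `&` triv_dom j) x).
exists (fun y => sc_real S (s y) *: triv_inv j y w); split.
  by apply: Cc_sub (cutoff_section w oVj _ cs) => y [].
have [_ _ [W [_ xW sW]] _] := cs.
by rewrite (sW _ (xW _ erefl)) sc_real1 scale1r triv_invK.
Qed.

End TestObjects.

Section RealInner.
Context {R : realType} {b : base_field} {n : nat} {M : ptopologicalType}.
Local Notation S := (scalars_of R b).
Context {X : manifold R n M} (mu : {measure set (borel M) -> \bar R}).
Context {E : vbundle S X} (h : bundle_metric E).
Implicit Types (u v w s t : section E) (f g : M -> R).

Definition ri u v : R := Rintegral mu setT (fun x : borel M => hr h (u x) (v x)).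

Lemma ri_inner u v : sc_re (inner mu h setT u v) = ri u v.
Proof. by rewrite sc_re_mk. Qed.

Lemma riC u v : ri u v = ri v u.
Proof. by apply: eq_Rintegral => x _; rewrite hr_sym. Qed.

Lemma ri_lin (c : R) u v w : L2 mu h setT u -> L2 mu h setT v -> L2 mu h setT w ->
  ri (slin (sc_real S c) u v) w = c * ri u w + ri v w.
Proof.
move=> Lu Lv Lw; rewrite /ri.
rewrite (@eq_Rintegral _ _ _ mu setT (fun x : borel M => c * hr h (u x) (w x) + hr h (v x) (w x))).
  rewrite RintegralD ?RintegralZl//; try exact: L2_integrable.
  by apply: integrable_scale; exact: L2_integrable.
by move=> x _; rewrite hrDl hrZl.
Qed.

Lemma ri_add u v w : L2 mu h setT u -> L2 mu h setT v -> L2 mu h setT w ->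
  ri (fun x => u x + v x) w = ri u w + ri v w.
Proof.
move=> Lu Lv Lw; have := ri_lin 1 Lu Lv Lw; rewrite mul1r => <-.
by apply: eq_Rintegral => x _; rewrite /slin sc_real1 scale1r.
Qed.

Lemma ri_rmul f u v : ri (rmul f u) v = ri u (rmul f v).
Proof. by apply: eq_Rintegral => x _; rewrite /rmul hrZl hrZr. Qed.

Lemma ri_l2ip (u v : l2sec mu h) : l2ip u v = ri (l2val u) (l2val v).
Proof. by []. Qed.

Lemma smooth_double_comm (F : vbundle S X) k (P : section E -> section F) f s :
  diff_op k P -> smooth_on X setT f -> smooth_section s -> smooth_section (double_comm P f s).
Proof.
move=> dP sf ss; have oT : open [set: M] := openT.
have sfs := smooth_rmul sf ss; have sffs := smooth_rmul sf sfs.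
have s2 : smooth_on X setT (fun x => - (2 * f x)).
  by apply: smooth_on_opp => //; apply: smooth_on_mul => //; exact: smooth_on_cst.
have s3 : smooth_on X setT (fun x => f x ^+ 2) by exact: smooth_on_mul.
have h1 := diff_op_smooth dP sffs; have h2 := smooth_rmul s2 (diff_op_smooth dP sfs).
have h3 := smooth_rmul s3 (diff_op_smooth dP ss).
have := smooth_slin 1 (smooth_slin 1 h1 h2) h3.
congr smooth_section; apply: functional_extensionality_dep => x.
by rewrite /slin !scale1r /double_comm /rmul sc_realN scaleNr.
Qed.

Lemma double_comm_zero (F : vbundle S X) k (P : section E -> section F) f s x :
  diff_op k P -> smooth_on X setT f -> smooth_section s -> ~ supp s x -> double_comm P f s x = 0.
Proof.
move=> dP sf ss nx; have sfs := smooth_rmul sf ss; have sffs := smooth_rmul sf sfs.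
rewrite /double_comm !(supp0 (x := x)) ?scaler0 ?subr0 ?addr0// => h0; apply: nx.
- exact: (diff_op_supp dP ss).
- exact/supp_rmul/(diff_op_supp dP sfs).
- exact/supp_rmul/supp_rmul/(diff_op_supp dP sffs).
Qed.

Lemma Cc_double_comm (F : vbundle S X) k (P : section E -> section F) f s W :
  diff_op k P -> smooth_on X setT f -> Cc W s -> Cc W (double_comm P f s).
Proof.
move=> dP sf [ss cs sW]; apply: (Cc_supp_sub (C := supp s)) => //.
  exact: (smooth_double_comm dP).
by move=> x; exact: double_comm_zero.
Qed.

End RealInner.

Definition comm1 (R : realType) (b : base_field) (n : nat) (M : ptopologicalType)
  (X : manifold R n M) (E F : vbundle (scalars_of R b) X) (P : section E -> section F)
  (f : M -> R) (s : section E) : section F :=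
  fun x => P (rmul f s) x - sc_real _ (f x) *: P s x.

(** * Weak form of the operator and injectivity of the symbol *)

Section Factorization.
Context {R : realType} {b : base_field} {n : nat} {M : ptopologicalType}.
Local Notation S := (scalars_of R b).
Context {X : manifold R n M} (mu : {measure set (borel M) -> \bar R}).
Context {E F : vbundle S X} (h : bundle_metric E) (hF : bundle_metric F).
Hypothesis mu_fin : forall K : set M, compact K ->
  exists U : set M, [/\ open U, K `<=` U & (mu U < +oo)%E].
Hypothesis mu_pos : forall (V : set M) x, open V -> V x -> (0 < mu V)%E.
Context (L : section E -> section E) (A : section E -> section F)
  (A' : section F -> section E) (B : section E -> section E).
Hypotheses (eL : elliptic 2 L) (dA : diff_op 1 A) (adj : formal_adjoint mu h hF A A').
Hypotheses (dB : diff_op 1 B)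
  (LE : forall s, smooth_section s -> forall x, L s x = A' (A s) x + B s x).
Implicit Types (u v s t : section E) (f g : M -> R).
Let dL : diff_op 2 L := eL.1.
Local Notation riE := (ri mu h).
Local Notation riF := (ri mu hF).

Lemma ri_L W u v : Cc W u -> Cc W v -> riE (L u) v = riF (A u) (A v) + riE (B u) v.
Proof.
move=> cu cv; have [k dA'] := adj.1; have [su ku uW] := cu; have [sv kv vW] := cv.
have cAu := Cc_diff_op dA cu; have cA'Au := Cc_diff_op dA' cAu.
rewrite (_ : L u = fun x => A' (A u) x + B u x); last first.
  by apply: functional_extensionality_dep => x; exact: LE.
rewrite ri_add; [congr (_ + _)| | |]; last 3 first.
- exact: (Cc_L2 h mu_fin cA'Au).
- exact: (Cc_L2 h mu_fin (Cc_diff_op dB cu)).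
- exact: (Cc_L2 h mu_fin cv).
have [sAu kAu _] := cAu.
have kk : compact (supp v `&` supp (A u)) by apply: compact_closedI => //; exact: supp_closed.
have e := congr1 (@sc_re _ _) (adj.2 v (A u) sv sAu kk).
have e1 := ri_inner mu hF (A v) (A u); have e2 := ri_inner mu h v (A' (A u)).
have e3 : riF (A v) (A u) = riE v (A' (A u)) by exact: etrans (esym e1) (etrans e e2).
by rewrite riC -e3 riC.
Qed.

Lemma comm1_mul f g s x : smooth_on X setT f -> smooth_on X setT g -> smooth_section s ->
  comm1 A f (rmul g s) x = sc_real S (g x) *: comm1 A f s x.
Proof.
move=> sf sg ss; have [i dx] := dom_cover X x; have [j jx] := triv_cover E x.
have [l lx] := triv_cover F x; have [c lf] := dA i j l.
apply: (triv_inj lx); rewrite linearZ /= /comm1.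
rewrite (comm1_symbol lf)//; last exact: smooth_rmul.
by rewrite (comm1_symbol lf)// /coords /rmul linearZ /= scalemxAr.
Qed.

Lemma Cc_comm1 W f s : smooth_on X setT f -> Cc W s -> Cc W (comm1 A f s).
Proof.
move=> sf cs; have h1 := Cc_diff_op dA (Cc_rmul sf cs).
have h2 := Cc_rmul (smooth_on_opp openT sf) (Cc_diff_op dA cs).
have := Cc_slin 1 h1 h2; congr Cc; apply: functional_extensionality_dep => x.
by rewrite /slin /comm1 /rmul scale1r sc_realN scaleNr.
Qed.

Lemma ri3 (f1 f2 f3 : borel M -> R) :
  mu.-integrable setT (EFin \o f1) -> mu.-integrable setT (EFin \o f2) ->
  mu.-integrable setT (EFin \o f3) ->
  Rintegral mu setT f1 + (-2 * Rintegral mu setT f2 + Rintegral mu setT f3) =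
  Rintegral mu setT (fun x => f1 x + (-2 * f2 x + f3 x)).
Proof.
move=> i1 i2 i3; have i4 := integrable_scale (-2) i2.
by rewrite RintegralD ?RintegralD ?RintegralZl//; exact: integrable_add.
Qed.

(** In the weak form of [L], move [f] through [A] by [A f = f A + [A, f]]. As [[A, f]] has order
    zero it commutes with [f], and everything cancels except the product of the two commutators. The
    part [B], of order one, has no double commutator. *)
Lemma double_comm_form W f u v : smooth_on X setT f -> Cc W u -> Cc W v ->
  riE (double_comm L f u) v = -2 * riF (comm1 A f u) (comm1 A f v).
Proof.
move=> sf cu cv; have oT : open [set: M] := openT.
have s2 : smooth_on X setT (fun x => f x ^+ 2) by exact: smooth_on_mul.
have cfu := Cc_rmul sf cu; have cffu := Cc_rmul sf cfu.
have cfv := Cc_rmul sf cv; have cffv := Cc_rmul sf cfv.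
have [su _ _] := cu; have [sv _ _] := cv; have [sfu _ _] := cfu; have [sfv _ _] := cfv.
have L2E k (P : section E -> section E) s : diff_op k P -> Cc W s -> L2 mu h setT (P s).
  by move=> dP cs; exact: (Cc_L2 h mu_fin (Cc_diff_op dP cs)).
have L2s s : Cc W s -> L2 mu h setT s by move=> cs; exact: (Cc_L2 h mu_fin cs).
have dcE k (P : section E -> section E) : diff_op k P ->
   riE (double_comm P f u) v = riE (P (rmul f (rmul f u))) v
     + (-2 * riE (P (rmul f u)) (rmul f v) + riE (P u) (rmul f (rmul f v))).
  move=> dP.
  have e : double_comm P f u = fun x => P (rmul f (rmul f u)) x +
      slin (sc_real S (-2)) (rmul f (P (rmul f u))) (rmul f (rmul f (P u))) x.
    apply: functional_extensionality_dep => x; rewrite /double_comm /slin /rmul.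
    by rewrite !scalerA -!sc_realM mulNr sc_realN scaleNr addrA expr2.
  have c1 := Cc_rmul sf (Cc_diff_op dP cfu); have c2 := Cc_rmul sf (Cc_rmul sf (Cc_diff_op dP cu)).
  rewrite e ri_add; [|exact: L2E|exact: (L2s _ (Cc_slin _ c1 c2))|exact: L2s].
  rewrite ri_lin; [|exact: L2s|exact: L2s|exact: L2s].
  by rewrite ri_rmul (ri_rmul _ _ f (rmul f (P u))) ri_rmul.
have B0 : riE (double_comm B f u) v = 0.
  rewrite /ri (@eq_Rintegral _ _ _ mu setT (fun=> 0)) ?Rintegral_cst ?mul0r//.
  by move=> x _; rewrite double_comm1// hr0.
have := dcE _ _ dB; rewrite B0 (dcE _ _ dL) !(ri_L (W := W))// => B1.
set a1 := riF _ _; set a2 := riF _ _; set a3 := riF (A u) _; set a4 := riF (comm1 A f u) _.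
suff key : a1 + (-2 * a2 + a3) = -2 * a4.
  by move: B1 key; lra.
rewrite {}/a1 {}/a2 {}/a3 {}/a4 {B1 B0 dcE}.
have cAfu := Cc_diff_op dA cfu; have cAu := Cc_diff_op dA cu; have cAv := Cc_diff_op dA cv.
have cau := Cc_comm1 sf cu; have cav := Cc_comm1 sf cv.
have E1 s : Cc W s -> A (rmul f s) = slin 1 (rmul f (A s)) (comm1 A f s).
  move=> cs; apply: functional_extensionality_dep => x.
  by rewrite /slin /comm1 scale1r /rmul addrC subrK.
have cm s : Cc W s -> comm1 A f (rmul f s) = rmul f (comm1 A f s).
  by move=> [ss _ _]; apply: functional_extensionality_dep => x; exact: comm1_mul.
rewrite (E1 _ cfu) (E1 _ cu) (E1 _ cfv) (E1 _ cv) !cm//.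
have L2F (s : section F) : Cc W s -> L2 mu hF setT s by move=> cs; exact: (Cc_L2 hF mu_fin cs).
have c3 := Cc_slin 1 (Cc_rmul sf cAu) cau; have c4 := Cc_slin 1 (Cc_rmul sf cAv) cav.
have c5 := Cc_slin 1 (Cc_rmul sf c3) (Cc_rmul sf cau).
have c6 := Cc_slin 1 (Cc_rmul sf c4) (Cc_rmul sf cav).
have i1 := L2_integrable (L2F _ c5) (L2F _ cAv).
have i2 := L2_integrable (L2F _ c3) (L2F _ c4).
have i3 := L2_integrable (L2F _ cAu) (L2F _ c6).
rewrite (ri3 i1 i2 i3) /ri -[RHS]RintegralZl//; last first.
  exact: L2_integrable (L2F _ cau) (L2F _ cav).
apply: eq_Rintegral => x _; rewrite /slin /rmul !scale1r.
move: (A u x) (A v x) (comm1 A f u x) (comm1 A f v x) (f x) => p q r t y.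
rewrite !(hrDl, hrDr, hrZl, hrZr).
by move: (hr _ _ _) (hr _ _ _) (hr _ _ _) (hr _ _ _) => *; ring.
Qed.

(** Take [f] with differential [xi] and [u] with value [w] at [x0]; then [[A, f] u] vanishes at
    [x0]. If the double commutator [Z] of [L] did not, the function [G] would be positive near [x0],
    while [double_comm_form] tested against a cutoff multiple of [Z] makes its weighted integral
    zero. Hence [Z] vanishes at [x0]; its value there is twice the symbol of [L] applied to [w], so
    ellipticity gives [w = 0]. *)
Lemma symbol_injective (i : atlas X) (j : triv_index E) (l : triv_index F)
  (c : seq 'I_n -> M -> 'M[S]_(rank F, rank E)) x0 (xi : 'rV[R]_n) : local_form 1 A i j l c ->
  dom i x0 -> triv_dom j x0 -> triv_dom l x0 -> xi != 0 ->
  forall w : 'cV[S]_(rank E), symbol 1 c x0 xi *m w = 0 -> w = 0.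
Proof.
move=> lf dx jx lx xi0 w w0.
have [f [sf gf]] := grad_prescribed xi dx.
have [u [cu uw]] := section_prescribed w openT I jx.
have [su _ _] := cu; have cZ := Cc_double_comm dL sf cu; have [sZ _ _] := cZ.
have cau := Cc_comm1 sf cu; have [sau _ _] := cau.
have caZ := Cc_comm1 sf cZ; have [saZ _ _] := caZ.
set Z := double_comm L f u in cZ sZ caZ saZ.
have au0 : comm1 A f u x0 = 0.
  by apply: (triv_inj lx); rewrite linear0 (comm1_symbol lf)// gf /coords uw.
have Z0 : Z x0 = 0.
  apply: contrapT => /eqP Zx0.
  pose G x := hr h (Z x) (Z x) + 2 * hr hF (comm1 A f u x) (comm1 A f Z x).
  have sG : smooth_on X setT G.
    apply: smooth_on_add; [exact: openT|exact: hr_smooth|].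
    by apply: smooth_on_mul; [exact: openT|exact: smooth_on_cst|exact: hr_smooth].
  pose d := G x0 / 2.
  have Gd : 0 < G x0 by rewrite /G au0 hr0 mulr0 addr0 hr_gt0.
  have d0 : 0 < d by rewrite divr_gt0.
  have : nbhs x0 [set x | d < G x].
    apply: cvgr_gt (smooth_on_continuous openT sG I) _ _.
    by rewrite ltr_pdivrMr// ltr_pMr// ltr1n.
  rewrite nbhsE => -[V [oV Vx] VG].
  have [p cp] := bump_ex X oV Vx.
  have [sp p01 [W [oW xW pW]] [C [cC CV pC]]] := cp.
  have cpZ := Cc_rmul sp cZ.
  have := double_comm_form sf cu cpZ; rewrite -/Z.
  have -> : comm1 A f (rmul p Z) = rmul p (comm1 A f Z).
    by apply: functional_extensionality_dep => x; exact: comm1_mul.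
  rewrite -!ri_rmul => eZ.
  have L2Z := Cc_L2 h mu_fin cZ; have L2pZ := Cc_L2 h mu_fin cpZ.
  have L2a := Cc_L2 hF mu_fin (Cc_rmul sp cau); have L2aZ := Cc_L2 hF mu_fin caZ.
  have iG : mu.-integrable setT (EFin \o (fun x : borel M => p x * G x)).
    have := integrable_add (L2_integrable L2pZ L2Z) (integrable_scale 2 (L2_integrable L2a L2aZ)).
    apply: eq_integrable => // x _ /=; congr EFin; rewrite /G /rmul hrZl hrZl; ring.
  have IG : Rintegral mu setT (fun x : borel M => p x * G x) = 0.
    have -> : Rintegral mu setT (fun x : borel M => p x * G x) =
       riE (rmul p Z) Z + 2 * riF (rmul p (comm1 A f u)) (comm1 A f Z).
      rewrite /ri -RintegralZl//; last exact: L2_integrable.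
      rewrite -RintegralD//; [|exact: L2_integrable|by apply: integrable_scale; exact: L2_integrable].
      apply: eq_Rintegral => x _; rewrite /G /rmul !hrZl; ring.
    by rewrite eZ mulNr addNr.
  have mWV : measurable (W `&` V : set (borel M)) by apply: borel_open; exact: openI.
  have : (d%:E * mu (W `&` V) <= \int[mu]_x (p x * G x)%:E)%E.
    apply: (@le_trans _ _ (\int[mu]_x (d * \1_(W `&` V : set (borel M)) x)%:E)%E).
      under eq_integral do rewrite EFinM.
      rewrite ge0_integralZl//; last 2 first.
      - by apply/measurable_EFinP; exact: measurable_indic.
      - by rewrite lee_fin ltW.
      by rewrite integral_indic// setIT.
    apply: ge0_le_integral => //.
    - by move=> x _; rewrite lee_fin mulr_ge0// ltW.
    - apply/measurable_EFinP; apply: measurable_funM; first exact: measurable_cst.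
      exact: measurable_indic.
    - by case/integrableP : iG.
    - move=> x _; rewrite lee_fin indicE; have /andP[p0 p1] := p01 x.
      case: (pselect ((W `&` V) x)) => WVx.
        rewrite mem_set// mulr1 pW ?mul1r; last by case: WVx.
        by apply/ltW/VG; case: WVx.
      rewrite memNset// mulr0.
      have [Vx'|nV] := pselect (V x).
        by rewrite mulr_ge0//; apply/ltW; apply: lt_trans d0 (VG _ Vx').
      by rewrite pC ?mul0r// => /CV.
  have -> : (\int[mu]_x (p x * G x)%:E = 0)%E.
    have fin := integrable_fin_num measurableT iG.
    by rewrite -[LHS]fineK// -[RHS]/(0%:E); congr EFin.
  apply/negP; rewrite -ltNge mule_gt0 ?lte_fin//; apply: (mu_pos (x := x0)); first exact: openI.
  by split => //; exact: xW.
have [c2 lf2] := dL i j j.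
have := congr1 (triv j x0) Z0.
rewrite linear0 /Z /double_comm (comm2_symbol lf2)//= gf /coords uw => h2.
have uS := eL.2 i j c2 lf2 x0 dx jx xi xi0.
have : symbol 2 c2 x0 xi *m w = 0.
  have two : sc_real S 2 != 0.
    apply/eqP => /(congr1 (@sc_re _ _)); rewrite sc_re_real sc_re0 => /eqP.
    by rewrite pnatr_eq0.
  by move: h2; rewrite -scalemxAl => /eqP; rewrite scaler_eq0 (negbTE two) => /eqP.
by move=> h3; rewrite -(mulKmx uS w) h3 mulmx0.
Qed.

Lemma sum_tuple1 (V : nmodType) (G : seq 'I_n -> V) :
  \sum_(t : 1.-tuple 'I_n) G t = \sum_a G [:: a].
Proof.
rewrite (reindex (fun a : 'I_n => [tuple a])) /=; first by [].
exists (fun t : 1.-tuple 'I_n => thead t) => [a _|t _]; first by rewrite /thead (tnth_nth a).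
by case/tupleP: t => a t; rewrite (tuple0 t); apply: val_inj.
Qed.

Lemma sum_tuple0 (V : nmodType) (G : seq 'I_n -> V) :
  \sum_(t : 0.-tuple 'I_n) G t = G [::].
Proof.
rewrite (eq_bigr (fun=> G [::])); last by move=> t _; rewrite (tuple0 t).
by rewrite sumr_const card_tuple expn0.
Qed.

Lemma symbol1E (p q : nat) (c : seq 'I_n -> M -> 'M[S]_(p, q)) x (xi : 'rV[R]_n) :
  symbol 1 c x xi = \sum_a sc_real S (xi 0 a) *: c [:: a] x.
Proof.
rewrite /symbol (sum_tuple1 (fun t : seq 'I_n => sc_real S (\prod_(a <- t) xi 0 a) *: c t x)).
by apply: eq_bigr => a _; rewrite big_seq1.
Qed.

(** Injectivity gives a lower bound for each covector. Linearity of the symbol makes it locally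
    uniform, compactness of the unit sphere uniform, and homogeneity extends it to all covectors. *)
Lemma symbol_bound (i : atlas X) (j : triv_index E) (l : triv_index F)
  (c : seq 'I_n -> M -> 'M[S]_(rank F, rank E)) x0 : local_form 1 A i j l c ->
  dom i x0 -> triv_dom j x0 -> triv_dom l x0 ->
  exists C : R, 0 < C /\ forall (xi : 'I_n -> R) (w : 'cV[S]_(rank E)),
    (\sum_a xi a ^+ 2) * cnsq w <= C * cnsq ((\sum_a sc_real S (xi a) *: c [:: a] x0) *m w).
Proof.
move=> lf dx jx lx; pose sg (xi : 'rV[R]_n) := \sum_a sc_real S (xi 0 a) *: c [:: a] x0.
pose N (xi : 'rV[R]_n) := \sum_a xi 0 a ^+ 2.
have cN (z : 'rV[R]_n) : {for z, continuous (fun xi : 'rV[R]_n => N (xi - z))}.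
  apply: (class_C_continuous (k := 0) (U := setT)) => //; apply: class_C_sum; first exact: openT.
  move=> a; have s1 : class_C 0 setT (fun xi : 'rV[R]_n => xi 0 a + - z 0 a).
    by apply: class_C_add; [exact: openT|exact: class_C_coord|exact: class_C_cst].
  apply: class_C_eq (class_C_mul openT s1 s1) => //; first exact: openT.
  by move=> y _; rewrite !mxE expr2.
have cN0 z : {for z, continuous N}.
  apply: (class_C_continuous (k := 0) (U := setT)) => //; apply: class_C_sum; first exact: openT.
  by move=> a; exact: (class_C_mul openT (class_C_coord _ _ _) (class_C_coord _ _ _)).
have cmp : compact ([set xi | N xi = 1] : set 'rV[R]_n).
  apply: (subclosed_compact (B := cbox 0 1)); last first.
  - move=> xi /= Nxi a; rewrite mxE subr0; apply: norm_le_sqr => //.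
    by rewrite expr1n -Nxi /N (bigD1 a)//= lerDl sumr_ge0// => k _; exact: sqr_ge0.
  - exact: cbox_compact.
  have -> : [set xi | N xi = 1] = N @^-1` [set 1] by [].
  by apply: closed_comp => [xi _|]; [exact: cN0|exact: closed_eq].
have [K [K0 HK]] : exists K : R, 0 < K /\ forall xi w, cnsq (sg xi *m w) <= K * N xi * cnsq w.
  pose k a := (rank E)%:R * (\sum_p \sum_q nsq (c [:: a] x0 p q)).
  have k0 a : 0 <= k a.
    by rewrite mulr_ge0// sumr_ge0// => p _; rewrite sumr_ge0// => q _; exact: nsq_ge0.
  have s0 : 0 <= \sum_a k a by exact: sumr_ge0.
  exists (n%:R * (\sum_a k a) + 1); split; first by rewrite ltr_wpDl// mulr_ge0.
  move=> xi w; rewrite /sg mulmx_suml; apply: le_trans (cnsq_sum_le _ _) _.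
  have N0 : 0 <= N xi by apply: sumr_ge0 => a _; exact: sqr_ge0.
  have w0 := cnsq_ge0 w.
  rewrite /index_enum -enumT size_enum_ord enumT.
  apply: (@le_trans _ _ (n%:R * ((\sum_a k a) * N xi * cnsq w))); last first.
    rewrite !mulrA; apply: ler_wpM2r => //; apply: ler_wpM2r => //.
    by rewrite lerDl.
  apply: ler_wpM2l => //; rewrite -mulrA mulr_suml; apply: ler_sum => a _.
  rewrite -scalemxAl cnsqZ nsq_real; apply: le_trans (_ : N xi * (k a * cnsq w) <= _).
    apply: ler_pM; [exact: sqr_ge0|exact: cnsq_ge0| |exact: cnsq_mulmx_le].
    by rewrite /N (bigD1 a)//= lerDl sumr_ge0// => p _; exact: sqr_ge0.
  by rewrite mulrCA.
have sgB xi z (w : 'cV[S]_(rank E)) : sg xi *m w = sg z *m w + sg (xi - z) *m w.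
  rewrite -mulmxDl; congr (_ *m _); rewrite /sg -big_split; apply: eq_bigr => a _ /=.
  have {1}-> : xi 0 a = z 0 a + (xi - z) 0 a by rewrite !mxE; ring.
  by rewrite sc_realD scalerDl.
have [C [C0 HC]] : exists C : R, 0 < C /\ forall xi, N xi = 1 -> forall w,
    cnsq w <= C * cnsq (sg xi *m w).
  apply: (compact_induction (P := fun Q => exists C : R, 0 < C /\ forall xi, Q xi ->
    forall w, cnsq w <= C * cnsq (sg xi *m w))) cmp _ _ _ _.
  - by exists 1.
  - by move=> Q Q' QQ' [C [C0 HC]]; exists C; split => // xi /QQ'; exact: HC.
  - move=> Q Q' [C [C0 HC]] [C' [C'0 HC']]; exists (C + C'); split; first exact: addr_gt0.
    move=> xi Qxi w; have y0 := cnsq_ge0 (sg xi *m w); rewrite mulrDl.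
    case: Qxi => [/HC/(_ w) q1|/HC'/(_ w) q1]; apply: le_trans q1 _.
      by rewrite lerDl mulr_ge0// ltW.
    by rewrite lerDr mulr_ge0// ltW.
  - move=> z Nz.
    have zinj : forall w : 'cV[S]_(rank E), sg z *m w = 0 -> w = 0.
      move=> w; rewrite /sg -symbol1E; apply: (symbol_injective lf) => //.
      apply/eqP => z0; have h1 : N z = 1 by exact: Nz.
      have h0 : N 0 = 0 by rewrite /N big1// => a _; rewrite mxE expr0n.
      have h01 : (0 : R) = 1 by rewrite -h0 -h1 z0.
      by have := oner_neq0 R; rewrite -h01 eqxx.
    have [q q0 Hq] := mulmx_injective_bound zinj.
    (* Within this distance the symbol changes by at most [q / 4] in square, which uses up half of
       the lower bound [q] at [z]. *)
    pose d := q / (4 * K); have d0 : 0 < d by rewrite divr_gt0// mulr_gt0.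
    have : nbhs z [set xi | N (xi - z) < d].
      apply: cvgr_lt (cN z) _ _; rewrite /N big1// => a _; by rewrite !mxE subrr expr0n.
    rewrite nbhsE => -[U [oU Uz] UN]; exists U; split => //.
    exists (4 / q); split; first by rewrite divr_gt0.
    move=> xi Uxi w.
    have y1 := Hq w; have y2 := HK (xi - z) w; have y3 := UN _ Uxi.
    have e : sg z *m w = sg xi *m w + - (sg (xi - z) *m w) by rewrite (sgB xi z) addrK.
    have y4 : cnsq (sg z *m w) <= 2 * cnsq (sg xi *m w) + 2 * cnsq (sg (xi - z) *m w).
      by rewrite e; apply: le_trans (cnsqD_le _ _) _; rewrite cnsqN.
    have y5 : cnsq (sg (xi - z) *m w) <= q / 4 * cnsq w.
      apply: le_trans y2 _; apply: ler_wpM2r; first exact: cnsq_ge0.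
      have -> : q / 4 = K * d by rewrite /d; field; exact: lt0r_neq0.
      by apply: ler_wpM2l; exact: ltW.
    rewrite mulrAC ler_pdivlMr//.
    have y6 := cnsq_ge0 (sg xi *m w).
    have y7 : cnsq w * q <= 2 * cnsq (sg xi *m w) + 2 * (q / 4 * cnsq w).
      by rewrite mulrC; move: y1 y4 y5; lra.
    by move: y7; rewrite mulrC; lra.
exists C; split => // xi w; pose z : 'rV[R]_n := \row_a xi a.
have -> : \sum_a xi a ^+ 2 = N z by apply: eq_bigr => a _; rewrite mxE.
have -> : \sum_a sc_real S (xi a) *: c [:: a] x0 = sg z by apply: eq_bigr => a _; rewrite mxE.
have N0 : 0 <= N z by apply: sumr_ge0 => a _; exact: sqr_ge0.
have [Nz|Nz] := eqVneq (N z) 0.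
  by rewrite Nz mul0r mulr_ge0 ?cnsq_ge0// ltW.
have Np : 0 < N z by rewrite lt_neqAle eq_sym Nz.
pose t := (Num.sqrt (N z))^-1.
have t2 : t ^+ 2 = (N z)^-1 by rewrite exprVn sqr_sqrtr.
have Nt : N (t *: z) = 1.
  rewrite /N (eq_bigr (fun a => t ^+ 2 * z 0 a ^+ 2)); last by move=> a _; rewrite mxE exprMn.
  by rewrite -mulr_sumr t2 mulVf.
have := HC _ Nt w.
have -> : sg (t *: z) = sc_real S t *: sg z.
  by rewrite /sg scaler_sumr; apply: eq_bigr => a _; rewrite mxE sc_realM scalerA.
rewrite -scalemxAl cnsqZ nsq_real t2 => y1.
have := ler_wpM2l N0 y1.
have -> // : N z * (C * ((N z)^-1 * cnsq (sg z *m w))) = C * cnsq (sg z *m w).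
by field; exact: lt0r_neq0.
Qed.

End Factorization.

(** * Grid estimates *)

Section ScalarGrids.
Context {R : realType} {b : base_field}.
Local Notation S := (scalars_of R b).
Context (n N : nat).
Local Notation G := {ffun 'I_n -> 'I_N.+1}.

Definition reim (z : S) (g : bool) : R := if g then sc_re z else sc_im z.

Lemma sum_bool (F : bool -> R) : \sum_g F g = F true + F false.
Proof. by rewrite big_bool. Qed.

Lemma sum_pair_bool (m : nat) (F : 'I_m -> bool -> R) :
  \sum_(i : 'I_m * bool) F i.1 i.2 = \sum_i (F i true + F i false).
Proof. by rewrite -(pair_bigA _ F) /=; apply: eq_bigr => i _; rewrite sum_bool. Qed.

Lemma cnsq_reim (m : nat) (w : 'cV[S]_m) : cnsq w = \sum_(i : 'I_m * bool) reim (w i.1 0) i.2 ^+ 2.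
Proof. by rewrite (sum_pair_bool (fun i g => reim (w i 0) g ^+ 2)). Qed.

(** The real matrix of [A] on pairs of real and imaginary parts. Over the real field it acts on two
    independent copies, so that both fields share one index set. *)
Definition real_rep (p m : nat) (A : 'M[S]_(p, m)) (q : 'I_p * bool) (i : 'I_m * bool) : R :=
  if q.2 then (if i.2 then sc_re (A q.1 i.1) else - sc_im (A q.1 i.1))
  else (if i.2 then sc_im (A q.1 i.1) else sc_re (A q.1 i.1)).

Lemma real_repE (p m : nat) (A : 'M[S]_(p, m)) (w : 'cV[S]_m) q :
  reim ((A *m w) q.1 0) q.2 = \sum_i real_rep A q i * reim (w i.1 0) i.2.
Proof.
case: q => q g; rewrite (sum_pair_bool (fun i g' => real_rep A (q, g) (i, g') * reim (w i 0) g')).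
rewrite mxE /reim /real_rep /=; case: g.
  by rewrite sc_re_sum; apply: eq_bigr => i _; rewrite sc_reM mulNr.
by rewrite sc_im_sum; apply: eq_bigr => i _; rewrite sc_imM addrC.
Qed.

End ScalarGrids.

Section RealRepresentation.
Context {R : realType}.

(** Here the imaginary half of [w] belongs to no vector over the field; the hypothesis is applied to
    the two halves separately. *)
Lemma real_rep_bound_real (p m : nat) (A : 'M[scalars_of R RealField]_(p, m)) (K C : R) : 0 <= C ->
  (forall w : 'cV[scalars_of R RealField]_m, K * cnsq w <= C * cnsq (A *m w)) ->
  forall w : 'I_m * bool -> R,
    K * (\sum_i w i ^+ 2) <= C * \sum_q (\sum_i real_rep A q i * w i) ^+ 2.
Proof.
move=> C0 hA w.
pose v g : 'cV[scalars_of R RealField]_m := \col_i w (i, g).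
have vE i g : v g i 0 = w (i, g) by rewrite mxE.
have nsqE (x : scalars_of R RealField) : nsq x = (x : R) ^+ 2 by rewrite /nsq /= expr0n /= addr0.
have E1 : \sum_i w i ^+ 2 = cnsq (v true) + cnsq (v false).
  rewrite (eq_bigr (fun i => w (i.1, i.2) ^+ 2)); last by move=> [].
  rewrite (sum_pair_bool (fun i g => w (i, g) ^+ 2)) -big_split; apply: eq_bigr => i _.
  by rewrite !nsqE !vE.
rewrite E1 mulrDr.
apply: le_trans (lerD (hA (v true)) (hA (v false))) _; rewrite -mulrDr; apply: ler_wpM2l => //.
pose F (q : 'I_p) (g : bool) := (\sum_i real_rep A (q, g) i * w i) ^+ 2.
rewrite [leRHS](eq_bigr (fun q => F q.1 q.2)); last by move=> [].
rewrite (sum_pair_bool F) -big_split; apply: ler_sum => q _.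
have key g : (A *m v g) q 0 = (\sum_i real_rep A (q, g) i * w i : R).
  rewrite (eq_bigr (fun i => real_rep A (q, g) (i.1, i.2) * w (i.1, i.2))); last by move=> [].
  rewrite (sum_pair_bool (fun i g' => real_rep A (q, g) (i, g') * w (i, g'))) mxE.
  apply: eq_bigr => i _; rewrite vE /real_rep /=; case: g.
    by rewrite oppr0 mul0r addr0.
  by rewrite mul0r add0r.
by rewrite !nsqE !key.
Qed.

Lemma real_rep_bound_complex (p m : nat) (A : 'M[scalars_of R ComplexField]_(p, m)) (K C : R) :
  (forall w : 'cV[scalars_of R ComplexField]_m, K * cnsq w <= C * cnsq (A *m w)) ->
  forall w : 'I_m * bool -> R,
    K * (\sum_i w i ^+ 2) <= C * \sum_q (\sum_i real_rep A q i * w i) ^+ 2.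
Proof.
move=> hA w.
pose v : 'cV[scalars_of R ComplexField]_m := \col_i Complex (w (i, true)) (w (i, false)).
have vE i : reim (v i.1 0) i.2 = w i by case: i => i []; rewrite /reim /= mxE.
have := hA v; rewrite !cnsq_reim.
have -> : \sum_i reim (v i.1 0) i.2 ^+ 2 = \sum_i w i ^+ 2 by apply: eq_bigr => i _; rewrite vE.
have -> // : \sum_i reim ((A *m v) i.1 0) i.2 ^+ 2 = \sum_q (\sum_i real_rep A q i * w i) ^+ 2.
apply: eq_bigr => q _; rewrite real_repE; congr (_ ^+ 2); apply: eq_bigr => i _.
by rewrite vE.
Qed.

End RealRepresentation.

Section ScalarGarding.
Context {R : realType} {b : base_field}.
Local Notation S := (scalars_of R b).
Context (n N : nat).
Local Notation G := {ffun 'I_n -> 'I_N.+1}.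

Lemma real_rep_bound (p m : nat) (A : 'M[S]_(p, m)) (K C : R) : 0 <= C ->
  (forall w : 'cV[S]_m, K * cnsq w <= C * cnsq (A *m w)) ->
  forall w : 'I_m * bool -> R,
    K * (\sum_i w i ^+ 2) <= C * \sum_q (\sum_i real_rep A q i * w i) ^+ 2.
Proof.
move: A; case: b => A C0 hA; first exact: real_rep_bound_real.
exact: real_rep_bound_complex.
Qed.

Lemma real_rep_sum (p m : nat) (xi : 'I_n -> R) (a : 'I_n -> 'M[S]_(p, m)) q i :
  real_rep (\sum_j sc_real S (xi j) *: a j) q i = \sum_j xi j * real_rep (a j) q i.
Proof.
rewrite /real_rep !summxE !sc_re_sum !sc_im_sum.
have eR : \sum_j sc_re ((sc_real S (xi j) *: a j) q.1 i.1) = \sum_j xi j * sc_re (a j q.1 i.1).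
  by apply: eq_bigr => j _; rewrite mxE sc_reM sc_re_real sc_im_real mul0r subr0.
have eI : \sum_j sc_im ((sc_real S (xi j) *: a j) q.1 i.1) = \sum_j xi j * sc_im (a j q.1 i.1).
  by apply: eq_bigr => j _; rewrite mxE sc_imM sc_re_real sc_im_real mul0r addr0.
case: q.2; case: i.2; rewrite ?eR ?eI //.
by rewrite -sumrN; apply: eq_bigr => j _; rewrite mulrN.
Qed.

Lemma garding_scalars (p m : nat) (a : 'I_n -> 'M[S]_(p, m)) (C : R) (ej : 'I_n -> G)
  (U : G -> 'cV[S]_m) : 0 <= C ->
  (forall (xi : 'I_n -> R) (w : 'cV[S]_m),
    (\sum_j xi j ^+ 2) * cnsq w <= C * cnsq ((\sum_j sc_real S (xi j) *: a j) *m w)) ->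
  \sum_(x : G) \sum_j cnsq (U (x + ej j) - U (x - ej j)) <=
  C * \sum_(x : G) cnsq (\sum_j a j *m (U (x + ej j) - U (x - ej j))).
Proof.
move=> C0 ha; pose u x (i : 'I_m * bool) := reim (U x i.1 0) i.2.
have reimB (v w : 'cV[S]_m) (i : 'I_m * bool) : reim ((v - w) i.1 0) i.2 = reim (v i.1 0) i.2 - reim (w i.1 0) i.2.
  by rewrite /reim !mxE; case: i.2; rewrite ?sc_reD ?sc_imD ?sc_reN ?sc_imN.
have hyp (xi : 'I_n -> R) (w : 'I_m * bool -> R) : (\sum_j xi j ^+ 2) * (\sum_i w i ^+ 2)
    <= C * \sum_q (\sum_j \sum_i xi j * real_rep (a j) q i * w i) ^+ 2.
  apply: le_trans (real_rep_bound C0 (ha xi) w) _.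
  rewrite le_eqVlt; apply/orP; left; apply/eqP; congr (_ * _); apply: eq_bigr => q _.
  congr (_ ^+ 2); rewrite exchange_big; apply: eq_bigr => i _ /=.
  by rewrite real_rep_sum mulr_suml.
have := discrete_garding ej u hyp.
have -> : \sum_(x : G) \sum_j \sum_i central_diff ej u j x i ^+ 2 =
  \sum_(x : G) \sum_j cnsq (U (x + ej j) - U (x - ej j)).
  apply: eq_bigr => x _; apply: eq_bigr => j _; rewrite cnsq_reim.
  by apply: eq_bigr => i _; rewrite reimB.
move/le_trans; apply; rewrite le_eqVlt; apply/orP; left; apply/eqP; congr (_ * _).
apply: eq_bigr => x _; rewrite cnsq_reim; apply: eq_bigr => q _; congr (_ ^+ 2).
have -> : reim ((\sum_j a j *m (U (x + ej j) - U (x - ej j))) q.1 0) q.2 =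
   \sum_j reim ((a j *m (U (x + ej j) - U (x - ej j))) q.1 0) q.2.
  by rewrite /reim summxE; case: q.2; rewrite ?sc_re_sum ?sc_im_sum.
apply: eq_bigr => j _; rewrite real_repE; apply: eq_bigr => i _.
by rewrite reimB.
Qed.

Lemma poincare_scalars (m k : nat) (U : G -> 'cV[S]_m) (ej : 'I_n -> G) : (0 < k)%N ->
  (forall j, ej j = [ffun i => if i == j then inZp 1 else 0]) ->
  exists d : {ffun 'I_n -> 'I_k},
    \sum_(x : G) cnsq (U x - U (x - block_residue k x + offset N d))
    <= 4 ^+ n * k%:R ^+ 2 * \sum_j \sum_(x : G) cnsq (U (x + ej j) - U x).
Proof.
move=> k0 he; pose u x (i : 'I_m * bool) := reim (U x i.1 0) i.2.
have [d hd] := discrete_poincare u k0 he; exists d.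
have reimB (v w : 'cV[S]_m) (i : 'I_m * bool) : reim ((v - w) i.1 0) i.2 = reim (v i.1 0) i.2 - reim (w i.1 0) i.2.
  by rewrite /reim !mxE; case: i.2; rewrite ?sc_reD ?sc_imD ?sc_reN ?sc_imN.
have -> : \sum_(x : G) cnsq (U x - U (x - block_residue k x + offset N d)) =
   \sum_(x : G) \sum_i (u x i - u (x - block_residue k x + offset N d) i) ^+ 2.
  by apply: eq_bigr => x _; rewrite cnsq_reim; apply: eq_bigr => i _; rewrite reimB.
apply: le_trans hd _; rewrite le_eqVlt; apply/orP; left; apply/eqP; congr (_ * _).
apply: eq_bigr => j _; apply: eq_bigr => x _; rewrite cnsq_reim.
by apply: eq_bigr => i _; rewrite reimB.
Qed.

End ScalarGarding.

(** * Gårding's inequality with frozen coefficients *)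

Section DiscreteGradient.
Context {R : realType} {b : base_field} (n : nat).
Local Notation S := (scalars_of R b).
Local Notation G N := {ffun 'I_n -> 'I_N.+1}.

(* [a0] are the frozen coefficients and [e] bounds the discretization error. *)
Lemma discrete_gradient (p m : nat) (C K0 Ka th : R) : 0 <= C -> 0 <= K0 -> 0 <= Ka ->
  0 <= th -> 16 * C * n%:R * th <= 1 ->
  exists K1, 0 <= K1 /\ forall (N : nat) (s e : R) (U : G N -> 'cV[S]_m) (D : G N -> 'I_n -> 'cV[S]_m)
    (Au : G N -> 'cV[S]_p) (a0 : 'I_n -> 'M[S]_(p, m)) (a : G N -> 'I_n -> 'M[S]_(p, m))
    (c0 : G N -> 'M[S]_(p, m)) (ej : 'I_n -> G N), 0 < s -> 0 <= e ->
  (forall (xi : 'I_n -> R) (w : 'cV[S]_m),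
    (\sum_j xi j ^+ 2) * cnsq w <= C * cnsq ((\sum_j sc_real S (xi j) *: a0 j) *m w)) ->
  (forall k j w, cnsq ((a k j - a0 j) *m w) <= th * cnsq w) ->
  (forall k w, cnsq (c0 k *m w) <= K0 * cnsq w) ->
  (forall j w, cnsq (a0 j *m w) <= Ka * cnsq w) ->
  (forall k, Au k = c0 k *m U k + \sum_j a k j *m D k j) ->
  (forall k j, cnsq (U (k + ej j) - U (k - ej j) - sc_real S (2 * s) *: D k j) <= s ^+ 2 * e) ->
  \sum_(k : G N) \sum_j cnsq (D k j) <= K1 * \sum_(k : G N) (cnsq (Au k) + cnsq (U k) + e).
Proof.
move=> C0 K00 Ka0 th0 small.
exists (2 * (16 * C + 16 * C * K0 + C * n%:R ^+ 2 * Ka + n%:R)); split.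
  by rewrite mulr_ge0 ?addr_ge0 ?mulr_ge0 ?exprn_ge0.
move=> N s e U D Au a0 a c0 ej s0 e0 hg hth hK0 hKa hAu he.
pose cd k j := U (k + ej j) - U (k - ej j).
have s2 : 0 < s ^+ 2 by rewrite exprn_gt0.
pose T := \sum_(k : G N) \sum_j cnsq (D k j); rewrite -/T.
pose Z := \sum_(k : G N) (cnsq (Au k) + cnsq (U k) + e).
have T0 : 0 <= T by apply: sumr_ge0 => k _; apply: sumr_ge0 => j _; exact: cnsq_ge0.
pose NN : R := \sum_(k : G N) 1.
have h1 : 4 * s ^+ 2 * T <= 2 * (\sum_(k : G N) \sum_j cnsq (cd k j)) + 2 * n%:R * (s ^+ 2 * (e * NN)).
  rewrite /T /NN !mulr_sumr -big_split /=; apply: ler_sum => k _.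
  rewrite !mulr1; rewrite !mulr_sumr.
  have -> : 2 * n%:R * (s ^+ 2 * e) = \sum_(j < n) 2 * (s ^+ 2 * e).
    by rewrite sumr_const card_ord -mulr_natr; ring.
  rewrite -big_split /=; apply: ler_sum => j _.
  have -> : 4 * s ^+ 2 * cnsq (D k j) = cnsq (cd k j + - (cd k j - sc_real S (2 * s) *: D k j)).
    by rewrite opprB addrC subrK cnsqZ nsq_real; ring.
  apply: le_trans (cnsqD_le _ _) _; rewrite cnsqN lerD2l; apply: ler_wpM2l => //.
  exact: he.
have h2 := garding_scalars ej U C0 hg.
have h3 : \sum_(x : G N) cnsq (\sum_j a0 j *m cd x j) <=
   2 * n%:R ^+ 2 * Ka * (s ^+ 2 * (e * NN)) + 8 * s ^+ 2 * \sum_(k : G N) cnsq (\sum_j a0 j *m D k j).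
  rewrite /NN !mulr_sumr -big_split /=; apply: ler_sum => k _; rewrite !mulr1.
  have -> : \sum_j a0 j *m cd k j = \sum_j a0 j *m (cd k j - sc_real S (2 * s) *: D k j)
     + sc_real S (2 * s) *: \sum_j a0 j *m D k j.
    rewrite scaler_sumr -big_split; apply: eq_bigr => j _ /=.
    by rewrite [in RHS]scalemxAr -mulmxDr subrK.
  apply: le_trans (cnsqD_le _ _) _; rewrite cnsqZ nsq_real.
  apply: lerD; last by rewrite le_eqVlt; apply/orP; left; apply/eqP; ring.
  apply: (@le_trans _ _ (2 * (n%:R * \sum_(j < n) Ka * (s ^+ 2 * e)))).
    apply: ler_wpM2l => //; apply: le_trans (cnsq_sum_le _ _) _.
    rewrite /index_enum -enumT size_enum_ord enumT; apply: ler_wpM2l => //.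
    apply: ler_sum => j _; apply: le_trans (hKa _ _) _; apply: ler_wpM2l => //; exact: he.
  by rewrite sumr_const card_ord -mulr_natr le_eqVlt; apply/orP; left; apply/eqP; ring.
have h4 : \sum_(k : G N) cnsq (\sum_j a0 j *m D k j) <= 4 * Z + 4 * K0 * Z + 2 * n%:R * th * T.
  rewrite /Z /T !mulr_sumr -!big_split /=; apply: ler_sum => k _.
  have -> : \sum_j a0 j *m D k j = Au k + - (c0 k *m U k) + - \sum_j (a k j - a0 j) *m D k j.
    rewrite hAu [c0 k *m U k + _]addrC addrK -sumrB; apply: eq_bigr => j _.
    by rewrite mulmxBl opprB addrC subrK.
  apply: le_trans (cnsqD_le _ _) _; rewrite cnsqN.
  have q1 := cnsqD_le (Au k) (- (c0 k *m U k)); rewrite cnsqN in q1.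
  have q2 := hK0 k (U k); have q3 := cnsq_ge0 (U k); have q5 := cnsq_ge0 (Au k).
  have q4 : cnsq (\sum_j (a k j - a0 j) *m D k j) <= n%:R * (th * \sum_j cnsq (D k j)).
    apply: le_trans (cnsq_sum_le _ _) _; rewrite /index_enum -enumT size_enum_ord enumT.
    by apply: ler_wpM2l => //; rewrite mulr_sumr; apply: ler_sum => j _; exact: hth.
  have -> : 2 * n%:R * th * \sum_j cnsq (D k j) = 2 * (n%:R * (th * \sum_j cnsq (D k j))) by ring.
  have q6 : K0 * cnsq (U k) <= K0 * (cnsq (Au k) + cnsq (U k) + e).
    by apply: ler_wpM2l => //; lra.
  rewrite -(mulrA 4 K0); move: (K0 * (_ + _)) (K0 * _) (n%:R * _) q1 q2 q4 q6 => *; lra.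
have Z0 : 0 <= Z by apply: sumr_ge0 => k _; rewrite !addr_ge0 ?cnsq_ge0.
have eN : e * NN <= Z.
  rewrite /NN mulr_sumr; apply: ler_sum => k _; rewrite mulr1.
  by have := cnsq_ge0 (U k); have := cnsq_ge0 (Au k); lra.
have h5 : 4 * s ^+ 2 * T <= 2 * C * (2 * n%:R ^+ 2 * Ka * (s ^+ 2 * Z)
     + 8 * s ^+ 2 * (4 * Z + 4 * K0 * Z + 2 * n%:R * th * T)) + 2 * n%:R * (s ^+ 2 * Z).
  apply: le_trans h1 _; apply: lerD; last first.
    by apply: ler_wpM2l; [rewrite mulr_ge0|apply: ler_wpM2l => //; exact: ltW].
  rewrite -mulrA; apply: ler_wpM2l => //; apply: le_trans h2 _; apply: ler_wpM2l => //.
  apply: le_trans h3 _; apply: lerD.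
    apply: ler_wpM2l; first by rewrite !mulr_ge0 ?exprn_ge0.
    by apply: ler_wpM2l => //; exact: ltW.
  by apply: ler_wpM2l => //; rewrite mulr_ge0// ltW.
have h6 : T <= (16 * C + 16 * C * K0 + C * n%:R ^+ 2 * Ka + n%:R) * Z + 8 * C * n%:R * th * T.
  rewrite -(ler_pM2l (_ : 0 < 4 * s ^+ 2)) ?mulr_gt0//; apply: le_trans h5 _.
  have hx : 0 <= s ^+ 2 * (n%:R * Z) by rewrite !mulr_ge0// ltW.
  rewrite -subr_ge0 [X in 0 <= X](_ : _ = 2 * (s ^+ 2 * (n%:R * Z))); last by ring.
  by rewrite mulr_ge0.
(* The smallness of [th] lets the oscillation of the coefficients be absorbed into the gradient. *)
have h7 : 8 * C * n%:R * th * T <= 2^-1 * T.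
  apply: ler_wpM2r => //.
  have -> : 8 * C * n%:R * th = 2^-1 * (16 * C * n%:R * th) by field.
  by move: small; move: (16 * C * n%:R * th) => y; lra.
have : 2^-1 * T <= (16 * C + 16 * C * K0 + C * n%:R ^+ 2 * Ka + n%:R) * Z.
  by move: h6 h7; move: (8 * C * n%:R * th * T) => y; lra.
rewrite -/Z -(mulrA 2); move: ((_ + _) * Z) => y hy.
by clear -hy; move: hy; move: T => t; lra.
Qed.

End DiscreteGradient.

(** * Finite differences in a cube *)

Section BoxCalculus.
Context {R : realType} {n : nat}.
Implicit Types (f : 'rV[R]_n -> R) (y z : 'rV[R]_n) (a : 'I_n).
Local Notation e a := (delta_mx (0 : 'I_1) a : 'rV[R]_n).

Lemma segment_derive f y (v : 'rV[R]_n) (t : R) : derivable f (t *: v + y) v ->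
  is_derive t 1 (fun h : R => f (h *: v + y)) ('D_v f (t *: v + y)).
Proof.
move=> df.
pose sh : R -> R := fun h => h - t.
have d0 : is_derive (sh t) 1 (fun h : R => f (h *: v + (t *: v + y))) ('D_v f (t *: v + y)).
  rewrite /sh subrr; apply: DeriveDef; first exact: ((derivable1P _ _ _).1 df).
  by rewrite [RHS]derive_along.
have d1 : is_derive t 1 sh 1.
  have := is_deriveB (is_derive_id t (1 : R)) (is_derive_cst t t (1 : R)).
  by rewrite subr0.
have := @is_derive1_comp _ _ sh _ _ _ d0 d1; rewrite mulr1.
have -> // : (fun h : R => f (h *: v + (t *: v + y))) \o sh = (fun h => f (h *: v + y)).
by apply/funext => h; rewrite /sh /= addrA -scalerDl subrK.
Qed.

Lemma segment_mvt f y a (t : R) : 0 <= t ->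
  (forall u, 0 <= u <= t -> derivable f (u *: e a + y) (e a)) ->
  exists2 u, 0 <= u <= t & f (t *: e a + y) - f y = 'D_(e a) f (u *: e a + y) * t.
Proof.
move=> t0 df.
have [||u] := @MVT_segment R (fun h => f (h *: e a + y)) (fun h => 'D_(e a) f (h *: e a + y)) 0 t t0.
- move=> u; rewrite in_itv /= => /andP[u0 ut]; apply: segment_derive; apply: df.
  by rewrite (ltW u0) (ltW ut).
- apply: derivable_within_continuous => u; rewrite in_itv /= => ut.
  by have [] := segment_derive (df _ ut).
by rewrite in_itv /= => ut; rewrite scale0r add0r subr0 => h; exists u.
Qed.

Context (y0 : 'rV[R]_n) (r : R) (O : set 'rV[R]_n).
Hypothesis rO : cbox y0 r `<=` O.

Lemma fin_bound (I : finType) (Q : I -> R -> Prop) :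
  (forall i, exists2 B, 0 < B & Q i B) -> (forall i B B', B <= B' -> Q i B -> Q i B') ->
  exists2 B, 0 < B & forall i, Q i B.
Proof.
move=> h mon; have /choice [B HB] : forall i, exists B, 0 < B /\ Q i B.
  by move=> i; have [B B0 QB] := h i; exists B.
have B0 i : 0 <= B i by apply: ltW; case: (HB i).
exists (\sum_i B i + 1); first by rewrite ltr_wpDl// sumr_ge0.
move=> i; apply: mon (HB i).2; rewrite (bigD1 i)//= -addrA lerDl addr_ge0// sumr_ge0//.
Qed.

Lemma cbox_step y a (t u : R) : cbox y0 r y -> cbox y0 r (t *: e a + y) -> 0 <= u <= t ->
  cbox y0 r (u *: e a + y).
Proof.
move=> hy ht /andP[u0 ut] c; have := hy c; have := ht c; rewrite !mxE eqxx /=.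
have [->|ca] := eqVneq c a; last by rewrite /= !mulr0 !add0r.
rewrite /= !mulr1 => h1 h2; move: h1 h2; rewrite !ler_norml.
by move=> /andP[h1 h2] /andP[h3 h4]; apply/andP; split; lra.
Qed.

Lemma box_step_le f a (B : R) : (forall y, O y -> derivable f y (e a)) ->
  (forall y, cbox y0 r y -> `|'D_(e a) f y| <= B) ->
  forall y t, 0 <= t -> cbox y0 r y -> cbox y0 r (t *: e a + y) ->
  `|f (t *: e a + y) - f y| <= B * t.
Proof.
move=> df DB y t t0 hy ht.
have [u u0|u ut ->] := segment_mvt (f := f) (y := y) (a := a) t0.
  by apply: df; apply: rO; exact: cbox_step ht u0.
by rewrite normrM (ger0_norm t0); apply: ler_wpM2r => //; apply: DB; exact: cbox_step ut.
Qed.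

Lemma class_C_bounded k f : class_C k O f ->
  exists2 B, 0 < B & forall y, cbox y0 r y -> `|f y| <= B.
Proof.
move=> cf; apply: compact_bounded_on; first exact: cbox_compact.
by move=> y /rO; exact: class_C_continuous cf.
Qed.

Lemma box_lipschitz f : class_C 1 O f -> exists2 B, 0 < B & forall s y z, 0 <= s ->
  cbox y0 r y -> cbox y0 r z -> (forall a, `|y 0 a - z 0 a| <= s) -> `|f y - f z| <= B * s.
Proof.
move=> cf.
have [B B0 HB] : exists2 B, 0 < B & forall a y, cbox y0 r y -> `|'D_(e a) f y| <= B.
  apply: (fin_bound (Q := fun a B => forall y, cbox y0 r y -> `|'D_(e a) f y| <= B)).
    by move=> a; apply: (class_C_bounded (k := 0)); exact: class_C_derive.
  by move=> a B B' BB' h y /h; move/le_trans; apply.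
exists (n%:R * B + B); first by rewrite ltr_wpDl// mulr_ge0// ltW.
move=> s y z s0 hy hz yz.
(* A path from [z] to [y] that changes one coordinate at a time and stays in the cube. *)
pose mix (q : seq 'I_n) : 'rV[R]_n := \row_a (if a \in q then y 0 a else z 0 a).
have hmix q : cbox y0 r (mix q) by move=> a; rewrite mxE; case: ifP.
have key q : uniq q -> `|f (mix q) - f z| <= (size q)%:R * (B * s).
  elim: q => [_|a q IH /= /andP[aq uq]].
    have -> : mix [::] = z by apply/rowP => a; rewrite mxE.
    by rewrite subrr normr0 mul0r.
  have step : `|f (mix (a :: q)) - f (mix q)| <= B * s.
    have e1 : mix (a :: q) = (y 0 a - z 0 a) *: e a + mix q.
      apply/rowP => c; rewrite !mxE eqxx /= in_cons.
      have [->|ca] := eqVneq c a; first by rewrite (negbTE aq) mulr1 subrK.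
      by rewrite mulr0 add0r.
    (* [box_step_le] treats forward steps only; a backward step is read from its other end. *)
    have [yz0|yz0] := leP 0 (y 0 a - z 0 a).
      rewrite e1; apply: le_trans (box_step_le (a := a) (B := B) _ (HB a) yz0 (hmix q) _) _.
      - by move=> x Ox; exact: class_C_derivable cf Ox.
      - by rewrite -e1.
      - by apply: ler_wpM2l; [exact: ltW|apply: le_trans (yz a); exact: ler_norm].
    have e2 : mix q = (z 0 a - y 0 a) *: e a + mix (a :: q).
      by rewrite e1 addrA -scalerDl -opprB addNr scale0r add0r.
    rewrite distrC {1}e2.
    apply: le_trans (box_step_le (a := a) (B := B) _ (HB a) _ (hmix _) _) _.
    - by move=> x Ox; exact: class_C_derivable cf Ox.
    - by rewrite -opprB oppr_ge0 ltW.
    - by rewrite -e2.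
    - by apply: ler_wpM2l; [exact: ltW|apply: le_trans (yz a); rewrite distrC; exact: ler_norm].
  rewrite -[f _ - f z](subrKA (f (mix q))); apply: le_trans (ler_normD _ _) _.
  by rewrite -natr1 mulrDl mul1r addrC; apply: lerD => //; exact: IH.
have := key _ (enum_uniq 'I_n).
have -> : mix (enum 'I_n) = y by apply/rowP => a; rewrite mxE mem_enum.
rewrite size_enum_ord => h; apply: le_trans h _.
by rewrite mulrDl -mulrA lerDl mulr_ge0// ltW.
Qed.

Lemma forward_diff f : class_C 2 O f -> exists2 B, 0 < B & forall s y a, 0 <= s ->
  cbox y0 r y -> cbox y0 r (s *: e a + y) ->
  `|f (s *: e a + y) - f y - s * 'D_(e a) f y| <= B * s ^+ 2.
Proof.
move=> cf.
have [B B0 HB] : exists2 B, 0 < B & forall a s y z, 0 <= s -> cbox y0 r y -> cbox y0 r z ->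
    (forall c, `|y 0 c - z 0 c| <= s) -> `|'D_(e a) f y - 'D_(e a) f z| <= B * s.
  apply: (fin_bound (Q := fun a B => forall s y z, 0 <= s -> cbox y0 r y -> cbox y0 r z ->
    (forall c, `|y 0 c - z 0 c| <= s) -> `|'D_(e a) f y - 'D_(e a) f z| <= B * s)).
    by move=> a; apply: box_lipschitz; exact: class_C_derive.
  move=> a B B' BB' h s y z s0 hy hz yz; apply: le_trans (h s y z s0 hy hz yz) _.
  exact: ler_wpM2r.
exists B => // s y a s0 hy hs.
have [u u0|u us ->] := segment_mvt (f := f) (y := y) (a := a) s0.
  apply: (class_C_derivable (U := O) (k := 1)) => //; apply: rO; exact: cbox_step hs u0.
rewrite mulrC -mulrBr normrM (ger0_norm s0) expr2 mulrA mulrC; apply: ler_wpM2r => //.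
apply: HB => //; first exact: cbox_step us.
move=> c; rewrite !mxE addrK eqxx /=; move/andP: us => [u0 us].
by have [_|_] := eqVneq c a; rewrite ?mulr1 ?mulr0 ?normr0// ger0_norm.
Qed.

End BoxCalculus.

Section VectorGrid.
Context {R : realType} {b : base_field} {n : nat} {M : ptopologicalType}.
Local Notation S := (scalars_of R b).
Context {X : manifold R n M} (i : atlas X) (W : set M) (y0 : 'rV[R]_n) (r : R).
Hypotheses (oW : open W) (rW : cbox y0 r `<=` chart i @` (W `&` dom i)).
Local Notation e a := (delta_mx (0 : 'I_1) a : 'rV[R]_n).

Lemma cbox_param y : cbox y0 r y -> [/\ W (param i y), dom i (param i y) & chart i (param i y) = y].
Proof. by move=> /rW [x [Wx dx] <-]; rewrite chartK. Qed.

Context (m : nat) (u : M -> 'cV[S]_m) (su : smooth_inV i W u).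

Let part (k : 'I_m * bool) (x : M) : R := reim (u x k.1 0) k.2.
Let spart k : smooth (chart i @` (W `&` dom i)) (part k \o param i).
Proof. by case: k => k g; have [h1 h2] := su k; rewrite /part; case: g; [exact: h1|exact: h2]. Qed.

Lemma vector_lipschitz : exists2 B, 0 < B & forall s y z, 0 <= s ->
  cbox y0 r y -> cbox y0 r z -> (forall a, `|y 0 a - z 0 a| <= s) ->
  cnsq (u (param i y) - u (param i z)) <= B * s ^+ 2.
Proof.
have [B B0 HB] : exists2 B, 0 < B & forall k s y z, 0 <= s ->
    cbox y0 r y -> cbox y0 r z -> (forall a, `|y 0 a - z 0 a| <= s) ->
    `|part k (param i y) - part k (param i z)| <= B * s.
  apply: (fin_bound (Q := fun k B => forall s y z, 0 <= s ->
    cbox y0 r y -> cbox y0 r z -> (forall a, `|y 0 a - z 0 a| <= s) ->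
    `|part k (param i y) - part k (param i z)| <= B * s)).
    by move=> k; have [B B0 HB] := box_lipschitz rW (spart k 1%N); exists B.
  move=> k B B' BB' h s y z s0 hy hz yz; apply: le_trans (h s y z s0 hy hz yz) _.
  exact: ler_wpM2r.
pose q : R := #|{: 'I_m * bool}|%:R.
exists (q * B ^+ 2 + 1); first by rewrite ltr_wpDl// mulr_ge0// exprn_ge0// ltW.
move=> s y z s0 hy hz yz; rewrite cnsq_reim.
apply: (@le_trans _ _ (\sum_(k : 'I_m * bool) (B * s) ^+ 2)).
  apply: ler_sum => k _; rewrite -[leLHS]real_normK ?num_real// ler_pXn2r ?nnegrE ?mulr_ge0 ?(ltW B0)//.
  have := HB k s y z s0 hy hz yz; congr (`|_| <= _); rewrite /part /reim !mxE.
  by case: k.2; rewrite ?sc_reD ?sc_imD ?sc_reN ?sc_imN.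
rewrite sumr_const -mulr_natl -/q exprMn mulrA; apply: ler_wpM2r; first exact: exprn_ge0.
by rewrite lerDl.
Qed.

Lemma vector_forward : exists2 B, 0 < B & forall s y a, 0 <= s ->
  cbox y0 r y -> cbox y0 r (s *: e a + y) ->
  cnsq (u (param i (s *: e a + y)) - u (param i y) - sc_real S s *: pderivV i a u (param i y))
  <= B * s ^+ 4.
Proof.
have [B B0 HB] : exists2 B, 0 < B & forall k s y a, 0 <= s ->
    cbox y0 r y -> cbox y0 r (s *: e a + y) ->
    `|part k (param i (s *: e a + y)) - part k (param i y) - s * pderiv i a (part k) (param i y)|
      <= B * s ^+ 2.
  apply: (fin_bound (Q := fun k B => forall s y a, 0 <= s ->
    cbox y0 r y -> cbox y0 r (s *: e a + y) ->
    `|part k (param i (s *: e a + y)) - part k (param i y) - s * pderiv i a (part k) (param i y)|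
      <= B * s ^+ 2)).
    move=> k; have [B B0 HB] := forward_diff rW (spart k 2%N); exists B => // s y a s0 hy hs.
    have [_ _ cy] := cbox_param hy; rewrite /pderiv cy; exact: HB.
  move=> k B B' BB' h s y a s0 hy hs; apply: le_trans (h s y a s0 hy hs) _.
  by apply: ler_wpM2r => //; exact: exprn_ge0.
pose q : R := #|{: 'I_m * bool}|%:R.
exists (q * B ^+ 2 + 1); first by rewrite ltr_wpDl// mulr_ge0// exprn_ge0// ltW.
move=> s y a s0 hy hs; rewrite cnsq_reim.
apply: (@le_trans _ _ (\sum_(k : 'I_m * bool) (B * s ^+ 2) ^+ 2)).
  apply: ler_sum => k _; rewrite -[leLHS]real_normK ?num_real// ler_pXn2r ?nnegrE ?mulr_ge0 ?exprn_ge0 ?(ltW B0)//.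
  have := HB k s y a s0 hy hs; congr (`|_| <= _); rewrite /part /reim !mxE.
  case: k.2; rewrite ?sc_reD ?sc_imD ?sc_reN ?sc_imN ?sc_reD ?sc_imD ?sc_reN ?sc_imN
    ?sc_reM ?sc_imM ?sc_re_real ?sc_im_real ?mul0r ?subr0 ?addr0 ?sc_re_pderivK ?sc_im_pderivK//.
rewrite sumr_const -mulr_natl -/q exprMn mulrA -exprM; apply: ler_wpM2r; first exact: exprn_ge0.
by rewrite lerDl.
Qed.

End VectorGrid.

(** * Grid cells and Riemann sums *)

Section Cells.
Context {R : realType} {n : nat} {M : ptopologicalType}.
Context {X : manifold R n M} (mu : {measure set (borel M) -> \bar R}).
Context (i : atlas X) (y0 : 'rV[R]_n) (r c C : R).
Hypotheses (r0 : 0 < r) (rd : cbox y0 r `<=` chart i @` dom i) (c0 : 0 < c) (C0 : 0 < C).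
Hypothesis hm : forall p s, 0 <= s -> hbox p s `<=` cbox y0 r ->
  ((c * s ^+ n)%:E <= mu (chart_box i p s) /\ mu (chart_box i p s) <= (C * s ^+ n)%:E)%E.
Context (N : nat).
Local Notation G := {ffun 'I_n -> 'I_N.+1}.

Definition step : R := 2 * r / N.+1%:R.
Definition node (k : G) : 'rV[R]_n := \row_a (y0 0 a - r + step * (k a)%:R).
Definition cell (k : G) := chart_box i (fun a => node k 0 a) step.

Lemma step_gt0 : 0 < step. Proof. by rewrite divr_gt0// mulr_gt0. Qed.

Lemma step_mul : step * N.+1%:R = 2 * r. Proof. by rewrite divfK// pnatr_eq0. Qed.

Lemma node_itv k a : y0 0 a - r <= node k 0 a /\ node k 0 a + step <= y0 0 a + r.
Proof.
rewrite mxE; have s0 := step_gt0; split; first by rewrite lerDl mulr_ge0// ltW.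
have h : step * (k a)%:R + step <= 2 * r.
  rewrite -step_mul -[X in _ + X]mulr1 -mulrDr natr1; apply: ler_wpM2l; first exact: ltW.
  by rewrite ler_nat ltn_ord.
by lra.
Qed.

Lemma node_cbox k : cbox y0 r (node k).
Proof.
move=> a; have [h1 h2] := node_itv k a; have s0 := step_gt0.
by rewrite ler_distl; apply/andP; split => //; apply: le_trans h2; rewrite lerDl ltW.
Qed.

Lemma cell_hbox k : hbox (fun a => node k 0 a) step `<=` cbox y0 r.
Proof. by apply: hbox_sub_cbox => a; exact: node_itv. Qed.

Lemma cellP k x : cell k x -> [/\ dom i x, cbox y0 r (chart i x) &
  forall a, `|chart i x 0 a - node k 0 a| <= step].
Proof.
move=> [dx hx]; split => //; first exact: cell_hbox hx.
move=> a; have /andP[h1 h2] := hx a; rewrite ger0_norm ?subr_ge0//.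
by rewrite lerBlDl ltW.
Qed.

Lemma cell_measurable k : measurable (cell k). Proof. exact: chart_box_measurable. Qed.

Lemma cell_disjoint k l x : cell k x -> cell l x -> k = l.
Proof.
move=> [_ hk] [_ hl]; apply/ffunP => a; apply: val_inj => /=.
have /andP[h1 h2] := hk a; have /andP[h3 h4] := hl a; rewrite !mxE in h1 h2 h3 h4.
have s0 := step_gt0.
have aux (p q : nat) : y0 0 a - r + step * p%:R <= chart i x 0 a ->
    chart i x 0 a < y0 0 a - r + step * q%:R + step -> (p <= q)%N.
  move=> u1 u2; rewrite -ltnS -(ltr_nat R) -(ltr_pM2l s0) -natr1 mulrDr mulr1.
  by move: u1 u2; move: (step * p%:R) (step * q%:R) => *; lra.
by apply/eqP; rewrite eqn_leq; apply/andP; split; apply: aux.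
Qed.

Lemma cell_cover x : dom i x -> (forall a, y0 0 a - r <= chart i x 0 a < y0 0 a + r) ->
  exists k : G, cell k x.
Proof.
move=> dx hx; have s0 := step_gt0.
have /choice [k Hk] : forall a, exists k : 'I_N.+1,
    y0 0 a - r + step * k%:R <= chart i x 0 a < y0 0 a - r + step * k%:R + step.
  move=> a; pose t := (chart i x 0 a - y0 0 a + r) / step.
  have /andP[h1 h2] := hx a.
  have t0 : 0 <= t by rewrite divr_ge0 ?(ltW s0)//; lra.
  have tN : t < N.+1%:R by rewrite ltr_pdivrMr// mulrC step_mul; lra.
  have /andP[g1 g2] := truncn_itv t0.
  have kN : (Num.truncn t < N.+1)%N.
    by rewrite -(ltr_nat R); apply: le_lt_trans g1 tN.
  have e : chart i x 0 a = step * t + y0 0 a - r.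
    by rewrite /t mulrC divfK ?gt_eqF//; lra.
  exists (Ordinal kN) => /=; rewrite e.
  have g3 := ler_wpM2l (ltW s0) g1.
  have g4 : step * t < step * (Num.truncn t)%:R + step.
    by rewrite -[X in _ + X]mulr1 -mulrDr natr1 ltr_pM2l.
  by move: g3 g4; move: (step * t) (step * _) => *; apply/andP; split; lra.
exists [ffun a => k a]; split => // a; rewrite mxE ffunE; exact: Hk.
Qed.

Section Integrals.
Context (g : borel M -> R) (Gk : G -> R).
Hypotheses (mg : measurable_fun setT g) (g0 : forall x, 0 <= g x) (Gk0 : forall k, 0 <= Gk k).

Let D := \big[setU/set0]_(k <- enum {: G}) cell k.
Let DP x : D x <-> exists k, cell k x.
Proof.
rewrite /D -bigcup_seq; split => [[k _ kx]|[k kx]]; first by exists k.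
by exists k => //=; rewrite mem_enum.
Qed.
Let mD : measurable D.
Proof. by rewrite /D; apply: bigsetU_measurable => k _; exact: cell_measurable. Qed.
Let intD : (\int[mu]_(x in D) (g x)%:E = \sum_(k <- enum {: G}) \int[mu]_(x in cell k) (g x)%:E)%E.
Proof.
apply: ge0_integral_bigsetU.
- by move=> k; exact: cell_measurable.
- exact: enum_uniq.
- by move=> k l _ _ [x [kx lx]]; exact: cell_disjoint kx lx.
- by apply/measurable_EFinP; exact: (measurable_funS measurableT).
- by move=> x _; rewrite lee_fin.
Qed.

Lemma grid_integral_le : (forall x, (forall k, ~ cell k x) -> g x = 0) ->
  (forall k x, cell k x -> g x <= Gk k) ->
  (\int[mu]_x (g x)%:E <= (C * step ^+ n * \sum_k Gk k)%:E)%E.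
Proof.
move=> gout gin.
have -> : (\int[mu]_x (g x)%:E = \int[mu]_(x in D) (g x)%:E)%E.
  rewrite [RHS]integral_mkcond; apply: eq_integral => x _; rewrite patchE.
  case: ifPn => // /negP nD; rewrite gout// => k kx; apply: nD; apply/mem_set/DP; by exists k.
rewrite intD mulr_sumr -sumEFin big_enum /=; apply: lee_sum => k _.
apply: (@le_trans _ _ (\int[mu]_(x in cell k) (Gk k)%:E)%E).
  apply: ge0_le_integral => //; first exact: cell_measurable.
  - by move=> x _; rewrite lee_fin.
  - by apply/measurable_EFinP; exact: (measurable_funS measurableT).
  - by move=> x kx; rewrite lee_fin gin.
rewrite integral_cst; last exact: cell_measurable.
rewrite mulrC EFinM; apply: lee_wpmul2l; first by rewrite lee_fin.
by have [_] := hm (ltW step_gt0) (@cell_hbox k).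
Qed.

Lemma grid_integral_ge : (forall k x, cell k x -> Gk k <= g x) ->
  ((c * step ^+ n * \sum_k Gk k)%:E <= \int[mu]_x (g x)%:E)%E.
Proof.
move=> gin.
apply: (@le_trans _ _ (\int[mu]_(x in D) (g x)%:E)%E); last first.
  by apply: ge0_subset_integral => //; [apply/measurable_EFinP|move=> x _; rewrite lee_fin].
rewrite intD mulr_sumr -sumEFin big_enum /=; apply: lee_sum => k _.
apply: (@le_trans _ _ (\int[mu]_(x in cell k) (Gk k)%:E)%E); last first.
  apply: ge0_le_integral => //; first exact: cell_measurable.
  - by move=> x _; rewrite lee_fin.
  - by apply/measurable_EFinP; exact: (measurable_funS measurableT).
  - by move=> x kx; rewrite lee_fin gin.
rewrite integral_cst; last exact: cell_measurable.
rewrite mulrC EFinM; apply: lee_wpmul2l; first by rewrite lee_fin.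
by have [] := hm (ltW step_gt0) (@cell_hbox k).
Qed.

End Integrals.

Lemma sum_cells (d : R) : step ^+ n * \sum_(k : G) d = (2 * r) ^+ n * d.
Proof.
rewrite sumr_const card_ffun !card_ord -[X in _ * X]mulr_natr natrX -[in RHS]step_mul [in RHS]exprMn.
by rewrite -[in RHS]mulrA; congr (_ * _); rewrite mulrC.
Qed.

End Cells.

(** * The local estimate *)

Section Sampling.
Context {R : realType} {b : base_field} {n : nat} {M : ptopologicalType}.
Local Notation S := (scalars_of R b).
Context {X : manifold R n M} (mu : {measure set (borel M) -> \bar R}).
Hypothesis mu_fin : forall K : set M, compact K ->
  exists U : set M, [/\ open U, K `<=` U & (mu U < +oo)%E].
Context (i : atlas X) (y0 : 'rV[R]_n) (r : R) (V0 : set M) (c1 C1 : R).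
Hypotheses (r0 : 0 < r) (oV0 : open V0) (V0d : V0 `<=` dom i).
Hypotheses (rV0 : cbox y0 r `<=` chart i @` (V0 `&` dom i)) (c10 : 0 < c1) (C10 : 0 < C1).
Hypothesis hm : forall p s, 0 <= s -> hbox p s `<=` cbox y0 r ->
  ((c1 * s ^+ n)%:E <= mu (chart_box i p s) /\ mu (chart_box i p s) <= (C1 * s ^+ n)%:E)%E.
Local Notation e a := (delta_mx (0 : 'I_1) a : 'rV[R]_n).
Local Notation G N := {ffun 'I_n -> 'I_N.+1}.

(** Sections supported in this open cube vanish on the faces of the closed one, so their samples
    live on the torus [G N]. *)
Definition boxV := [set x | dom i x /\ obox y0 r (chart i x)].
Definition pt N (k : G N) : M := param i (node y0 r k).
Definition unit_shift N (a : 'I_n) : G N := [ffun c => if c == a then inZp 1 else 0].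

Lemma rd : cbox y0 r `<=` chart i @` dom i.
Proof. by move=> y /rV0 [x [_ dx] <-]; exists x. Qed.

Lemma boxV_open : open boxV.
Proof.
rewrite openE => x [dx ox]; apply: filterI.
  by apply: open_nbhs_nbhs; split => //; exact: dom_open.
apply: (chart_continuous dx); apply: open_nbhs_nbhs; split => //; exact: obox_open.
Qed.

Lemma cbox_in x : dom i x -> cbox y0 r (chart i x) -> V0 x.
Proof. by move=> dx /rV0 [z [Vz dz] zx]; rewrite -(chartK dx) -zx chartK. Qed.

Lemma ptP N (k : G N) : [/\ V0 (pt k), dom i (pt k) & chart i (pt k) = node y0 r k].
Proof. exact: (cbox_param rV0 (node_cbox y0 r0 k)). Qed.

Lemma boxV_cell N x : boxV x -> exists k : G N, cell i y0 r k x.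
Proof.
move=> [dx ox]; apply: (cell_cover r0 N dx) => a; have := ox a.
by rewrite ltr_norml => /andP[h1 h2]; apply/andP; split; lra.
Qed.

Lemma cell_V0 N (k : G N) x : cell i y0 r k x -> V0 x.
Proof. by move=> /(cellP r0)[dx cx _]; exact: cbox_in. Qed.

Lemma step_cbox N (k : G N) a : cbox y0 r (step r N *: e a + node y0 r k).
Proof.
move=> c; rewrite !mxE eqxx /=; have s0 := step_gt0 r0 N.
have [h1 h2] := node_itv y0 r0 k c; rewrite !mxE in h1 h2.
rewrite ler_norml; move: h1 h2; move: (step r N * (k c)%:R) => z h1 h2.
by have [ca|ca] := eqVneq c a; rewrite /= ?mulr1 ?mulr0; apply/andP; split; lra.
Qed.

Lemma boxV_param y : cbox y0 r y -> boxV (param i y) -> obox y0 r y.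
Proof. by move=> /(cbox_param rV0)[_ _ cy] [_]; rewrite cy. Qed.

(** The cyclic and the geometric neighbour of a node differ only in the last layer. There they lie
    on opposite faces of the cube, where [f] is 0. *)
Lemma wrap_value (T : nmodType) (f : M -> T) N (k : G N) a : (forall x, ~ boxV x -> f x = 0) ->
  f (pt (k + unit_shift N a)) = f (param i (step r N *: e a + node y0 r k)).
Proof.
move=> f0; have [kN|kN] := ltnP (k a).+1 N.+1.
  congr (f (param i _)); apply/rowP => c; rewrite !mxE eqxx /= !ffunE /=.
  have [ca|ca] := eqVneq c a; last by rewrite mulr0 add0r addn0 modn_small.
  rewrite ca; have -> : ((k a + (inZp 1 : 'I_N.+1)) %% N.+1 = (k a).+1)%N.
    by rewrite /= modnDmr addn1 modn_small.
  by rewrite -natr1 /=; ring.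
have kE : nat_of_ord (k a) = N by apply/eqP; rewrite eqn_leq -ltnS ltn_ord /= -ltnS.
have nb y : cbox y0 r y -> (y 0 a <= y0 0 a - r) || (y0 0 a + r <= y 0 a) -> f (param i y) = 0.
  move=> cy hy; apply: f0 => /(boxV_param cy)/(_ a); rewrite ltr_norml => /andP[h1 h2].
  by clear kE kN; case/orP : hy => hy; lra.
rewrite /pt !nb//; first exact: step_cbox.
- apply/orP; right; rewrite !mxE !eqxx /= mulr1 kE.
  have := step_mul r N; rewrite -natr1 mulrDr mulr1; move: (step r N * _) => z; lra.
- exact: node_cbox.
- apply/orP; left; rewrite !mxE !ffunE eqxx /= kE.
  have -> : ((N + (inZp 1 : 'I_N.+1)) %% N.+1 = 0)%N by rewrite /= modnDmr addn1 modnn.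
  by rewrite mulr0 addr0.
Qed.

Lemma box_compact : compact (param i @` cbox y0 r).
Proof.
apply: continuous_compact; last exact: cbox_compact.
apply: continuous_in_subspaceT => y /set_mem hy; apply: param_continuous; exact: rd.
Qed.

Lemma cell_box N (k : G N) x : cell i y0 r k x -> (param i @` cbox y0 r) x.
Proof. by move=> /(cellP r0)[dx cx _]; exists (chart i x) => //; rewrite chartK. Qed.

Section OneBundle.
Context {E : vbundle S X} (h : bundle_metric E) (j : triv_index E).
Hypothesis V0j : V0 `<=` triv_dom j.
Implicit Types (v : section E).

Lemma coords_smooth v : smooth_section v -> smooth_inV i V0 (coords j v).
Proof.
by move=> /smooth_sectionE sv k; apply: smooth_inK_sub (sv i j k).
Qed.

Lemma cell_lipschitz (m : nat) (u : M -> 'cV[S]_m) : smooth_inV i V0 u ->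
  exists2 B, 0 < B & forall N (k : G N) x, cell i y0 r k x ->
    cnsq (u x - u (pt k)) <= B * step r N ^+ 2 /\ cnsq (u (pt k) - u x) <= B * step r N ^+ 2.
Proof.
move=> su; have [B B0 HB] := vector_lipschitz rV0 su; exists B => // N k x kx.
have [dx cx hx] := cellP r0 kx; have s0 := ltW (step_gt0 r0 N).
have := HB _ _ _ s0 cx (node_cbox y0 r0 k) hx; rewrite chartK// => h1; split => //.
by rewrite -cnsqN opprB.
Qed.

(** Comparison of the Riemann sum with the integral on each cell, by the Lipschitz bound for the
    coordinates of [v]. The error constant [B] depends on [v], the leading one does not. The set
    [Ub] only serves to integrate the constant error. *)
Lemma sample_le (K : R) v : 0 <= K -> Cc boxV v ->
  (forall x, V0 x -> forall w : fiber E x, cnsq (triv j x w) <= K * hr h w w) ->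
  exists B, 0 <= B /\ forall N,
    c1 * step r N ^+ n * (\sum_(k : G N) cnsq (coords j v (pt k)))
    <= 2 * K * ri mu h v v + B * step r N ^+ 2.
Proof.
move=> K0 cv hK; have [sv _ _] := cv.
have [B0 B00 HB] := cell_lipschitz (coords_smooth sv).
have [Ub [oU KU fU]] := mu_fin box_compact.
have mU : measurable (Ub : set (borel M)) by exact: borel_open.
pose mB := fine (mu Ub); have mB0 : 0 <= mB by exact: fine_ge0.
exists (2 * B0 * mB); split; first by rewrite !mulr_ge0// ltW.
move=> N; pose s := step r N; rewrite -/s.
have s0 : 0 <= s ^+ 2 by exact: sqr_ge0.
pose g (x : borel M) : R := 2 * K * hr h (v x) (v x) + 2 * B0 * s ^+ 2 * \1_(Ub : set (borel M)) x.
have Lv := Cc_L2 h mu_fin cv.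
have i1 := integrable_scale (2 * K) (L2_integrable Lv Lv).
have i2 : mu.-integrable setT (EFin \o (fun x : borel M => \1_(Ub : set (borel M)) x : R)).
  apply/integrableP; split; first by apply/measurable_EFinP; exact: measurable_indic.
  rewrite (eq_integral (fun x : borel M => (\1_(Ub : set (borel M)) x)%:E)).
    by rewrite integral_indic// setIT.
  by move=> x _ /=; rewrite ger0_norm.
have i3 := integrable_scale (2 * B0 * s ^+ 2) i2.
have ig := integrable_add i1 i3.
have mg : measurable_fun setT g by case/integrableP : ig => /measurable_EFinP.
have g0 x : 0 <= g x.
  by rewrite addr_ge0// !mulr_ge0 ?hr_ge0// ltW.
have := @grid_integral_ge _ _ _ _ mu i y0 r c1 C1 r0 hm N g _ mg g0 (fun k => cnsq_ge0 (coords j v (pt k))).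
have -> : (\int[mu]_x (g x)%:E = (2 * K * ri mu h v v + 2 * B0 * mB * s ^+ 2)%:E)%E.
  have -> : 2 * K * ri mu h v v + 2 * B0 * mB * s ^+ 2 = Rintegral mu setT g.
    rewrite /g RintegralD// !RintegralZl//; last exact: L2_integrable.
    rewrite {2}/Rintegral integral_indic// setIT -/mB /ri; ring.
  by rewrite /Rintegral fineK//; exact: integrable_fin_num.
rewrite lee_fin; apply => k x kx.
have := cnsqD_le (coords j v x) (coords j v (pt k) - coords j v x).
rewrite addrC subrK => q1; have [_ q2] := HB _ _ _ kx; rewrite -/s in q2.
have q3 := hK _ (cell_V0 kx) (v x).
rewrite /g indicE mem_set ?mulr1; last by apply: KU; exact: cell_box kx.
move: q1 q2 q3; rewrite -!mulrA /coords; move: (B0 * _) (K * _) => p q; lra.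
Qed.

(** The samples [w] are free and [v] need not be smooth, because the lemma is also applied to the
    difference of a section and its piecewise constant approximation. *)
Lemma sample_ge_gen (K : R) v N (w : G N -> 'cV[S]_(rank E)) (d : R) : 0 <= K -> 0 <= d ->
  L2 mu h setT v ->
  (forall x, V0 x -> forall z : fiber E x, hr h z z <= K * cnsq (triv j x z)) ->
  (forall x, (forall k : G N, ~ cell i y0 r k x) -> v x = 0) ->
  (forall (k : G N) x, cell i y0 r k x -> cnsq (coords j v x - w k) <= d) ->
  ri mu h v v <= 2 * C1 * K * (step r N ^+ n * (\sum_(k : G N) cnsq (w k)) + (2 * r) ^+ n * d).
Proof.
move=> K0 d0 Lv hK v0 hw.
have iv := L2_integrable Lv Lv.
have mv : measurable_fun setT (fun x : borel M => hr h (v x) (v x)).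
  by case/integrableP : iv => /measurable_EFinP.
have G0 (k : G N) : 0 <= 2 * K * (cnsq (w k) + d) by rewrite mulr_ge0 ?addr_ge0 ?cnsq_ge0// mulr_ge0.
have := @grid_integral_le _ _ _ _ mu i y0 r c1 C1 r0 hm N _ _ mv (fun x => hr_ge0 h (v x)) G0.
have -> : (\int[mu]_x (hr h (v x) (v x))%:E = (ri mu h v v)%:E)%E.
  by rewrite /ri /Rintegral fineK//; exact: integrable_fin_num.
rewrite lee_fin => le; apply: le_trans (le _ _) _.
- by move=> x /v0 ->; rewrite hr0.
- move=> k x kx; apply: le_trans (hK _ (cell_V0 kx) _) _.
  rewrite -mulrA mulrCA; apply: ler_wpM2l => //.
  have := cnsqD_le (w k) (coords j v x - w k); rewrite addrC subrK.
  by have := hw _ _ kx; rewrite /coords; lra.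
rewrite le_eqVlt; apply/orP; left; apply/eqP.
by rewrite -(sum_cells r N d) -mulr_sumr big_split /=; ring.
Qed.

Lemma sample_ge (K : R) v : 0 <= K -> Cc boxV v ->
  (forall x, V0 x -> forall z : fiber E x, hr h z z <= K * cnsq (triv j x z)) ->
  exists B, 0 <= B /\ forall N,
    ri mu h v v <= 2 * C1 * K * step r N ^+ n * (\sum_(k : G N) cnsq (coords j v (pt k)))
      + B * step r N ^+ 2.
Proof.
move=> K0 cv hK; have [sv _ vV] := cv.
have [B0 B00 HB] := cell_lipschitz (coords_smooth sv).
have p0 : 0 <= (2 * r) ^+ n by rewrite exprn_ge0// mulr_ge0// ltW.
exists (2 * C1 * K * ((2 * r) ^+ n * B0)); split.
  by rewrite !mulr_ge0// ltW.
move=> N; have s0 : 0 <= B0 * step r N ^+ 2 by rewrite mulr_ge0 ?sqr_ge0// ltW.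
have := @sample_ge_gen K v N (fun k => coords j v (pt k)) _ K0 s0 (Cc_L2 h mu_fin cv) hK.
move=> le; apply: le_trans (le _ _) _.
- move=> x nx; apply: (supp0 (s := v)) => /vV /(@boxV_cell N)[k kx]; exact: nx kx.
- by move=> k x kx; have [] := HB _ _ _ kx.
by rewrite le_eqVlt; apply/orP; left; apply/eqP; ring.
Qed.

(** A central difference is the sum of two forward differences, at [k] and at its predecessor, whose
    derivatives are close by the Lipschitz bound. The second estimate feeds the Poincaré
    inequality. *)
Lemma central_diff_bound v : Cc boxV v -> exists B, 0 <= B /\ forall N (k : G N) a,
  let Uk (k : G N) := coords j v (pt k) in let s := step r N in
  let D := pderivV i a (coords j v) in
  cnsq (Uk (k + unit_shift N a) - Uk (k - unit_shift N a) - sc_real S (2 * s) *: D (pt k))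
    <= s ^+ 2 * (B * s ^+ 2) /\
  cnsq (Uk (k + unit_shift N a) - Uk k) <= 2 * (B * s ^+ 4) + 2 * s ^+ 2 * cnsq (D (pt k)).
Proof.
move=> cv; have [sv _ vV] := cv; have su := coords_smooth sv.
have [B B0 HB] := vector_forward rV0 su.
have [B' B'0 HB'] : exists2 B, 0 < B & forall a s y z, 0 <= s ->
    cbox y0 r y -> cbox y0 r z -> (forall c, `|y 0 c - z 0 c| <= s) ->
    cnsq (pderivV i a (coords j v) (param i y) - pderivV i a (coords j v) (param i z)) <= B * s ^+ 2.
  apply: (fin_bound (Q := fun a B => forall s y z, 0 <= s ->
    cbox y0 r y -> cbox y0 r z -> (forall c, `|y 0 c - z 0 c| <= s) ->
    cnsq (pderivV i a (coords j v) (param i y) - pderivV i a (coords j v) (param i z)) <= B * s ^+ 2)).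
    by move=> a; exact: (vector_lipschitz rV0 (smooth_inV_pderiv a oV0 su)).
  move=> a Q Q' QQ' hh s y z s0 hy hz yz; apply: le_trans (hh s y z s0 hy hz yz) _.
  by apply: ler_wpM2r => //; exact: sqr_ge0.
exists (6 * B + 4 * B'); split; first by rewrite addr_ge0// mulr_ge0// ltW.
move=> N k a Uk s D; have s0 : 0 <= s by exact: ltW (step_gt0 r0 N).
have U0 x : ~ boxV x -> coords j v x = 0.
  by move=> nx; rewrite /coords (supp0 (s := v)) ?linear0// => /vV.
have D0 x : V0 x -> ~ boxV x -> D x = 0.
  move=> V0x nx; have dx := V0d V0x.
  have : ~ supp v x by move=> /vV.
  move/suppP => [U]; rewrite nbhsE => -[U' [oU' U'x] U'U] vU.
  have -> : D x = pderivV i a (fun=> 0) x.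
    by apply: (pderivV_eq (W := U')) => // y /U'U /vU vy; rewrite /coords vy linear0.
  by apply/colP => c; rewrite [LHS]mxE [RHS]mxE; exact: pderivK_cst.
have fwd (l : G N) : cnsq (Uk (l + unit_shift N a) - Uk l - sc_real S s *: D (pt l)) <= B * s ^+ 4.
  rewrite /Uk (wrap_value l a U0); apply: HB => //; [exact: node_cbox|exact: step_cbox].
pose l := k - unit_shift N a; have lk : l + unit_shift N a = k by rewrite /l subrK.
(* [wrap_value] wants a function that vanishes everywhere off the cube, while the derivative is
   known to do so only within [V0]. *)
pose D' x := if `[< V0 x >] then D x else 0.
have DD (q : G N) : D (pt q) = D' (pt q).
  by rewrite /D'; case: asboolP => // nq; have [Vq _ _] := ptP q.
have hD : cnsq (D (pt l) - D (pt k)) <= B' * s ^+ 2.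
  have -> : D (pt k) = D' (param i (step r N *: e a + node y0 r l)).
    rewrite -[in LHS]lk DD; apply: wrap_value => x nx.
    by rewrite /D'; case: asboolP => // Vx; exact: D0.
  have [Vq _ _] := cbox_param rV0 (step_cbox l a).
  rewrite /D'; case: asboolP => // _; apply: HB' => //.
  - exact: node_cbox.
  - exact: step_cbox.
  move=> c; rewrite [(_ + node y0 r l) 0 c]mxE opprD addrA addrAC subrr add0r normrN !mxE eqxx /=.
  by case: eqVneq => _; rewrite ?mulr1 ?mulr0 ?normr0// ger0_norm.
split; last first.
  have := cnsqD_le (Uk (k + unit_shift N a) - Uk k - sc_real S s *: D (pt k)) (sc_real S s *: D (pt k)).
  rewrite subrK cnsqZ nsq_real => q1; apply: le_trans q1 _; rewrite mulrA lerD2r.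
  apply: ler_wpM2l => //; apply: le_trans (fwd k) _; apply: ler_wpM2r; first exact: exprn_ge0.
  by rewrite -[leLHS]mul1r -[leLHS]addr0; apply: lerD; [apply: ler_wpM2r; [exact: ltW|rewrite ler1n]|rewrite mulr_ge0// ltW].
have q1 := fwd k; have q2 := fwd l; rewrite lk in q2.
have -> : Uk (k + unit_shift N a) - Uk l - sc_real S (2 * s) *: D (pt k) =
   (Uk (k + unit_shift N a) - Uk k - sc_real S s *: D (pt k)) +
   ((Uk k - Uk l - sc_real S s *: D (pt l)) + sc_real S s *: (D (pt l) - D (pt k))).
  have -> : 2 * s = s + s by ring.
  rewrite sc_realD scalerDl scalerBr.
  by apply/colP => c; rewrite !mxE; ring.
apply: le_trans (cnsqD_le _ _) _.
have q3 := cnsqD_le (Uk k - Uk l - sc_real S s *: D (pt l)) (sc_real S s *: (D (pt l) - D (pt k))).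
have q4 : cnsq (sc_real S s *: (D (pt l) - D (pt k))) <= s ^+ 2 * (B' * s ^+ 2).
  by rewrite cnsqZ nsq_real; apply: ler_wpM2l => //; exact: sqr_ge0.
have -> : s ^+ 2 * ((6 * B + 4 * B') * s ^+ 2) = 2 * (B * s ^+ 4) + 2 * (2 * (B * s ^+ 4) + 2 * (s ^+ 2 * (B' * s ^+ 2))) by ring.
move: q1 q2 q3 q4; move: (B * s ^+ 4) (s ^+ 2 * _) => *; lra.
Qed.

End OneBundle.
End Sampling.

(** * Distance to a finite-dimensional space, by finitely many functionals *)

Section GramSchmidt.
Context {R : realType} {V : lmodType R} (ip : V -> V -> R).
Hypothesis ipP : inner_product_on setT ip.
Let sT := subspaceT (V := V).

(* Induction: project the other vectors, and [u], orthogonally to the first. *)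
Lemma finite_approx (T : seq V) : exists e : seq V, forall u (c : nat -> R),
  let z := \sum_(k < size T) c k *: T`_k in
  ip u u <= ip (u - z) (u - z) + \sum_(x <- e) ip u x ^+ 2.
Proof.
have [m mT] := ubnP (size T); elim: m T mT => // m IH [|t T] mT.
  by exists [::] => u c /=; rewrite big_ord0 big_nil subr0 addr0.
have ge0 x : 0 <= ip x x by exact: (ip_ge0 ipP).
have [t0|t0] := eqVneq (ip t t) 0.
  have [e He] := IH T mT; exists e => u c.
  have := He u (fun k => c k.+1); rewrite /= big_ord_recl /=.
  set z := \sum_(k < size T) _ => h.
  apply: le_trans h _; rewrite lerD2r.
  have n0 x : ip t x = 0 by exact: (ip_eq0 sT ipP I I t0).
  have n1 x : ip x t = 0 by rewrite (ipC ipP).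
  have e1 : u - z = (u - (c 0%N *: t + z)) + c 0%N *: t.
    by rewrite opprD [- _ - z]addrC addrA subrK.
  rewrite e1 (ipDl ipP)// !(ipDr sT ipP)// !(ipZl sT ipP)// !(ipZr sT ipP)//.
  by rewrite !n0 !n1 !mulr0 !addr0.
have tp : 0 < ip t t by rewrite lt_neqAle eq_sym t0 ge0.
pose N := ip t t; pose P x := x - (ip x t / N) *: t.
have PD x y : P (x + y) = P x + P y.
  by rewrite /P (ipDl ipP)// mulrDl scalerDl opprD addrACA.
have PZ a x : P (a *: x) = a *: P x.
  by rewrite /P (ipZl sT ipP)// scalerBr scalerA mulrA.
have Pt : P t = 0 by rewrite /P divff// scale1r subrr.
have Psum (I : Type) (r : seq I) (F : I -> V) : P (\sum_(i <- r) F i) = \sum_(i <- r) P (F i).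
  elim/big_ind2 : _ => [|x1 x2 y1 y2 <- <-|//].
    by rewrite -[0 in LHS](scale0r t) PZ scale0r.
  exact: PD.
have Psym x y : ip (P x) y = ip x (P y).
  rewrite /P (ipBl sT ipP)// (ipBr sT ipP)// (ipZl sT ipP)// (ipZr sT ipP)//.
  by rewrite (ipC ipP (u := t) (v := y))//; ring.
have Pnorm x : ip x x = ip (P x) (P x) + ip x t ^+ 2 / N.
  have : ip (P x) (P x) = ip x x - ip x t ^+ 2 / N; last by move=> ->; rewrite subrK.
  rewrite /P (ipBl sT ipP)// !(ipBr sT ipP)// !(ipZl sT ipP)// !(ipZr sT ipP)//.
  by rewrite (ipC ipP (u := t) (v := x))// -/N; field.
have [|e He] := IH (map P T); first by rewrite size_map.
exists ((Num.sqrt N)^-1 *: t :: map P e) => u c.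
rewrite [\sum_(k < _) _]big_ord_recl /= big_cons big_map.
set z := \sum_(k < size T) _.
have := He (P u) (fun k => c k.+1); rewrite size_map.
have -> : \sum_(k < size T) c k.+1 *: (map P T)`_k = P (c 0%N *: t + z).
  rewrite PD PZ Pt scaler0 add0r Psum; apply: eq_bigr => k _.
  by rewrite PZ (nth_map 0).
rewrite -/z; set w := c 0%N *: t + z => /=.
have -> : P u - P w = P (u - w) by rewrite -[w in RHS]scale1r -scaleNr PD PZ scaleN1r.
have h1 := Pnorm (u - w); have h2 : 0 <= ip (u - w) t ^+ 2 / N.
  by rewrite mulr_ge0 ?sqr_ge0// invr_ge0 ltW.
rewrite (Pnorm u) (ipZr sT ipP)// exprMn exprVn sqr_sqrtr; last exact: ltW.
rewrite (eq_bigr (fun x => ip u (P x) ^+ 2)); last by move=> x _; rewrite Psym.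
rewrite h1; move: (ip (P (u - w)) _) (_ / N) h2 (\sum_(x <- e) _) (ip (P u) _) => p1 p2 h2 p3 p4.
by rewrite mulrC; move: (_ * _) => p5; lra.
Qed.

Lemma finite_family_approx (I : finType) (T : I -> V) : exists e : seq V, forall u (c : I -> R),
  let z := \sum_i c i *: T i in
  ip u u <= ip (u - z) (u - z) + \sum_(x <- e) ip u x ^+ 2.
Proof.
have [e He] := finite_approx [seq T i | i <- enum I]; exists e => u c.
pose d k := [seq c i | i <- enum I]`_k.
have := He u d; rewrite size_map.
have -> // : \sum_(k < size (enum I)) d k *: [seq T i | i <- enum I]`_k = \sum_i c i *: T i.
rewrite -[RHS]big_enum /= /d; elim: (enum I) => [|i l IHl]; first by rewrite big_ord0 big_nil.
by rewrite /= big_ord_recl big_cons IHl.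
Qed.

End GramSchmidt.

Section Absorption.
Context {R : realType}.

(** The energy controls |Au|^2 only up to the pairing of Bu with u, and Bu involves the gradient sum
    [S1] that is to be bounded. This closes the circle: [S1] returns with a factor proportional to
    the free weight [t]. The quantities [eA], [eU], [eB], [eD] are discretization errors. *)
Lemma absorb (K1 c1 KF Kl Q b1 : R) : 0 <= K1 -> 0 < c1 -> 0 <= KF -> 0 <= Kl -> 0 <= Q -> 0 <= b1 ->
  exists K2, 0 <= K2 /\ forall q rU rA rB SA SU S1 eA eU eB eD : R,
  0 <= q -> 0 <= rU -> 0 <= rB -> 0 <= SU -> 0 <= S1 -> 0 <= eA -> 0 <= eU -> 0 <= eB -> 0 <= eD ->
  rU <= q -> (forall t, 0 < t -> rA <= b1 * q + t * rB + t^-1 * rU) ->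
  c1 * SA <= 2 * KF * rA + eA -> c1 * SU <= 2 * Kl * rU + eU -> rB <= Q * (SU + S1) + eB ->
  S1 <= K1 * (SA + SU + eD) -> S1 <= K2 * (q + (eA + eU + eB + eD)).
Proof.
move=> K10 c10 KF0 Kl0 Q0 b10.
have [P [P0 PE]] : exists P, 0 <= P /\ P = K1 / c1.
  by exists (K1 / c1); rewrite divr_ge0// ltW.
(* Chosen so that the coefficient [2 * P * KF * t * Q] of the returning [S1] is at most one half. *)
pose t := (4 * P * KF * Q + 1)^-1.
have d0 : 0 < 4 * P * KF * Q + 1 by rewrite ltr_wpDl// !mulr_ge0//.
have t0 : 0 < t by rewrite invr_gt0.
have tP : 2 * P * KF * t * Q <= 2^-1.
  have -> : 2 * P * KF * t * Q = 2^-1 * ((4 * P * KF * Q) * t) by field.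
  rewrite -[leRHS]mulr1; apply: ler_wpM2l; first by rewrite invr_ge0.
  by rewrite /t ler_pdivrMr// mul1r lerDl.
have ti0 : 0 <= t^-1 by rewrite invr_ge0 ltW.
have ci0 : 0 <= c1^-1 by rewrite invr_ge0 ltW.
pose a1 := P * 2 * KF * (b1 + t^-1) + P * 2 * KF * t * Q * 2 * Kl / c1 + P * 2 * Kl.
pose a2 := P * 2 * KF * t * Q / c1 + P.
pose a3 := P * 2 * KF * t.
have t00 := ltW t0.
have a10 : 0 <= a1 by rewrite /a1 !addr_ge0 ?mulr_ge0 ?addr_ge0.
have a20 : 0 <= a2 by rewrite /a2 !addr_ge0 ?mulr_ge0.
have a30 : 0 <= a3 by rewrite /a3 !mulr_ge0.
exists (2 * (a1 + P + a2 + a3 + K1)); split.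
  apply: mulr_ge0 => //; apply: addr_ge0 => //; apply: addr_ge0 => //.
  by apply: addr_ge0 => //; exact: addr_ge0.
move=> q rU rA rB SA SU S1 eA eU eB eD q0 rU0 rB0 SU0 S10 eA0 eU0 eB0 eD0 h1 h2 h3 h4 h5 h6.
have g4 : SU <= c1^-1 * (2 * Kl * q + eU).
  rewrite ler_pdivlMl//; apply: le_trans h4 _; rewrite lerD2r.
  by apply: ler_wpM2l => //; rewrite mulr_ge0.
have g2 : rA <= (b1 + t^-1) * q + t * (Q * (c1^-1 * (2 * Kl * q + eU) + S1) + eB).
  apply: le_trans (h2 t t0) _.
  have q1 : t^-1 * rU <= t^-1 * q by exact: ler_wpM2l.
  have q2 : t * rB <= t * (Q * (c1^-1 * (2 * Kl * q + eU) + S1) + eB).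
    apply: ler_wpM2l => //; apply: le_trans h5 _; rewrite lerD2r; apply: ler_wpM2l => //.
    by rewrite lerD2r.
  rewrite mulrDl; move: q1 q2; move: (t^-1 * rU) (t^-1 * q) (t * rB) (t * _) (b1 * q) => *; lra.
have g3 : SA <= c1^-1 * (2 * KF * rA + eA) by rewrite ler_pdivlMl.
have g6 : S1 <= P * (2 * KF * rA + eA) + P * (2 * Kl * q + eU) + K1 * eD.
  apply: le_trans h6 _; rewrite mulrDr lerD2r mulrDr PE.
  rewrite -[K1 / c1 * (2 * KF * rA + eA)]mulrA -[K1 / c1 * (2 * Kl * q + eU)]mulrA.
  by apply: lerD; apply: ler_wpM2l.
have g7 : P * (2 * KF * rA) <= P * (2 * KF * ((b1 + t^-1) * q + t * (Q * (c1^-1 * (2 * Kl * q + eU) + S1) + eB))).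
  by apply: ler_wpM2l => //; apply: ler_wpM2l => //; rewrite mulr_ge0.
have g8 : S1 <= a1 * q + P * eA + a2 * eU + a3 * eB + K1 * eD + (2 * P * KF * t * Q) * S1.
  apply: le_trans g6 _; rewrite mulrDr.
  have -> : a1 * q + P * eA + a2 * eU + a3 * eB + K1 * eD + (2 * P * KF * t * Q) * S1 =
    P * (2 * KF * ((b1 + t^-1) * q + t * (Q * (c1^-1 * (2 * Kl * q + eU) + S1) + eB)))
    + P * eA + P * (2 * Kl * q + eU) + K1 * eD by rewrite /a1 /a2 /a3; ring.
  by rewrite !lerD2r.
have g9 : (2 * P * KF * t * Q) * S1 <= 2^-1 * S1 by exact: ler_wpM2r.
pose T := q + (eA + eU + eB + eD).
have T1 : q <= T by rewrite /T lerDl !addr_ge0.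
have T2 : eA <= T by rewrite /T; lra.
have T3 : eU <= T by rewrite /T; lra.
have T4 : eB <= T by rewrite /T; lra.
have T5 : eD <= T by rewrite /T; lra.
have := ler_wpM2l a10 T1; have := ler_wpM2l P0 T2; have := ler_wpM2l a20 T3.
have := ler_wpM2l a30 T4; have := ler_wpM2l K10 T5; rewrite -/T.
have -> : 2 * (a1 + P + a2 + a3 + K1) * T = 2 * (a1 * T) + 2 * (P * T) + 2 * (a2 * T) + 2 * (a3 * T) + 2 * (K1 * T) by ring.
move: g8 g9; move: (a1 * T) (P * T) (a2 * T) (a3 * T) (K1 * T) (a1 * q) (P * eA) (a2 * eU) (a3 * eB) (K1 * eD) (_ * S1).
move=> y1 y2 y3 y4 y5 z1 z2 z3 z4 z5 z6; lra.
Qed.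

End Absorption.

(** * Gradient and Rellich estimates in a small cube *)

Section LocalEstimate.
Context {R : realType} {b : base_field} {n : nat} {M : ptopologicalType}.
Local Notation S := (scalars_of R b).
Context {X : manifold R n M} (mu : {measure set (borel M) -> \bar R}).
Context {E F : vbundle S X} (h : bundle_metric E) (hF : bundle_metric F).
Hypothesis mu_fin : forall K : set M, compact K ->
  exists U : set M, [/\ open U, K `<=` U & (mu U < +oo)%E].
Context (L : section E -> section E) (A : section E -> section F)
  (A' : section F -> section E) (B : section E -> section E) (beta : R).
Hypotheses (dA : diff_op 1 A) (adj : formal_adjoint mu h hF A A') (dB : diff_op 1 B).
Hypothesis LE : forall s, smooth_section s -> forall x, L s x = A' (A s) x + B s x.
Hypothesis bb : forall u, Cc setT u -> beta * ri mu h u u <= ri mu h (L u) u.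
Local Notation riE := (ri mu h).
Local Notation riF := (ri mu hF).

Definition energy u : R := riE (L u) u + (1 - beta) * riE u u.

Lemma ri_ge0 (u : section E) : 0 <= riE u u.
Proof. by apply: Rintegral_ge0 => x _; exact: hr_ge0. Qed.

Lemma energy_ge u : Cc setT u -> riE u u <= energy u.
Proof. by move=> /bb; rewrite /energy; lra. Qed.

Lemma ri_cauchy (u v : section E) (t : R) : L2 mu h setT u -> L2 mu h setT v -> 0 < t ->
  2 * `|riE u v| <= t * riE u u + t^-1 * riE v v.
Proof.
move=> Lu Lv t0.
exact: (cauchy_schwarz_eps (subspaceT (V := l2sec mu h)) (l2_ipP mu h) t0 (I : setT (L2Sec Lu)) (I : setT (L2Sec Lv))).
Qed.

Context (i : atlas X) (j : triv_index E) (l : triv_index F).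
Context (cA : seq 'I_n -> M -> 'M[S]_(rank F, rank E)) (cB : seq 'I_n -> M -> 'M[S]_(rank E, rank E)).
Hypotheses (lfA : local_form 1 A i j l cA) (lfB : local_form 1 B i j j cB).
Context (y0 : 'rV[R]_n) (r : R) (V0 : set M) (c1 C1 : R).
Hypotheses (r0 : 0 < r) (oV0 : open V0) (V0d : V0 `<=` dom i) (V0j : V0 `<=` triv_dom j)
  (V0l : V0 `<=` triv_dom l).
Hypotheses (rV0 : cbox y0 r `<=` chart i @` (V0 `&` dom i)) (c10 : 0 < c1) (C10 : 0 < C1).
Hypothesis hm : forall p s, 0 <= s -> hbox p s `<=` cbox y0 r ->
  ((c1 * s ^+ n)%:E <= mu (chart_box i p s) /\ mu (chart_box i p s) <= (C1 * s ^+ n)%:E)%E.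
Context (a0 : 'I_n -> 'M[S]_(rank F, rank E)) (C K0 Ka Kb KF Ku Kl th : R).
Hypotheses (C0 : 0 <= C) (K00 : 0 <= K0) (Ka0 : 0 <= Ka) (Kb0 : 0 <= Kb) (KF0 : 0 <= KF)
  (Ku0 : 0 <= Ku) (Kl0 : 0 <= Kl) (th0 : 0 <= th) (small : 16 * C * n%:R * th <= 1).
Hypothesis hsym : forall (xi : 'I_n -> R) (w : 'cV[S]_(rank E)),
  (\sum_j xi j ^+ 2) * cnsq w <= C * cnsq ((\sum_j sc_real S (xi j) *: a0 j) *m w).
Hypothesis hth : forall x, V0 x -> forall a w, cnsq ((cA [:: a] x - a0 a) *m w) <= th * cnsq w.
Hypothesis hK0 : forall x, V0 x -> forall w, cnsq (cA [::] x *m w) <= K0 * cnsq w.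
Hypothesis hKa : forall a w, cnsq (a0 a *m w) <= Ka * cnsq w.
Hypothesis hKb0 : forall x, V0 x -> forall w, cnsq (cB [::] x *m w) <= Kb * cnsq w.
Hypothesis hKb : forall x, V0 x -> forall a w, cnsq (cB [:: a] x *m w) <= Kb * cnsq w.
Hypothesis hKF : forall x, V0 x -> forall w : fiber F x, cnsq (triv l x w) <= KF * hr hF w w.
Hypothesis hKu : forall x, V0 x -> forall w : fiber E x, hr h w w <= Ku * cnsq (triv j x w).
Hypothesis hKl : forall x, V0 x -> forall w : fiber E x, cnsq (triv j x w) <= Kl * hr h w w.
Local Notation G N := {ffun 'I_n -> 'I_N.+1}.
Local Notation V := (boxV i y0 r).
Local Notation P k := (pt i y0 r k).
Local Notation step := (step r).

Lemma local_form1E (E1 F1 : vbundle S X) (Q : section E1 -> section F1) j1 l1 c s x :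
  local_form 1 Q i j1 l1 c -> smooth_section s -> dom i x -> triv_dom j1 x -> triv_dom l1 x ->
  triv l1 x (Q s x) = c [::] x *m coords j1 s x + \sum_a c [:: a] x *m pderivV i a (coords j1 s) x.
Proof.
move=> lf ss dx jx lx; rewrite (local_form_eq lf)// big_ord_recr big_ord1 /=.
by rewrite (sum_tuple0 (fun t : seq 'I_n => c t x *m pderivs i t (coords j1 s) x))
  (sum_tuple1 (fun t : seq 'I_n => c t x *m pderivs i t (coords j1 s) x)).
Qed.

Let s0 N : 0 < step N. Proof. exact: step_gt0. Qed.
Let p0 : 0 <= (2 * r) ^+ n. Proof. by rewrite exprn_ge0// mulr_ge0// ltW. Qed.

Definition grad_sum N (u : section E) : R :=
  step N ^+ n * \sum_(k : G N) \sum_a cnsq (pderivV i a (coords j u) (P k)).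

Lemma grad_sum_ge0 N u : 0 <= grad_sum N u.
Proof.
rewrite mulr_ge0 ?exprn_ge0 ?(ltW (s0 N))// sumr_ge0// => k _; rewrite sumr_ge0// => a _.
exact: cnsq_ge0.
Qed.

(** Gårding's inequality for the sampled gradient. [K2] precedes [u], whereas [Bu] may depend on
    derivatives of [u]; its term disappears as the mesh is refined for fixed [u]. *)
Lemma gradient_sum : exists K2, 0 <= K2 /\ forall u, Cc V u -> exists Bu, 0 <= Bu /\
  forall N, grad_sum N u <= K2 * energy u + Bu * step N ^+ 2.
Proof.
have [K1 [K10 HK1]] := @discrete_gradient _ b n (rank F) (rank E) _ _ _ _ C0 K00 Ka0 th0 small.
(* Bounds |Bu|^2 by the sampled values and first derivatives of [u], through the coefficients
   [cB]. *)
pose Q := 2 * C1 * Ku * (2 * Kb + 2 * n%:R * n%:R * Kb).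
have Q0 : 0 <= Q by rewrite /Q !mulr_ge0 ?addr_ge0 ?mulr_ge0 ?(ltW C10).
have b10 : 0 <= 1 + `|1 - beta| by rewrite addr_ge0.
have [K2 [K20 HK2]] := absorb K10 c10 KF0 Kl0 Q0 b10.
exists K2; split => // u cu.
have cuT : Cc setT u by exact: Cc_sub cu.
have [su _ uV] := cu.
have cAu := Cc_diff_op dA cu; have cBu := Cc_diff_op dB cu.
have [BA [BA0 HA]] := sample_le mu_fin r0 rV0 hm V0l KF0 cAu hKF.
have [BU [BU0 HU]] := sample_le mu_fin r0 rV0 hm V0j Kl0 cu hKl.
have [BB [BB0 HB]] := sample_ge mu_fin r0 rV0 C10 hm V0j Ku0 cBu hKu.
have [BD [BD0 HD]] := central_diff_bound r0 oV0 V0d rV0 V0j cu.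
exists (K2 * (BA + BU + BB + (2 * r) ^+ n * BD)); split.
  by rewrite mulr_ge0// !addr_ge0// mulr_ge0.
move=> N; set s := step N; have s2 : 0 <= s ^+ 2 by exact: sqr_ge0.
have sn : 0 <= s ^+ n by rewrite exprn_ge0// ltW// s0.
pose SA := s ^+ n * \sum_(k : G N) cnsq (coords l (A u) (P k)).
pose SU := s ^+ n * \sum_(k : G N) cnsq (coords j u (P k)).
have e0 : 0 <= BD * s ^+ 2 by rewrite mulr_ge0.
have := HK1 N s (BD * s ^+ 2) (fun k => coords j u (P k)) (fun k a => pderivV i a (coords j u) (P k))
  (fun k => coords l (A u) (P k)) a0 (fun k a => cA [:: a] (P k)) (fun k => cA [::] (P k))
  (unit_shift N) (s0 N) e0 hsym.
have PV (k : G N) : V0 (P k) by have [] := ptP r0 rV0 k.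
move=> /(_ (fun k a w => hth (PV k) a w) (fun k w => hK0 (PV k) w) hKa).
have lfk (k : G N) : coords l (A u) (P k) = cA [::] (P k) *m coords j u (P k) +
    \sum_a cA [:: a] (P k) *m pderivV i a (coords j u) (P k).
  by have V0x := PV k; apply: (local_form1E lfA) => //; [exact: V0d|exact: V0j|exact: V0l].
move=> /(_ lfk (fun k a => (HD N k a).1)) hS.
have h6 : grad_sum N u <= K1 * (SA + SU + (2 * r) ^+ n * BD * s ^+ 2).
  have := ler_wpM2l sn hS; rewrite -/(grad_sum N u) mulrCA; congr (_ <= _ * _).
  rewrite /SA /SU !big_split /= !mulrDr; congr (_ + _).
  by rewrite (sum_cells r N (BD * s ^+ 2)) mulrA.
have := HK2 (energy u) (riE u u) (riF (A u) (A u)) (riE (B u) (B u)) SA SU (grad_sum N u)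
  (BA * s ^+ 2) (BU * s ^+ 2) (BB * s ^+ 2) ((2 * r) ^+ n * BD * s ^+ 2).
move=> hh; rewrite [leRHS](_ : _ = K2 * (energy u +
  (BA * s ^+ 2 + BU * s ^+ 2 + BB * s ^+ 2 + (2 * r) ^+ n * BD * s ^+ 2))); last by ring.
apply: hh.
- by apply: le_trans (energy_ge cuT); exact: ri_ge0.
- exact: ri_ge0.
- exact: ri_ge0.
- by rewrite mulr_ge0// sumr_ge0// => k _; exact: cnsq_ge0.
- exact: grad_sum_ge0.
- exact: mulr_ge0.
- exact: mulr_ge0.
- exact: mulr_ge0.
- by apply: mulr_ge0 => //; exact: mulr_ge0.
- exact: energy_ge.
(* By the weak form, |Au|^2 is the energy up to a multiple of |u|^2 and the pairing of Bu with u,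
   which is split with weight [t]. *)
- move=> t t0; have e1 := ri_L mu_fin dA adj dB LE cu cu.
  have e2 : riF (A u) (A u) = energy u - (1 - beta) * riE u u - riE (B u) u.
    by rewrite /energy e1; ring.
  have q1 := ri_cauchy (Cc_L2 h mu_fin cBu) (Cc_L2 h mu_fin cu) t0.
  have q2 := ler_norm (- riE (B u) u); rewrite normrN in q2.
  have q3 : - ((1 - beta) * riE u u) <= `|1 - beta| * energy u.
    apply: (@le_trans _ _ (`|1 - beta| * riE u u)); last first.
      by apply: ler_wpM2l => //; exact: energy_ge.
    rewrite -mulNr; apply: ler_wpM2r; first exact: ri_ge0.
    by rewrite -normrN; exact: ler_norm.
  have q4 : 0 <= t * riE (B u) (B u) by rewrite mulr_ge0 ?ri_ge0// ltW.
  have q5 : 0 <= t^-1 * riE u u by rewrite mulr_ge0 ?ri_ge0// invr_ge0 ltW.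
  have q6 := normr_ge0 (riE (B u) u).
  rewrite e2; have -> : (1 + `|1 - beta|) * energy u = energy u + `|1 - beta| * energy u by ring.
  move: q1 q2 q3 q4 q5 q6; move: (t * _) (t^-1 * _) (`|1 - beta| * _) ((1 - beta) * _) (`|riE (B u) u|) => *.
  by lra.
- by have := HA N; rewrite -/s /SA mulrA.
- by have := HU N; rewrite -/s /SU mulrA.
- apply: le_trans (HB N) _; rewrite -/s lerD2r /Q.
  have -> : 2 * C1 * Ku * (2 * Kb + 2 * n%:R * n%:R * Kb) * (SU + grad_sum N u) =
    2 * C1 * Ku * ((2 * Kb + 2 * n%:R * n%:R * Kb) * (SU + grad_sum N u)) by rewrite !mulrA.
  rewrite -mulrA; apply: ler_wpM2l; first by rewrite !mulr_ge0// ltW.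
  apply: (@le_trans _ _ (2 * Kb * SU + 2 * n%:R * Kb * grad_sum N u)).
    rewrite /SU /grad_sum -/s mulrCA [X in _ + X]mulrCA -mulrDr; apply: ler_wpM2l => //.
    rewrite !mulr_sumr -big_split /=; apply: ler_sum => k _; have V0x := PV k.
    have -> : coords j (B u) (P k) = cB [::] (P k) *m coords j u (P k) +
        \sum_a cB [:: a] (P k) *m pderivV i a (coords j u) (P k).
      by apply: (local_form1E lfB) => //; [exact: V0d|exact: V0j|exact: V0j].
    apply: le_trans (cnsqD_le _ _) _; rewrite -!mulrA; apply: lerD.
      by apply: ler_wpM2l => //; exact: hKb0.
    apply: ler_wpM2l => //; apply: le_trans (cnsq_sum_le _ _) _.
    rewrite /index_enum -enumT size_enum_ord enumT; apply: ler_wpM2l => //.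
    by rewrite mulr_sumr; apply: ler_sum => a _; exact: hKb.
  have gs := grad_sum_ge0 N u.
  have SU0 : 0 <= SU by rewrite mulr_ge0// sumr_ge0// => k _; exact: cnsq_ge0.
  have e : (2 * Kb + 2 * n%:R * n%:R * Kb) * (SU + grad_sum N u) = 2 * Kb * SU +
      2 * n%:R * Kb * grad_sum N u + 2 * (n%:R * n%:R * Kb * SU)
      + (n%:R * n%:R + 1 - n%:R) * (2 * Kb * grad_sum N u) by ring.
  have n2 : 0 <= n%:R * n%:R + 1 - n%:R :> R by move: (n%:R) => x; nra.
  rewrite e -addrA lerDl; clear -SU0 gs n2 Kb0; move: SU0 gs n2; move: SU (grad_sum N u) => y1 y2 y10 y20 n2.
  apply: addr_ge0.
    by apply: mulr_ge0 => //; apply: mulr_ge0 => //; apply: mulr_ge0.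
  by apply: mulr_ge0 => //; apply: mulr_ge0 => //; apply: mulr_ge0.
exact: h6.
Qed.

(** The real basis 1, i of the scalars; over the real field the second element is 0. *)
Definition basis_scalar (g : bool) : S := if g then 1 else sc_mk S 0 1.

Lemma basis_scalarE (z : S) : \sum_g sc_real S (reim z g) * basis_scalar g = z.
Proof.
rewrite big_bool /reim /basis_scalar mulr1; move: z; case: b => [z|[p q]] /=.
  by rewrite mul0r addr0.
by apply/eqP; rewrite eq_complex /= !(mulr0, mul0r, mulr1, subr0, addr0, add0r) !eqxx.
Qed.

(** A grid [G N] has [N.+1] nodes per side, hence the predecessors: a grid with [m * p] nodes
    refines one with [p] nodes, and its blocks of side [m] are the coarse cells. *)
Lemma block_index (m p : nat) : (0 < m)%N -> (0 < p)%N ->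
  forall k : G (m * p).-1, exists q : G p.-1,
    (forall x, cell i y0 r k x -> cell i y0 r q x) /\
    forall a, (q a = k a %/ m :> nat)%N.
Proof.
move=> m0 p1 k; have mp : ((m * p).-1.+1 = m * p)%N by rewrite prednK// muln_gt0 m0.
have pp : (p.-1.+1 = p)%N by rewrite prednK.
have kd a : (k a %/ m < p.-1.+1)%N by rewrite pp ltn_divLR//; apply: leq_trans (ltn_ord (k a)) _; rewrite mp mulnC.
exists [ffun a => Ordinal (kd a)]; split; last by move=> a; rewrite ffunE.
move=> x [dx hx]; split => // a; have /andP[h1 h2] := hx a.
have sp : step p.-1 = m%:R * step (m * p).-1.
  have q1 := step_mul r p.-1; have q2 := step_mul r (m * p).-1; rewrite pp in q1.
  rewrite mp natrM in q2; have pn : p%:R != 0 :> R by rewrite pnatr_eq0 -lt0n.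
  by apply: (mulIf pn); rewrite q1 -q2; ring.
rewrite !mxE !ffunE /= in h1 h2 *; rewrite sp.
have s1 := s0 (m * p).-1; move: (step (m * p).-1) s1 h1 h2 => s s1 h1 h2.
have e1 : s * ((k a %/ m * m)%N)%:R <= s * (k a)%:R.
  by apply: ler_wpM2l; [exact: ltW|rewrite ler_nat leq_trunc_div].
have e2 : s * (k a)%:R + s <= s * (((k a %/ m).+1 * m)%N)%:R.
  rewrite -[X in _ + X]mulr1 -mulrDr natr1; apply: ler_wpM2l; first exact: ltW.
  by rewrite ler_nat ltn_ceil.
move: e1 e2; rewrite mulSn !natrD !natrM mulrDr.
have -> : m%:R * s * (k a %/ m)%:R = s * ((k a %/ m)%:R * m%:R) by ring.
rewrite (mulrC m%:R s); move: (s * (_ * _)) (s * m%:R) (s * (k a)%:R) h1 h2 => z1 z2 z3 *.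
by apply/andP; split; lra.
Qed.

(** The sample point chosen by the Poincaré inequality depends on the coarse cell only, so sampling
    there defines a section constant on coarse cells. *)
Lemma block_corner (m p : nat) (d : {ffun 'I_n -> 'I_m}) : (0 < m)%N -> (0 < p)%N ->
  exists om : G p.-1 -> G (m * p).-1, forall (k : G (m * p).-1) (q : G p.-1),
    (forall a, (q a = k a %/ m :> nat)%N) ->
    k - block_residue m k + offset (m * p).-1 d = om q.
Proof.
move=> m0 p1; exists (fun q : G p.-1 => [ffun a => inZp (q a * m + d a)] : G (m * p).-1) => k q hq.
apply/ffunP => a; rewrite /block_residue /offset !ffunE.
have e : k a = inZp (k a %/ m * m)%N + inZp (k a %% m) :> 'I_(m * p).-1.+1.
  by apply: val_inj => /=; rewrite modnDm -divn_eq modn_small.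
by rewrite [X in X - _]e addrK hq; apply: val_inj => /=; rewrite modnDm.
Qed.

Lemma l2val_sum (I : Type) (q : seq I) (T : I -> l2sec mu h) x :
  l2val (\sum_(k <- q) T k) x = \sum_(k <- q) l2val (T k) x.
Proof.
by elim: q => [|k q IH]; rewrite ?big_nil// !big_cons l2valD IH.
Qed.

(** The finite-dimensional space of approximants: sections with constant coordinates on each cell,
    spanned by frame vectors and their multiples by i, cut off to the cells. The family depends on
    the coarse grid alone, never on the section to be approximated. *)
Lemma block_sections (p : nat) : exists T : G p * ('I_(rank E) * bool) -> l2sec mu h,
  forall w : G p -> 'cV[S]_(rank E),
  let z := \sum_k reim (w k.1 k.2.1 0) k.2.2 *: T k in
  (forall q x, cell i y0 r q x -> coords j (l2val z) x = w q) /\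
  (forall x, (forall q : G p, ~ cell i y0 r q x) -> l2val z x = 0).
Proof.
have cK := box_compact rV0.
have KV0 : param i @` cbox y0 r `<=` V0.
  by move=> _ [y cy <-]; have [] := cbox_param rV0 cy.
have [ps cps] := cutoff_ex X oV0 cK KV0.
pose sg (k : 'I_(rank E) * bool) : section E :=
  fun y => sc_real S (ps y) *: triv_inv j y (basis_scalar k.2 *: delta_mx k.1 0).
have csg k : Cc V0 (sg k) by exact: (cutoff_section _ oV0 V0j cps).
pose tT (q : G p) k : section E := fun x => sc_real S (\1_(cell i y0 r q) (x : borel M)) *: sg k x.
have LT q k : L2 mu h setT (tT q k).
  have [ssg _ _] := csg k; have Ls := Cc_L2 h mu_fin (csg k).
  have [ms is_] := (L2E mu h (sg k)).1 Ls.
  have mc : measurable (cell i y0 r q) by exact: cell_measurable.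
  have mt : measurable_section (tT q k).
    have -> : tT q k = (fun x => sc_real S (\1_(cell i y0 r q) (x : borel M)) *: sg k x + 0).
      by apply: functional_extensionality_dep => x; rewrite addr0.
    apply: measurable_section_lin => [j'||] //; last exact: (L2_measurable (L2_zero mu h)).
    split.
      apply: (eq_measurable_fun (\1_(cell i y0 r q) : borel M -> R)) => [x _|]; first by rewrite sc_re_real.
      by apply: measurable_funTS; exact: measurable_indic.
    apply: (eq_measurable_fun (fun=> 0 : R)) => [x _|]; first by rewrite sc_im_real.
    exact: measurable_cst.
  apply/L2E; split => //; apply: integrable_le is_; first exact: hr_measurable.
  move=> x; rewrite ger0_norm ?hr_ge0// /tT hr_scale nsq_real indicE.
  by case: (_ \in _); rewrite ?expr1n ?mul1r// expr0n mul0r hr_ge0.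
exists (fun k => L2Sec (LT k.1 k.2)) => w z.
have zE x : l2val z x = \sum_q \sum_k sc_real S (reim (w q k.1 0) k.2 * \1_(cell i y0 r q) (x : borel M)) *: sg k x.
  rewrite /z -(pair_bigA _ (fun q k => reim (w q k.1 0) k.2 *: L2Sec (LT q k))) /= l2val_sum.
  apply: eq_bigr => q _; rewrite l2val_sum; apply: eq_bigr => k _.
  by rewrite l2valZ /= /tT scalerA -sc_realM.
split => [q x qx|x nx]; last first.
  rewrite zE big1// => q _; rewrite big1// => k _.
  by rewrite indicE memNset ?mulr0 ?sc_real0 ?scale0r//; exact: nx.
rewrite /coords zE (bigD1 q)//= [X in _ + X]big1 ?addr0; last first.
  move=> q' qq'; rewrite big1// => k _; rewrite indicE memNset ?mulr0 ?sc_real0 ?scale0r//.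
  by move=> q'x; move/eqP: qq'; apply; exact: (cell_disjoint r0 q'x qx).
have [_ _ [W [_ KW ps1]] _] := cps.
have px : ps x = 1 by apply/ps1/KW; exact: (cell_box r0 qx).
have jx : triv_dom j x by apply: V0j; exact: (cell_V0 r0 rV0 qx).
rewrite linear_sum.
rewrite (eq_bigr (fun k : 'I_(rank E) * bool =>
  (sc_real S (reim (w q k.1 0) k.2) * basis_scalar k.2) *: (delta_mx k.1 0 : 'cV[S]_(rank E)))).
  rewrite -(pair_bigA _ (fun a g => (sc_real S (reim (w q a 0) g) * basis_scalar g) *: (delta_mx a 0 : 'cV[S]_(rank E)))) /=.
  apply/colP => a; rewrite summxE (bigD1 a)//= [X in _ + X]big1 ?addr0; last first.
    move=> a' aa'; rewrite summxE big1// => g _; by rewrite !mxE eq_sym (negbTE aa') mulr0.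
  rewrite summxE -[RHS]basis_scalarE; apply: eq_bigr => g _.
  by rewrite !mxE !eqxx mulr1.
move=> k _; rewrite indicE mem_set// mulr1 /sg px sc_real1 scale1r linearZ /= triv_invK//.
by rewrite scalerA.
Qed.

(** A coarse grid is fixed by [eps], and [v] is compared with a section [z] constant on its cells,
    sampled on a refined grid. Poincaré on blocks of width [2 * r / p%:R] and the gradient estimate
    bound |v - z|^2 by [eps] times the energy plus an error. The functionals measure the projection
    of [v] to the space containing [z]. *)
Lemma local_estimate (eps : R) : 0 < eps -> exists s : seq (l2sec mu h), forall v : l2sec mu h,
  Cc V (l2val v) ->
  l2ip v v <= eps * energy (l2val v) + \sum_(x <- s) l2ip v x ^+ 2.
Proof.
move=> eps0; have [K2 [K20 HK2]] := gradient_sum.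
pose K3 := 2 * C1 * Ku * (4 ^+ n * (2 * r) ^+ 2 * (2 * K2)).
have K30 : 0 <= K3 by rewrite /K3 !mulr_ge0 ?exprn_ge0 ?mulr_ge0 ?(ltW C10) ?(ltW r0).
(* Then [p%:R] exceeds [K3 / eps], and [p%:R <= p%:R ^+ 2]. *)
pose p := (Num.truncn (K3 / eps)).+1.
have pK : K3 / p%:R ^+ 2 <= eps.
  have pp : 0 < p%:R :> R by rewrite ltr0n.
  have h1 : K3 / eps < p%:R.
    have h0 : 0 <= K3 / eps by rewrite divr_ge0// ltW.
    by have /andP[_] := truncn_itv h0.
  rewrite ler_pdivrMr ?exprn_gt0//; move: h1; rewrite ltr_pdivrMr// => h1.
  apply: le_trans (ltW h1) _; rewrite mulrC; apply: ler_wpM2l; first exact: ltW.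
  by rewrite expr2 -[leLHS]mulr1; apply: ler_wpM2l; [exact: ltW|rewrite ler1n].
have p1 : (0 < p)%N by [].
have [T HT] := block_sections p.-1.
have [s Hs] := finite_family_approx (l2_ipP mu h) T.
exists s => v cv; have cvT : Cc setT (l2val v) by exact: Cc_sub cv.
have [sv _ vV] := cv; set u := l2val v in cv cvT sv vV *.
have [Bu [Bu0 HBu]] := HK2 u cv.
have [BD [BD0 HD]] := central_diff_bound r0 oV0 V0d rV0 V0j cv.
have [BL BL0 HL] := cell_lipschitz r0 rV0 (coords_smooth i V0j sv).
have q0 : 0 <= energy u by apply: le_trans (energy_ge cvT); exact: ri_ge0.
pose Berr := 2 * C1 * Ku * (4 ^+ n * (2 * r) ^+ 2 * (2 * (n%:R * ((2 * r) ^+ n * BD)) + 2 * Bu)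
   + (2 * r) ^+ n * BL).
have Be0 : 0 <= Berr.
  rewrite /Berr; apply: mulr_ge0; first by rewrite !mulr_ge0// ltW.
  apply: addr_ge0; last by rewrite mulr_ge0// ltW.
  apply: mulr_ge0; first by rewrite mulr_ge0 ?exprn_ge0 ?mulr_ge0 ?(ltW r0).
  by apply: addr_ge0; rewrite !mulr_ge0.
(* The refinement [m] enters only through the mesh in the error term; neither [eps] nor the
   functionals depend on it. *)
have key m : (0 < m)%N -> l2ip v v <= eps * energy u + Berr * step (m * p).-1 ^+ 2
    + \sum_(x <- s) l2ip v x ^+ 2.
  move=> m0; set N := (m * p).-1; pose st := step N.
  have st0 : 0 < st by exact: s0.
  pose Uk (k : G N) := coords j u (P k).
  have [d hd] := poincare_scalars Uk m0 (fun a => erefl (unit_shift N a)).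
  have [om Hom] := block_corner d m0 p1.
  pose wq (q : G p.-1) := Uk (om q).
  have [z1 z2] := HT wq; have hz := Hs v (fun k => reim (wq k.1 k.2.1 0) k.2.2).
  move: z1 z2 hz; rewrite /=; set z := \sum_k _ => z1 z2 hz.
  apply: le_trans hz _; rewrite lerD2r.
  pose ck (k : G N) := k - block_residue m k + offset N d.
  have d0 : 0 <= BL * st ^+ 2 by rewrite mulr_ge0 ?sqr_ge0// ltW.
  have vz : ri mu h (l2val (v - z)) (l2val (v - z)) <= 2 * C1 * Ku *
     (st ^+ n * (\sum_(k : G N) cnsq (Uk k - Uk (ck k))) + (2 * r) ^+ n * (BL * st ^+ 2)).
    apply: (sample_ge_gen r0 rV0 hm (j := j) (w := fun k => Uk k - Uk (ck k))) => //.
    - exact: (l2P (v - z)).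
    - move=> x nx; rewrite l2valB -/u (supp0 (s := u)); last first.
        by move=> /vV /(boxV_cell r0 N)[k]; exact: nx.
      rewrite z2 ?subr0// => q [dx qx]; have hc : forall a, y0 0 a - r <= chart i x 0 a < y0 0 a + r.
        move=> a; have /andP[h1 h2] := qx a; have [h3 h4] := node_itv y0 r0 q a.
        by apply/andP; split; [exact: le_trans h3 h1|exact: lt_le_trans h2 h4].
      by have [k] := cell_cover r0 N dx hc; exact: nx.
    - move=> k x kx; have [q [kq qE]] := block_index m0 p1 k.
      have e : coords j (l2val (v - z)) x = coords j u x - Uk (ck k).
        rewrite /coords l2valB linearB /= -/u; congr (_ - _).
        by have := z1 q x (kq x kx); rewrite /coords => ->; rewrite /wq -(Hom k q qE).
      have -> : coords j (l2val (v - z)) x - (Uk k - Uk (ck k)) = coords j u x - Uk k.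
        by rewrite e opprB addrA subrK.
      by have [] := HL N k x kx.
  apply: le_trans vz _.
  have pn : (0 : R) < p%:R by rewrite ltr0n.
  have ms : m%:R * st = 2 * r / p%:R.
    have := step_mul r N; rewrite -/st prednK ?muln_gt0 ?m0// natrM => <-.
    by field; exact: lt0r_neq0.
  have hpo : st ^+ n * (\sum_(k : G N) cnsq (Uk k - Uk (ck k))) <=
     4 ^+ n * (2 * r / p%:R) ^+ 2 * (2 * (n%:R * ((2 * r) ^+ n * BD)) * st ^+ 2 + 2 * grad_sum N u).
    have h1 : \sum_a \sum_(k : G N) cnsq (Uk (k + unit_shift N a) - Uk k) <=
       \sum_a \sum_(k : G N) (2 * (BD * st ^+ 4) + 2 * st ^+ 2 * cnsq (pderivV i a (coords j u) (P k))).
      by apply: ler_sum => a _; apply: ler_sum => k _; have [_] := HD N k a.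
    have h2 : st ^+ n * (\sum_a \sum_(k : G N) (2 * (BD * st ^+ 4) + 2 * st ^+ 2 * cnsq (pderivV i a (coords j u) (P k))))
      = st ^+ 2 * (2 * (n%:R * ((2 * r) ^+ n * BD)) * st ^+ 2 + 2 * grad_sum N u).
      rewrite mulr_sumr (eq_bigr (fun a => (2 * r) ^+ n * (2 * (BD * st ^+ 4)) + 2 * st ^+ 2 *
        (st ^+ n * \sum_(k : G N) cnsq (pderivV i a (coords j u) (P k))))); last first.
        by move=> a _; rewrite big_split /= mulrDr (sum_cells r N) -mulr_sumr; congr (_ + _); exact: mulrCA.
      rewrite big_split /= sumr_const card_ord -[X in X + _]mulr_natr -mulr_sumr -mulr_sumr.
      by rewrite /grad_sum -/st [in RHS]exchange_big /=; move: (\sum_(a < n) _) => y; ring.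
    have sn : 0 <= st ^+ n by rewrite exprn_ge0// ltW.
    apply: le_trans (ler_wpM2l sn hd) _.
    have h3 := ler_wpM2l sn h1; rewrite h2 in h3.
    have c5 : 0 <= 4 ^+ n * m%:R ^+ 2 :> R by rewrite mulr_ge0// exprn_ge0.
    rewrite mulrCA; apply: le_trans (ler_wpM2l c5 h3) _.
    rewrite -ms [(m%:R * st) ^+ 2]exprMn le_eqVlt; apply/orP; left; apply/eqP.
    by move: (2 * _ * _ + _) => y; ring.
  have gs := HBu N; rewrite -/st in gs.
  have CK0 : 0 <= 2 * C1 * Ku by rewrite !mulr_ge0// ltW.
  have c4 : 0 <= 4 ^+ n * (2 * r / p%:R) ^+ 2 :> R by apply: mulr_ge0; [exact: exprn_ge0|exact: sqr_ge0].
  apply: (@le_trans _ _ (2 * C1 * Ku * (4 ^+ n * (2 * r / p%:R) ^+ 2 *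
     (2 * (n%:R * ((2 * r) ^+ n * BD)) * st ^+ 2 + 2 * (K2 * energy u + Bu * st ^+ 2))
      + (2 * r) ^+ n * (BL * st ^+ 2)))).
    apply: ler_wpM2l => //; rewrite lerD2r; apply: le_trans hpo _; apply: ler_wpM2l => //.
    by rewrite lerD2l; apply: ler_wpM2l.
  have e1 : 2 * C1 * Ku * (4 ^+ n * (2 * r / p%:R) ^+ 2 *
     (2 * (n%:R * ((2 * r) ^+ n * BD)) * st ^+ 2 + 2 * (K2 * energy u + Bu * st ^+ 2))
      + (2 * r) ^+ n * (BL * st ^+ 2)) = K3 / p%:R ^+ 2 * energy u +
     2 * C1 * Ku * (4 ^+ n * (2 * r / p%:R) ^+ 2 * (2 * (n%:R * ((2 * r) ^+ n * BD)) + 2 * Bu)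
       + (2 * r) ^+ n * BL) * st ^+ 2.
    by rewrite /K3; field; exact: lt0r_neq0.
  rewrite e1; apply: lerD; first exact: ler_wpM2r.
  apply: ler_wpM2r; first exact: sqr_ge0.
  rewrite /Berr; apply: ler_wpM2l => //; rewrite lerD2r; apply: ler_wpM2r.
    by apply: addr_ge0; rewrite !mulr_ge0.
  apply: ler_wpM2l; first exact: exprn_ge0.
  rewrite ler_pXn2r ?nnegrE ?divr_ge0 ?mulr_ge0 ?(ltW r0) ?(ltW pn)//.
  rewrite ler_pdivrMr// -[leLHS]mulr1; apply: ler_wpM2l; first by rewrite mulr_ge0// ltW.
  by rewrite ler1n.
(* With [v] and [s] fixed, [m] is now taken so large that the error falls below any [de]. *)
rewrite -/u; apply/ler_addgt0Pr => de de0.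
pose m := (Num.truncn (Berr * (2 * r) ^+ 2 / de)).+1.
have m0 : (0 < m)%N by [].
have hB : Berr * step (m * p).-1 ^+ 2 <= de.
  have mR : 0 < m%:R :> R by rewrite ltr0n.
  have h1 : step (m * p).-1 <= 2 * r / m%:R.
    have := step_mul r (m * p).-1; rewrite prednK ?muln_gt0 ?m0// natrM mulrA.
    move=> e; rewrite ler_pdivlMr// -e ler_peMr ?ler1n// mulr_ge0// ltW//; exact: s0.
  have h2 : Berr * (2 * r) ^+ 2 / de < m%:R.
    have h0 : 0 <= Berr * (2 * r) ^+ 2 / de.
      by apply: divr_ge0; [apply: mulr_ge0 => //; exact: sqr_ge0|exact: ltW].
    by have /andP[_] := truncn_itv h0.
  apply: (@le_trans _ _ (Berr * (2 * r / m%:R) ^+ 2)).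
    have s1 : 0 <= step (m * p).-1 by apply: ltW; exact: s0.
    have s2 : 0 <= 2 * r / m%:R by apply: le_trans h1.
    by apply: ler_wpM2l => //; apply: lerXn2r; rewrite ?nnegrE.
  rewrite exprMn exprVn mulrA ler_pdivrMr ?exprn_gt0//.
  move: h2; rewrite ltr_pdivrMr// => h2; apply: le_trans (ltW h2) _.
  rewrite mulrC; apply: ler_wpM2l; first exact: ltW.
  by rewrite expr2 -[leLHS]mulr1; apply: ler_wpM2l; [exact: ltW|rewrite ler1n].
apply: le_trans (key m m0) _; rewrite -addrA [X in _ + X]addrC addrA lerD2l.
exact: hB.
Qed.

End LocalEstimate.

(** * Localization and compactness *)
Section Partition.
Context {R : realType} {n : nat} {M : ptopologicalType} (X : manifold R n M).

(** The rational parametrization of the circle by a cutoff [s] gives a smooth pair of squares with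
    sum 1, without square roots. *)
Lemma partition_ex (A V : set M) : open V -> compact A -> A `<=` V ->
  exists (f k : M -> R) (C W : set M),
  [/\ smooth_on X setT f /\ smooth_on X setT k, forall x, f x ^+ 2 + k x ^+ 2 = 1,
      [/\ open W, A `<=` W & forall x, W x -> f x = 1 /\ k x = 0]
    & [/\ compact C, C `<=` V & forall x, ~ C x -> f x = 0 /\ k x = 1]].
Proof.
move=> oV cA AV; have [s [ss _ [W [oW AW s1]] [C [cC CV s0]]]] := cutoff_ex X oV cA AV.
have d0 x : 1 + s x * s x != 0 by apply: lt0r_neq0; have := sqr_ge0 (s x); rewrite expr2; lra.
have sd : smooth_on X setT (fun x => (1 + s x * s x)^-1).
  apply: smooth_on_inv; [exact: openT|by move=> x _; exact: d0|].
  apply: smooth_on_add; [exact: openT|exact: (@smooth_on_cst _ _ _ X setT 1)|].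
  by apply: smooth_on_mul => //; exact: openT.
exists (fun x => 2 * s x * (1 + s x * s x)^-1), (fun x => (1 + - (s x * s x)) * (1 + s x * s x)^-1), C, W.
split.
- split; (apply: smooth_on_mul; [exact: openT| |exact: sd]).
    by apply: smooth_on_mul => //; [exact: openT|exact: (@smooth_on_cst _ _ _ X setT 2)].
  apply: smooth_on_add; [exact: openT|exact: (@smooth_on_cst _ _ _ X setT 1)|].
  by apply: smooth_on_opp; [exact: openT|apply: smooth_on_mul => //; exact: openT].
- by move=> x; have := d0 x; move: (s x) => y y0; field.
- split => // x /s1 ->; have e : (1 + 1 * 1 : R) = 2 by ring.
  by rewrite e !mulr1 divff ?subrr ?mul0r// pnatr_eq0.
- by split => // x /s0 ->; rewrite !mulr0 mul0r addr0 oppr0 addr0 invr1 mulr1.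
Qed.

Lemma smooth_in_continuous (i : atlas X) (W : set M) (f : M -> R) x : open W -> smooth_in i W f -> W x -> dom i x ->
  {for x, continuous f}.
Proof.
move=> oW sf Wx dx; have cx : (chart i @` (W `&` dom i)) (chart i x) by exists x.
have c1 := class_C_continuous (sf 0%N) cx; have c2 := chart_continuous dx.
have c3 : {for x, continuous ((f \o param i) \o chart i)}.
  by apply: continuous_comp => //; exact: c1.
have e : \near x, ((f \o param i) \o chart i) x = f x.
  have : nbhs x (dom i) by apply: open_nbhs_nbhs; split => //; exact: dom_open.
  by apply: filterS => y dy; rewrite /= chartK.
rewrite /prop_for /continuous_at => A; rewrite -[f x](nbhs_singleton e) => /c3.
by apply: filterS2 e => y /= <-.
Qed.

End Partition.

Section RealPairings.
Context {R : realType} {b : base_field} {n : nat} {M : ptopologicalType}.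
Local Notation S := (scalars_of R b).
Context {X : manifold R n M} (mu : {measure set (borel M) -> \bar R}).
Context {E : vbundle S X} (h : bundle_metric E).

Lemma ri_le (F : vbundle S X) (hF : bundle_metric F) (u : section F) (v w : section E) :
  L2 mu hF setT u -> L2 mu h setT v -> L2 mu h setT w ->
  (forall x, hr hF (u x) (u x) <= hr h (v x) (w x)) -> ri mu hF u u <= ri mu h v w.
Proof.
by move=> Lu Lv Lw uvw; apply: le_Rintegral => //; exact: L2_integrable.
Qed.

Lemma L2_rmul (f : M -> R) (v : section E) : smooth_on X setT f -> (forall x, f x ^+ 2 <= 1) ->
  L2 mu h setT v -> L2 mu h setT (rmul f v).
Proof.
move=> sf f1 Lv; have [mv iv] := (L2E mu h v).1 Lv.
have mf : measurable_fun setT (f : borel M -> R).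
  apply: continuous_on_measurable; first exact: openT.
  by move=> x _; apply: (smooth_on_continuous (X := X) (W := setT)) => //; exact: openT.
have mt : measurable_section (rmul f v).
  have -> : rmul f v = (fun x => sc_real S (f x) *: v x + 0).
    by apply: functional_extensionality_dep => x; rewrite addr0.
  apply: measurable_section_lin => [j||] //; last exact: (L2_measurable (L2_zero mu h)).
  split.
    by apply: (eq_measurable_fun (f : borel M -> R)) => [x _|]; [rewrite sc_re_real|exact: measurable_funTS].
  apply: (eq_measurable_fun (fun=> 0 : R)) => [x _|]; first by rewrite sc_im_real.
  exact: measurable_cst.
apply/L2E; split => //; apply: integrable_le iv; first exact: hr_measurable.
move=> x; rewrite ger0_norm ?hr_ge0// /rmul hr_scale nsq_real -[leRHS]mul1r.
by apply: ler_wpM2r; [exact: hr_ge0|exact: f1].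
Qed.

End RealPairings.

(** * Localization of the energy and compactness *)

Section Localization.
Context {R : realType} {b : base_field} {n : nat} {M : ptopologicalType}.
Local Notation S := (scalars_of R b).
Context {X : manifold R n M} (mu : {measure set (borel M) -> \bar R}).
Context {E F : vbundle S X} (h : bundle_metric E) (hF : bundle_metric F).
Hypothesis mu_fin : forall K : set M, compact K ->
  exists U : set M, [/\ open U, K `<=` U & (mu U < +oo)%E].
Hypothesis mu_pos : forall (V : set M) x, open V -> V x -> (0 < mu V)%E.
Hypothesis mu_box : forall (i : atlas X) y r, cbox y r `<=` chart i @` dom i ->
  exists c C : R, [/\ 0 < c, 0 < C & forall p s, 0 <= s -> hbox p s `<=` cbox y r ->
    ((c * s ^+ n)%:E <= mu (chart_box i p s) /\ mu (chart_box i p s) <= (C * s ^+ n)%:E)%E].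
Context (L : section E -> section E) (A : section E -> section F)
  (A' : section F -> section E) (B : section E -> section E) (beta : R).
Hypotheses (eL : elliptic 2 L) (dA : diff_op 1 A) (adj : formal_adjoint mu h hF A A') (dB : diff_op 1 B).
Hypothesis LE : forall s, smooth_section s -> forall x, L s x = A' (A s) x + B s x.
Hypothesis sa : formally_self_adjoint mu h L.
Hypothesis bb : forall u, Cc setT u -> beta * ri mu h u u <= ri mu h (L u) u.
Local Notation riE := (ri mu h).
Local Notation riF := (ri mu hF).
Local Notation en := (energy mu h L beta).
Let dL : diff_op 2 L := eL.1.

(** The symbol bound [C] is taken at the point [x0]. It determines the admissible oscillation [th]
    of the coefficients, and the cube is shrunk afterwards to respect it. The cube does not depend
    on [eps]. *)
Lemma local_estimate_ex x0 : exists V, [/\ open V, V x0 & forall eps : R, 0 < eps ->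
  exists s : seq (l2sec mu h), forall v : l2sec mu h, Cc V (l2val v) ->
  l2ip v v <= eps * en (l2val v) + \sum_(x <- s) l2ip v x ^+ 2].
Proof.
have [i dx] := dom_cover X x0; have [j jx] := triv_cover E x0; have [l lx] := triv_cover F x0.
have [cA lfA] := dA i j l; have [cB lfB] := dB i j j.
have [C [C0 hsym]] := symbol_bound mu_fin mu_pos eL dA adj dB LE lfA dx jx lx.
pose WA := dom i `&` triv_dom j `&` triv_dom l; pose WB := dom i `&` triv_dom j `&` triv_dom j.
have oA : open WA.
  by apply: openI; [apply: openI|]; [exact: dom_open|exact: triv_open|exact: triv_open].
have oB : open WB.
  by apply: openI; [apply: openI|]; [exact: dom_open|exact: triv_open|exact: triv_open].
have Ax : WA x0 by []. have Bx : WB x0 by [].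
pose th := (16 * C * n%:R + 1)^-1.
have den0 : 0 <= 16 * C * n%:R by apply: mulr_ge0 => //; apply: mulr_ge0 => //; exact: ltW.
have den : 0 < 16 * C * n%:R + 1 by apply: ltr_wpDl.
have th0 : 0 < th by rewrite invr_gt0.
have small : 16 * C * n%:R * th <= 1 by rewrite /th ler_pdivrMr// mul1r lerDl.
have [K0 [K00 nK0]] := near_mx_bounded oA Ax (lfA.1 [::]).
have nth1 : \forall x \near x0, forall a w, cnsq ((cA [:: a] x - cA [:: a] x0) *m w) <= th * cnsq w.
  by apply: filter_forall => a; exact: (near_mx_close oA Ax (lfA.1 [:: a]) th0).
have [Kb0 [Kb00 nKb0]] := near_mx_bounded oB Bx (lfB.1 [::]).
have [Kb Kb1 nKb] : exists2 B0, 0 < B0 & forall a, \forall x \near x0, forall w,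
    cnsq (cB [:: a] x *m w) <= B0 * cnsq w.
  apply: fin_bound => [a|a B1 B2 B12 hB]; last first.
    apply: filterS hB => x hx w; apply: le_trans (hx w) _.
    by apply: ler_wpM2r => //; exact: cnsq_ge0.
  by have [B1 [B10 hB1]] := near_mx_bounded oB Bx (lfB.1 [:: a]); exists B1.
have [Ka Ka0 hKa] : exists2 B0, 0 < B0 & forall a, forall w,
    cnsq (cA [:: a] x0 *m w) <= B0 * cnsq w.
  apply: fin_bound => [a|a B1 B2 B12 hB w]; last first.
    by apply: le_trans (hB w) _; apply: ler_wpM2r => //; exact: cnsq_ge0.
  have [B1 [B10 hB1]] := near_mx_bounded oA Ax (lfA.1 [:: a]); exists B1 => //.
  exact: (nbhs_singleton hB1).
have [Ku [Ku0 nKu]] := near_hr_upper h jx.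
have [Kl [Kl0 nKl]] := near_hr_lower h jx.
have [KF [KF0 nKF]] := near_hr_lower hF lx.
pose G := [set x | [/\ forall a w, cnsq ((cA [:: a] x - cA [:: a] x0) *m w) <= th * cnsq w,
   forall w, cnsq (cA [::] x *m w) <= K0 * cnsq w,
   forall w, cnsq (cB [::] x *m w) <= Kb0 * cnsq w
   & forall a w, cnsq (cB [:: a] x *m w) <= Kb * cnsq w] /\
   [/\ forall w : fiber F x, cnsq (triv l x w) <= KF * hr hF w w,
   forall w : fiber E x, hr h w w <= Ku * cnsq (triv j x w)
   & forall w : fiber E x, cnsq (triv j x w) <= Kl * hr h w w]].
have nG : nbhs x0 G.
  have nKb' : \forall x \near x0, forall a w, cnsq (cB [:: a] x *m w) <= Kb * cnsq w.
    exact: filter_forall.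
  apply: (filterS _ (filterI (filterI (filterI nth1 nK0) (filterI nKb0 nKb')) (filterI (filterI nKF nKu) nKl))).
  by move=> x [[[h1 h2] [h3 h4]] [[h5 h6] h7]].
pose V0 := G° `&` WA.
have oV0 : open V0 by apply: openI => //; exact: open_interior.
have V0x : V0 x0 by split.
have V0G : V0 `<=` G by move=> x [/interior_subset].
have nc : nbhs (chart i x0) (chart i @` (V0 `&` dom i)).
  by apply: open_nbhs_nbhs; split; [exact: chart_image_open|exists x0].
have [r r0 rV0] := nbhs_cbox nc.
have rd : cbox (chart i x0) r `<=` chart i @` dom i.
  by move=> y /rV0[x [_ d] <-]; exists x.
have [c1 [C1 [c10 C10 hm]]] := mu_box rd.
exists (boxV i (chart i x0) r); split; first exact: boxV_open.
  by split => //= a; rewrite subrr normr0.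
have KK0 : 0 <= Kb0 + Kb by apply: addr_ge0; exact: ltW.
apply: (local_estimate mu_fin dA adj dB LE bb lfA lfB (V0 := V0) (C := C) (K0 := K0) (Ka := Ka)
  (Kb := Kb0 + Kb) (KF := KF) (Ku := Ku) (Kl := Kl) (th := th) r0 oV0 _ _ _ rV0 c10 C10 hm).
- by move=> x [_ [[]]].
- by move=> x [_ [[]]].
- by move=> x [_ []].
- exact: ltW.
- exact: ltW.
- exact: ltW.
- exact: KK0.
- exact: ltW.
- exact: ltW.
- exact: ltW.
- exact: ltW.
- exact: small.
- exact: hsym.
- by move=> x /V0G[[]].
- by move=> x /V0G[[]].
- exact: hKa.
- move=> x /V0G[[_ _ hh _] _] w; apply: le_trans (hh w) _.
  by apply: ler_wpM2r; [exact: cnsq_ge0|rewrite lerDl ltW].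
- move=> x /V0G[[_ _ _ hh] _] a w; apply: le_trans (hh a w) _.
  by apply: ler_wpM2r; [exact: cnsq_ge0|rewrite lerDr ltW].
- by move=> x /V0G[_ []].
- by move=> x /V0G[_ []].
- by move=> x /V0G[_ []].
Qed.

Section FirstOrder.
Context (f : M -> R) (C : set M) (c : R).
Hypotheses (sf : smooth_on X setT f) (cC : compact C) (fC : forall x, ~ C x -> f x = c).

Lemma comm1_off v x : smooth_section v -> ~ C x -> comm1 A f v x = 0.
Proof.
move=> sv nC; have [i dx] := dom_cover X x; have [j jx] := triv_cover E x.
have [l lx] := triv_cover F x; have [cA lfA] := dA i j l.
apply: (triv_inj lx); rewrite /comm1 (comm1_symbol lfA)// symbol1E linear0.
rewrite big1 ?mul0mx// => a _; rewrite mxE.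
have oC : open (~` C) by apply: closed_openC; apply: compact_closed cC; exact: man_hausdorff X.
by rewrite (pderiv_eq a oC nC dx (g := fun=> c))// pderiv_cst sc_real0 scale0r.
Qed.

Lemma comm1_bound : exists Cf : R, 0 <= Cf /\ forall v x, smooth_section v ->
  hr hF (comm1 A f v x) (comm1 A f v x) <= Cf * hr h (v x) (v x).
Proof.
pose P (D : set M) := exists Cf : R, 0 <= Cf /\ forall v x, smooth_section v -> D x ->
  hr hF (comm1 A f v x) (comm1 A f v x) <= Cf * hr h (v x) (v x).
suff [Cf [Cf0 HC]] : P C.
  exists Cf; split => // v x sv; have [Cx|nCx] := pselect (C x); first exact: HC.
  by rewrite comm1_off// hr0 mulr_ge0// hr_ge0.
apply: compact_induction => //.
- by exists 0.
- by move=> D1 D2 D12 [Cf [Cf0 HC]]; exists Cf; split => // v x sv /D12; exact: HC.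
- move=> D1 D2 [C1 [C10 H1]] [C2 [C20 H2]]; exists (C1 + C2); split; first exact: addr_ge0.
  move=> v x sv [/(H1 v x sv) hh|/(H2 v x sv) hh]; apply: le_trans hh _; apply: ler_wpM2r; rewrite ?hr_ge0//.
    by rewrite lerDl.
  by rewrite lerDr.
move=> x0 _; have [i dx] := dom_cover X x0; have [j jx] := triv_cover E x0.
have [l lx] := triv_cover F x0; have [cA lfA] := dA i j l.
pose WA := dom i `&` triv_dom j `&` triv_dom l.
have oA : open WA.
  by apply: openI; [apply: openI|]; [exact: dom_open|exact: triv_open|exact: triv_open].
have Ax : WA x0 by [].
have [Kp Kp0 nKp] : exists2 B0, 0 < B0 & forall a, \forall x \near x0, `|pderiv i a f x| <= B0.
  apply: fin_bound => [a|a B1 B2 B12]; last by apply: filterS => x /le_trans; exact.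
  have cp : {for x0, continuous (pderiv i a f)}.
    apply: (smooth_in_continuous (W := setT) (i := i)) => //; first exact: openT.
    by apply: smooth_in_pderiv; [exact: openT|exact: smooth_on_in].
  exists (`|pderiv i a f x0| + 1); first by apply: ltr_wpDl.
  have hd : \forall t \near x0, `|pderiv i a f x0 - pderiv i a f t| <= 1.
    exact: (@cvgr_dist_le _ _ _ (nbhs x0) _ (pderiv i a f) _ cp 1 ltr01).
  apply: filterS hd => x hx.
  have -> : pderiv i a f x = pderiv i a f x0 - (pderiv i a f x0 - pderiv i a f x) by ring.
  by apply: le_trans (ler_normB _ _) _; rewrite lerD2l.
have [Km Km0 nKm] : exists2 B0, 0 < B0 & forall a, \forall x \near x0, forall w,
    cnsq (cA [:: a] x *m w) <= B0 * cnsq w.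
  apply: fin_bound => [a|a B1 B2 B12].
    by have [B1 [B10 hB1]] := near_mx_bounded oA Ax (lfA.1 [:: a]); exists B1.
  apply: filterS => x hx w; apply: le_trans (hx w) _.
  by apply: ler_wpM2r => //; exact: cnsq_ge0.
have [Ku [Ku0 nKu]] := near_hr_upper hF lx.
have [Kl [Kl0 nKl]] := near_hr_lower h jx.
pose G := [set x | [/\ forall a, `|pderiv i a f x| <= Kp,
   forall a w, cnsq (cA [:: a] x *m w) <= Km * cnsq w,
   forall w : fiber F x, hr hF w w <= Ku * cnsq (triv l x w)
   & forall w : fiber E x, cnsq (triv j x w) <= Kl * hr h w w]].
have nG : nbhs x0 G.
  have nKp' : \forall x \near x0, forall a, `|pderiv i a f x| <= Kp by exact: filter_forall.
  have nKm' : \forall x \near x0, forall a w, cnsq (cA [:: a] x *m w) <= Km * cnsq w.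
    exact: filter_forall.
  apply: (filterS _ (filterI (filterI nKp' nKm') (filterI nKu nKl))).
  by move=> x [[h1 h2] [h3 h4]].
exists (G° `&` WA); split; [by apply: openI => //; exact: open_interior|by split|].
have nn : 0 <= n%:R * (n%:R * (Kp ^+ 2 * Km)) :> R.
  by apply: mulr_ge0 => //; apply: mulr_ge0 => //; apply: mulr_ge0; [exact: sqr_ge0|exact: ltW].
exists (Ku * (n%:R * (n%:R * (Kp ^+ 2 * Km)) * Kl)); split.
  by apply: mulr_ge0; [exact: ltW|apply: mulr_ge0 => //; exact: ltW].
move=> v x sv [/interior_subset[hp hm hu hl] Wx].
apply: le_trans (hu _) _; rewrite -[leRHS]mulrA; apply: ler_wpM2l; first exact: ltW.
rewrite /comm1 (comm1_symbol lfA)// symbol1E mulmx_suml.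
apply: (@le_trans _ _ (n%:R * (n%:R * (Kp ^+ 2 * Km)) * cnsq (coords j v x))); last first.
  by rewrite -[leRHS]mulrA; apply: ler_wpM2l => //; exact: hl.
apply: le_trans (cnsq_sum_le _ _) _; rewrite /index_enum -enumT size_enum_ord enumT -mulrA.
apply: ler_wpM2l => //.
apply: (@le_trans _ _ (\sum_(a < n) Kp ^+ 2 * Km * cnsq (coords j v x))).
  apply: ler_sum => a _; rewrite mxE -scalemxAl cnsqZ nsq_real -mulrA; apply: ler_pM => //.
  - exact: sqr_ge0.
  - exact: cnsq_ge0.
  - by rewrite -(@real_normK _ (pderiv i a f x)) ?num_real//; apply: lerXn2r; rewrite ?nnegrE//; exact: ltW.
by rewrite sumr_const card_ord -[leLHS]mulr_natl mulrA.
Qed.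

(** The commutator lives on [C], so it only sees the mass of [v] there. The weight [g] is 1 when the
    energy is to be bounded, and the weight of [local_compactness] when smallness is needed. *)
Lemma comm1_ri_le (g : M -> R) Cf : 0 <= Cf -> (forall v x, smooth_section v ->
    hr hF (comm1 A f v x) (comm1 A f v x) <= Cf * hr h (v x) (v x)) ->
  smooth_on X setT g -> (forall x, 0 <= g x) -> (forall x, C x -> 1 <= g x) ->
  forall v, Cc setT v -> riF (comm1 A f v) (comm1 A f v) <= Cf * riE v (rmul g v).
Proof.
move=> Cf0 HC sg g0 g1 v cv; have [sv _ _] := cv.
have cgv := Cc_rmul sg cv.
have L1 : L2 mu hF setT (comm1 A f v) by apply: Cc_L2 => //; exact: (Cc_comm1 dA sf cv).
have Lv := Cc_L2 h mu_fin cv; have Lg := Cc_L2 h mu_fin cgv.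
have e : Cf * riE v (rmul g v) = riE (slin (sc_real S Cf) v (fun=> 0)) (rmul g v).
  rewrite ri_lin//; last exact: L2_zero.
  rewrite [X in _ = _ + X](_ : _ = 0) ?addr0//.
  rewrite /ri (@eq_Rintegral _ _ _ mu setT (fun=> 0)) ?Rintegral_cst ?mul0r// => x _.
  exact: hr0.
rewrite e; apply: ri_le => //.
  by apply: L2_lin => //; exact: L2_zero.
move=> x; rewrite /slin addr0 hrZl /rmul hrZr.
have [Cx|nCx] := pselect (C x); last first.
  by rewrite comm1_off// hr0; apply: mulr_ge0 => //; apply: mulr_ge0 => //; exact: hr_ge0.
apply: le_trans (HC v x sv) _; apply: ler_wpM2l => //.
by rewrite ler_peMl ?hr_ge0// g1.
Qed.

End FirstOrder.

Lemma ri_sa u v : Cc setT u -> Cc setT v -> riE (L u) v = riE u (L v).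
Proof.
move=> [su ku _] [sv kv _]; rewrite -!ri_inner sa.2//.
by apply: compact_closedI => //; exact: supp_closed.
Qed.

(** [double_comm_form] with both sections equal to [v]: self-adjointness identifies the two outer
    terms of the double commutator, and a common factor -2 drops out. *)
Lemma localization_formula f v : smooth_on X setT f -> Cc setT v ->
  riE (L (rmul f v)) (rmul f v) = riE (L v) (rmul f (rmul f v)) + riF (comm1 A f v) (comm1 A f v).
Proof.
move=> sf cv; have cfv := Cc_rmul sf cv; have cffv := Cc_rmul sf cfv.
have L2C u : Cc setT u -> L2 mu h setT u by move=> cu; exact: (Cc_L2 h mu_fin cu).
have cLv := Cc_diff_op dL cv; have cLfv := Cc_diff_op dL cfv; have cLffv := Cc_diff_op dL cffv.
have := double_comm_form mu_fin eL dA adj dB LE sf cv cv.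
have -> : double_comm L f v = slin (sc_real S (-2)) (rmul f (L (rmul f v)))
    (fun x => L (rmul f (rmul f v)) x + rmul f (rmul f (L v)) x).
  apply: functional_extensionality_dep => x; rewrite /double_comm /slin /rmul !scalerA -!sc_realM expr2.
  by rewrite mulNr sc_realN scaleNr addrCA addrA.
have c1 := Cc_rmul sf cLfv; have c2 := Cc_rmul sf (Cc_rmul sf cLv).
have L3 : L2 mu h setT (fun x => L (rmul f (rmul f v)) x + rmul f (rmul f (L v)) x).
  have -> : (fun x => L (rmul f (rmul f v)) x + rmul f (rmul f (L v)) x) =
      slin 1 (L (rmul f (rmul f v))) (rmul f (rmul f (L v))).
    by apply: functional_extensionality_dep => x; rewrite /slin scale1r.
  by apply: L2C; exact: Cc_slin.
rewrite ri_lin; [|exact: L2C|exact: L3|exact: L2C].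
rewrite ri_add; [|exact: L2C|exact: L2C|exact: L2C].
have e1 : riE (L (rmul f (rmul f v))) v = riE (L v) (rmul f (rmul f v)) by rewrite ri_sa// riC.
have e2 : riE (rmul f (rmul f (L v))) v = riE (L v) (rmul f (rmul f v)) by rewrite !ri_rmul.
rewrite e1 e2 (ri_rmul mu h f (L (rmul f v))).
move: (riE _ _) (riE _ _) (riF _ _) => x y z; lra.
Qed.

Let L2C u : Cc setT u -> L2 mu h setT u. Proof. by move=> cu; exact: (Cc_L2 h mu_fin cu). Qed.

Lemma energy_ge0 u : Cc setT u -> 0 <= en u.
Proof. by move=> cu; apply: le_trans (energy_ge bb cu); exact: ri_ge0. Qed.

Lemma ri_rmul_sqr f v : riE (rmul f v) (rmul f v) = riE v (rmul (fun x => f x ^+ 2) v).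
Proof.
rewrite ri_rmul; congr riE; apply: functional_extensionality_dep => x.
by rewrite /rmul scalerA -sc_realM expr2.
Qed.

Lemma ri_split f k v : smooth_on X setT f -> smooth_on X setT k ->
  (forall x, f x ^+ 2 + k x ^+ 2 = 1) -> Cc setT v -> forall u, L2 mu h setT u ->
  riE u (rmul f (rmul f v)) + riE u (rmul k (rmul k v)) = riE u v.
Proof.
move=> sf sk fk cv u Lu; have c1 := Cc_rmul sf (Cc_rmul sf cv); have c2 := Cc_rmul sk (Cc_rmul sk cv).
rewrite riC [X in _ + X]riC -ri_add; [|exact: L2C|exact: L2C|by []].
rewrite riC; congr riE; apply: functional_extensionality_dep => x.
by rewrite /rmul !scalerA -!sc_realM -scalerDl -sc_realD -!expr2 fk sc_real1 scale1r.
Qed.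

Lemma energy_split f k v : smooth_on X setT f -> smooth_on X setT k ->
  (forall x, f x ^+ 2 + k x ^+ 2 = 1) -> Cc setT v ->
  en (rmul f v) + en (rmul k v) = en v + riF (comm1 A f v) (comm1 A f v)
    + riF (comm1 A k v) (comm1 A k v).
Proof.
move=> sf sk fk cv; have cLv := Cc_diff_op dL cv.
rewrite /energy !localization_formula//.
have e1 := ri_split sf sk fk cv (L2C cLv); have e2 := ri_split sf sk fk cv (L2C cv).
rewrite !ri_rmul -e1 -e2.
move: (riE _ _) (riE _ _) (riE _ _) (riE _ _) (riF _ _) (riF _ _) => *; ring.
Qed.

(** Both localized energies are non-negative, so each is at most their sum, which exceeds the energy
    of [v] only by the two commutator terms of order zero. *)
Lemma energy_rmul_le f k (C : set M) (c1 c2 : R) : smooth_on X setT f -> smooth_on X setT k ->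
  (forall x, f x ^+ 2 + k x ^+ 2 = 1) -> compact C -> (forall x, ~ C x -> f x = c1 /\ k x = c2) ->
  exists Q : R, 1 <= Q /\ forall v, Cc setT v -> en (rmul f v) <= Q * en v /\ en (rmul k v) <= Q * en v.
Proof.
move=> sf sk fk cC fkC.
have fC x : ~ C x -> f x = c1 by move/fkC => [].
have kC x : ~ C x -> k x = c2 by move/fkC => [].
have [C1 [C10 H1]] := comm1_bound sf cC fC; have [C2 [C20 H2]] := comm1_bound sk cC kC.
exists (1 + C1 + C2); split; first by rewrite -addrA lerDl addr_ge0.
move=> v cv; have e := energy_split sf sk fk cv.
have s1 := @smooth_on_cst _ _ _ X setT 1.
have one : rmul (fun=> 1) v = v.
  by apply: functional_extensionality_dep => x; rewrite /rmul sc_real1 scale1r.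
have h1 := comm1_ri_le sf cC fC C10 H1 s1 (fun=> ler01) (fun _ _ => lexx 1) cv.
have h2 := comm1_ri_le sk cC kC C20 H2 s1 (fun=> ler01) (fun _ _ => lexx 1) cv.
rewrite one in h1 h2.
have h3 := ler_wpM2l C10 (energy_ge bb cv); have h4 := ler_wpM2l C20 (energy_ge bb cv).
have p1 := energy_ge0 (Cc_rmul sf cv); have p2 := energy_ge0 (Cc_rmul sk cv).
rewrite !mulrDl mul1r; move: (riF _ _) (riF _ _) (C1 * riE _ _) (C2 * riE _ _) (C1 * en _) (C2 * en _) e h1 h2 h3 h4 => *.
by split; lra.
Qed.

Lemma partition_sqr_le1 (f k : M -> R) : (forall x, f x ^+ 2 + k x ^+ 2 = 1) ->
  (forall x, f x ^+ 2 <= 1) /\ (forall x, k x ^+ 2 <= 1).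
Proof.
by move=> fk; split => x; have := fk x; have := sqr_ge0 (f x); have := sqr_ge0 (k x); lra.
Qed.

(* Rellich's theorem, with finitely many functionals in place of a compact
   embedding. *)
Lemma local_compactness (K : set M) : compact K -> exists g : M -> R,
  [/\ smooth_on X setT g, forall x, 0 <= g x, forall x, K x -> 1 <= g x &
   forall eps : R, 0 < eps -> exists s : seq (l2sec mu h), forall v : l2sec mu h,
   Cc setT (l2val v) ->
   riE (l2val v) (rmul g (l2val v)) <= eps * en (l2val v) + \sum_(x <- s) l2ip v x ^+ 2].
Proof.
move=> cK.
pose P (D : set M) := exists g : M -> R,
  [/\ smooth_on X setT g, forall x, 0 <= g x, forall x, D x -> 1 <= g x &
   forall eps : R, 0 < eps -> exists s : seq (l2sec mu h), forall v : l2sec mu h,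
   Cc setT (l2val v) ->
   riE (l2val v) (rmul g (l2val v)) <= eps * en (l2val v) + \sum_(x <- s) l2ip v x ^+ 2].
suff : P K by [].
apply: compact_induction => //.
- exists (fun=> 0); split => //; first exact: (@smooth_on_cst _ _ _ X setT 0).
  move=> eps eps0; exists [::] => v cv; rewrite big_nil addr0 -ri_rmul.
  have -> : rmul (fun=> 0) (l2val v) = (fun=> 0).
    by apply: functional_extensionality_dep => x; rewrite /rmul sc_real0 scale0r.
  rewrite /ri (@eq_Rintegral _ _ _ mu setT (fun=> 0)) ?Rintegral_cst ?mul0r//.
    by apply: mulr_ge0; [exact: ltW|exact: energy_ge0].
  by move=> x _; exact: hr0.
- by move=> D1 D2 D12 [g [h1 h2 h3 h4]]; exists g; split => // x /D12; exact: h3.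
- move=> D1 D2 [g1 [h1 h2 h3 h4]] [g2 [k1 k2 k3 k4]]; exists (fun x => g1 x + g2 x); split.
  + by apply: smooth_on_add => //; exact: openT.
  + by move=> x; apply: addr_ge0.
  + by move=> x [/h3|/k3] => hh; [apply: le_trans hh _; rewrite lerDl|apply: le_trans hh _; rewrite lerDr].
  + move=> eps eps0; have e2 : 0 < eps / 2 by apply: divr_gt0.
    have [s1 Hs1] := h4 _ e2; have [s2 Hs2] := k4 _ e2.
    exists (s1 ++ s2) => v cv; rewrite big_cat /=.
    have -> : rmul (fun x => g1 x + g2 x) (l2val v) = (fun x => rmul g1 (l2val v) x + rmul g2 (l2val v) x).
      by apply: functional_extensionality_dep => x; rewrite /rmul sc_realD scalerDl.
    rewrite riC ri_add; [|exact: L2C (Cc_rmul h1 cv)|exact: L2C (Cc_rmul k1 cv)|exact: L2C].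
    rewrite riC [X in _ + X <= _]riC; have := lerD (Hs1 v cv) (Hs2 v cv).
    have ee : eps * en (l2val v) = eps / 2 * en (l2val v) + eps / 2 * en (l2val v) by field.
    by rewrite ee; move/le_trans; apply; rewrite addrACA.
move=> x0 _; have [V [oV Vx HV]] := local_estimate_ex x0.
have V1 : [set x0] `<=` V by move=> _ ->.
have [f [k [C [W [[sf sk] fk [oW xW fW] [cC CV fC]]]]]] := partition_ex X oV (@compact_set1 _ x0) V1.
have [f1 _] := partition_sqr_le1 fk.
exists W; split => //; first exact: xW.
have [Q [Q1 HQ]] := energy_rmul_le sf sk fk cC fC.
have Q0 : 0 < Q by apply: lt_le_trans Q1.
exists (fun x => f x ^+ 2); split.
- by under eq_fun do rewrite expr2; apply: smooth_on_mul => //; exact: openT.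
- by move=> x; exact: sqr_ge0.
- by move=> x /fW[-> _]; rewrite expr1n.
move=> eps eps0; have [s Hs] := HV (eps / Q) (divr_gt0 eps0 Q0).
(* Multiplication by [f] is symmetric, so the cutoff passes from the section to the functionals. *)
pose mf (x : l2sec mu h) := L2Sec (L2_rmul sf f1 (l2P x)).
exists [seq mf x | x <- s] => v cv.
have cfv : Cc V (l2val (mf v)).
  have clC : closed C by apply: compact_closed cC; exact: man_hausdorff X.
  by apply: (Cc_rmul_supp sf cv clC CV) => x /fC[].
rewrite -ri_rmul_sqr; have := Hs (mf v) cfv; rewrite ri_l2ip => /le_trans; apply.
rewrite big_map; apply: lerD.
  have [h1 _] := HQ _ cv; have := ler_wpM2l (ltW (divr_gt0 eps0 Q0)) h1.
  by rewrite mulrA divfK ?gt_eqF.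
rewrite le_eqVlt; apply/orP; left; apply/eqP; apply: eq_bigr => x _.
by rewrite !ri_l2ip /= ri_rmul.
Qed.

(** The operator [L + 1 - beta], made total: off the compactly supported smooth sections, where its
    value might not be square-integrable, it is set to 0. *)
Definition l2op (v : l2sec mu h) : l2sec mu h :=
  match pselect (Cc setT (l2val v)) with
  | left cv => L2Sec (L2_lin (sc_real S (1 - beta)) (l2P v) (L2C (Cc_diff_op dL cv)))
  | right _ => 0
  end.

Lemma l2opE v : Cc setT (l2val v) -> l2val (l2op v) = slin (sc_real S (1 - beta)) (l2val v) (L (l2val v)).
Proof. by move=> cv; rewrite /l2op; case: pselect. Qed.

Lemma l2op_ip v u : Cc setT (l2val v) ->
  l2ip (l2op v) u = riE (L (l2val v)) (l2val u) + (1 - beta) * riE (l2val v) (l2val u).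
Proof.
move=> cv; rewrite ri_l2ip l2opE// ri_lin; first by rewrite addrC.
- exact: l2P.
- exact: L2C (Cc_diff_op dL cv).
- exact: l2P.
Qed.

Definition l2_Cc (W : set M) : set (l2sec mu h) := [set v | Cc W (l2val v)].

Lemma l2val_lin a (u v : l2sec mu h) : l2val (a *: u + v) = slin (sc_real S a) (l2val u) (l2val v).
Proof. by apply: functional_extensionality_dep => x; rewrite l2valD l2valZ. Qed.

Lemma l2op_coercive (W : set M) : coercive_form (l2ip (mu := mu) (h := h)) l2op (l2_Cc W).
Proof.
have cT (v : l2sec mu h) : l2_Cc W v -> Cc setT (l2val v) by exact: Cc_sub.
split.
- split; first exact: Cc0.
  by move=> a u v cu cv; suff: Cc W (l2val (a *: u + v)) by []; rewrite l2val_lin; exact: Cc_slin.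
- split.
  + move=> a u v w /cT cu /cT cv /cT cw.
    have [su _ _] := cu; have [sv _ _] := cv.
    have cuv : Cc setT (l2val (a *: u + v)) by rewrite l2val_lin; exact: Cc_slin.
    rewrite !l2op_ip// l2val_lin.
    have -> : L (slin (sc_real S a) (l2val u) (l2val v)) = slin (sc_real S a) (L (l2val u)) (L (l2val v)).
      by apply: functional_extensionality_dep => x; exact: (diff_op_lin dL).
    rewrite !ri_lin; try exact: l2P; try exact: (L2C (Cc_diff_op dL cu)); try exact: (L2C (Cc_diff_op dL cv)).
    move: (riE _ _) (riE _ _) (riE _ _) (riE _ _) => *; ring.
  + move=> u v /cT cu /cT cv; rewrite !l2op_ip// ri_sa// [in RHS]riC.
    by rewrite (riC mu h (l2val v)).
  + by move=> u /cT cu; rewrite l2op_ip//; exact: energy_ge0.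
- by move=> v /cT cv; rewrite l2op_ip// ri_l2ip; exact: energy_ge.
Qed.

(** The map [X] of [compact_differenceP] is multiplication by [k ^+ 2], with [k] zero near [K].
    Split |v|^2 into |f v|^2 + |k v|^2. The first term is mass on the compact set [C]; the second is
    at most the energy of [k v], that is, the form at [v] and [X v] plus a commutator supported in
    [C]. [local_compactness] makes the mass on [C] small. *)
Lemma compact_difference_complement (K : set M) : compact K ->
  compact_difference (l2ip (mu := mu) (h := h)) l2op (l2_Cc setT) (l2_Cc (~` K)).
Proof.
move=> cK; have [f [k [C [W [[sf sk] fk [oW KW fW] [cC _ fC]]]]]] := partition_ex X (@openT M) cK (@subsetT _ K).
have [f1 k1] := partition_sqr_le1 fk.
have [Q [Q1 HQ]] := energy_rmul_le sf sk fk cC fC.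
have Q0 : 0 <= Q by apply: le_trans Q1.
have kC x : ~ C x -> k x = 1 by move/fC => [].
have [Ck [Ck0 HCk]] := comm1_bound sk cC kC.
have [g [sg g0 g1 Hg]] := local_compactness cC.
pose mk (x : l2sec mu h) := L2Sec (L2_rmul sk k1 (l2P x)).
have ckv (v : l2sec mu h) : Cc setT (l2val v) -> Cc setT (l2val (mk v)) by move=> cv; exact: Cc_rmul.
apply: (compact_differenceP (l2_ipP mu h) (@l2_complete _ _ _ _ _ mu _ h) (X := fun v => mk (mk v)) (C := Q * Q)).
- exact: l2op_coercive.
- exact: l2op_coercive.
- by move=> v; apply: Cc_sub.
- move=> v cv; apply: (Cc_rmul_supp sk (ckv v cv) (C := ~` W)).
  + exact: open_closedC.
  + by move=> x nW /KW.
  + by move=> x /contrapT/fW[].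
- move=> v cv; have cv' := ckv v cv; have cv2 := ckv _ cv'; rewrite !l2op_ip//.
  have [_ h1] := HQ _ (ckv v cv); have [_ h2] := HQ _ cv.
  by apply: le_trans h1 _; rewrite -mulrA; exact: ler_wpM2l.
(* The mass on [C] is charged once for [f v] and [Ck] times for the commutator; the functionals are
   rescaled by the square root of the same factor. *)
move=> eps eps0; pose e' := eps / (1 + Ck).
have Ck1 : 0 < 1 + Ck by apply: ltr_pwDl.
have [s Hs] := Hg e' (divr_gt0 eps0 Ck1).
pose sc (x : l2sec mu h) : l2sec mu h := Num.sqrt (1 + Ck) *: x.
exists [seq sc x | x <- s] => v cv; have cv' : Cc setT (l2val v) by [].
have h1 := Hs v cv; have cLv := Cc_diff_op dL cv'.
have e0 : l2ip v v = riE (rmul f (l2val v)) (rmul f (l2val v)) + riE (rmul k (l2val v)) (rmul k (l2val v)).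
  by rewrite ri_l2ip !ri_rmul (ri_split sf sk fk cv')//; exact: l2P.
have h2 : riE (rmul f (l2val v)) (rmul f (l2val v)) <= riE (l2val v) (rmul g (l2val v)).
  apply: ri_le; [exact: L2C (Cc_rmul sf cv')|exact: l2P|exact: L2C (Cc_rmul sg cv')|].
  move=> x; rewrite /rmul hr_scale nsq_real hrZr; apply: ler_wpM2r; first exact: hr_ge0.
  have [Cx|/fC[-> _]] := pselect (C x); first by apply: le_trans (f1 x) _; exact: g1.
  by rewrite expr0n.
have h3 : riE (rmul k (l2val v)) (rmul k (l2val v)) <= en (rmul k (l2val v)).
  by apply: energy_ge => //; exact: ckv.
have h4 := comm1_ri_le sk cC kC Ck0 HCk sg g0 g1 cv'.
have h5 : en (rmul k (l2val v)) = l2ip (l2op v) (mk (mk v)) + riF (comm1 A k (l2val v)) (comm1 A k (l2val v)).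
  by rewrite l2op_ip// /energy localization_formula// !ri_rmul /= addrAC.
have -> : \sum_(x <- [seq sc x | x <- s]) l2ip v x ^+ 2 = (1 + Ck) * \sum_(x <- s) l2ip v x ^+ 2.
  rewrite big_map mulr_sumr; apply: eq_bigr => x _.
  by rewrite /sc (ipZr (subspaceT (V := l2sec mu h)) (l2_ipP mu h))// exprMn sqr_sqrtr// ltW.
have h6 := ler_norm (l2ip (l2op v) (mk (mk v))).
have h7 : `|l2ip (l2op v) (mk (mk v))| <= Q * Q * `|l2ip (l2op v) (mk (mk v))|.
  by rewrite ler_peMl// -[leLHS]mulr1; apply: ler_pM.
have h8 := ler_wpM2l (ltW Ck1) h1.
have h9 : (1 + Ck) * (e' * en (l2val v)) = eps * l2ip (l2op v) v.
  by rewrite l2op_ip// /e' mulrA mulrCA divff ?mulr1// gt_eqF.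
rewrite mulrDr h9 mulrDl mul1r in h8.
rewrite e0; move: (l2ip _ _) (riE _ _) (riE _ _) (riE _ _) (riF _ _) h2 h3 h4 h5 h6 h7 h8 => *.
lra.
Qed.

End Localization.

(** * Operators over an open subset *)
Section Restriction.
Context {R : realType} {b : base_field} {n : nat} {M : ptopologicalType}.
Local Notation S := (scalars_of R b).
Context {X : manifold R n M} (mu : {measure set (borel M) -> \bar R}).
Context {E : vbundle S X} (h : bundle_metric E) (W : set M).
Hypothesis oW : open W.
Local Notation H := (l2sec mu h).
Let mW : measurable (W : set (borel M)) := borel_open oW.

(** Extension by zero places the operators over [W] and over [M] in the same Hilbert space. *)
Definition zext (u : section E) : section E := fun x => if x \in W then u x else 0.

Lemma zext_in u x : W x -> zext u x = u x.
Proof. by move=> Wx; rewrite /zext mem_set. Qed.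

Lemma zext_out u x : ~ W x -> zext u x = 0.
Proof. by move=> Wx; rewrite /zext memNset. Qed.

Lemma zext_Cc v : Cc W v -> zext v = v.
Proof.
move=> [_ _ vW]; apply: functional_extensionality_dep => x.
have [Wx|nWx] := pselect (W x); first exact: zext_in.
by rewrite zext_out//; apply/esym/supp0 => /vW.
Qed.

Lemma inner_re u v : sc_re (inner mu h W u v) = ri mu h (zext u) (zext v).
Proof.
rewrite sc_re_mk Rintegral_mkcond; apply: eq_Rintegral => x _; rewrite patchE /zext.
by case: ifP => // _; rewrite hr0.
Qed.

(** The scalar -i, or 0 over the real field: in both cases its product with [z] has the imaginary
    part of [z] as real part. *)
Definition scJ : S := sc_mk S 0 (-1).

Lemma sc_imE (z : S) : sc_im z = sc_re (scJ * z).
Proof. by rewrite sc_reM; move: z; rewrite /scJ; case: b => z /=; ring. Qed.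

Lemma inner_im u v : sc_im (inner mu h W u v) = sc_re (inner mu h W (fun x => scJ *: u x) v).
Proof.
rewrite /inner sc_re_mk.
have -> : sc_im (sc_mk S (Rintegral mu W (fun x => sc_re (h x (u x) (v x))))
   (Rintegral mu W (fun x => sc_im (h x (u x) (v x))))) = Rintegral mu W (fun x => sc_im (h x (u x) (v x))).
  move: u v; case: (b) E h => // E0 h0 u v /=.
  by rewrite (@eq_Rintegral _ _ _ mu W (fun=> 0)) ?Rintegral_cst ?mul0r.
by apply: eq_Rintegral => x _; rewrite bmZl -sc_imE.
Qed.

Lemma L2_zext u : L2 mu h W u -> L2 mu h setT (zext u).
Proof.
move=> [m1 fin1]; split.
  move=> j a; have mj : measurable (triv_dom j : set (borel M)).
    by apply: borel_open; exact: triv_open.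
  have [mr mi] := m1 j a; rewrite setTI; split.
    rewrite (_ : (fun x => _) = (fun x => sc_re (triv j x (u x) a 0)) \_ W).
      by apply/(measurable_restrict _ mW mj); rewrite setIC.
    apply: functional_extensionality_dep => x; rewrite patchE /zext.
    by case: ifP => // _; rewrite linear0 mxE sc_re0.
  rewrite (_ : (fun x => _) = (fun x => sc_im (triv j x (u x) a 0)) \_ W).
    by apply/(measurable_restrict _ mW mj); rewrite setIC.
  apply: functional_extensionality_dep => x; rewrite patchE /zext.
  by case: ifP => // _; rewrite linear0 mxE sc_im0.
apply: le_lt_trans fin1; rewrite le_eqVlt; apply/orP; left; apply/eqP.
rewrite [RHS]integral_mkcond; apply: eq_integral => x _; rewrite patchE /zext.
by case: ifP => // _; rewrite bm0l sc_re0.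
Qed.

Lemma L2_restrict u : L2 mu h setT u -> L2 mu h W u.
Proof.
move=> Lu; have [_ iu] := (L2E mu h u).1 Lu; have [m1 fin1] := Lu; split.
  move=> j a; have mj : measurable (triv_dom j : set (borel M)).
    by apply: borel_open; exact: triv_open.
  have [mr mi] := m1 j a; rewrite setTI in mr mi.
  by split; [apply: measurable_funS mr|apply: measurable_funS mi].
apply: le_lt_trans fin1; apply: ge0_subset_integral => //; last by move=> x _; rewrite lee_fin; exact: hr_ge0.
exact: (measurable_int _ iu).
Qed.

Definition l2ext u (Lu : L2 mu h W u) : H := L2Sec (L2_zext Lu).

Lemma norm2_ge0 u : 0 <= norm2 mu h W u.
Proof. by rewrite /norm2 inner_re; exact: ri_ge0. Qed.

Lemma norm2_le u (z : H) : (forall x, W x -> u x = l2val z x) -> norm2 mu h W u <= l2ip z z.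
Proof.
move=> uz; rewrite /norm2 inner_re ri_l2ip.
have -> : zext u = zext (l2val z).
  by apply: functional_extensionality_dep => x; rewrite /zext; case: ifP => // /set_mem/uz.
apply: ri_le; try exact: l2P; first by apply: L2_zext; apply: L2_restrict; exact: l2P.
by move=> x; rewrite /zext; case: ifP => // _; rewrite hr0 hr_ge0.
Qed.

Lemma norm2_eq u (z : H) : (forall x, W x -> u x = l2val z x) ->
  (forall x, ~ W x -> l2val z x = 0) -> l2ip z z = norm2 mu h W u.
Proof.
move=> uz z0; rewrite /norm2 inner_re ri_l2ip.
have -> // : zext u = l2val z.
apply: functional_extensionality_dep => x; have [Wx|nWx] := pselect (W x).
  by rewrite zext_in// uz.
by rewrite zext_out// z0.
Qed.

Lemma norm2_eq0 u (z : H) : (forall x, W x -> u x = l2val z x) -> l2ip z z = 0 ->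
  norm2 mu h W u = 0.
Proof. by move=> uz z0; apply/le_anti; rewrite norm2_ge0 andbT -z0; exact: norm2_le. Qed.

Lemma ri_zext v u : Cc W v -> ri mu h v (zext u) = ri mu h v u.
Proof.
move=> [_ _ vW]; apply: eq_Rintegral => x _; have [Wx|nWx] := pselect (W x); first by rewrite zext_in.
by rewrite (supp0 (s := v)) ?hr0// => /vW.
Qed.

Section Graphs.
Hypothesis mu_fin : forall K : set M, compact K ->
  exists U : set M, [/\ open U, K `<=` U & (mu U < +oo)%E].
Context (L : section E -> section E) (beta : R).
Hypotheses (eL : elliptic 2 L).
Let dL : diff_op 2 L := eL.1.
Local Notation op := (l2op mu_fin beta eL).
Local Notation rg := (resolvent_graph (l2ip (mu := mu) (h := h)) op (l2_Cc W)).
Let ipP := l2_ipP mu h.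
Let sT := subspaceT (V := H).
Let CcT (v : section E) : Cc W v -> Cc setT v. Proof. exact: Cc_sub. Qed.
Let CcL2 (v : section E) : Cc W v -> L2 mu h setT v. Proof. by move=> cv; exact: (Cc_L2 h mu_fin cv). Qed.

Lemma innerL_re v : Cc W v -> sc_re (innerL mu h L beta W v v) =
  ri mu h (L v) v + (1 - beta) * ri mu h v v.
Proof.
move=> cv; have cLv := Cc_diff_op dL cv.
rewrite /innerL sc_reD !inner_re (zext_Cc cv).
have -> : (fun x => L v x - sc_real S beta *: v x) = slin (sc_real S (- beta)) v (L v).
  by apply: functional_extensionality_dep => x; rewrite /slin sc_realN scaleNr addrC.
rewrite zext_Cc; last exact: Cc_slin.
rewrite ri_lin; [|exact: CcL2|exact: CcL2|exact: CcL2].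
by move: (ri _ _ _ _) (ri _ _ _ _) => *; ring.
Qed.

(** The shift moves [(1 - beta) u] to the right-hand side. The real part of the adjoint equation is
    all that the real Hilbert space records. *)
Lemma friedrichs_resolvent u f (Lu : L2 mu h W u) (Lf : L2 mu h W f) :
  friedrichs_graph mu h L beta W u f ->
  rg (l2ext Lu) (l2ext Lf + (1 - beta) *: l2ext Lu).
Proof.
move=> [[_ [w [cw cauw w0]]] [_ _ adjf]].
pose w' k : H := L2Sec (CcL2 (cw k)).
have nrm k : l2ip (w' k - l2ext Lu) (w' k - l2ext Lu) = dist2 mu h W (w k) u.
  apply: norm2_eq => x Wx; rewrite l2valB /=; first by rewrite zext_in.
  have [_ _ wW] := cw k; by rewrite zext_out// (supp0 (s := w k)) ?subrr// => /wW.
split.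
  exists w'; split => //.
    move=> e e0; have [N HN] := cauw e e0; exists N => k l kN lN.
    have wkl : l2val (w' k - w' l) = (fun x => w k x - w l x).
      by apply: functional_extensionality_dep => x; rewrite l2valB.
    have ckl : Cc W (l2val (w' k - w' l)).
      have -> : l2val (w' k - w' l) = slin (sc_real S (-1)) (w l) (w k).
        by rewrite wkl; apply: functional_extensionality_dep => x; rewrite /slin sc_realN sc_real1 scaleN1r addrC.
      exact: Cc_slin.
    by rewrite l2op_ip; [rewrite -innerL_re// wkl; exact: HN|exact: CcT].
  rewrite /ip_cvg (_ : (fun k => _) = (fun k => dist2 mu h W (w k) u))//.
  by apply: functional_extensionality_dep => k; exact: nrm.
move=> v cv; have cLv := Cc_diff_op dL cv.
rewrite l2op_ip; last exact: CcT.
rewrite (ipDr sT ipP)// (ipZr sT ipP)// !ri_l2ip /=; congr (_ + _).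
by have := congr1 (@sc_re _ _) (adjf _ cv); rewrite !inner_re (zext_Cc cLv) (zext_Cc (cv : Cc W (l2val v))).
Qed.

Lemma resolvent_friedrichs (x F : H) : rg x F ->
  friedrichs_graph mu h L beta W (l2val x) (l2val (F - (1 - beta) *: x)).
Proof.
move=> [[w [cw cauw w0]] adjx]; split.
  split; first by apply: L2_restrict; exact: l2P.
  exists (fun k => l2val (w k)); split => //.
    move=> e e0; have [N HN] := cauw e e0; exists N => k l kN lN.
    have wkl : l2val (w k - w l) = (fun x => l2val (w k) x - l2val (w l) x).
      by apply: functional_extensionality_dep => y; rewrite l2valB.
    have ckl : Cc W (l2val (w k - w l)).
      have -> : l2val (w k - w l) = slin (sc_real S (-1)) (l2val (w l)) (l2val (w k)).
        by rewrite wkl; apply: functional_extensionality_dep => y; rewrite /slin sc_realN sc_real1 scaleN1r addrC.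
      by apply: Cc_slin; exact: cw.
    by rewrite -wkl innerL_re// -l2op_ip; [exact: HN|exact: CcT].
  apply: (squeeze_cvgr _ (cvg_cst (0 : R)) w0); near=> k; apply/andP; split; first exact: norm2_ge0.
  by apply: norm2_le => y _; rewrite l2valB.
have key v : Cc W v -> sc_re (inner mu h W (L v) (l2val x)) =
    sc_re (inner mu h W v (l2val (F - (1 - beta) *: x))).
  move=> cv; have cLv := Cc_diff_op dL cv.
  rewrite !inner_re (zext_Cc cLv) (zext_Cc cv) !ri_zext//.
  have := adjx (L2Sec (CcL2 cv)) cv; rewrite l2op_ip; last exact: CcT.
  have -> : ri mu h v (l2val (F - (1 - beta) *: x)) = l2ip (L2Sec (CcL2 cv)) (F - (1 - beta) *: x).
    by rewrite ri_l2ip.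
  rewrite (ipBr sT ipP)// (ipZr sT ipP)// [l2ip (L2Sec (CcL2 cv)) x]ri_l2ip /=.
  by move=> <-; rewrite addrK.
split.
- by apply: L2_restrict; exact: l2P.
- by apply: L2_restrict; exact: l2P.
(* The imaginary part of the adjoint equation is its real part for the test section multiplied by
   [scJ]. *)
move=> v cv; have [sv _ _] := cv; apply: sc_ext; first exact: key.
have cJ : Cc W (slin scJ v (fun=> 0)) by apply: Cc_slin => //; exact: Cc0.
rewrite !inner_im.
have -> : (fun y => scJ *: L v y) = L (slin scJ v (fun=> 0)).
  apply: functional_extensionality_dep => y.
  by rewrite (diff_op_lin dL)//; [rewrite (diff_op0 dL) addr0|exact: smooth_section0].
have -> : (fun y => scJ *: v y) = slin scJ v (fun=> 0).
  by apply: functional_extensionality_dep => y; rewrite /slin addr0.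
exact: key.
Unshelve. all: by end_near.
Qed.

(** The right-hand side is only tested against sections supported in [W], so the resolvent of the
    restricted operator ignores its values elsewhere. *)
Lemma resolvent_off (x F F' : H) : rg x F -> (forall y, W y -> l2val F' y = l2val F y) -> rg x F'.
Proof.
move=> [cx adjx] FF; split => // v cv; rewrite adjx//; apply: eq_Rintegral => y _.
have [Wy|nWy] := pselect (W y); first by rewrite FF.
by have [_ _ vW] := cv; rewrite (supp0 (s := l2val v)) ?hr0// => /vW.
Qed.

Context (lambda : R).
Local Notation kap := (lambda + (1 - beta)).

Definition shifted_graph (u g : section E) := exists f, friedrichs_graph mu h L beta W u f /\
  g = (fun x => f x - sc_real S lambda *: u x).

(** With [f = g + lambda u], the right-hand side [f + (1 - beta) u] of the resolvent becomes
    [g + kap u], which is how [kap] arises. *)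
Lemma shifted_resolvent u g : shifted_graph u g -> exists (Lu : L2 mu h W u) (Lg : L2 mu h W g),
  rg (l2ext Lu) (l2ext Lg + kap *: l2ext Lu).
Proof.
move=> [f [fr ge]]; have [[Lu _] [_ Lf _]] := fr.
have Lg : L2 mu h W g.
  have -> : g = (fun x => f x - sc_real S lambda *: u x) by [].
  have -> : L2 mu h W (fun x => f x - sc_real S lambda *: u x) =
     L2 mu h W (fun x => if x \in W then l2val (l2ext Lf - lambda *: l2ext Lu) x else f x - sc_real S lambda *: u x).
    congr L2; apply: functional_extensionality_dep => x; case: ifP => // /set_mem Wx.
    by rewrite l2valB l2valZ /= !zext_in.
  have /L2_restrict[m1 i1] := l2P (l2ext Lf - lambda *: l2ext Lu); split.
    move=> j a; have [mr mi] := m1 j a; split.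
      by apply: eq_measurable_fun mr => x /set_mem[Wx _]; rewrite mem_set.
    by apply: eq_measurable_fun mi => x /set_mem[Wx _]; rewrite mem_set.
  by apply: le_lt_trans i1; rewrite le_eqVlt; apply/orP; left; apply/eqP; apply: eq_integral => x ->.
exists Lu, Lg; have := friedrichs_resolvent Lu Lf fr.
congr (resolvent_graph _ _ _ _ _); apply: l2sec_ext => x; rewrite !l2valD !l2valZ /=.
have [Wx|nWx] := pselect (W x); last by rewrite !zext_out// !scaler0.
by rewrite !zext_in// ge sc_realD scalerDl addrA subrK.
Qed.

Lemma resolvent_shifted (x F : H) : rg x F -> shifted_graph (l2val x) (l2val (F - kap *: x)).
Proof.
move=> /resolvent_friedrichs fr; exists (l2val (F - (1 - beta) *: x)); split => //.
apply: functional_extensionality_dep => y.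
by rewrite !l2valB !l2valZ sc_realD scalerDl opprD addrA addrAC.
Qed.

Hypothesis cD : coercive_form (l2ip (mu := mu) (h := h)) op (l2_Cc W).
Let cpl := @l2_complete _ _ _ _ _ mu E h.

Lemma estimate_fredholm m : fredholm_estimate (l2ip (mu := mu) (h := h)) op (l2_Cc W) kap m ->
  fredholm mu h W shifted_graph.
Proof.
move=> est; split.
- have [m' [r Hr]] := estimate_kernel ipP cpl cD est.
  exists m', (fun k => l2val (r k)); split => [k|u g Gug n0].
    by apply: L2_restrict; exact: l2P.
  have [Lu [Lg rgu]] := shifted_resolvent Gug.
  have e : l2ext Lg + kap *: l2ext Lu - kap *: l2ext Lu = l2ext Lg by rewrite addrK.
  have z0 : l2ip (l2ext Lg) (l2ext Lg) = 0.
    by rewrite -n0; apply: norm2_eq => x Wx; [rewrite /= zext_in|rewrite /= zext_out].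
  have [|c Hc] := Hr _ _ rgu; first by rewrite e.
  exists (fun k => sc_real S (c k)); apply: norm2_eq0 Hc => x Wx.
  rewrite l2valB l2val_sum /= zext_in//; congr (_ - _).
  by apply: eq_bigr => k _; rewrite /= addr0.
- move=> u g f' Gug Lf' g0.
  have /choice [Z HZ] : forall k, exists z : H * H, rg z.1 (z.2 + kap *: z.1) /\
      (forall x, W x -> l2val z.2 x = g k x) /\ (forall x, ~ W x -> l2val z.2 x = 0).
    move=> k; have [Lu [Lg rgu]] := shifted_resolvent (Gug k).
    exists (l2ext Lu, l2ext Lg); split => //=.
    by split => x Wx; [exact: zext_in|exact: zext_out].
  have [|v [q [rgv q0]]] := estimate_closed_range ipP cpl cD est (g := l2ext Lf') (fun k => (HZ k).1).
    rewrite /ip_cvg (_ : (fun k => _) = (fun k => dist2 mu h W (g k) f'))//.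
    apply: functional_extensionality_dep => k; have [_ [z1 z2]] := HZ k.
    rewrite addrK; apply: norm2_eq => x Wx; rewrite l2valB /=.
      by rewrite z1// zext_in.
    by rewrite z2// zext_out// subrr.
  exists (l2val v), (l2val (q - kap *: v)); split; first exact: resolvent_shifted.
  by apply: norm2_eq0 q0 => x Wx; rewrite [in RHS]l2valB /= zext_in.
- have [e He] := estimate_finite_codim ipP cpl cD est.
  exists m, (fun k => l2val (e k)); split => [k|f Lf].
    by apply: L2_restrict; exact: l2P.
  have [c [u [q [rgu z0]]]] := He (l2ext Lf).
  exists (fun k => sc_real S (c k)), (l2val u), (l2val (q - kap *: u)); split.
    exact: resolvent_shifted.
  apply: norm2_eq0 z0 => x Wx; rewrite [in RHS]l2valB [in RHS]l2valD l2val_sum /= zext_in//.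
  by congr (_ - (_ + _)); apply: eq_bigr => k _; rewrite /= addr0.
Qed.

(** A complement of the range spanned over the scalars by the [e k] is spanned over the reals by the
    [e k] and their multiples by i, whence the index set with [bool]. *)
Lemma fredholm_estimate_ex : fredholm mu h W shifted_graph ->
  exists m, fredholm_estimate (l2ip (mu := mu) (h := h)) op (l2_Cc W) kap m.
Proof.
move=> [_ _ [m [e [Le He]]]]; exists #|{: 'I_m * bool}|.
apply: (finite_codim_estimate ipP cpl cD).
pose fam (p : 'I_m * bool) : H := L2Sec (L2_lin (basis_scalar p.2) (L2_zext (Le p.1)) (L2_zero mu h)).
exists (fun i => fam (enum_val i)) => f.
have [c [u [g [Gug d0]]]] := He _ (L2_restrict (l2P f)).
have [Lu [Lg rgu]] := shifted_resolvent Gug.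
pose cf (p : 'I_m * bool) := reim (c p.1) p.2.
pose fW := l2ext (L2_restrict (l2P f)).
(* The part [f - fW] of [f] outside [W] is added to the right-hand side, as [resolvent_off] permits;
   without it [f] would be reached on [W] only. *)
exists (fun i => cf (enum_val i)), (l2ext Lu), (l2ext Lg + kap *: l2ext Lu + (f - fW)).
have sE : \sum_(i < #|{: 'I_m * bool}|) cf (enum_val i) *: fam (enum_val i) = \sum_p cf p *: fam p.
  by rewrite [RHS](reindex (fun i : 'I_#|{: 'I_m * bool}| => enum_val i)) //=; exact: onW_bij (enum_val_bij _).
have famE x : l2val (\sum_p cf p *: fam p) x = \sum_(k < m) c k *: zext (e k) x.
  rewrite l2val_sum -(pair_bigA _ (fun k g => l2val (cf (k, g) *: fam (k, g)) x)) /=.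
  apply: eq_bigr => k _.
  rewrite (eq_bigr (fun g => (sc_real S (reim (c k) g) * basis_scalar g) *: zext (e k) x)).
    by rewrite -scaler_suml basis_scalarE.
  by move=> q _; rewrite /= !addr0 scalerA.
split.
  apply: resolvent_off rgu _ => y Wy; rewrite [LHS]l2valD [X in _ + X]l2valB /= !zext_in//.
  by rewrite subrr addr0.
move=> z; rewrite -d0; apply: norm2_eq => x Wx; rewrite /z sE.
  rewrite !(l2valB, l2valD, l2valN, l2valZ) famE /= !zext_in//.
  rewrite subrr addr0 addrK; congr (_ - (_ + _)).
  by apply: eq_bigr => k _; rewrite zext_in.
rewrite !(l2valB, l2valD, l2valN, l2valZ) famE /= !zext_out// !scaler0 add0r subr0 subr0 add0r.
by rewrite big1 ?addr0 ?subrr// => k _; rewrite zext_out// scaler0.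
Qed.

End Graphs.
End Restriction.

Theorem theoremA17 (R : realType) (b : base_field) (n : nat)
  (M : ptopologicalType) (X : manifold R n M) (g : riemannian_metric X)
  (E : vbundle (scalars_of R b) X) (h : bundle_metric E)
  (nabla : atlas X -> 'I_n -> section E -> section E)
  (dv mu : {measure set (borel M) -> \bar R}) (phi : M -> R)
  (L : section E -> section E) (beta : R) (K : set M) :
  connection nabla -> metric_compatible h nabla ->
  riemannian_volume g dv ->
  smooth_on X setT phi -> (forall x, 0 < phi x) ->
  weighted_measure dv phi mu ->
  generalized_Laplace_type mu h L ->
  formally_self_adjoint mu h L ->
  bounded_below mu h L beta ->
  compact K -> K <> setT -> smooth_boundary X K ->
  sigma_ess mu h L beta setT = sigma_ess mu h L beta (~` K).
Proof.
move=> _ _ vol sphi phi0 wm [eL [F [hF [A [A' [B [dA adj dB LE]]]]]]] sa bbS cK _ _.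
have mu_fin (C : set M) (cC : compact C) := mu_compact_finite vol sphi phi0 wm cC.
have mu_pos (V : set M) x (oV : open V) (Vx : V x) := mu_open_gt0 vol sphi phi0 wm oV Vx.
have bb u : Cc setT u -> beta * ri mu h u u <= ri mu h (L u) u.
  by move=> /bbS/sc_le_re; rewrite sc_re_real /norm2 !ri_inner.
have cd := compact_difference_complement mu_fin mu_pos
  (fun i y r => chart_box_measure vol sphi phi0 wm (i := i) (y := y) (r := r))
  eL dA adj dB LE sa bb cK.
have oK : open (~` K) by apply: closed_openC; apply: compact_closed cK; exact: man_hausdorff X.
have oT : open (setT : set M) by exact: openT.
have qT := l2op_coercive mu_fin eL sa bb setT; have qK := l2op_coercive mu_fin eL sa bb (~` K).
have ipP := l2_ipP mu h; have cpl := @l2_complete _ _ _ _ _ mu E h.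
(* Each inclusion transfers the Fredholm property in one direction, compactness of the difference of
   resolvents being symmetric. *)
apply/seteqP; split => lambda /=; apply: contra_not => fr.
- have [m est] := fredholm_estimate_ex oK qK fr.
  have [m' est'] := estimate_transfer ipP cpl qK (compact_differenceC ipP cd) est.
  exact: (estimate_fredholm oT qT est').
- have [m est] := fredholm_estimate_ex oT qT fr.
  have [m' est'] := estimate_transfer ipP cpl qT cd est.
  exact: (estimate_fredholm oK qK est').
Qed.
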